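(* Suppose $Q\in\mathscr L^{(\infty)}_0$. (i) Let $2>\varepsilon>0$ and $Q\in\mathscr L^{(0)}_\varepsilon$. Then the family $\{-\frac\varepsilon2\le\Re(m)\}\ni m\mapsto H_m$ is regular. (ii) Let $Q\in\mathscr L^{(0)}_0$. Then the family $\{\Re(m)\ge0,\ m\ne0\}\ni m\mapsto H_m$ is regular. If moreover $Q\in\mathscr L^{(0)}_{0,\ln^2}$, then $m=0$ can be included, i.e. $\{\Re(m)\ge0\}\ni m\mapsto H_m$ is regular.
   Context: $Q:]0,\infty[\to\mathbb C$ locally integrable; $L_{m^2}:=-\partial_x^2+(m^2-\frac14)x^{-2}+Q(x)$ on $AC^1]0,\infty[$ (functions with absolutely continuous derivative). $Q\in\mathscr L^{(\infty)}_0$ iff $\int_1^\infty|Q|<\infty$; $Q\in\mathscr L^{(0)}_\varepsilon$ iff $\int_0^1x^{1-\varepsilon}|Q|<\infty$; $Q\in\mathscr L^{(0)}_{0,\ln^2}$ iff $\int_0^1x(1+|\ln x|^2)|Q|<\infty$. $\mathcal D(L^{\max}_{m^2}):=\{f\in L^2]0,\infty[\cap AC^1]0,\infty[:L_{m^2}f\in L^2]0,\infty[\}$; $\mathscr W(f,g;0):=\lim_{x\to0}(f(x)g'(x)-f'(x)g(x))$. $H_m$ is the closed operator on $L^2]0,\infty[$ given by restricting $L_{m^2}$ to $\mathcal D(H_m):=\{f\in\mathcal D(L^{\max}_{m^2}):\mathscr W(x^{\frac12+m},f;0)=0\}$. A family $z\mapsto H(z)$ of closed operators on an open set is holomorphic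 if for every $z_0$ there are $\lambda\in\mathbb C$ and a neighborhood $\Theta_0$ of $z_0$ such that $\lambda$ is in the resolvent set of $H(z)$ for $z\in\Theta_0$ and $z\mapsto(f|(H(z)-\lambda)^{-1}g)$ is holomorphic on $\Theta_0$ for all $f,g$; continuity is defined in the same way with ''holomorphic'' replaced by ''continuous'' (weak resolvent sense). A family on a set $\Omega\subset\mathbb C$ is regular if it is continuous on $\Omega$ and holomorphic on the interior of $\Omega$. *)

(* Defs.v *)
(* Complex numbers are R[i] from
   mathcomp-real-closed, used through the alias  (R[i])^o  which carries the
   normed-module structure of a numFieldType over itself (topology, limits,
   complex derivatives). *)
From HB Require Import structures.
From mathcomp Require Import all_boot all_order all_algebra.
From mathcomp Require Import all_classical all_reals all_analysis.
From mathcomp Require Import complex.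
Set Implicit Arguments.
Unset Strict Implicit.
Unset Printing Implicit Defensive.
Import Order.TTheory GRing.Theory Num.Theory.
Import numFieldNormedType.Exports.
Local Open Scope ring_scope.
Local Open Scope classical_set_scope.

Section Defs.
Variable R : realType.

Definition CC : Type := (R[i])^o.
Definition cR (r : R) : CC := Complex r 0.
Definition cre (z : CC) : R := complex.Re z.
Definition cim (z : CC) : R := complex.Im z.
Definition cmod (z : CC) : R := Num.sqrt (cre z ^+ 2 + cim z ^+ 2).

Local Notation mu := (@lebesgue_measure R).

Definition pos : set R := [set x | 0 < x].

Definition cmeasurable (f : R -> CC) : Prop :=
  measurable_fun pos (fun x => cre (f x)) /\ measurable_fun pos (fun x => cim (f x)).

Definition L2 (f : R -> CC) : Prop :=
  cmeasurable f /\
  (\int[mu]_(x in pos) ((cmod (f x)) ^+ 2)%R%:E < +oo)%E.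

Definition norm2 (f : R -> CC) : R :=
  Num.sqrt (Rintegral mu pos (fun x => (cmod (f x)) ^+ 2)).

(** scalar product (f|g) = int conj(f) g, antilinear in the first argument *)
Definition inner (f g : R -> CC) : CC :=
  Complex
    (Rintegral mu pos (fun x => cre (f x) * cre (g x) + cim (f x) * cim (g x)))
    (Rintegral mu pos (fun x => cre (f x) * cim (g x) - cim (f x) * cre (g x))).

Definition ae_eq (f g : R -> CC) : Prop :=
  {ae mu, forall x, pos x -> f x = g x}.

Definition cderivable (f : R -> CC) (x : R) : Prop :=
  derivable (fun y => cre (f y)) x 1 /\ derivable (fun y => cim (f y)) x 1.
Definition cderiv (f : R -> CC) (x : R) : CC :=
  Complex ((fun y => cre (f y))^`() x) ((fun y => cim (f y))^`() x).

Definition abs_cont (a b : R) (f : R -> R) : Prop :=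
  forall e : R, 0 < e -> exists2 d : R, 0 < d &
    forall (n : nat) (s : 'I_n -> R * R),
      (forall i, a <= (s i).1 /\ (s i).1 <= (s i).2 /\ (s i).2 <= b) ->
      (forall i j, i != j -> (s i).2 <= (s j).1 \/ (s j).2 <= (s i).1) ->
      \sum_(i < n) ((s i).2 - (s i).1) < d ->
      \sum_(i < n) `|f (s i).2 - f (s i).1| < e.

Definition AC1 (f : R -> CC) : Prop :=
  (forall x, 0 < x -> cderivable f x) /\
  (forall a b, 0 < a -> a <= b ->
     abs_cont a b (fun y => cre (cderiv f y)) /\
     abs_cont a b (fun y => cim (cderiv f y))).

Definition loc_integrable (Q : R -> CC) : Prop :=
  cmeasurable Q /\
  forall a b : R, 0 < a -> a <= b ->
    (\int[mu]_(x in [set y | (a <= y <= b)%R]) (cmod (Q x))%:E < +oo)%E.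

Definition Linf0 (Q : R -> CC) : Prop :=
  (\int[mu]_(x in [set y : R | (1 <= y)%R]) (cmod (Q x))%:E < +oo)%E.
Definition L0eps (eps : R) (Q : R -> CC) : Prop :=
  (\int[mu]_(x in [set y : R | (0 < y <= 1)%R]) (x `^ (1 - eps) * cmod (Q x))%R%:E < +oo)%E.
Definition L0ln2 (Q : R -> CC) : Prop :=
  (\int[mu]_(x in [set y : R | (0 < y <= 1)%R])
      (x * (1 + (ln x) ^+ 2) * cmod (Q x))%R%:E < +oo)%E.

(** complex power x^s = exp(s ln x) for x > 0 *)
Definition cpow (x : R) (s : CC) : CC :=
  Complex (expR (cre s * ln x) * cos (cim s * ln x))
          (expR (cre s * ln x) * sin (cim s * ln x)).

Definition Lexpr (Q : R -> CC) (m : CC) (f : R -> CC) : R -> CC :=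
  fun x => - cderiv (cderiv f) x + (m ^+ 2 - 4^-1) * cR (x ^- 2) * f x
           + Q x * f x.

Definition Dmax (Q : R -> CC) (m : CC) (f : R -> CC) : Prop :=
  L2 f /\ AC1 f /\ L2 (Lexpr Q m f).

Definition wronsk0_eq0 (f g : R -> CC) : Prop :=
  (f x * cderiv g x - cderiv f x * g x) @[x --> 0^'+] --> (0 : CC).

Definition DH (Q : R -> CC) (m : CC) (f : R -> CC) : Prop :=
  Dmax Q m f /\ wronsk0_eq0 (fun x => cpow x (2^-1 + m)) f.

Definition operator : Type := ((R -> CC) -> Prop) * ((R -> CC) -> (R -> CC)).

Definition Hop (Q : R -> CC) (m : CC) : operator := (DH Q m, Lexpr Q m).

Definition in_resolvent (H : operator) (l : CC) : Prop :=
  (forall g, L2 g -> exists f, H.1 f /\ ae_eq (fun x => H.2 f x - l * f x) g) /\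
  (forall f1 f2, H.1 f1 -> H.1 f2 ->
     ae_eq (fun x => H.2 f1 x - l * f1 x) (fun x => H.2 f2 x - l * f2 x) ->
     ae_eq f1 f2) /\
  (exists c : R, forall f, H.1 f ->
     norm2 f <= c * norm2 (fun x => H.2 f x - l * f x)).

Definition res_witness (H : CC -> operator) (l : CC) (N : set CC)
    (g : R -> CC) (r : CC -> (R -> CC)) : Prop :=
  forall z, N z -> (H z).1 (r z) /\
    ae_eq (fun x => (H z).2 (r z) x - l * r z x) g.

Definition wcontinuous_on (O : set CC) (H : CC -> operator) : Prop :=
  forall z0, O z0 -> exists l : CC, exists N : set CC,
    [/\ open N, N z0,
        (forall z, (O `&` N) z -> in_resolvent (H z) l) &
        forall f g, L2 f -> L2 g -> exists r,
          res_witness H l (O `&` N) g r /\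
          {within O `&` N, continuous (fun z => inner f (r z))}].

Definition wholomorphic_on (U : set CC) (H : CC -> operator) : Prop :=
  forall z0, U z0 -> exists l : CC, exists N : set CC,
    [/\ open N, N z0, N `<=` U,
        (forall z, N z -> in_resolvent (H z) l) &
        forall f g, L2 f -> L2 g -> exists r,
          res_witness H l N g r /\
          (forall z, N z -> derivable (fun w => inner f (r w)) z 1)].

Definition regular_on (O : set CC) (H : CC -> operator) : Prop :=
  wcontinuous_on O H /\ wholomorphic_on O° H.

End Defs.

(* Main.v *)
From HB Require Import structures.
From mathcomp Require Import all_boot all_order all_algebra.
From mathcomp Require Import all_classical all_reals all_analysis measurable_realfun.
From mathcomp Require Import complex ring lra.
From mathcomp Require separable cyclic cyclotomic.
Set Implicit Arguments.
Unset Strict Implicit.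
Unset Printing Implicit Defensive.
Import Order.TTheory GRing.Theory Num.Theory.
Import numFieldNormedType.Exports.
Local Open Scope ring_scope.
Local Open Scope classical_set_scope.
Require Import Defs.

(** Let [u] and [v] solve [L f = - k^2 f], with [u ~ x^(1/2+m)] at 0 and [v ~ exp(-k x)] at
    infinity. Both come from Volterra systems whose iterates converge uniformly in [m], so they
    and their Wronskian [W] depend on [m] in the same way (continuously, holomorphically) as the
    coefficients. Where [W <> 0], the Green kernel built from [u] and [v], which is bounded on [L^2]
    by a Schur test, is the resolvent of [H_m] at [-k^2]: solutions in [L^2] are multiples of [v],
    and the boundary condition at 0 excludes them.
    For [Q = 0] the equality [W = 0] is impossible because [u] would decay, whereas a quadratic
    expression in [u] and [u' - (1/2+m) u / x] is monotone and vanishes at both ends. For general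
    [Q], scaling by [k] turns [Q] into a small perturbation of the case [Q = 0], [k = 1]; a
    solution that behaves like [u] at 0 and decays at infinity is then zero by contraction, so
    [W <> 0] at a given [m] for large [k], and near that [m] by continuity. *)

(** * Absolutely continuous functions *)

Section AbsoluteContinuity.
Variable R : realType.
Implicit Types (a b x y e d : R) (F G : R -> R) (s : seq (R * R)).
Local Notation mu := (@lebesgue_measure R).
Local Notation TV := (@total_variation R).

(** The coefficient [Q] is complex, so self-adjointness cannot supply a point of the resolvent set;
    it has to come from the Wronskian, and one number [- k ^+ 2] must serve a whole neighbourhood of
    each parameter, up to the edge of the half-plane. Hence every estimate is uniform on small sets
    [M] of parameters. What the three integrability conditions share is a weight [kw] with |e(x) -
    e(y)| y^(2 Re z) <= kc x * kw y for the kernel of the equation at 0: [kw] is y^(-eps), 1 or 1 +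
    |ln y|, the last one surviving z = 0, where the exponents 1/2 + z and 1/2 - z merge. The record
    [kpack] isolates this, and all that follows from it is common to the three cases. Domains are
    defined by epsilon-delta absolute continuity and pointwise derivatives; both are exchanged once
    for integral identities. Holomorphy has to pass through integrals over ]0, oo[, so it is taken
    as uniform approximation by polynomials on smaller discs: interpolation at roots of unity
    commutes with integration. *)

Definition apart (p q : R * R) := (p.2 <= q.1) || (q.2 <= p.1).

Definition family a b s :=
  all (fun p => [&& a <= p.1, p.1 <= p.2 & p.2 <= b]) s && pairwise apart s.

(** [jump id s] is the total length of the family; the smallness condition of absolute continuity is
    expressed with it. *)
Definition jump F s := \sum_(p <- s) `|F p.2 - F p.1|.

(** Sequences of pairs, unlike families indexed by ['I_n], can be concatenated and refined by
    induction. *)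
Lemma abs_cont_family a b F : abs_cont a b F ->
  forall e, 0 < e -> exists2 d : R, 0 < d &
    forall s, family a b s -> jump id s < d -> jump F s < e.
Proof.
move=> acF e e0; have [d d0 H] := acF e e0; exists d => // s /andP[/allP ws pw] sd.
have wn (i : 'I_(size s)) : [&& a <= (nth (0, 0) s i).1,
    (nth (0, 0) s i).1 <= (nth (0, 0) s i).2 & (nth (0, 0) s i).2 <= b].
  by apply: ws; exact: mem_nth.
rewrite /jump (big_nth (0, 0)) big_mkord.
apply: (H (size s) (fun i => nth (0, 0) s i)).
- by move=> i; case/and3P: (wn i).
- move=> i j; rewrite neq_ltn => /orP[] ij; [|apply/or_comm];
  move/(pairwiseP (0, 0)): pw => /(_ _ _ (ltn_ord _) (ltn_ord _) ij) /orP; [|]; tauto.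
- apply: le_lt_trans sd; rewrite /jump (big_nth (0, 0)) big_mkord.
  by apply: ler_sum => i _; rewrite ler_norm.
Qed.

Fixpoint steps x (t : seq R) : seq (R * R) :=
  if t is y :: t' then (x, y) :: steps y t' else [::].

Lemma steps_family x t : path <%R x t -> family x (last x t) (steps x t).
Proof.
elim: t x => [|y t IH] x //= /andP[xy pt].
have /andP[ws pw] := IH y pt.
have yl : y <= last y t.
  by elim: t y pt {IH ws pw xy} => [|z t IHt] y //= /andP[yz] /IHt; apply: le_trans; exact: ltW.
apply/andP; split; rewrite /= ?lexx ?(ltW xy) ?yl /=.
  by apply: sub_all ws => p /and3P[h1 -> ->]; rewrite (le_trans _ h1) ?ltW.
rewrite pw andbT; apply: sub_all ws => p /and3P[h1 _ _].
by rewrite /apart /= h1.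
Qed.

Lemma steps_len x t : path <%R x t -> jump id (steps x t) = last x t - x.
Proof.
elim: t x => [|y t IH] x /=; rewrite /jump ?big_nil ?subrr//.
move=> /andP[xy pt]; rewrite big_cons /= -/(jump id _) IH// gtr0_norm ?subr_gt0//.
by rewrite addrC subrKA.
Qed.

Lemma steps_jump F x t : \sum_(p <- zip t (x :: t)) `|F p.1 - F p.2| = jump F (steps x t).
Proof.
by elim: t x => [|y t IH] x; rewrite /jump /= ?big_nil// !big_cons IH.
Qed.

Lemma tv_steps F x y t : itv_partition x y t ->
  (jump F (steps x t))%:E = (variation x y F t)%:E.
Proof. by move=> h; rewrite (variation_zip F h) steps_jump. Qed.

(** A partition of an interval shorter than [d] is itself a family of total length below [d], so
    every variation sum over it is below [e]. *)
Lemma abs_cont_tv_small a b F e : abs_cont a b F -> 0 < e -> exists2 d : R, 0 < d &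
  forall x y, a <= x -> x <= y -> y <= b -> y - x < d -> (TV x y F <= e%:E)%E.
Proof.
move=> acF e0; have [d d0 H] := abs_cont_family acF e0; exists d => // x y ax xy yb yxd.
apply: ge_ereal_sup => _ [_ [t pt <-] <-].
rewrite -(tv_steps F pt) lee_fin ltW//; apply: H.
  case: pt => pt /eqP lt; have /andP[ws pw] := steps_family pt.
  apply/andP; split => //; apply: sub_all ws => p /and3P[h1 -> h2].
  by rewrite (le_trans ax)//= (le_trans h2)// lt.
by case: pt => pt /eqP lt; rewrite steps_len// lt.
Qed.

(** The interval is cut into steps of length [d / 2], with [d] the threshold that belongs to the
    increment 1; each step adds at most 1 to the variation. *)
Lemma abs_cont_tv_fin a b F : a <= b -> abs_cont a b F -> TV a b F \is a fin_num.
Proof.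
move=> ab acF; have [d d0 H] := abs_cont_tv_small acF ltr01.
have K n : forall y, a <= y -> y <= b -> y <= a + n%:R * (d / 2) -> (TV a y F <= n%:R%:E)%E.
  elim: n => [|n IH] y ay yb yn.
    have -> : y = a by apply/eqP; rewrite eq_le ay andbT; move: yn; rewrite mul0r addr0.
    by rewrite total_variationxx.
  have [yn'|yn'] := leP y (a + n%:R * (d / 2)).
    by apply: (le_trans (IH _ ay yb yn')); rewrite lee_fin ler_nat.
  have az : a <= a + n%:R * (d / 2) by rewrite lerDl mulr_ge0// divr_ge0// ltW.
  have -> : (n.+1%:R)%:E = (n%:R%:E + 1%:E)%E :> \bar R by rewrite -EFinD natr1.
  rewrite (total_variationD _ az (ltW yn')); apply: leeD.
    by apply: IH => //; rewrite (le_trans (ltW yn')).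
  apply: H => //; first exact: ltW.
  by move: yn; rewrite -natr1 mulrDl mul1r; lra.
rewrite ge0_fin_numE ?total_variation_ge0//.
apply: (@le_lt_trans _ _ (Num.bound ((b - a) / (d / 2)))%:R%:E); last by rewrite ltry.
apply: K => //; rewrite -lerBlDl -ler_pdivrMr ?divr_gt0//.
by rewrite ltW// archi_boundP// divr_ge0 ?subr_ge0// divr_ge0// ltW.
Qed.

Lemma tv_fin_sub a b F x y : TV a b F \is a fin_num -> a <= x -> x <= y -> y <= b ->
  TV x y F \is a fin_num.
Proof.
move=> tf ax xy yb.
have ay := le_trans ax xy; have ab := le_trans ay yb.
rewrite ge0_fin_numE ?total_variation_ge0//; move: tf.
rewrite ge0_fin_numE ?total_variation_ge0//; apply: le_lt_trans.
rewrite (total_variationD _ ay yb) (total_variationD _ ax xy).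
rewrite -[leLHS]add0e -[leLHS]adde0.
by apply: leeD; rewrite ?total_variation_ge0//; apply: leeD; rewrite ?total_variation_ge0.
Qed.

Lemma tv_approx F x y e : x <= y -> TV x y F \is a fin_num -> 0 < e ->
  exists s, [/\ family x y s, jump id s <= y - x & fine (TV x y F) <= jump F s + e].
Proof.
rewrite le_eqVlt => /predU1P[<- _ e0|xy tf e0].
  by exists [::]; rewrite total_variationxx /jump !big_nil subrr /= add0r; split=> //; exact: ltW.
have [_ [_ [t pt <-] <-] h] := ub_ereal_sup_adherent e0 tf.
have [p /eqP l] := pt; exists (steps x t); split.
- by have := steps_family p; rewrite l.
- by rewrite steps_len// l.
- rewrite -lee_fin fineK// EFinD (tv_steps F pt) -leeBlDr//; exact: ltW.
Qed.

(** Each interval is replaced by a partition that almost realizes its variation. The last clause,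
    that refined intervals lie inside old ones, keeps pieces of different intervals apart in the
    induction. *)
Lemma family_refine a b F s e : TV a b F \is a fin_num -> family a b s -> 0 < e ->
  exists s', [/\ family a b s', jump id s' <= jump id s,
    \sum_(p <- s) fine (TV p.1 p.2 F) <= jump F s' + e *+ size s &
    forall q, q \in s' -> exists2 p, p \in s & p.1 <= q.1 /\ q.2 <= p.2].
Proof.
move=> tf + e0; elim: s => [|p s IH]; first by exists [::]; rewrite /jump !big_nil addr0.
move=> /andP[/= /andP[/and3P[ap pp pb] ws] /andP[al pw]].
have [|s1 [/andP[w1 f1] l1 j1 r1]] := IH; first by apply/andP.
have [s2 [/andP[w2 f2] l2 j2]] := tv_approx pp (tv_fin_sub tf ap pp pb) e0.
exists (s2 ++ s1); split.
- apply/andP; split.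
    rewrite all_cat w1 andbT; apply: sub_all w2 => q /and3P[h1 -> h3].
    by rewrite (le_trans ap h1) /= (le_trans h3).
  rewrite pairwise_cat f1 f2 !andbT; apply/allrelP => q1 q2 m1 m2.
  have /and3P[h1 _ h2] := allP w2 _ m1.
  have [p' p's [h3 h4]] := r1 _ m2.
  have := allP al _ p's; rewrite /apart => /orP[k|k]; apply/orP; [left|right].
    exact: (le_trans h2 (le_trans k h3)).
  exact: (le_trans h4 (le_trans k h1)).
- rewrite /jump big_cat big_cons /=; apply: lerD => //.
  by rewrite (le_trans l2)// ler_norm.
- rewrite big_cons /jump big_cat /= mulrS.
  by rewrite -!/(jump _ _); move: j1 j2; lra.
- move=> q; rewrite mem_cat => /orP[m|m].
    by exists p; rewrite ?mem_head//; have /and3P[h1 _ h2] := allP w2 _ m.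
  by have [p' m' h] := r1 _ m; exists p'; rewrite // in_cons m' orbT.
Qed.

(** Refining a family does not lengthen it, so the refined increments stay below [e / 2]; the error
    of the refinement, again [e / 2], is shared among the intervals. *)
Lemma abs_cont_tv a b F e : a <= b -> abs_cont a b F -> 0 < e -> exists2 d : R, 0 < d &
  forall s, family a b s -> jump id s < d -> \sum_(p <- s) fine (TV p.1 p.2 F) < e.
Proof.
move=> ab acF e0; have tf := abs_cont_tv_fin ab acF.
have e20 : 0 < e / 2 by rewrite divr_gt0.
have [d d0 H] := abs_cont_family acF e20; exists d => // s fs sd.
have k0 : 0 < (e / 2) / (size s).+1%:R by rewrite divr_gt0.
have [s' [fs' l' j' _]] := family_refine tf fs k0.
apply: (le_lt_trans j').
have := H _ fs' (le_lt_trans l' sd).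
have : e / 2 / (size s).+1%:R *+ size s <= e / 2.
  rewrite -mulr_natr -mulrA ger_pMr// mulrC ler_pdivrMr ?ltr0n// mul1r ler_nat.
  exact: leqnSn.
set u := _ *+ _ => u1 u2; have -> : e = e / 2 + e / 2 by field.
by rewrite ltr_leD.
Qed.

(** * The density of a monotone absolutely continuous function *)

Section MonotoneDensity.
Variables (a b : R) (G : R -> R).
Hypotheses (ab : a < b) (ndG : {homo G : x y / x <= y}) (cG : continuous G)
  (Ga : forall x, x <= a -> G x = G a) (Gb : forall x, b <= x -> G x = G b).
Hypothesis acG : forall e, 0 < e -> exists2 d : R, 0 < d &
    forall s, family a b s -> jump id s < d -> jump G s < e.

Let Gc : cumulative R R := HB.pack G (isCumulative.Build R _ R G ndG (right_continuousW cG)).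

Let nu : {measure set (measurableTypeR R) -> \bar R} := lebesgue_stieltjes_measure Gc.

Let nu_oc x y : x <= y -> nu `]x, y]%classic = (G y - G x)%:E.
Proof.
move=> xy; rewrite /nu /= /lebesgue_stieltjes_measure /measure_extension measurable_mu_extE/=; last first.
  exact: is_ocitv.
by rewrite wlength_itv_bnd.
Qed.

(** [G] is constant outside [[a, b]], so every interval []-n, n]], and in the limit the whole line,
    has mass at most [G b - G a]. *)
Let nu_le (A : set (measurableTypeR R)) : measurable A -> (nu A <= (G b - G a)%:E)%E.
Proof.
move=> mA; pose B n : set (measurableTypeR R) := `](- n%:R : R), n%:R]%classic.
have mB n : measurable (B n) by exact: measurable_itv.
have lim : (nu \o B) x @[x --> \oo] --> nu (\bigcup_n B n).
  apply: nondecreasing_cvg_mu => //; first exact: bigcup_measurable.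
  move=> n m nm; rewrite subsetEset => x; rewrite /B /= !in_itv /= => /andP[h1 h2].
  by rewrite (le_trans h2) ?ler_nat// andbT; apply: le_lt_trans h1; rewrite lerN2 ler_nat.
have le1 : (nu (\bigcup_n B n) <= (G b - G a)%:E)%E.
  have := cvg_lim (@ereal_hausdorff R) lim => <-.
  apply: lime_le; first by apply/cvg_ex; eexists; exact: lim.
  apply: nearW => n /=; rewrite /B nu_oc ?lee_fin; last by rewrite (@le_trans _ _ 0)// oppr_le0.
  have h1 : G n%:R <= G b by have [/Gb->//|/ltW/ndG] := leP b n%:R.
  have h2 : G a <= G (- n%:R) by have [/Ga->//|/ltW/ndG] := leP (- n%:R) a.
  exact: lerB.
apply: le_trans le1; apply: le_measure; rewrite ?inE//; first exact: bigcup_measurable.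
move=> x _; exists (Num.bound `|x : R|) => //=; rewrite /B /= in_itv /=.
by have := archi_boundP (normr_ge0 (x : R)); rewrite ltr_norml => /andP[-> /ltW].
Qed.

(** The cells of a uniform grid that lie in [U] form a family of length below [d], so the mass of
    their union is at most [e]; each point of [U] in []a, b]] belongs to such a cell for all
    sufficiently fine grids. *)
Let nu_open (U : set R) e d : open U -> (mu U < d%:E)%E ->
  (forall s, family a b s -> jump id s < d -> jump G s < e) ->
  (nu (U `&` `]a, b]%classic) <= e%:E)%E.
Proof.
move=> oU Ud H.
pose t n i : R := a + i%:R * ((b - a) / n.+1%:R).
have tmono n i j : (i <= j)%N -> t n i <= t n j.
  by move=> ij; rewrite lerD2l ler_wpM2r ?ler_nat// divr_ge0// subr_ge0 ltW.
have tl n i : t n i.+1 - t n i = (b - a) / n.+1%:R by rewrite /t -natr1; ring.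
have tend n : t n n.+1 = b by rewrite /t mulrCA divff ?pnatr_eq0// mulr1 addrC subrK.
pose I n i : set R := `]t n i, t n i.+1]%classic.
pose P n i := `[< I n i `<=` U >].
pose V n : set (measurableTypeR R) := \big[setU/set0]_(i < n.+1 | P n i) I n i.
have mI n i : measurable (I n i : set (measurableTypeR R)) by exact: measurable_itv.
have tI n : trivIset (P n) (I n).
  apply/trivIsetP => i j _ _; rewrite neq_ltn => /orP ij.
  apply/eqP; apply/negPn/negP => /set0P[x []]; rewrite /I /= !in_itv /=.
  move=> /andP[h1 h2] /andP[h3 h4]; case: ij => ij.
    by have := lt_le_trans h3 (le_trans h2 (tmono n _ _ ij)); rewrite ltxx.
  by have := lt_le_trans h1 (le_trans h4 (tmono n _ _ ij)); rewrite ltxx.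
have tI' n : trivIset (fun i : 'I_n.+1 => P n i) (fun i : 'I_n.+1 => I n i).
  by move=> i j Pi Pj h; apply: val_inj; apply: (tI n).
have mV n : measurable (V n) by apply: bigsetU_measurable.
have VU n : V n `<=` U.
  rewrite /V; apply: (@big_ind _ (fun X : set R => X `<=` U)) => [x []|X Y XU YU x [/XU|/YU]|i /asboolP]//.
have mU : measurable (U : set (measurableTypeR R)) by exact: open_measurable.
have nuV n : (nu (V n) <= e%:E)%E.
  rewrite /V measure_bigsetU_ord_cond//.
  rewrite (eq_bigr (fun i : 'I_n.+1 => (`|G (t n i.+1) - G (t n i)|)%:E)); last first.
    by move=> i _; rewrite /I [LHS]nu_oc ?tmono// ger0_norm// subr_ge0 ndG// tmono.
  rewrite sumEFin lee_fin ltW//.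
  pose s := [seq (t n i, t n i.+1) | i <- index_iota 0 n.+1 & P n i].
  have -> : \sum_(i < n.+1 | P n i) `|G (t n i.+1) - G (t n i)| = jump G s.
    by rewrite /jump big_map big_filter big_mkord.
  apply: H.
    apply/andP; split.
      rewrite all_map; apply/allP => i; rewrite mem_filter mem_index_iota /= => /andP[_ ii].
      rewrite tmono//= (le_trans (tmono n _ _ ii)) ?tend// andbT /t lerDl mulr_ge0// divr_ge0// subr_ge0 ltW//.
    apply/(pairwiseP (0, 0)) => i j; rewrite !inE size_map => si sj ij.
    rewrite !(nth_map 0%N)//; apply/orP; left => /=; apply: tmono.
    have srt : sorted ltn [seq i <- index_iota 0 n.+1 | P n i].
      exact: (sorted_filter ltn_trans _ (iota_ltn_sorted _ _)).
    exact: (sorted_ltn_nth ltn_trans 0%N srt).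
  have -> : jump id s = fine (mu (V n)).
    rewrite /V measure_bigsetU_ord_cond// /jump big_map big_filter big_mkord.
    rewrite (eq_bigr (fun i : 'I_n.+1 => (`|t n i.+1 - t n i|)%:E)) ?sumEFin//.
    move=> i _; rewrite [LHS]lebesgue_measure_itv /= lte_fin -subr_gt0 tl divr_gt0 ?subr_gt0//.
    by rewrite -EFinB tl ger0_norm// divr_ge0// subr_ge0 ltW.
  have VUm : (mu (V n) < d%:E)%E.
    by apply: le_lt_trans Ud; apply: le_measure; rewrite ?inE//; exact: mV.
  by rewrite -lte_fin fineK// ge0_fin_numE// (lt_trans VUm)// ltry.
(* Successive grids are not nested, so [V n] need not be monotone in [n]; its tail intersections
   are, and their union still contains the part of [U] in []a, b]]. *)
pose W n : set (measurableTypeR R) := \bigcap_(k >= n) V k.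
have mW n : measurable (W n) by exact: bigcap_measurableType.
have UW : U `&` `]a, b]%classic `<=` \bigcup_n W n.
  move=> x [Ux]; rewrite /= in_itv /= => /andP[ax xb].
  have [r /= r0 rU] := (nbhs_ballP _ _).1 (open_nbhs_nbhs (conj oU Ux)).
  pose n0 := Num.bound ((b - a) / r); exists n0 => // n /= nn0.
  have nr : (b - a) / n.+1%:R < r.
    rewrite ltr_pdivrMr// -ltr_pdivrMl// mulrC (lt_le_trans (archi_boundP _)) ?divr_ge0 ?subr_ge0 ?(ltW ab) ?(ltW r0)//.
    by rewrite ler_nat ltnW.
  have exi : exists i, x <= t n i.+1 by exists n; rewrite tend.
  have [i xi imin] := ex_minnP exi.
  have it : t n i < x.
    case: i xi imin => [|i] xi imin; first by rewrite /t mul0r addr0.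
    by rewrite ltNge; apply/negP => /imin; rewrite ltnn.
  have iin : (i < n.+1)%N by rewrite ltnS; apply: imin; rewrite tend.
  suff Pi : P n i.
    rewrite /V (bigD1 (Ordinal iin))//=; left.
    by rewrite /I /= in_itv /= it.
  apply/asboolP => z; rewrite /I /= in_itv /= => /andP[z1 z2]; apply: rU; rewrite -ball_normE /ball_ /=.
  move: (tl n i) nr z1 z2 it xi; move: (t n i) (t n i.+1) (_ / _) => p q w *.
  by rewrite ltr_norml; apply/andP; split; lra.
have lim : (nu \o W) x @[x --> \oo] --> nu (\bigcup_n W n).
  apply: nondecreasing_cvg_mu => //; first exact: bigcup_measurable.
  move=> n m nm; rewrite subsetEset => x; rewrite /W /bigcap /= => h k mk.
  by apply: h; exact: leq_trans mk.
apply: (@le_trans _ _ (nu (\bigcup_n W n))).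
  apply: le_measure; rewrite ?inE//; last exact: bigcup_measurable.
  by apply: measurableI => //; exact: measurable_itv.
have <- := cvg_lim (@ereal_hausdorff R) lim.
apply: lime_le; first by apply/cvg_ex; eexists; exact: lim.
apply: nearW => n /=; apply: le_trans (nuV n).
by apply: le_measure; rewrite ?inE//; apply: bigcap_inf => /=.
Qed.

(** Outer regularity encloses a null set in an open set of measure below [d], and the complement of
    []a, b]] carries no mass. *)
Let nu_dom : nu `<< mu.
Proof.
apply/null_content_dominatesP => A mA A0; apply/eqP; rewrite eq_le measure_ge0 andbT.
have mab : measurable (`]a, b]%classic : set (measurableTypeR R)) by exact: measurable_itv.
have n1 : nu (~` `]a, b]%classic) = 0%E.
  apply/eqP; rewrite eq_le measure_ge0 andbT -setTD measureD//; last first.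
    by rewrite (le_lt_trans (nu_le measurableT))// ltry.
  rewrite setTI [X in (_ - X)%E](_ : _ = (G b - G a)%:E); last exact: nu_oc (ltW ab).
  by rewrite leeBlDr// add0e nu_le.
have n2 : (nu (A `&` `]a, b]%classic) <= 0)%E.
  apply/lee_addgt0Pr => e e0; rewrite add0e.
  have [d d0 Hd] := acG e0.
  have A1 : (mu A < +oo)%E by rewrite A0 ltry.
  have [U [oU AU Ud]] := lebesgue_regularity_outer mA A1 d0.
  have mU : measurable (U : set (measurableTypeR R)) by exact: open_measurable.
  apply: le_trans (nu_open oU _ Hd).
    apply: le_measure; rewrite ?inE; [exact: measurableI|exact: measurableI|].
    exact: setSI.
  apply: le_lt_trans Ud; have mUA : measurable (U `\` A : set (measurableTypeR R)) by exact: measurableD.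
  apply: (@le_trans _ _ (mu ((U `\` A) `|` A))); last first.
    by rewrite -[leRHS]adde0 -[X in (_ + X)%E]A0; exact: measureU2.
  apply: le_measure; rewrite ?inE//; first exact: measurableU.
  by move=> x Ux; have [h|h] := pselect (A x); [right|left].
rewrite -[leRHS]adde0 -{2}n1; apply: (@le_trans _ _ (nu (A `&` `]a, b]%classic) + nu (~` `]a, b]%classic))%E).
  apply: (@le_trans _ _ (nu ((A `&` `]a, b]%classic) `|` (~` `]a, b]%classic)))); last first.
    by apply: measureU2; [exact: measurableI|exact: measurableC].
  apply: le_measure; rewrite ?inE//; first by apply: measurableU; [exact: measurableI|exact: measurableC].
  by move=> x Ax; have [h|h] := pselect (`]a, b]%classic x); [left|right].
exact: leeD2r.
Qed.

(** Absolute continuity of [G] makes its Lebesgue-Stieltjes measure absolutely continuous with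
    respect to [mu]; the density is the Radon-Nikodym derivative. *)
Lemma monotone_density : exists g : R -> R, mu.-integrable setT (EFin \o g) /\
  forall x y, x <= y -> G y - G x = \int[mu]_(t in `[x, y]) g t.
Proof.
have fin : (nu setT < +oo)%E by rewrite (le_lt_trans (nu_le measurableT))// ltry.
(* The restriction of [nu] to the whole space only serves to carry the proof of its finiteness. *)
pose nf : {finite_measure set (measurableTypeR R) -> \bar R} := mfrestr (@measurableT _ (measurableTypeR R)) fin.
have nfE X : nf X = nu X by rewrite /nf /= /mfrestr /mrestr setIT.
have dom : charge_of_finite_measure nf `<< mu.
  apply/null_content_dominatesP => X mX X0; rewrite /charge_of_finite_measure nfE.
  by move/null_content_dominatesP : nu_dom; exact.
pose f := Radon_Nikodym (charge_of_finite_measure nf) mu.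
have ffin x : f x \is a fin_num by exact: Radon_Nikodym_fin_num.
have fE : EFin \o (fine \o f) = f by apply/funext => x /=; rewrite fineK.
have fi : mu.-integrable setT f by exact: Radon_Nikodym_integrable.
exists (fine \o f); rewrite fE; split => // x y xy.
have i1 : mu.-integrable `]x, y] (EFin \o (fine \o f)).
  by rewrite fE; apply: integrableS fi.
rewrite -Rintegral_itv_obnd_cbnd// /Rintegral.
have h : nf `]x, y]%classic = (\int[mu]_(t in `]x, y]) f t)%E :=
  Radon_Nikodym_integral dom (measurable_itv (Interval (BRight x) (BRight y))).
rewrite nfE nu_oc// in h; rewrite (eq_integral f) => [|z _]; last by rewrite /= fineK.
by rewrite -h.
Qed.

End MonotoneDensity.

Let clamp a b x := Num.max a (Num.min b x).

(** Jordan decomposition: with [G] the variation from [a], both [G] and [K = G - F] are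
    nondecreasing and absolutely continuous. Composition with [clamp] makes them functions on the
    line that are constant outside [[a, b]]. *)
Lemma abs_cont_density a b F : a < b -> abs_cont a b F ->
  exists f : R -> R, mu.-integrable setT (EFin \o f) /\
  forall x y, a <= x -> x <= y -> y <= b -> F y - F x = \int[mu]_(t in `[x, y]) f t.
Proof.
move=> ab acF; have tf := abs_cont_tv_fin (ltW ab) acF.
pose T x y := fine (TV x y F).
have ca x : a <= clamp a b x by rewrite /clamp le_max lexx.
have cb x : clamp a b x <= b by rewrite /clamp ge_max (ltW ab) ge_min lexx.
have cle x y : x <= y -> clamp a b x <= clamp a b y.
  by move=> xy; rewrite /clamp ge_max le_max lexx /= le_max; apply/orP; right; rewrite le_min ge_min lexx /= ge_min xy orbT.
have cid x : a <= x -> x <= b -> clamp a b x = x.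
  by move=> ax xb; rewrite /clamp (min_idPr xb) (max_idPr ax).
have cl x : x <= a -> clamp a b x = a.
  by move=> xa; rewrite /clamp (min_idPr (le_trans xa (ltW ab))) (max_idPl xa).
have cr x : b <= x -> clamp a b x = b.
  by move=> bx; rewrite /clamp (min_idPl bx) (max_idPr (ltW ab)).
have ccont x y : `|clamp a b x - clamp a b y| <= `|x - y|.
  wlog xy : x y / x <= y => [h|].
    by have [/h//|/ltW/h] := leP x y; rewrite distrC [leRHS]distrC.
  rewrite distrC [leRHS]distrC !ger0_norm ?subr_ge0 ?cle//.
  by rewrite /clamp !maxEle !minEle; repeat case: ifP; move=> *; lra.
have Tadd x y z : a <= x -> x <= y -> y <= z -> z <= b -> T x z = T x y + T y z.
  move=> ax xy yz zb; rewrite /T (total_variationD _ xy yz) fineD//.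
    by apply: (tv_fin_sub tf) => //; rewrite (le_trans yz).
  by apply: (tv_fin_sub tf) => //; rewrite (le_trans ax).
have TF x y : a <= x -> x <= y -> y <= b -> `|F y - F x| <= T x y.
  move=> ax xy yb; rewrite -lee_fin fineK ?total_variation_ge//.
  exact: (tv_fin_sub tf).
pose G x := T a (clamp a b x).
pose F' x := F (clamp a b x).
have Ginc x y : x <= y -> G y - G x = T (clamp a b x) (clamp a b y).
  by move=> xy; rewrite /G (@Tadd a (clamp a b x)) ?cle// addrC addKr.
have small e : 0 < e -> exists2 d : R, 0 < d & forall x y, `|x - y| < d -> `|G x - G y| <= e /\ `|F' x - F' y| <= e.
  move=> e0; have [d d0 H] := abs_cont_tv_small acF e0; exists d => // x y.
  wlog xy : x y / x <= y => [h|].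
    have [/h//|/ltW/h] := leP x y; rewrite distrC => h1 /h1.
    by rewrite distrC [X in _ /\ X <= _]distrC.
  move=> dxy; have k : T (clamp a b x) (clamp a b y) <= e.
    rewrite -lee_fin fineK; last by apply: (tv_fin_sub tf) => //; exact: cle.
    apply: H => //; first exact: cle.
    rewrite (le_lt_trans (ler_norm _))//; apply: le_lt_trans dxy.
    by rewrite distrC ccont.
  rewrite distrC [X in _ /\ X <= _]distrC Ginc// ger0_norm; last first.
    by rewrite fine_ge0// total_variation_ge0// cle.
  by split => //; apply: le_trans k; apply: TF; rewrite ?cle.
have contGF (h : R -> R) : (forall e, 0 < e -> exists2 d : R, 0 < d & forall x y, `|x - y| < d -> `|h x - h y| <= e) -> continuous h.
  move=> H x; apply/cvgrPdist_le => e e0; have [d d0 K] := H e e0.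
  by near=> y; apply: K; near: y; apply: cvgr_dist_lt => //; exact: cvg_id.
have cG : continuous G.
  by apply: contGF => e /small[d d0 H]; exists d => // x y /H[].
have cF' : continuous F'.
  by apply: contGF => e /small[d d0 H]; exists d => // x y /H[].
have famT s : family a b s -> jump G s = \sum_(p <- s) T p.1 p.2.
  move=> /andP[/allP ws _]; rewrite /jump; apply: eq_big_seq => p /ws /and3P[h1 h2 h3].
  rewrite Ginc// !cid ?(le_trans h1)// ?(le_trans h2)// ger0_norm// fine_ge0//.
  exact: total_variation_ge0.
have acG e : 0 < e -> exists2 d : R, 0 < d & forall s, family a b s -> jump id s < d -> jump G s < e.
  move=> /(abs_cont_tv (ltW ab) acF)[d d0 H]; exists d => // s fs /(H _ fs).
  by rewrite famT.
have ndG : {homo G : x y / x <= y}.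
  move=> x y xy; rewrite -subr_ge0 Ginc// fine_ge0// total_variation_ge0//.
  exact: cle.
pose K x := G x - F' x.
have ndK : {homo K : x y / x <= y}.
  move=> x y xy; have := TF _ _ (ca x) (cle _ _ xy) (cb y).
  rewrite -(Ginc _ _ xy) -/(F' _) -/(F' x) => /(le_trans (ler_norm _)).
  by rewrite /K; lra.
(* An increment of [F] is at most the variation, which is the increment of [G]; hence the increments
   of [K] are at most twice those of [G]. *)
have acK e : 0 < e -> exists2 d : R, 0 < d & forall s, family a b s -> jump id s < d -> jump K s < e.
  move=> e0; have [|d d0 H] := acG (e / 2); first by rewrite divr_gt0.
  exists d => // s fs /(H _ fs) j.
  suff : jump K s <= jump G s + jump G s by lra.
  rewrite /jump -big_split /= big_seq [leRHS]big_seq; apply: ler_sum => p ps.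
  have /andP[/allP/(_ _ ps)/and3P[h1 h2 h3] _] := fs.
  have := TF _ _ h1 h2 h3; rewrite -{2}(cid p.1) ?(le_trans h2)//  -{2}(cid p.2) ?(le_trans h1)//.
  rewrite -Ginc// /K /F' !cid ?(le_trans h1)// ?(le_trans h2)// => k.
  rewrite (_ : _ - _ - _ = (G p.2 - G p.1) - (F p.2 - F p.1)); last by ring.
  apply: (le_trans (ler_normB _ _)); rewrite lerD2l; apply: (le_trans k).
  exact: ler_norm.
have [g [gi gE]] := monotone_density ab ndG cG (fun x xa => congr1 (T a) (etrans (cl x xa) (esym (cl a (lexx a)))))
  (fun x bx => congr1 (T a) (etrans (cr x bx) (esym (cr b (lexx b))))) acG.
have cK : continuous K by move=> x; apply: cvgB; [exact: cG|exact: cF'].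
have [h [hi hE]] := monotone_density ab ndK cK
  (fun x xa => congr1 (fun z => T a z - F z) (etrans (cl x xa) (esym (cl a (lexx a)))))
  (fun x bx => congr1 (fun z => T a z - F z) (etrans (cr x bx) (esym (cr b (lexx b))))) acK.
exists (fun t => g t - h t); split.
  have -> : EFin \o (fun t => g t - h t) = ((EFin \o g) \- (EFin \o h))%E.
    by apply/funext => t /=; rewrite EFinB.
  exact: integrableB.
move=> x y ax xy yb; rewrite RintegralB//; [|exact: integrableS gi|exact: integrableS hi].
rewrite -gE// -hE// /K /F' !cid ?(le_trans ax)// ?(le_trans xy)//.
by ring.
Unshelve. all: by end_near. Qed.
End AbsoluteContinuity.

(** * Integration of complex functions *)

Section ComplexArithmetic.
Variable R : realType.
Implicit Types (z w : CC R) (r : R).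

Lemma CCP z w : cre z = cre w -> cim z = cim w -> z = w.
Proof. by case: z w => [a b] [c d]; rewrite /cre /cim /= => -> ->. Qed.

Lemma creD z w : cre (z + w) = cre z + cre w. Proof. by case: z w => [? ?] []. Qed.
Lemma cimD z w : cim (z + w) = cim z + cim w. Proof. by case: z w => [? ?] []. Qed.
Lemma creN z : cre (- z) = - cre z. Proof. by case: z. Qed.
Lemma cimN z : cim (- z) = - cim z. Proof. by case: z. Qed.
Lemma creM z w : cre (z * w) = cre z * cre w - cim z * cim w.
Proof. by case: z w => [? ?] []. Qed.
Lemma cimM z w : cim (z * w) = cre z * cim w + cim z * cre w.
Proof. by case: z w => [? ?] []. Qed.
Lemma cre_cR r : cre (cR r) = r. Proof. by []. Qed.
Lemma cim_cR r : cim (cR r) = 0. Proof. by []. Qed.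
Lemma cre0 : cre (0 : CC R) = 0. Proof. by []. Qed.
Lemma cim0 : cim (0 : CC R) = 0. Proof. by []. Qed.
Lemma cre1 : cre (1 : CC R) = 1. Proof. by []. Qed.
Lemma cim1 : cim (1 : CC R) = 0. Proof. by []. Qed.
Lemma creC (a b : R) : cre (Complex a b : CC R) = a. Proof. by []. Qed.
Lemma cimC (a b : R) : cim (Complex a b : CC R) = b. Proof. by []. Qed.
Definition cE := (creD, cimD, creN, cimN, creM, cimM, cre_cR, cim_cR, cre0, cim0, cre1, cim1, creC, cimC).

Lemma cR0 : cR (0 : R) = 0. Proof. by []. Qed.
Lemma cR1 : cR (1 : R) = 1. Proof. by []. Qed.
Lemma cRD r s : cR (r + s) = cR r + cR s. Proof. by apply: CCP; rewrite !cE ?addr0. Qed.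
Lemma cRN r : cR (- r) = - cR r. Proof. by apply: CCP; rewrite !cE ?oppr0. Qed.
Lemma cRM r s : cR (r * s) = cR r * cR s.
Proof. by apply: CCP; rewrite !cE ?(mulr0, mul0r, subr0, addr0). Qed.
Lemma cR_neq0 r : r != 0 -> cR r != 0.
Proof. by apply: contra_neq => /(congr1 (@cre R)). Qed.
Lemma cRV r : cR r^-1 = (cR r)^-1.
Proof.
have [->|r0] := eqVneq r 0; first by rewrite invr0 cR0 invr0.
by apply: (mulfI (cR_neq0 r0)); rewrite -cRM !divff// cR_neq0.
Qed.
Lemma cRX r n : cR (r ^+ n) = cR r ^+ n.
Proof. by elim: n => [|n IH]; rewrite ?expr0// !exprS cRM IH. Qed.
Lemma cR_nat n : cR (n%:R) = n%:R :> CC R.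
Proof. by elim: n => [|n IH]; rewrite ?mulr0n// -!natr1 cRD IH. Qed.

Lemma cmod_normc z : cmod z = Normc.normc z. Proof. by case: z. Qed.
Lemma cmod_norm z : `|z| = cR (cmod z). Proof. by case: z. Qed.
Lemma cmod_ge0 z : 0 <= cmod z. Proof. exact: sqrtr_ge0. Qed.
Lemma cmod_sqr z : cmod z ^+ 2 = cre z ^+ 2 + cim z ^+ 2.
Proof. by rewrite sqr_sqrtr// addr_ge0// sqr_ge0. Qed.
Lemma cmodM z w : cmod (z * w) = cmod z * cmod w.
Proof. by rewrite !cmod_normc Normc.normcM. Qed.
Lemma cmodD z w : cmod (z + w) <= cmod z + cmod w.
Proof. by rewrite !cmod_normc; exact: (@le_normcD _ (z : R[i]) (w : R[i])). Qed.
Lemma cmodN z : cmod (- z) = cmod z.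
Proof. by rewrite /cmod !cE !sqrrN. Qed.
Lemma cmodB z w : cmod (z - w) <= cmod z + cmod w.
Proof. by rewrite -(cmodN w) cmodD. Qed.
Lemma cmodBC z w : cmod (z - w) = cmod (w - z).
Proof. by rewrite -cmodN opprB. Qed.
Lemma cmod_tri z w t : cmod (z - t) <= cmod (z - w) + cmod (w - t).
Proof. by rewrite -[z - t](subrKA w) cmodD. Qed.
Lemma cmod_cR r : cmod (cR r) = `|r|.
Proof. by rewrite /cmod !cE expr0n addr0 sqrtr_sqr. Qed.
Lemma cmod0 : cmod (0 : CC R) = 0. Proof. by rewrite -cR0 cmod_cR normr0. Qed.
Lemma cmod1 : cmod (1 : CC R) = 1. Proof. by rewrite -cR1 cmod_cR normr1. Qed.
Lemma cmod_eq0 z : cmod z = 0 -> z = 0.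
Proof. by rewrite cmod_normc => /Normc.eq0_normc. Qed.
Lemma cmod_gt0 z : z != 0 -> 0 < cmod z.
Proof. by move=> z0; rewrite lt_def cmod_ge0 andbT; apply: contra_neq z0; exact: cmod_eq0. Qed.
Lemma cmodV z : cmod z^-1 = (cmod z)^-1.
Proof. by rewrite !cmod_normc Normc.normcV. Qed.
Lemma cmodX z n : cmod (z ^+ n) = cmod z ^+ n.
Proof. by elim: n => [|n IH]; rewrite ?expr0 ?cmod1// !exprS cmodM IH. Qed.
Lemma cre_le z : `|cre z| <= cmod z.
Proof. by rewrite -sqrtr_sqr ler_wsqrtr// lerDl sqr_ge0. Qed.
Lemma cim_le z : `|cim z| <= cmod z.
Proof. by rewrite -sqrtr_sqr ler_wsqrtr// lerDr sqr_ge0. Qed.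
Lemma cmod_le z : cmod z <= `|cre z| + `|cim z|.
Proof.
rewrite -[leRHS]ger0_norm ?addr_ge0// -sqrtr_sqr ler_wsqrtr// sqrrD !real_normK ?num_real//.
by rewrite addrAC lerDl mulrn_wge0// mulr_ge0.
Qed.
End ComplexArithmetic.

Section RealIntegral.
Variable R : realType.
Local Notation mu := (@lebesgue_measure R).
Implicit Types (D E : set R) (f g h : R -> R).

Definition RI D f := mu.-integrable D (EFin \o f).
Definition Rint D f : R := \int[mu]_(x in D) f x.

Lemma RI_meas D f : RI D f -> measurable_fun D f.
Proof. by move=> /integrableP[/measurable_EFinP]. Qed.

Lemma RI_ext D f g : (forall x, D x -> f x = g x) -> RI D f -> RI D g.
Proof.
move=> fg /integrableP[mf fi]; apply/integrableP; split.
  by apply: eq_measurable_fun mf => x; rewrite inE => Dx /=; rewrite fg.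
apply: le_lt_trans fi; rewrite le_eqVlt; apply/orP; left; apply/eqP/eq_integral => x.
by rewrite inE => Dx /=; rewrite fg.
Qed.

Lemma Rint_ext D f g : (forall x, D x -> f x = g x) -> Rint D f = Rint D g.
Proof. by move=> fg; apply: eq_Rintegral => x; rewrite inE => /fg. Qed.

Lemma meas_ext D f g : (forall x, D x -> f x = g x) -> measurable_fun D f -> measurable_fun D g.
Proof. by move=> fg; apply: eq_measurable_fun => x; rewrite inE => /fg. Qed.

Lemma RI_le D f g : measurable D -> measurable_fun D f ->
  (forall x, D x -> `|f x| <= g x) -> RI D g -> RI D f.
Proof.
move=> mD mf fg; apply: le_integrable => //; first exact/measurable_EFinP.
by move=> x Dx /=; rewrite lee_fin (le_trans (fg x Dx))// ler_norm.
Qed.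

Lemma RI_ge0 D f : measurable_fun D f -> (forall x, D x -> 0 <= f x) ->
  (\int[mu]_(x in D) (f x)%:E < +oo)%E -> RI D f.
Proof.
move=> mf f0 fin; apply/integrableP; split; first exact/measurable_EFinP.
apply: le_lt_trans fin; rewrite le_eqVlt; apply/orP; left; apply/eqP/eq_integral => x.
by rewrite inE => /f0 h /=; rewrite ger0_norm.
Qed.

Lemma RI_fin D f : measurable D -> RI D f -> (\int[mu]_(x in D) (f x)%:E = (Rint D f)%:E)%E.
Proof. by move=> mD fi; rewrite /Rint /Rintegral fineK//; exact: integrable_fin_num. Qed.

Lemma RI_D D f g : measurable D -> RI D f -> RI D g -> RI D (fun x => f x + g x).
Proof.
move=> mD fi gi; have -> : RI D (fun x => f x + g x) = mu.-integrable D ((EFin \o f) \+ (EFin \o g)).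
  by congr (integrable _ _ _); apply/funext => x /=.
exact: integrableD.
Qed.

Lemma RI_Z D c f : measurable D -> RI D f -> RI D (fun x => c * f x).
Proof. by move=> mD fi; have := @integrableZl _ _ _ mu D mD c (EFin \o f) fi. Qed.

Lemma RI_N D f : measurable D -> RI D f -> RI D (fun x => - f x).
Proof. by move=> mD /(RI_Z (-1) mD); apply: RI_ext => x _; rewrite mulN1r. Qed.

Lemma RI_B D f g : measurable D -> RI D f -> RI D g -> RI D (fun x => f x - g x).
Proof. by move=> mD fi gi; apply: RI_D => //; exact: RI_N. Qed.

Lemma RI_sub D E f : measurable D -> measurable E -> D `<=` E -> RI E f -> RI D f.
Proof. by move=> mD mE DE; exact: integrableS. Qed.

Lemma RI_norm D f : measurable D -> RI D f -> RI D (fun x => `|f x|).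
Proof. by move=> mD; exact: integrable_norm. Qed.

Lemma RI_cst (a b c : R) : RI `[a, b] (fun=> c).
Proof.
apply: measurable_bounded_integrable => //; last first.
  by exists `|c|; split; [exact: num_real|move=> x /ltW cx y _ /=].
by rewrite [X in (X < _)%E]lebesgue_measure_itv /=; case: ifP => // _; rewrite -EFinB ltry.
Qed.

Lemma RI0 D : measurable D -> RI D (fun=> 0).
Proof.
by move=> mD; apply: RI_ge0 => //; rewrite (_ : (\int[mu]_(x in D) _)%E = 0%E) ?ltry//; exact: integral0.
Qed.

Lemma RintD D f g : measurable D -> RI D f -> RI D g ->
  Rint D (fun x => f x + g x) = Rint D f + Rint D g.
Proof. by move=> *; apply: RintegralD. Qed.

Lemma RintB D f g : measurable D -> RI D f -> RI D g ->
  Rint D (fun x => f x - g x) = Rint D f - Rint D g.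
Proof. by move=> *; apply: RintegralB. Qed.

Lemma RintZ D c f : measurable D -> RI D f -> Rint D (fun x => c * f x) = c * Rint D f.
Proof. by move=> *; apply: RintegralZl. Qed.

Lemma Rint_le D f g : measurable D -> RI D f -> RI D g -> (forall x, D x -> f x <= g x) ->
  Rint D f <= Rint D g.
Proof. by move=> *; apply: le_Rintegral. Qed.

Lemma Rint_ge0 D f : (forall x, D x -> 0 <= f x) -> 0 <= Rint D f.
Proof. by move=> *; apply: Rintegral_ge0. Qed.

Lemma Rint_norm D f : measurable D -> RI D f -> `|Rint D f| <= Rint D (fun x => `|f x|).
Proof. by move=> *; apply: le_normr_Rintegral. Qed.

Lemma Rint_cst (a b c : R) : a <= b -> Rint `[a, b] (fun=> c) = c * (b - a).
Proof.
move=> ab; rewrite /Rint Rintegral_cst// [X in fine X]lebesgue_measure_itv /= lte_fin.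
by move: ab; rewrite le_eqVlt => /predU1P[->|->]//; rewrite ltxx subrr.
Qed.

Lemma Rint_sub_le D E f : measurable D -> measurable E -> D `<=` E ->
  (forall x, E x -> 0 <= f x) -> RI E f -> Rint D f <= Rint E f.
Proof.
move=> mD mE DE f0 fi; rewrite -lee_fin -!RI_fin//; last exact: RI_sub fi.
apply: ge0_subset_integral => //; first by apply/measurable_EFinP; exact: RI_meas.
Qed.

Lemma Rint_cat (a b c : R) f : a <= b -> b <= c -> RI `[a, c] f ->
  Rint `[a, c] f = Rint `[a, b] f + Rint `[b, c] f.
Proof.
move=> ab bc fi; have := @Rintegral_itvB R f (BLeft a) (BRight c) b fi.
rewrite !bnd_simp => /(_ ab bc) /eqP; rewrite subr_eq addrC => /eqP E.
rewrite /Rint E Rintegral_itv_obnd_cbnd//; apply: RI_sub fi => //.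
by move=> x /=; rewrite !in_itv /= => /andP[h ->]; rewrite andbT (le_trans ab)// ltW.
Qed.

Lemma Rint_dct D (f : nat -> R -> R) g h : measurable D ->
  (forall n, measurable_fun D (f n)) ->
  (forall x, D x -> f ^~ x @ \oo --> g x) ->
  (forall n x, D x -> `|f n x| <= h x) -> RI D h ->
  RI D g /\ (fun n => Rint D (f n)) @ \oo --> Rint D g.
Proof.
move=> mD mf fg fh hi.
have mg : measurable_fun D g by apply: (measurable_fun_cvg mf) => x /fg.
have mE k : measurable_fun D k -> measurable_fun D (EFin \o k) by move=> ?; exact/measurable_EFinP.
have [|||||gi _ lim] := @dominated_convergence _ _ _ mu D mD (fun n => EFin \o f n) (EFin \o g) (EFin \o h).
- by move=> n; apply: mE.
- exact: mE.
- by apply: aeW => x Dx /=; apply: cvg_EFin; [exact: nearW|exact: fg].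
- exact: hi.
- by apply: aeW => x n Dx /=; rewrite lee_fin fh.
split => //; have E : (\int[mu]_(x in D) (g x)%:E = (Rint D g)%:E)%E by exact: RI_fin.
by move: lim; rewrite /= E => /fine_cvg.
Qed.

End RealIntegral.

Section ComplexIntegral.
Variable R : realType.
Local Notation mu := (@lebesgue_measure R).
Implicit Types (D E : set R) (f g : R -> CC R) (h : R -> R).

Definition cmeas D f :=
  measurable_fun D (fun x => cre (f x)) /\ measurable_fun D (fun x => cim (f x)).
Definition CI D f := RI D (fun x => cre (f x)) /\ RI D (fun x => cim (f x)).
Definition cint D f : CC R := Complex (Rint D (fun x => cre (f x))) (Rint D (fun x => cim (f x))).

Lemma CI_meas D f : CI D f -> cmeas D f.
Proof. by move=> [/RI_meas ? /RI_meas]. Qed.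

Lemma cmeas_ext D f g : (forall x, D x -> f x = g x) -> cmeas D f -> cmeas D g.
Proof. by move=> fg [mr mi]; split; [apply: meas_ext mr|apply: meas_ext mi] => x /fg ->. Qed.

Lemma CI_ext D f g : (forall x, D x -> f x = g x) -> CI D f -> CI D g.
Proof. by move=> fg [mr mi]; split; [apply: RI_ext mr|apply: RI_ext mi] => x /fg ->. Qed.

Lemma cint_ext D f g : (forall x, D x -> f x = g x) -> cint D f = cint D g.
Proof. by move=> fg; congr Complex; apply: Rint_ext => x /fg ->. Qed.

Lemma cmeas_sub D E f : measurable E -> D `<=` E -> cmeas E f -> cmeas D f.
Proof. by move=> mE DE [mr mi]; split; [apply: measurable_funS mr|apply: measurable_funS mi]. Qed.

Lemma cmeasD D f g : cmeas D f -> cmeas D g -> cmeas D (fun x => f x + g x).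
Proof.
move=> [f1 f2] [g1 g2]; split.
  by apply: (meas_ext _ (measurable_funD f1 g1)) => x _; rewrite creD.
by apply: (meas_ext _ (measurable_funD f2 g2)) => x _; rewrite cimD.
Qed.

Lemma cmeasM D f g : cmeas D f -> cmeas D g -> cmeas D (fun x => f x * g x).
Proof.
move=> [f1 f2] [g1 g2]; split.
  by apply: (meas_ext _ (measurable_funB (measurable_funM f1 g1) (measurable_funM f2 g2))) => x _; rewrite creM.
by apply: (meas_ext _ (measurable_funD (measurable_funM f1 g2) (measurable_funM f2 g1))) => x _; rewrite cimM.
Qed.

Lemma cmeas_cst D (c : CC R) : cmeas D (fun=> c).
Proof. by split; exact: measurable_cst. Qed.

Lemma cmeasZ D (c : CC R) f : cmeas D f -> cmeas D (fun x => c * f x).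
Proof. by move=> fm; apply: cmeasM fm; exact: cmeas_cst. Qed.

Lemma cmeasN D f : cmeas D f -> cmeas D (fun x => - f x).
Proof. by move=> /(cmeasZ (-1)); apply: cmeas_ext => x _; rewrite mulN1r. Qed.

Lemma cmeasB D f g : cmeas D f -> cmeas D g -> cmeas D (fun x => f x - g x).
Proof. by move=> fm gm; apply: cmeasD => //; exact: cmeasN. Qed.

Lemma cmeas_R D h : measurable_fun D h -> cmeas D (fun x => cR (h x)).
Proof. by move=> mh; split => //=; exact: measurable_cst. Qed.

Lemma cmeas_mod D f : cmeas D f -> measurable_fun D (fun x => cmod (f x)).
Proof.
move=> [f1 f2]; apply: (@measurableT_comp _ _ _ _ _ _ (@Num.sqrt R) _ (fun x => cre (f x) ^+ 2 + cim (f x) ^+ 2)).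
  by apply: continuous_measurable_fun; exact: sqrt_continuous.
by apply: measurable_funD; apply: measurable_funX.
Qed.

Lemma cmeas_conj D f : cmeas D f -> cmeas D (fun x => Complex (cre (f x)) (- cim (f x))).
Proof. by move=> [f1 f2]; split => //=; exact: measurable_funN. Qed.

Definition ccvg (u : nat -> CC R) (l : CC R) :=
  (fun n => cre (u n)) @ \oo --> cre l /\ (fun n => cim (u n)) @ \oo --> cim l.

Lemma ccvgP u l : ccvg u l <-> (fun n => cmod (u n - l)) @ \oo --> (0 : R).
Proof.
split=> [[h1 h2]|h].
  have h3 : (fun n => `|cre (u n) - cre l| + `|cim (u n) - cim l|) @ \oo --> (0 : R).
    rewrite -[X in _ --> X]addr0; apply: cvgD.
      rewrite -(normr0 R); apply: cvg_norm; rewrite -(subrr (cre l)).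
      by apply: cvgB => //; exact: cvg_cst.
    rewrite -(normr0 R); apply: cvg_norm; rewrite -(subrr (cim l)).
    by apply: cvgB => //; exact: cvg_cst.
  apply: (squeeze_cvgr _ (cvg_cst 0) h3); apply: nearW => n.
  by rewrite cmod_ge0 (le_trans (cmod_le _))// !cE.
split; apply/cvgrPdist_le => e e0; move/cvgrPdist_le : h => /(_ e e0);
  apply: filterS => n; rewrite sub0r normrN ger0_norm ?cmod_ge0// cmodBC; apply: le_trans.
  by have := cre_le (l - u n); rewrite !cE.
by have := cim_le (l - u n); rewrite !cE.
Qed.

Lemma cmeas_lim D (u : nat -> R -> CC R) f : (forall n, cmeas D (u n)) ->
  (forall x, D x -> ccvg (u ^~ x) (f x)) -> cmeas D f.
Proof.
move=> um ul; split.
  by apply: (measurable_fun_cvg (fun n => (um n).1)) => x /ul[].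
by apply: (measurable_fun_cvg (fun n => (um n).2)) => x /ul[].
Qed.

Lemma CI_le D f h : measurable D -> cmeas D f -> (forall x, D x -> cmod (f x) <= h x) ->
  RI D h -> CI D f.
Proof.
move=> mD [f1 f2] fh hi; split.
  by apply: RI_le f1 _ hi => // x /fh; apply: le_trans; exact: cre_le.
by apply: RI_le f2 _ hi => // x /fh; apply: le_trans; exact: cim_le.
Qed.

Lemma CI_mod D f : measurable D -> CI D f -> RI D (fun x => cmod (f x)).
Proof.
move=> mD [f1 f2]; apply: RI_le (RI_D mD (RI_norm mD f1) (RI_norm mD f2)) => //.
  by apply: cmeas_mod; exact: CI_meas.
by move=> x _; rewrite ger0_norm ?cmod_ge0// cmod_le.
Qed.

Lemma CI_D D f g : measurable D -> CI D f -> CI D g -> CI D (fun x => f x + g x).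
Proof.
move=> mD [f1 f2] [g1 g2]; split.
  by apply: RI_ext (RI_D mD f1 g1) => x _; rewrite creD.
by apply: RI_ext (RI_D mD f2 g2) => x _; rewrite cimD.
Qed.

Lemma cintD D f g : measurable D -> CI D f -> CI D g ->
  cint D (fun x => f x + g x) = cint D f + cint D g.
Proof.
move=> mD [f1 f2] [g1 g2]; apply: CCP; rewrite /cint !cE -RintD//; apply: Rint_ext => x _.
  by rewrite creD.
by rewrite cimD.
Qed.

Lemma CI_Z D (c : CC R) f : measurable D -> CI D f -> CI D (fun x => c * f x).
Proof.
move=> mD [f1 f2]; split.
  by apply: RI_ext (RI_B mD (RI_Z (cre c) mD f1) (RI_Z (cim c) mD f2)) => x _; rewrite creM.
by apply: RI_ext (RI_D mD (RI_Z (cre c) mD f2) (RI_Z (cim c) mD f1)) => x _; rewrite cimM.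
Qed.

Lemma cintZ D (c : CC R) f : measurable D -> CI D f -> cint D (fun x => c * f x) = c * cint D f.
Proof.
move=> mD [f1 f2]; apply: CCP; rewrite /cint !cE -!RintZ// -?RintB -?RintD//; try exact: RI_Z.
  by apply: Rint_ext => x _; rewrite creM.
by apply: Rint_ext => x _; rewrite cimM.
Qed.

Lemma CI_N D f : measurable D -> CI D f -> CI D (fun x => - f x).
Proof. by move=> mD /(CI_Z (-1) mD); apply: CI_ext => x _; rewrite mulN1r. Qed.

Lemma CI_B D f g : measurable D -> CI D f -> CI D g -> CI D (fun x => f x - g x).
Proof. by move=> mD fi gi; apply: CI_D => //; exact: CI_N. Qed.

Lemma cintN D f : measurable D -> CI D f -> cint D (fun x => - f x) = - cint D f.
Proof.
by move=> mD fi; rewrite -mulN1r -cintZ//; apply: cint_ext => x _; rewrite mulN1r.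
Qed.

Lemma cintB D f g : measurable D -> CI D f -> CI D g ->
  cint D (fun x => f x - g x) = cint D f - cint D g.
Proof. by move=> mD fi gi; rewrite cintD ?cintN//; exact: CI_N. Qed.

(** Rotation: |z|^2 is the real part of the integral of conj(z) f, which is at most |z| times the
    integral of |f|. Estimating real and imaginary parts separately would lose a factor. *)
Lemma cint_norm D f : measurable D -> CI D f -> cmod (cint D f) <= Rint D (fun x => cmod (f x)).
Proof.
move=> mD [f1 f2]; set z := cint D f; have [->|z0] := eqVneq z 0.
  by rewrite cmod0 Rint_ge0// => x _; exact: cmod_ge0.
have fm := CI_mod mD (conj f1 f2).
rewrite -(ler_pM2l (cmod_gt0 z0)) -expr2 cmod_sqr -RintZ//.
rewrite !expr2 {2}/z [in X in _ + _ * X <= _]/z /cint !cE -!RintZ// -RintD//; try exact: RI_Z.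
apply: Rint_le => //; [by apply: RI_D => //; exact: RI_Z|exact: RI_Z|].
move=> x _; apply: le_trans (_ : cmod (Complex (cre z) (- cim z) * f x : CC R) <= _).
  by apply: le_trans (cre_le _); rewrite !cE mulNr opprK ler_norm.
by rewrite cmodM /cmod !cE sqrrN.
Qed.

Lemma cint_le D f h : measurable D -> CI D f -> RI D h -> (forall x, D x -> cmod (f x) <= h x) ->
  cmod (cint D f) <= Rint D h.
Proof.
move=> mD fi hi fh; apply: (le_trans (cint_norm mD fi)); apply: Rint_le => //.
exact: CI_mod.
Qed.

Lemma cint_dct D (f : nat -> R -> CC R) g h : measurable D -> (forall n, cmeas D (f n)) ->
  (forall x, D x -> ccvg (f ^~ x) (g x)) ->
  (forall n x, D x -> cmod (f n x) <= h x) -> RI D h ->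
  CI D g /\ ccvg (fun n => cint D (f n)) (cint D g).
Proof.
move=> mD fm fg fh hi.
have [i1 l1] := Rint_dct mD (fun n => (fm n).1) (fun x Dx => (fg x Dx).1)
  (fun n x Dx => le_trans (cre_le _) (fh n x Dx)) hi.
have [i2 l2] := Rint_dct mD (fun n => (fm n).2) (fun x Dx => (fg x Dx).2)
  (fun n x Dx => le_trans (cim_le _) (fh n x Dx)) hi.
by split; split.
Qed.

End ComplexIntegral.

(** * Primitives *)

Section RealPrimitive.
Variable R : realType.
Local Notation mu := (@lebesgue_measure R).
Implicit Types (F G f g h : R -> R) (a b x y e : R).

(** [F] is locally absolutely continuous on ]0, oo[ with density [f]. Unlike the epsilon-delta form,
    the integral form is directly stable under sums and under changes of [f] on null sets, and it
    does not mention derivatives. *)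
Definition rprim F f := measurable_fun (@pos R) f /\
  forall a b, 0 < a -> a <= b -> RI `[a, b] f /\ F b - F a = Rint `[a, b] f.

Lemma pos_meas : measurable (@pos R).
Proof.
have -> : @pos R = `]0, +oo[%classic by apply/seteqP; split => x; rewrite /pos /= in_itv /= andbT.
exact: measurable_itv.
Qed.

Lemma itv_pos a b : 0 < a -> `[a, b] `<=` @pos R.
Proof. by move=> a0 x; rewrite /pos /= in_itv /= => /andP[/(lt_le_trans a0)]. Qed.

Lemma aeS (P Q : R -> Prop) : (forall x, P x -> Q x) ->
  {ae mu, forall x, P x} -> {ae mu, forall x, Q x}.
Proof. by move=> PQ [A [mA A0 h]]; exists A; split=> // x nq; apply: h => px; apply: nq; exact: PQ. Qed.

Lemma aeI (P Q : R -> Prop) : {ae mu, forall x, P x} -> {ae mu, forall x, Q x} ->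
  {ae mu, forall x, P x /\ Q x}.
Proof.
move=> hP hQ; have := negligibleU hP hQ; apply: negligibleS => x /not_andP[]; [left|right] => //.
Qed.

Lemma ae_neq a : {ae mu, forall x, x != a}.
Proof.
exists [set a]; split; [exact: measurable_set1|exact: lebesgue_measure_set1|].
by move=> x /negP; rewrite negbK => /eqP.
Qed.

Lemma RI_restrict D f : measurable D -> RI D f -> RI setT (f \_ D).
Proof.
by move=> mD fi; have := (@integrable_mkcond _ _ _ mu D (EFin \o f) mD).1 fi; rewrite restrict_EFin.
Qed.

Lemma RI_ae D f h : measurable D -> measurable_fun D h -> {ae mu, forall x, D x -> f x = h x} ->
  RI D f -> RI D h /\ Rint D f = Rint D h.
Proof.
move=> mD mh fh fi; have mf := RI_meas fi.
have mE k : measurable_fun D k -> measurable_fun D (EFin \o k) by move=> ?; exact/measurable_EFinP.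
split; last first.
  rewrite /Rint /Rintegral; congr fine; apply: ae_eq_integral => //; [exact: mE|exact: mE|].
  by apply: aeS fh => x H /H /= ->.
move/integrableP : fi => [_ i]; apply/integrableP; split; first exact: mE.
apply: le_lt_trans i; rewrite le_eqVlt; apply/orP; left; apply/eqP; apply: ae_eq_integral => //.
- by apply: measurableT_comp => //; exact: mE.
- by apply: measurableT_comp => //; exact: mE.
- by apply: aeS fh => x H /H /= ->.
Qed.

(** Lebesgue differentiation of the integral from [a], transferred to [F], which differs from it by
    a constant near each interior point. *)
Lemma density_derive a b F f : RI setT f ->
  (forall x y, a <= x -> x <= y -> y <= b -> F y - F x = Rint `[x, y] f) ->
  {ae mu, forall x, a < x < b -> derivable F x 1 /\ F^`() x = f x}.
Proof.
move=> fi FE.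
have li : locally_integrable setT f.
  by apply: open_integrable_locally => //; exact: openT.
have fy y : mu.-integrable [set` Interval (BLeft a) (BRight y)] (EFin \o f) by apply: RI_sub fi.
apply: aeS (FTC1 fy li) => x H /andP[ax xb].
have [|d e] := H; first by rewrite /= lte_fin.
pose G y := \int[mu]_(t in `[a, y]) f t.
have GE y : G y = Rint `[a, y] f by [].
have E : \forall y \near x, F y = F a + G y.
  near=> y; have ay : a < y by near: y; exact: lt_nbhsr.
  have yb : y < b by near: y; exact: lt_nbhsl.
  by rewrite GE -FE ?lexx ?ltW// addrC subrK.
have dG : is_derive x 1 G (f x) := DeriveDef d (etrans (esym (derive1E _ _)) e).
have dE : is_derive x 1 (fun y => F a + G y) (f x).
  by have := is_deriveD (is_derive_cst (F a) x 1) dG; rewrite add0r.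
have dF : is_derive x 1 F (f x).
  apply: near_eq_is_derive dE => //.
  by near=> y; apply/esym; near: y.
by split; [exact: ex_derive|rewrite derive1E; exact: derive_val].
Unshelve. all: by end_near. Qed.

(** [f] is only locally integrable on ]0, oo[, so it is restricted to the compact intervals
    [1/(n+1), n+1], and countably many null sets are united. *)
Lemma rprim_derive F f : rprim F f ->
  {ae mu, forall x, 0 < x -> derivable F x 1 /\ F^`() x = f x}.
Proof.
move=> [mf H]; pose K n := `[n.+1%:R^-1 : R, n.+1%:R]%classic.
have mK n : measurable (K n) by exact: measurable_itv.
have P n : {ae mu, forall x, n.+1%:R^-1 < x < n.+1%:R -> derivable F x 1 /\ F^`() x = f x}.
  have n0 : (0 : R) < n.+1%:R^-1 by rewrite invr_gt0.
  have nn : (n.+1%:R^-1 : R) <= n.+1%:R.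
    by rewrite (@le_trans _ _ 1)// ?invf_le1 ?ler1n.
  have [fi _] := H _ _ n0 nn.
  have gi : RI setT (f \_ (K n)).
    exact: RI_restrict.
  have [|N [mN N0 HN]] := @density_derive n.+1%:R^-1 n.+1%:R F (f \_ (K n)) gi.
    move=> x y x1 xy y1; have [_ ->] := H x y (lt_le_trans n0 x1) xy.
    apply: Rint_ext => t; rewrite /= in_itv /= => /andP[xt ty].
    by rewrite patchE mem_set// /K /= in_itv /= (le_trans x1)// (le_trans ty).
  exists N; split=> // x Hx; apply: HN => h; apply: Hx => xx.
  have [d e] := h xx; split => //; rewrite e patchE mem_set//.
  by rewrite /K /= in_itv /=; case/andP: xx => /ltW -> /ltW ->.
apply: aeS (ae_foralln P) => x Hx x0.
pose n := maxn (Num.bound x) (Num.bound x^-1); apply: (Hx n).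
have x'0 : 0 < x^-1 by rewrite invr_gt0.
apply/andP; split.
  rewrite -[ltRHS]invrK ltf_pV2 ?posrE//; apply: lt_le_trans (archi_boundP (ltW x'0)) _.
  by rewrite ler_nat; apply: leqW; exact: leq_maxr.
apply: lt_le_trans (archi_boundP (ltW x0)) _.
by rewrite ler_nat; apply: leqW; exact: leq_maxl.
Qed.

(** The density produced by absolute continuity and the given [h] both equal the derivative of [F]
    almost everywhere, so one may be exchanged for the other. *)
Lemma abs_cont_rprim F h : measurable_fun (@pos R) h ->
  (forall a b, 0 < a -> a <= b -> abs_cont a b F) ->
  {ae mu, forall x, 0 < x -> derivable F x 1 -> F^`() x = h x} -> rprim F h.
Proof.
move=> mh acF aeh; split => // a b a0; rewrite le_eqVlt => /predU1P[<-|ab].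
  split.
    rewrite set_itv1 /RI; apply/integrableP; split.
      by apply/measurable_EFinP; exact: measurable_fun_set1.
    by rewrite integral_set1 ltry.
  by rewrite subrr /Rint set_itv1 Rintegral_set1.
have [f [fi fE]] := abs_cont_density ab (acF _ _ a0 (ltW ab)).
have fd := density_derive fi fE.
have mab : measurable `[a, b]%classic by exact: measurable_itv.
have fi' : RI `[a, b] f by apply: RI_sub fi.
have mh' : measurable_fun `[a, b] h by apply: measurable_funS mh; [exact: pos_meas|exact: itv_pos].
have ae1 : {ae mu, forall x, `[a, b]%classic x -> f x = h x}.
  apply: aeS (aeI (aeI fd aeh) (aeI (ae_neq a) (ae_neq b))) => x [[H1 H2] [xa xb]].
  rewrite /= in_itv /= => /andP[ax bx].
  have axb : a < x < b by rewrite !lt_neqAle ax bx eq_sym xa xb.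
  have [d <-] := H1 axb; apply: H2 => //.
  exact: lt_le_trans ax.
have [hi fhE] := RI_ae mab mh' ae1 fi'.
by split => //; rewrite -fhE /Rint -fE// ltW.
Qed.

(** The integral of [|f|] over a set is small when its measure is; the set is the union of the open
    intervals, since closed ones could share endpoints. *)
Lemma rprim_abs_cont F f a b : rprim F f -> 0 < a -> a <= b -> abs_cont a b F.
Proof.
move=> [mf H] a0 ab e e0; have [fi _] := H a b a0 ab.
have mab : measurable `[a, b]%classic by exact: measurable_itv.
have [d [d0 Hd]] := integral_normr_continuous (RI_restrict mab fi) e0.
exists d => // n s hs dj sd.
pose I (i : 'I_n) : set R := `](s i).1, (s i).2[%classic.
have mI i : measurable (I i) by exact: measurable_itv.
have tI : trivIset xpredT I.
  apply/trivIsetP => i j _ _ ij; apply/eqP; apply/negPn/negP => /set0P[x []].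
  rewrite /I /= !in_itv /= => /andP[h1 h2] /andP[h3 h4].
  case: (dj i j ij) => k.
    by have := lt_trans h3 (lt_le_trans h2 k); rewrite ltxx.
  by have := lt_trans h1 (lt_le_trans h4 k); rewrite ltxx.
have tI' : trivIset setT I by move=> i j _ _; exact: tI.
pose U := \big[setU/set0]_(i < n) I i.
have mU : measurable U by apply: bigsetU_measurable.
have muU : (mu U < d%:E)%E.
  rewrite [X in (X < _)%E](_ : _ = (\sum_(i < n) ((s i).2 - (s i).1))%:E) ?lte_fin//.
  rewrite /U measure_bigsetU_ord//.
  rewrite -sumEFin; apply: eq_bigr => i _; rewrite /I [LHS]lebesgue_measure_itv /= lte_fin.
  have [_ [h _]] := hs i; move: h; rewrite le_eqVlt => /predU1P[->|->]; last by rewrite EFinB.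
  by rewrite ltxx subrr.
have IU i : I i `<=` U by move=> x Ix; rewrite /U (bigD1 i)//=; left.
have UE : U `<=` `[a, b].
  rewrite /U; apply: (@big_ind _ (fun X : set R => X `<=` `[a, b])) => [x []|X Y XU YU x [/XU|/YU]|i _ x]//.
  rewrite /I /= !in_itv /= => /andP[h1 h2]; have [k1 [k2 k3]] := hs i.
  by rewrite (le_trans k1 (ltW h1)) (le_trans (ltW h2) k3).
have fn : RI `[a, b] (fun x => `|f x|) by exact: RI_norm.
have fnI i : RI (I i) (fun x => `|f x|) := RI_sub (mI i) mab (subset_trans (IU i) UE) fn.
have mE D (k : R -> R) : measurable_fun D k -> measurable_fun D (fun x => (k x)%:E) by move=> ?; exact/measurable_EFinP.
apply: le_lt_trans (Hd U mU muU).
apply: (@le_trans _ _ (\sum_(i < n) Rint (I i) (fun x => `|f x|))).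
  apply: ler_sum => i _; have [k1 [k2 k3]] := hs i.
  have [fii ->] := H (s i).1 (s i).2 (lt_le_trans a0 k1) k2.
  apply: (le_trans (Rint_norm _ _)) => //.
  rewrite -lee_fin -RI_fin//; last exact: RI_norm.
  rewrite -RI_fin// le_eqVlt; apply/orP; left; apply/eqP; rewrite /I.
  by apply: integral_itv_bndoo; exact: (mE _ _ (RI_meas (fnI i))).
rewrite -lee_fin -sumEFin (eq_bigr (fun i => \int[mu]_(x in I i) (`|f x|)%:E)%E); last first.
  by move=> i _; rewrite RI_fin.
rewrite -(@ge0_integral_bigsetU _ _ _ mu _ I (fun x => `|f x|%:E) (index_enum 'I_n)) ?index_enum_uniq//; last 2 first.
- by move=> i j _ _; exact: tI.
- exact: (mE _ _ (RI_meas (RI_sub mU mab UE fn))).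
rewrite -/U RI_fin//; last exact: (RI_sub mU mab UE fn).
rewrite lee_fin le_eqVlt; apply/orP; left; apply/eqP; apply: Rint_ext => x Ux.
by rewrite patchE mem_set//; exact: UE.
Qed.

Lemma abs_cont_cont F x : (forall a b, 0 < a -> a <= b -> abs_cont a b F) -> 0 < x ->
  {for x, continuous F}.
Proof.
move=> acF x0; have x20 : 0 < x / 2 by rewrite divr_gt0.
have x2x : x / 2 <= x + 1 by lra.
apply/cvgrPdist_le => e e0; have [d d0 H] := abs_cont_family (acF _ _ x20 x2x) e0.
near=> y.
have y1 : x / 2 <= y by near: y; apply: lt_le_nbhsr; lra.
have y2 : y <= x + 1 by near: y; apply: lt_le_nbhsl; lra.
have yd : `|x - y| < d by near: y; apply: cvgr_dist_lt => //; exact: cvg_id.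
wlog xy : / True by apply.
have [xy'|/ltW xy'] := leP x y.
  rewrite distrC ltW//; have := H [:: (x, y)]; rewrite /jump !big_cons !big_nil !addr0 /=.
  apply; last by rewrite distrC.
  by rewrite /family /= xy' y2 !andbT; lra.
rewrite ltW//; have := H [:: (y, x)]; rewrite /jump !big_cons !big_nil !addr0 /=.
apply => //; rewrite /family /= xy' y1 /= !andbT; lra.
Unshelve. all: by end_near. Qed.

Lemma rprim_cont F f x : rprim F f -> 0 < x -> {for x, continuous F}.
Proof. by move=> pF x0; apply: abs_cont_cont => // a b; exact: (rprim_abs_cont pF). Qed.

Lemma cont_pos_meas F : (forall x, 0 < x -> {for x, continuous F}) -> measurable_fun (@pos R) F.
Proof.
move=> cF; apply: open_continuous_measurable_fun; last by move=> x; rewrite inE; exact: cF.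
have -> : @pos R = `]0, +oo[%classic by apply/seteqP; split => x; rewrite /pos /= in_itv /= andbT.
exact: interval_open.
Qed.

Lemma abs_cont_lip a b F G H C : 0 <= C -> abs_cont a b F -> abs_cont a b G ->
  (forall x y, a <= x -> x <= y -> y <= b -> `|H y - H x| <= C * (`|F y - F x| + `|G y - G x|)) ->
  abs_cont a b H.
Proof.
move=> C0 aF aG HC e e0; have k0 : 0 < e / 2 / (C + 1) by rewrite !divr_gt0// ltr_wpDl.
have [d1 d10 H1] := aF _ k0; have [d2 d20 H2] := aG _ k0.
exists (Num.min d1 d2); first by rewrite lt_min d10.
move=> n s hs dj; rewrite lt_min => /andP[/(H1 _ _ hs dj) k1 /(H2 _ _ hs dj) k2].
apply: (@le_lt_trans _ _ (C * (\sum_(i < n) `|F (s i).2 - F (s i).1| + \sum_(i < n) `|G (s i).2 - G (s i).1|))).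
  by rewrite -big_split mulr_sumr; apply: ler_sum => i _; have [? [? ?]] := hs i; exact: HC.
have := ltrD k1 k2; set S := _ + _ => k3.
have S0 : 0 <= S by rewrite addr_ge0// sumr_ge0.
apply: (@le_lt_trans _ _ ((C + 1) * S)); first by rewrite ler_wpM2r// lerDl.
by rewrite mulrC -ltr_pdivlMr ?ltr_wpDl//; apply: lt_le_trans k3 _; lra.
Qed.

Lemma rprim_bound F f a b : rprim F f -> 0 < a -> exists2 M : R, 0 <= M & forall x, a <= x <= b -> `|F x| <= M.
Proof.
move=> pF a0; have [ab|ba] := leP a b; last first.
  by exists 0 => // x /andP[h1 /(le_trans h1)]; rewrite leNgt ba.
have [_ H] := pF; have [fi _] := H a b a0 ab.
have fn : RI `[a, b] (fun x => `|f x|) by apply: RI_norm.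
exists (`|F a| + Rint `[a, b] (fun x => `|f x|)).
  by rewrite addr_ge0// Rint_ge0.
move=> x /andP[ax xb]; have [fx fE] := H a x a0 ax.
rewrite -[F x](subrK (F a)) addrC (le_trans (ler_normD _ _))// lerD2l fE.
apply: (le_trans (Rint_norm _ fx)) => //; apply: Rint_sub_le => // t.
by rewrite /= !in_itv /= => /andP[-> /le_trans ->].
Qed.

(** A locally Lipschitz function of absolutely continuous functions is absolutely continuous, and
    the chain rule at almost every point identifies its density. Products and exponentials are
    instances, so integration by parts is obtained without Fubini. *)
Lemma rprim_comp2 F f G g H h : rprim F f -> rprim G g -> measurable_fun (@pos R) h ->
  (forall M, 0 <= M -> exists2 C, 0 <= C & forall x y, 0 < x -> 0 < y ->
    `|F x| <= M -> `|G x| <= M -> `|F y| <= M -> `|G y| <= M ->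
    `|H y - H x| <= C * (`|F y - F x| + `|G y - G x|)) ->
  (forall x, 0 < x -> is_derive x 1 F (f x) -> is_derive x 1 G (g x) -> is_derive x 1 H (h x)) ->
  rprim H h.
Proof.
move=> pF pG mh lip der; apply: abs_cont_rprim => //.
  move=> a b a0 ab; have [M1 M10 H1] := rprim_bound b pF a0; have [M2 M20 H2] := rprim_bound b pG a0.
  have [|C C0 HC] := lip (M1 + M2); first exact: addr_ge0.
  apply: (abs_cont_lip C0 (rprim_abs_cont pF a0 ab) (rprim_abs_cont pG a0 ab)) => x y ax xy yb.
  have k1 : a <= x <= b by rewrite ax (le_trans xy).
  have k2 : a <= y <= b by rewrite yb andbT (le_trans ax).
  apply: HC; rewrite ?(lt_le_trans a0)// ?(le_trans ax)//.
  - by apply: (le_trans (H1 _ k1)); rewrite lerDl.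
  - by apply: (le_trans (H2 _ k1)); rewrite lerDr.
  - by apply: (le_trans (H1 _ k2)); rewrite lerDl.
  - by apply: (le_trans (H2 _ k2)); rewrite lerDr.
apply: aeS (aeI (rprim_derive pF) (rprim_derive pG)) => x [HF HG] x0 _.
have [d1 e1] := HF x0; have [d2 e2] := HG x0.
have dH : is_derive x 1 H (h x).
  by apply: der => //; [exact: (DeriveDef d1 (etrans (esym (derive1E _ _)) e1))|exact: (DeriveDef d2 (etrans (esym (derive1E _ _)) e2))].
by rewrite derive1E; exact: derive_val.
Qed.

Lemma rprim_meas F f : rprim F f -> measurable_fun (@pos R) F.
Proof. by move=> pF; apply: cont_pos_meas => x x0; exact: rprim_cont pF x0. Qed.

Lemma rprimM F f G g : rprim F f -> rprim G g ->
  rprim (fun x => F x * G x) (fun x => f x * G x + F x * g x).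
Proof.
move=> pF pG; have mf := pF.1; have mg := pG.1.
apply: (rprim_comp2 pF pG).
- by apply: measurable_funD; apply: measurable_funM => //; [exact: rprim_meas pG|exact: rprim_meas pF].
- move=> M M0; exists M => // x y x0 y0 Fx Gx Fy Gy.
  rewrite (_ : _ - _ = (F y - F x) * G y + F x * (G y - G x)); last by ring.
  rewrite (le_trans (ler_normD _ _))// !normrM mulrDr; apply: lerD.
    by rewrite mulrC ler_wpM2r.
  by rewrite ler_wpM2r.
- move=> x x0 dF dG; have := is_deriveM dF dG; rewrite addrC => h.
  by apply: is_derive_eq h _; rewrite /GRing.scale /= mulrC.
Qed.

Lemma rprimD F f G g : rprim F f -> rprim G g -> rprim (fun x => F x + G x) (fun x => f x + g x).
Proof.
move=> [mf HF] [mg HG]; split; first exact: measurable_funD.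
move=> a b a0 ab; have [fi fE] := HF a b a0 ab; have [gi gE] := HG a b a0 ab.
by split; [exact: RI_D|rewrite RintD// -fE -gE; ring].
Qed.

Lemma rprimZ c F f : rprim F f -> rprim (fun x => c * F x) (fun x => c * f x).
Proof.
move=> [mf HF]; split; first by apply: measurable_funM => //; exact: measurable_cst.
move=> a b a0 ab; have [fi fE] := HF a b a0 ab.
by split; [exact: RI_Z|rewrite RintZ// -fE; ring].
Qed.

Lemma rprim_cst c : rprim (fun=> c) (fun=> 0).
Proof.
split; first exact: measurable_cst.
move=> a b a0 ab; split; first exact: RI_cst.
by rewrite Rint_cst// mul0r subrr.
Qed.

Lemma rprim_ext F f G g : rprim F f -> (forall x, 0 < x -> F x = G x) ->
  (forall x, 0 < x -> f x = g x) -> rprim G g.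
Proof.
move=> [mf HF] FG fg; split; first by apply: meas_ext mf => x; exact: fg.
move=> a b a0 ab; have [fi fE] := HF a b a0 ab.
have fg' x : `[a, b]%classic x -> f x = g x by move=> /(itv_pos a0); exact: fg.
split; first by apply: RI_ext fi.
by rewrite -!FG ?(lt_le_trans a0)// fE; exact: Rint_ext.
Qed.

Lemma rprim_derive1 F f x : rprim F f -> 0 < x -> {for x, continuous f} ->
  derivable F x 1 /\ F^`() x = f x.
Proof.
move=> [mf HF] x0 cf; have x20 : 0 < x / 2 by rewrite divr_gt0.
have x2x : x / 2 <= x + 1 by lra.
have [fi _] := HF (x / 2) (x + 1) x20 x2x.
have [||] := @continuous_FTC1_closed R f (x / 2) x (x + 1) _ fi _ cf; [lra|lra|].
move=> d e; pose G y := Rint `[x / 2, y] f.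
have dG : is_derive x 1 G (f x) := DeriveDef d (etrans (esym (derive1E _ _)) e).
have dF : is_derive x 1 F (f x).
  have dE : is_derive x 1 (fun y => F (x / 2) + G y) (f x).
    by have := is_deriveD (is_derive_cst (F (x / 2)) x 1) dG; rewrite add0r.
  apply: near_eq_is_derive dE.
  near=> y; have y1 : x / 2 <= y by near: y; apply: lt_le_nbhsr; lra.
  by have [_ h] := HF _ y x20 y1; rewrite /G -h; ring.
by split; [exact: ex_derive|rewrite derive1E; exact: derive_val].
Unshelve. all: by end_near. Qed.

Lemma rprim_C1 F f : (forall x, 0 < x -> is_derive x 1 F (f x)) ->
  (forall x, 0 < x -> {for x, continuous f}) -> rprim F f.
Proof.
move=> dF cf; split; first exact: cont_pos_meas.
move=> a b a0; rewrite le_eqVlt => /predU1P[<-|ab].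
  split; last by rewrite subrr /Rint set_itv1 Rintegral_set1.
  rewrite set_itv1 /RI; apply/integrableP; split.
    by apply/measurable_EFinP; exact: measurable_fun_set1.
  by rewrite integral_set1 ltry.
have cw : {within `[a, b], continuous f}.
  by apply: continuous_in_subspaceT => x; rewrite inE => /(itv_pos a0); exact: cf.
have fi : RI `[a, b] f by apply: continuous_compact_integrable => //; exact: segment_compact.
split => //; have := @continuous_FTC2 R f F a b ab cw; rewrite RI_fin// -EFinB => H.
apply/esym; suff : (Rint `[a, b] f)%:E = (F b - F a)%:E by case.
have dx x : 0 < x -> derivable F x 1 by move=> /dF[].
apply: H.
  have cF x : 0 < x -> {for x, continuous F}.
    by move=> x0; apply/differentiable_continuous/derivable1_diffP; exact: dx.
  split; first by move=> x; rewrite in_itv /= => /andP[/(lt_trans a0) ? _]; exact: dx.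
    by apply: cvg_at_right_filter; exact: cF.
  by apply: cvg_at_left_filter; apply: cF; exact: lt_trans ab.
move=> x; rewrite in_itv /= => /andP[/(lt_trans a0) x0 _].
by rewrite derive1E; have [_ ->] := dF x x0.
Qed.

End RealPrimitive.

(** * Measurability of the pointwise derivative *)

Section DeriveMeasurable.
Variable R : realType.
Implicit Types (F f g : R -> R) (x e : R).

Lemma derive1_near F G x : (\near x, F x = G x) -> F^`() x = G^`() x.
Proof. by move=> FG; rewrite !derive1E; apply: near_eq_derive => //; exact: oner_neq0. Qed.

Lemma bigcap_rat_meas (P : set rat) (B : rat -> set R) :
  (forall p, P p -> measurable (B p)) -> measurable (\bigcap_(p in P) B p).
Proof.
move=> mB; rewrite -[X in measurable X]setCK setC_bigcap; apply: measurableC.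
rewrite bigcup_mkcond; apply: bigcupT_measurable_rat => p.
by case: ifP => // /set_mem Pp; apply: measurableC; exact: mB.
Qed.

(** Differentiability at [x] is a Cauchy condition on difference quotients; by continuity of [F]
    rational increments suffice, so the set [S] where it holds is a countable combination of
    measurable sets. On [S] the derivative is the limit of the quotients with increments 1/(n+1). *)
Lemma derive1_meas F : (forall x, 0 < x -> {for x, continuous F}) ->
  measurable_fun (@pos R) F^`().
Proof.
move=> cF; pose F0 x := if 0 < x then F x else 0.
have F0E x : 0 < x -> F0 x = F x by rewrite /F0 => ->.
have mF0 : measurable_fun setT F0.
  rewrite -(setUv (@pos R)); apply/measurable_funU; [exact: pos_meas|apply: measurableC; exact: pos_meas|].
  split; first by apply: meas_ext (cont_pos_meas cF) => x /F0E.
  apply: (meas_ext _ (@measurable_cst _ _ _ _ _ (0 : R))) => x /negP; rewrite /F0.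
  by case: ifP.
pose q h x := h^-1 * (F0 (h + x) - F0 x).
have mq h : measurable_fun setT (q h).
  apply: measurable_funM; first exact: measurable_cst.
  apply: measurable_funB => //; apply: measurableT_comp => //.
  by apply: measurable_funD => //; exact: measurable_cst.
pose ok (n : nat) (p : rat) := (p != 0) && (`|ratr p : R| < n.+1%:R^-1).
pose C n k : set R := [set x | n.+1%:R^-1 < x] `&`
  \bigcap_(p in [set p : rat | ok n p]) \bigcap_(r in [set r : rat | ok n r])
    [set x | `|q (ratr p) x - q (ratr r) x| <= k.+1%:R^-1].
have mC n k : measurable (C n k).
  apply: measurableI.
    rewrite (_ : [set x | _] = `]n.+1%:R^-1, +oo[%classic); first exact: measurable_itv.
    by apply/seteqP; split => x /=; rewrite in_itv /= andbT.
  apply: bigcap_rat_meas => p _; apply: bigcap_rat_meas => r _.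
  rewrite (_ : [set x | _] = setT `&` (fun x => `|q (ratr p) x - q (ratr r) x|) @^-1` `]-oo, k.+1%:R^-1]%classic); last first.
    by rewrite setTI; apply/seteqP; split => x /=; rewrite in_itv.
  have : measurable_fun setT (fun x => `|q (ratr p) x - q (ratr r) x|).
    by apply: measurableT_comp => //; exact: measurable_funB.
  by apply => //; exact: measurable_itv.
pose S := \bigcap_k \bigcup_n C n k.
have mS : measurable S by apply: bigcapT_measurable => k; exact: bigcupT_measurable.
pose Q x := (fun h : R => h^-1 *: (F (h + x) - F x)) @ 0^'.
have S0 x : S x -> 0 < x.
  by move=> /(_ 0%N I) [n _ [/= + _]]; apply: lt_trans; rewrite invr_gt0.
have small x : 0 < x -> exists n : nat, n.+1%:R^-1 < x.
  move=> x0; exists (Num.bound x^-1); have h : x^-1 < (Num.bound x^-1)%:R by apply: archi_boundP; rewrite ltW ?invr_gt0.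
  rewrite -[ltRHS]invrK ltf_pV2 ?posrE ?invr_gt0//; apply: lt_le_trans h _.
  by rewrite ler_nat.
have qE x h : 0 < x -> `|h| < x -> q h x = h^-1 *: (F (h + x) - F x).
  by move=> x0; rewrite ltr_norml => /andP[h1 h2]; rewrite /q !F0E//; lra.
have cvgS x : 0 < x -> cvg (Q x) -> S x.
  move=> x0 /cvg_ex[l /cvgrPdist_le H] k _.
  have k0 : 0 < (k.+1%:R^-1 / 2 : R) by rewrite divr_gt0.
  have [d /= d0 Hd] := H _ k0.
  have [|n] := small (Num.min d x); first by rewrite lt_min d0.
  rewrite lt_min => /andP[nd nx]; exists n => //; split => //.
  have near p : ok n p -> `|l - q (ratr p) x| <= k.+1%:R^-1 / 2.
    move=> /andP[p0 pn]; rewrite qE// ?(lt_trans pn)//; apply: Hd => /=.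
      by rewrite /ball /= sub0r normrN (lt_trans pn).
    by rewrite -(rmorph0 (@ratr R)) (inj_eq (fmorph_inj _)).
  move=> p /= /near hp r /near hr /=.
  rewrite (_ : _ - _ = (l - q (ratr r) x) - (l - q (ratr p) x)); last by ring.
  by apply: (le_trans (ler_normB _ _)); rewrite (splitr k.+1%:R^-1); exact: lerD.
have Scvg x : S x -> cvg (Q x).
  move=> Sx; have x0 := S0 _ Sx; apply: cauchy_cvg; apply/cauchyP => e e0.
  have [k ke] := small _ e0; have [n _ [/= nx H]] := Sx k I.
  have [p0 p0n] : exists p0 : rat, ok n p0.
    have n0 : (0 : R) < n.+1%:R^-1 by rewrite invr_gt0.
    have [p] := rat_in_itvoo n0; rewrite in_itv /= => /andP[h1 h2]; exists p.
    rewrite /ok gtr0_norm// h2 andbT; apply: contraTneq h1 => ->.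
    by rewrite rmorph0 ltxx.
  exists (q (ratr p0) x); exists n.+1%:R^-1 => /=; first by rewrite invr_gt0.
  move=> h /=; rewrite /ball /= sub0r normrN => hn h0.
  have hx := lt_trans hn nx.
  rewrite -(qE x h x0 hx) distrC; apply: le_lt_trans ke; rewrite leNgt; apply/negP => bad.
  have cq : {for h, continuous (q ^~ x)}.
    rewrite /q; apply: cvgM; first by apply: cvgV => //; exact: cvg_id.
    apply: cvgB; last exact: cvg_cst.
    have hx0 : 0 < h + x by move: hx; rewrite ltr_norml => /andP[]; lra.
    have c0 : {for (h + x), continuous F0}.
      have : F (y) @[y --> h + x] --> F0 (h + x) by rewrite F0E//; exact: cF.
      apply: cvg_trans; apply: near_eq_cvg; near=> y; apply/esym/F0E.
      by near: y; exact: lt_nbhsr.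
    apply: (@continuous_comp _ _ _ (fun y => y + x) F0) => //.
    by apply: cvgD; [exact: cvg_id|exact: cvg_cst].
  have : \forall y \near h, [/\ k.+1%:R^-1 < `|q y x - q (ratr p0) x|, y != 0 & `|y| < n.+1%:R^-1].
    near=> y; split.
    - near: y; apply: cvgr_gt bad; apply: cvg_norm; apply: cvgB => //; exact: cvg_cst.
    - near: y; apply: (@cvgr_neq0 _ _ _ _ _ id h) => //; exact: cvg_id.
    - near: y; apply: cvgr_lt hn; apply: cvg_norm; exact: cvg_id.
  move=> [d /= d0 Hd]; have [|r] := @rat_in_itvoo R (h - d) (h + d); first by lra.
  rewrite in_itv /= => /andP[r1 r2]; have [|b1 b2 b3] := Hd (ratr r).
    by rewrite /ball /= distrC ltr_norml; apply/andP; split; lra.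
  have rok : ok n r by rewrite /ok b3 andbT; apply: contra_neq b2 => ->; rewrite rmorph0.
  by have := H r rok p0 p0n; rewrite /= leNgt b1.
have -> : @pos R = S `|` (@pos R `\` S).
  apply/seteqP; split => x; first by move=> x0; have [|] := pselect (S x); [left|right].
  by case => [/S0|[]].
apply/measurable_funU => //; first by apply: measurableD => //; exact: pos_meas.
split.
  apply: (@measurable_fun_cvg _ _ _ _ (fun n => q n.+1%:R^-1)).
    by move=> n; apply: measurable_funS (mq _).
  move=> x Sx; have x0 := S0 x Sx; have /cvg_ex[l Hl] := Scvg x Sx.
  have -> : F^`() x = l by rewrite /derive1; apply: cvg_lim => //; exact: Hl.
  have lim : (fun n : nat => n.+1%:R^-1 : R) @ \oo --> 0^'.
    move=> A [d /= d0 Hd]; have := @cvg_harmonic R => /cvgrPdist_lt /(_ d d0).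
    by apply: filterS => n hn; apply: Hd => //=; rewrite invr_neq0.
  apply: cvg_trans (cvg_comp _ _ lim Hl); apply: near_eq_cvg; near=> n => /=.
  by rewrite /q !F0E// addr_gt0// invr_gt0.
(* Where the quotients diverge the derivative is the default value of [lim], hence constant. *)
apply: (meas_ext _ (@measurable_cst _ _ _ _ _ (point : R))) => x [x0 nS].
rewrite /derive1 dvgP// => c; apply: nS; exact: cvgS.
Unshelve. all: by end_near. Qed.

End DeriveMeasurable.

Section ComplexPrimitive.
Variable R : realType.
Local Notation mu := (@lebesgue_measure R).
Implicit Types (F G f g : R -> CC R) (x a b : R) (c : CC R).

Definition prim F f := rprim (fun x => cre (F x)) (fun x => cre (f x)) /\
  rprim (fun x => cim (F x)) (fun x => cim (f x)).

Definition ccont F x := {for x, continuous (fun x => cre (F x))} /\ {for x, continuous (fun x => cim (F x))}.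

Lemma prim_int F f a b : prim F f -> 0 < a -> a <= b ->
  CI `[a, b] f /\ F b - F a = cint `[a, b] f.
Proof.
move=> [[_ h1] [_ h2]] a0 ab; have [i1 e1] := h1 a b a0 ab; have [i2 e2] := h2 a b a0 ab.
by split; [split|apply: CCP; rewrite /cint !cE].
Qed.

Lemma prim_meas F f : prim F f -> cmeas (@pos R) f.
Proof. by move=> [[m1 _] [m2 _]]. Qed.

Lemma prim_cont F f x : prim F f -> 0 < x -> ccont F x.
Proof. by move=> [h1 h2] x0; split; [exact: rprim_cont h1 x0|exact: rprim_cont h2 x0]. Qed.

Lemma prim_measF F f : prim F f -> cmeas (@pos R) F.
Proof. by move=> [/rprim_meas ? /rprim_meas]. Qed.

Lemma prim_ext F f G g : prim F f -> (forall x, 0 < x -> F x = G x) ->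
  (forall x, 0 < x -> f x = g x) -> prim G g.
Proof.
move=> [h1 h2] FG fg; split; [apply: rprim_ext h1 _ _|apply: rprim_ext h2 _ _] => x x0;
  by rewrite ?FG ?fg.
Qed.

Lemma prim_cst c : prim (fun=> c) (fun=> 0).
Proof. by split; exact: rprim_cst. Qed.

Lemma primD F f G g : prim F f -> prim G g -> prim (fun x => F x + G x) (fun x => f x + g x).
Proof.
move=> [f1 f2] [g1 g2]; split.
  by apply: rprim_ext (rprimD f1 g1) _ _ => x _; rewrite creD.
by apply: rprim_ext (rprimD f2 g2) _ _ => x _; rewrite cimD.
Qed.

Lemma primM F f G g : prim F f -> prim G g ->
  prim (fun x => F x * G x) (fun x => f x * G x + F x * g x).
Proof.
move=> [f1 f2] [g1 g2]; split.
  apply: rprim_ext (rprimD (rprimM f1 g1) (rprimZ (-1) (rprimM f2 g2))) _ _ => x _; rewrite !cE; ring.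
by apply: rprim_ext (rprimD (rprimM f1 g2) (rprimM f2 g1)) _ _ => x _; rewrite !cE; ring.
Qed.

Lemma primZ c F f : prim F f -> prim (fun x => c * F x) (fun x => c * f x).
Proof. by move=> pF; apply: prim_ext (primM (prim_cst c) pF) _ _ => x _ //; ring. Qed.

Lemma primB F f G g : prim F f -> prim G g -> prim (fun x => F x - G x) (fun x => f x - g x).
Proof.
by move=> pF pG; apply: prim_ext (primD pF (primZ (-1) pG)) _ _ => x _; rewrite mulN1r.
Qed.

Lemma prim_R (h k : R -> R) : rprim h k -> prim (fun x => cR (h x)) (fun x => cR (k x)).
Proof. by move=> p; split => //=; exact: rprim_cst. Qed.

Lemma prim0_eq F a b : prim F (fun=> 0) -> 0 < a -> 0 < b -> F a = F b.
Proof.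
wlog ab : a b / a <= b => [H pF a0 b0|pF a0 b0].
  by have [/H->//|/ltW/H->//] := leP a b.
have [_] := prim_int pF a0 ab; rewrite /cint !cE (_ : Rint _ _ = 0).
  by move=> /eqP; rewrite subr_eq0 => /eqP.
by rewrite Rint_cst// mul0r.
Qed.

(** The pointwise second derivative is measurable, default values included, so it can itself serve
    as the density of the first. *)
Lemma AC1_prim f : AC1 f -> prim f (cderiv f) /\ prim (cderiv f) (cderiv (cderiv f)).
Proof.
move=> [df ac].
have c1 x : 0 < x -> {for x, continuous (fun y => cre (cderiv f y))}.
  by move=> x0; apply: abs_cont_cont => // a b a0 ab; have [] := ac a b a0 ab.
have c2 x : 0 < x -> {for x, continuous (fun y => cim (cderiv f y))}.
  by move=> x0; apply: abs_cont_cont => // a b a0 ab; have [] := ac a b a0 ab.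
split; split.
- apply: (rprim_C1 _ c1) => x /df[d1 _].
  by apply: (DeriveDef d1); rewrite -derive1E.
- apply: (rprim_C1 _ c2) => x /df[_ d1].
  by apply: (DeriveDef d1); rewrite -derive1E.
- apply: abs_cont_rprim; first exact: derive1_meas.
    by move=> a b a0 ab; have [] := ac a b a0 ab.
  by apply: aeW.
- apply: abs_cont_rprim; first exact: derive1_meas.
    by move=> a b a0 ab; have [] := ac a b a0 ab.
  by apply: aeW.
Qed.

(** [f] is continuous, so it is the derivative of [F] everywhere; [g] is only locally integrable, so
    the second derivative is known almost everywhere, which matches the [ae_eq] in the definition of
    the resolvent set. *)
Lemma prim_AC1 F f g : prim F f -> prim f g ->
  [/\ AC1 F, forall x, 0 < x -> cderiv F x = f x &
    {ae mu, forall x, 0 < x -> cderiv (cderiv F) x = g x}].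
Proof.
move=> pF pf; have cf x (x0 : 0 < x) := prim_cont pf x0.
have d1 x (x0 : 0 < x) := rprim_derive1 pF.1 x0 (cf x x0).1.
have d2 x (x0 : 0 < x) := rprim_derive1 pF.2 x0 (cf x x0).2.
have dE x : 0 < x -> cderiv F x = f x.
  by move=> x0; apply: CCP; rewrite /cderiv !cE; [have [] := d1 x x0|have [] := d2 x x0].
split => //.
  split; first by move=> x x0; split; [have [] := d1 x x0|have [] := d2 x x0].
  have acE (u v : R -> R) a b : 0 < a -> a <= b -> (forall x, 0 < x -> u x = v x) -> abs_cont a b u -> abs_cont a b v.
    move=> a0 ab uv h e e0; have [d d0 H] := h e e0; exists d => // n s hs dj sd.
    rewrite (eq_bigr (fun i => `|u (s i).2 - u (s i).1|)); first exact: H.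
    move=> i _; have [k1 [k2 k3]] := hs i.
    by rewrite !uv// ?(lt_le_trans a0)// (le_trans k1).
  move=> a b a0 ab; split.
    by apply: acE (rprim_abs_cont pf.1 a0 ab) => // x x0; rewrite dE.
  by apply: acE (rprim_abs_cont pf.2 a0 ab) => // x x0; rewrite dE.
apply: aeS (aeI (rprim_derive pf.1) (rprim_derive pf.2)) => x [h1 h2] x0.
have [_ e1] := h1 x0; have [_ e2] := h2 x0.
apply: CCP; rewrite /cderiv !cE -?e1 -?e2; apply: derive1_near; near=> y.
  by rewrite -dE//; near: y; exact: lt_nbhsr.
by rewrite -dE//; near: y; exact: lt_nbhsr.
Unshelve. all: by end_near. Qed.

End ComplexPrimitive.

(** * Volterra systems at an endpoint *)

Section Endpoints.
Variable R : realType.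
Local Notation mu := (@lebesgue_measure R).
Implicit Types (f g h : R -> R) (x y a b e : R) (D : R -> set R).

Lemma Rint_restrict (D S : set R) f : measurable S -> S `<=` D -> Rint D (f \_ S) = Rint S f.
Proof.
by move=> mS SD; rewrite /Rint -Rintegral_mkcondr (_ : D `&` S = S)//; exact: setIidr.
Qed.

(** Dominated convergence with majorant [|f|], as each point eventually leaves the sets [S n]. *)
Lemma Rint_vanish (D : set R) (S : nat -> set R) f : measurable D ->
  (forall n, measurable (S n)) -> (forall n, S n `<=` D) ->
  (forall x, D x -> \forall n \near \oo, ~ S n x) -> RI D f ->
  (fun n => Rint (S n) f) @ \oo --> (0 : R).
Proof.
move=> mD mS SD ex fi.
have [||||_] := @Rint_dct R D (fun n => f \_ (S n)) (fun=> 0) (fun x => `|f x|) mD.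
- move=> n; apply: measurable_funS (RI_meas (RI_restrict (mS n) (RI_sub (mS n) mD (SD n) fi))) => //.
- move=> x Dx; apply: cvg_near_cst; move: (ex x Dx); apply: filterS => n Sx.
  by rewrite patchE memNset.
- move=> n x Dx; rewrite patchE; case: ifP => // _; by rewrite normr0.
- exact: RI_norm.
- under eq_fun do rewrite Rint_restrict//.
  rewrite (_ : Rint D (fun=> 0) = 0)// -[LHS]mulr1; rewrite (_ : (fun=> 0) = fun x : R => 0 * (0:R)).
    by rewrite RintZ ?mul0r//; exact: RI0.
  by apply/funext => t; rewrite mul0r.
Qed.

Definition D0 x : set R := `]0, x].
Definition Doo x : set R := `[x, +oo[.

(* The endpoint 0 is [D0] with [sg = 1], the endpoint infinity is [Doo] with [sg = -1]. *)
Record endpoint D (sg : R) : Prop := Endpoint {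
  ep_sg : sg = 1 \/ sg = -1;
  ep_meas : forall x, measurable (D x);
  ep_pos : forall x, 0 < x -> D x `<=` @pos R;
  ep_nest : forall x y, 0 < x -> D x y -> D y `<=` D x;
  ep_prim : forall f, measurable_fun (@pos R) f -> (forall x, 0 < x -> RI (D x) f) ->
    rprim (fun x => sg * Rint (D x) f) f;
  ep_vanish : forall f, (forall x, 0 < x -> RI (D x) f) -> forall e, 0 < e ->
    exists2 x, 0 < x & `|Rint (D x) f| < e }.

Lemma RI_itv_oc a b f : RI `]a, b] f -> RI `[a, b] f /\ Rint `[a, b] f = Rint `]a, b] f.
Proof.
move=> fi; have [ab|ba] := leP a b; last first.
  rewrite (_ : `[a, b]%classic = set0); last by rewrite set_itv_ge// bnd_simp -ltNge.
  rewrite (_ : `]a, b]%classic = set0); last by rewrite set_itv_ge// bnd_simp -leNgt ltW.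
  by split => //; move: fi; rewrite (_ : `]a, b]%classic = set0)// set_itv_ge// bnd_simp -leNgt ltW.
suff h : RI `[a, b] f.
  split => //; rewrite /Rint -Rintegral_itv_obnd_cbnd//.
move: fi => /integrableP[m1 i1]; apply/integrableP; split.
  have -> : `[a, b]%classic = [set a] `|` `]a, b].
    apply/seteqP; split => x /=; rewrite !in_itv /=.
      by rewrite le_eqVlt => /andP[/predU1P[->|->] ->]; [left|right].
    by case=> [->|/andP[/ltW -> ->]//]; rewrite lexx.
  by apply/measurable_funU => //; split => //; exact: measurable_fun_set1.
rewrite -integral_itv_obnd_cbnd//; apply: measurableT_comp => //.
Qed.

Lemma endpoint0 : endpoint D0 1.
Proof.
have D0m x : measurable (D0 x) by exact: measurable_itv.
split.
- by left.
- exact: D0m.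
- by move=> x x0 y; rewrite /D0 /pos /= in_itv /= => /andP[].
- by move=> x y x0; rewrite /D0 /= in_itv /= => /andP[y0 yx] t; rewrite /= !in_itv /= => /andP[-> /le_trans ->].
- move=> f mf fi; split => // a b a0 ab; have b0 := lt_le_trans a0 ab.
  have fab : RI `[a, b] f.
    apply: RI_sub (fi b b0) => //.
    by move=> x; rewrite /D0 /= !in_itv /= => /andP[/(lt_le_trans a0) -> ->].
  split => //; rewrite !mul1r.
  have [i1 <-] := RI_itv_oc (fi a a0); have [i2 <-] := RI_itv_oc (fi b b0).
  by rewrite (Rint_cat (ltW a0) ab i2) addrC addKr.
- move=> f fi e e0; have lim : (fun n : nat => Rint (D0 n.+1%:R^-1) f) @ \oo --> (0 : R).
    apply: (Rint_vanish (D0m 1) _ _ _ (fi 1 ltr01)) => //.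
      move=> n x; rewrite /D0 /= !in_itv /= => /andP[-> /le_trans ->] //.
      by rewrite invf_le1 ?ler1n.
    move=> x; rewrite /D0 /= in_itv /= => /andP[x0 _].
    have := @cvg_harmonic R => /cvgrPdist_lt /(_ x x0).
    apply: filterS => n /= h; rewrite /D0 /= in_itv /= => /andP[_]; apply/negP; rewrite -ltNge.
    by rewrite sub0r normrN gtr0_norm ?invr_gt0 in h.
  move/cvgrPdist_lt : lim => /(_ e e0) [n _ /(_ n (leqnn n))] /=; rewrite sub0r normrN => h.
  by exists n.+1%:R^-1 => //; rewrite invr_gt0.
Qed.

Lemma endpointoo : endpoint Doo (-1).
Proof.
have Dm x : measurable (Doo x) by exact: measurable_itv.
split.
- by right.
- exact: Dm.
- by move=> x x0 y; rewrite /Doo /pos /= in_itv /= andbT; exact: lt_le_trans.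
- by move=> x y x0; rewrite /Doo /= in_itv /= andbT => xy t; rewrite /= !in_itv /= !andbT; exact: le_trans.
- move=> f mf fi; split => // a b a0 ab; have b0 := lt_le_trans a0 ab.
  have sab : `[a, b] `<=` Doo a by move=> x; rewrite /Doo /= !in_itv /= andbT => /andP[].
  have fab : RI `[a, b] f by apply: RI_sub (fi a a0) => //.
  split => //; have := @Rintegral_itvB R f (BLeft a) +oo%O b (fi a a0).
  rewrite !bnd_simp => /(_ ab isT) H.
  have -> : Rint (Doo b) f = Rint `]b, +oo[ f.
    rewrite /Rint /Doo Rintegral_itv_obnd_cbnd//; apply: RI_sub (fi b b0) => //.
    by move=> x; rewrite /Doo /= !in_itv /= !andbT => /ltW.
  by rewrite /Rint -H /Doo; ring.
- move=> f fi e e0; have lim : (fun n : nat => Rint (Doo n.+1%:R) f) @ \oo --> (0 : R).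
    apply: (Rint_vanish (Dm 1) _ _ _ (fi 1 ltr01)) => //.
      by move=> n x; rewrite /Doo /= !in_itv /= !andbT; apply: le_trans; rewrite ler1n.
    move=> x _; near=> n; rewrite /Doo /= in_itv /= andbT; apply/negP; rewrite -ltNge.
    apply: (@lt_trans _ _ n%:R); last by rewrite ltr_nat.
    by near: n; exact: nbhs_infty_gtr.
  move/cvgrPdist_lt : lim => /(_ e e0) [n _ /(_ n (leqnn n))] /=; rewrite sub0r normrN => h.
  by exists n.+1%:R.
Unshelve. all: by end_near. Qed.

End Endpoints.

(** * Limits of geometrically convergent sequences *)

Section GeometricLimit.
Variable R : realType.
Implicit Types (u : nat -> R) (A : R).

(** The sequences u_n - 2 A 2^(-n) and u_n + 2 A 2^(-n) are monotone and enclose the limit, which is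
    the supremum of the lower one. The formula makes sense for every sequence, so a limit depending
    on [z] and [x] is defined without a choice. *)
Definition glim u A : R := sup (range (fun n => u n - 2 * A * 2^-1 ^+ n)).

Lemma glimP u A n : 0 <= A -> (forall n, `|u n.+1 - u n| <= A * 2^-1 ^+ n) ->
  `|u n - glim u A| <= 2 * A * 2^-1 ^+ n.
Proof.
move=> A0 hu; pose b n := u n - 2 * A * 2^-1 ^+ n; pose c n := u n + 2 * A * 2^-1 ^+ n.
have p0 m : (0 : R) <= 2^-1 ^+ m by rewrite exprn_ge0.
have bS m : b m <= b m.+1.
  have := hu m; rewrite ler_norml /b exprS => /andP[h _]; have := p0 m.
  move: (2^-1 ^+ m) h => p; lra.
have cS m : c m.+1 <= c m.
  have := hu m; rewrite ler_norml /c exprS => /andP[_ h]; have := p0 m.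
  move: (2^-1 ^+ m) h => p; lra.
have bm m k : b m <= b (m + k)%N.
  by elim: k => [|k IH]; rewrite ?addn0// addnS (le_trans IH).
have cm m k : c (m + k)%N <= c m.
  by elim: k => [|k IH]; rewrite ?addn0// addnS (le_trans (cS _)).
have bc m : b m <= c m.
  by rewrite /b /c lerD2l ge0_cp// !mulr_ge0.
have bcmk m k : b m <= c k.
  by apply: (le_trans (bm m k)); apply: (le_trans (bc _)); rewrite addnC cm.
have ub k : ubound (range b) (c k) by move=> _ [m _ <-].
have hs : has_sup (range b) by split; [exists (b 0%N); exists 0%N|exists (c 0%N); exact: ub].
have l1 : b n <= glim u A by apply: sup_upper_bound => //; exists n.
have l2 : glim u A <= c n by apply: sup_le_ub (ub n); have [] := hs.
by rewrite ler_norml; apply/andP; split; move: l1 l2; rewrite /b /c; lra.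
Qed.

Definition cglim (u : nat -> CC R) A : CC R :=
  Complex (glim (fun n => cre (u n)) A) (glim (fun n => cim (u n)) A).

Lemma cglimP (u : nat -> CC R) A n : 0 <= A -> (forall n, cmod (u n.+1 - u n) <= A * 2^-1 ^+ n) ->
  cmod (u n - cglim u A) <= 4 * A * 2^-1 ^+ n.
Proof.
move=> A0 hu; apply: (le_trans (cmod_le _)); rewrite /cglim !cE.
have h1 := @glimP (fun n => cre (u n)) A n A0 (fun m => le_trans _ (hu m)).
have h2 := @glimP (fun n => cim (u n)) A n A0 (fun m => le_trans _ (hu m)).
apply: (le_trans (lerD (h1 _) (h2 _))); last by rewrite -!mulrA; lra.
  by move=> m; have := cre_le (u m.+1 - u m); rewrite !cE.
by move=> m; have := cim_le (u m.+1 - u m); rewrite !cE.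
Qed.

End GeometricLimit.

Section FunctionClass.
Variable R : realType.

(* The properties of a class of functions of the spectral parameter [z] that the
   construction of the solutions preserves; it is instantiated with the
   continuous and with the holomorphic functions. *)
Record fclass (N : set (CC R)) := FClass {
  fc :> (CC R -> CC R) -> Prop;
  fc_ext : forall f g, (forall z, N z -> f z = g z) -> fc f -> fc g;
  fc_cst : forall c, fc (fun=> c);
  fc_id : fc id;
  fc_add : forall f g, fc f -> fc g -> fc (fun z => f z + g z);
  fc_mul : forall f g, fc f -> fc g -> fc (fun z => f z * g z);
  fc_ulim : forall f, (forall e : R, 0 < e -> exists2 g, fc g &
     forall z, N z -> cmod (f z - g z) <= e) -> fc f;
  fc_int : forall (D : set R) (f : CC R -> R -> CC R) (h : R -> R),
    measurable D -> RI D h -> (forall z, N z -> cmeas D (f z)) ->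
    (forall z y, N z -> D y -> cmod (f z y) <= h y) ->
    (forall y, D y -> fc (fun z => f z y)) -> fc (fun z => cint D (f z)) }.

Variables (N : set (CC R)) (FF : fclass N).

Lemma fc_scale c f : FF f -> FF (fun z => c * f z).
Proof. by move=> Ff; apply: fc_mul => //; exact: fc_cst. Qed.

Lemma fc_opp f : FF f -> FF (fun z => - f z).
Proof. by move=> /(fc_scale (-1)); apply: fc_ext => z _; rewrite mulN1r. Qed.

Lemma fc_sub f g : FF f -> FF g -> FF (fun z => f z - g z).
Proof. by move=> Ff Fg; apply: fc_add => //; exact: fc_opp. Qed.

Lemma fc_exp f n : FF f -> FF (fun z => f z ^+ n).
Proof.
move=> Ff; elim: n => [|n IH]; first exact: fc_cst.
by apply: fc_ext (fc_mul Ff IH) => z _; rewrite exprS.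
Qed.

Lemma fc_seq_lim (u : nat -> CC R -> CC R) f (e : nat -> R) :
  (forall n, FF (u n)) -> e @ \oo --> (0 : R) ->
  (forall n z, N z -> cmod (f z - u n z) <= e n) -> FF f.
Proof.
move=> Fu e0 H; apply: fc_ulim => d d0.
move/cvgrPdist_le : e0 => /(_ d d0) [n _ /(_ n (leqnn n))] /=.
rewrite sub0r normrN => h; exists (u n) => // z Nz; apply: (le_trans (H n z Nz)).
by apply: le_trans h; exact: ler_norm.
Qed.

End FunctionClass.

(** * Exponentials and integrals towards an endpoint *)

Section RealPrimitiveExtra.
Variable R : realType.
Implicit Types (F f : R -> R).

Lemma expR_lip (M x y : R) : x <= M -> y <= M -> `|expR y - expR x| <= expR M * `|y - x|.
Proof.
wlog xy : x y / x <= y => [H|xM yM].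
  by have [/H//|/ltW/H h xM yM] := leP x y; rewrite distrC [X in _ * X]distrC h.
rewrite !ger0_norm ?subr_ge0 ?ler_expR//.
have := @expR_ge1Dx R (x - y); rewrite expRB => h.
have E : 0 < expR y by exact: expR_gt0.
have : expR y * (1 + (x - y)) <= expR x.
  by rewrite -ler_pdivlMl// mulrC.
have : expR y * (y - x) <= expR M * (y - x) by rewrite ler_wpM2r ?subr_ge0// ler_expR.
move: (expR M) (expR x) (expR y) => *; lra.
Qed.

Lemma rprim_expR F f : rprim F f -> rprim (fun x => expR (F x)) (fun x => f x * expR (F x)).
Proof.
move=> pF; have mF := rprim_meas pF.
apply: (rprim_comp2 pF pF).
- apply: measurable_funM; first exact: pF.1.
  by apply: measurableT_comp => //.
- move=> M M0; exists (expR M); first exact: expR_ge0.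
  move=> x y _ _ Fx _ Fy _; apply: (le_trans (expR_lip (le_trans (ler_norm _) Fx) (le_trans (ler_norm _) Fy))).
  by rewrite ler_wpM2l ?expR_ge0// lerDl.
- move=> x x0 dF _; have h : is_derive (F x) 1 expR (expR (F x)) by exact: is_derive_expR.
  have := is_derive1_comp h dF; rewrite /comp mulrC => k.
  by apply: is_derive_eq k _.
Qed.

Lemma rprim0_eq F (a b : R) : rprim F (fun=> 0) -> 0 < a -> 0 < b -> F a = F b.
Proof.
wlog ab : a b / a <= b => [H pF a0 b0|pF a0 b0].
  by have [/H->//|/ltW/H->//] := leP a b.
have [_ /eqP] := pF.2 a b a0 ab; rewrite Rint_cst// mul0r subr_eq0 => /eqP ->//.
Qed.

Variables (D : R -> set R) (sg : R).
Hypothesis ep : endpoint D sg.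

Lemma ep_sg2 : sg * sg = 1.
Proof. by case: (ep_sg ep) => ->; rewrite ?mulr1// mulrNN mulr1. Qed.

Lemma ep_self x y : 0 < x -> D x y -> 0 < y.
Proof. by move=> x0 /(ep_pos ep x0). Qed.

Lemma ep_meas_sub x (f : R -> R) : 0 < x -> measurable_fun (@pos R) f -> measurable_fun (D x) f.
Proof. by move=> x0; apply: measurable_funS; [exact: pos_meas|exact: (ep_pos ep)]. Qed.

Lemma ep_cmeas x (f : R -> CC R) : 0 < x -> cmeas (@pos R) f -> cmeas (D x) f.
Proof. by move=> x0; apply: cmeas_sub; [exact: pos_meas|exact: (ep_pos ep)]. Qed.

(* The weight [exp (2 G)] of the contraction argument satisfies
   [2 G' exp (2 G) = (exp (2 G))'] up to the sign. *)
Lemma ep_exp_weight (g : R -> R) : measurable_fun (@pos R) g -> (forall x, 0 < x -> 0 <= g x) ->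
  (forall x, 0 < x -> RI (D x) g) -> let G x := Rint (D x) g in
  forall x, 0 < x -> RI (D x) (fun y => g y * expR (2 * G y)) /\
    Rint (D x) (fun y => g y * expR (2 * G y)) <= expR (2 * G x) / 2.
Proof.
move=> mg g0 gi G.
have G0 x : 0 < x -> 0 <= G x by move=> x0; apply: Rint_ge0 => y /(ep_self x0)/g0.
have pG : rprim (fun x => sg * G x) g := ep_prim ep mg gi.
have pG2 : rprim (fun x => 2 * G x) (fun x => 2 * (sg * g x)).
  apply: rprim_ext (rprimZ 2 (rprimZ sg pG)) _ _ => // x x0.
  by rewrite [X in 2 * X]mulrA ep_sg2 mul1r.
have pE := rprim_expR pG2.
pose k y := g y * expR (2 * G y).
have mk : measurable_fun (@pos R) k.
  by apply: measurable_funM => //; exact: rprim_meas pE.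
have Gle x y : 0 < x -> D x y -> G y <= G x.
  move=> x0 Dy; have y0 := ep_self x0 Dy.
  by apply: Rint_sub_le (ep_meas ep y) (ep_meas ep x) (ep_nest ep x0 Dy) _ (gi x x0) => t /(ep_self x0)/g0.
have ki x : 0 < x -> RI (D x) k.
  move=> x0; apply: RI_le (RI_Z (expR (2 * G x)) (ep_meas ep x) (gi x x0)).
  - exact: (ep_meas ep).
  - exact: ep_meas_sub.
  - move=> y Dy; have y0 := ep_self x0 Dy; rewrite /k ger0_norm ?mulr_ge0 ?expR_ge0 ?g0// mulrC.
    by rewrite ler_wpM2r ?g0// ler_expR ler_pM2l// Gle.
move=> x x0; split; first exact: ki.
have pJ : rprim (fun x => sg * Rint (D x) k) k := ep_prim ep mk ki.
have pd : rprim (fun x => sg * Rint (D x) k - sg / 2 * expR (2 * G x)) (fun=> 0).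
  apply: rprim_ext (rprimD pJ (rprimZ (- (sg / 2)) pE)) _ _ => y y0; first by rewrite mulNr.
  rewrite /k; have := ep_sg2; move: (expR _) (g y) => p q s2.
  rewrite (_ : _ + _ = p * q * (1 - sg * sg)); last by field.
  by rewrite s2 subrr mulr0.
rewrite leNgt; apply/negP => bad; set B := Rint _ _ in bad.
have d0 : 0 < B - expR (2 * G x) / 2 by rewrite subr_gt0.
have [y y0 Hy] := ep_vanish ep ki d0.
have := rprim0_eq pd x0 y0; rewrite -/B => /(congr1 (fun t => sg * t)).
have := ep_sg2 => s2.
have e1 u v : sg * (sg * u - sg / 2 * v) = u - v / 2.
  by rewrite mulrBr mulrA s2 mul1r mulrA mulrA s2 mul1r mulrC.
rewrite !e1 => E; move: Hy; rewrite ltr_norml => /andP[_]; rewrite E.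
have : 0 < expR (2 * G y) by exact: expR_gt0.
move: (expR (2 * G y)) (Rint (D y) k) => p q; lra.
Qed.

Lemma ep_prim_c (f : R -> CC R) : cmeas (@pos R) f -> (forall x, 0 < x -> CI (D x) f) ->
  prim (fun x => cR sg * cint (D x) f) f.
Proof.
move=> [m1 m2] fi; split.
  apply: rprim_ext (ep_prim ep m1 (fun x x0 => (fi x x0).1)) _ _ => // x _.
  by rewrite /cint !cE mul0r subr0.
apply: rprim_ext (ep_prim ep m2 (fun x x0 => (fi x x0).2)) _ _ => // x _.
by rewrite /cint !cE mul0r addr0.
Qed.

End RealPrimitiveExtra.

(* The system [phi' = e' psi], [psi' = rho phi] with [(phi, psi) -> (1, 0)] at the endpoint
   amounts to [phi x = 1 + sg * int_(D x) (e x - e y) rho y phi y dy]. *)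
Section Volterra.
Variable R : realType.
Variables (N : set (CC R)) (FF : fclass N) (D : R -> set R) (sg : R).
Hypothesis ep : endpoint D sg.
Variables (e de rho : CC R -> R -> CC R) (c w B : R -> R).
Hypotheses (pe : forall z, N z -> prim (e z) (de z))
  (mrho : forall z, N z -> cmeas (@pos R) (rho z))
  (Fe : forall x, 0 < x -> FF (fun z => e z x))
  (Frho : forall x, 0 < x -> FF (fun z => rho z x))
  (bK : forall z x y, N z -> 0 < x -> D x y -> cmod ((e z x - e z y) * rho z y) <= c x * w y)
  (bR : forall z x y, N z -> 0 < x -> D x y -> cmod (rho z y) <= B x * w y)
  (B0 : forall x, 0 < x -> 0 <= B x)
  (c1 : forall x, 0 < x -> 1 <= c x) (w0 : forall x, 0 < x -> 0 <= w x)
  (mcw : measurable_fun (@pos R) (fun x => c x * w x)) (icw : forall x, 0 < x -> RI (D x) (fun y => c y * w y)).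

(** A weight of Bielecki type: measured against it, the Volterra operator has norm at most 1/2 on
    the whole half-line, however large the integral of [c * w] is. *)
Definition vweight x := c x * expR (2 * Rint (D x) (fun y => c y * w y)).
Local Notation om := vweight.

Let p2 : (0 : R) <= 2. Proof. exact: ler0n. Qed.
Let p5 : (0 : R) <= 5. Proof. exact: ler0n. Qed.

Let cw0 x : 0 < x -> 0 <= c x * w x.
Proof. by move=> x0; rewrite mulr_ge0 ?w0// (le_trans ler01)// c1. Qed.

Lemma vweight_ge1 x : 0 < x -> 1 <= om x.
Proof.
move=> x0; rewrite -[leLHS]mulr1 ler_pM ?c1// -(expR0 R) ler_expR mulr_ge0//.
by apply: Rint_ge0 => y /(ep_self ep x0)/cw0.
Qed.

Let om0 x : 0 < x -> 0 <= om x.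
Proof. by move=> /vweight_ge1; apply: le_trans. Qed.

Let womE : (fun y => w y * om y) = (fun y => (c y * w y) * expR (2 * Rint (D y) (fun y => c y * w y))).
Proof. by apply/funext => y; rewrite /om; ring. Qed.

Lemma vweight_RI x : 0 < x -> RI (D x) (fun y => w y * om y).
Proof. by move=> x0; rewrite womE; have [] := ep_exp_weight ep mcw cw0 icw x0. Qed.

Lemma vweight_int x : 0 < x -> c x * Rint (D x) (fun y => w y * om y) <= om x / 2.
Proof.
move=> x0; rewrite womE; have [_ h] := ep_exp_weight ep mcw cw0 icw x0.
by rewrite /om -mulrA ler_wpM2l// (le_trans ler01)// c1.
Qed.

Let mD x : measurable (D x) := ep_meas ep x.

Definition vgood (phi : R -> CC R) (M : R) :=
  cmeas (@pos R) phi /\ forall x, 0 < x -> cmod (phi x) <= M * om x.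

Lemma vint_le (z : CC R) (k : R -> CC R) phi M C x : N z -> 0 < x -> vgood phi M -> 0 <= M ->
  cmeas (@pos R) k -> (forall y, D x y -> cmod (k y) <= C * w y) ->
  CI (D x) (fun y => k y * phi y) /\
  forall y, D x y -> cmod (k y * phi y) <= (C * M) * (w y * om y).
Proof.
move=> Nz x0 [mp bp] M0 mk bk.
have H y : D x y -> cmod (k y * phi y) <= (C * M) * (w y * om y).
  move=> Dy; have y0 := ep_self ep x0 Dy; rewrite cmodM.
  apply: (@le_trans _ _ ((C * w y) * (M * om y))); last by rewrite le_eqVlt; apply/orP; left; apply/eqP; ring.
  by apply: ler_pM; rewrite ?cmod_ge0 ?bk ?bp.
split => //; apply: CI_le (RI_Z (C * M) (mD x) (vweight_RI x0)) => //.
by apply: (ep_cmeas ep x0); exact: cmeasM.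
Qed.

Definition vPsi z (phi : R -> CC R) x := cR sg * cint (D x) (fun y => rho z y * phi y).
Definition vT z (phi : R -> CC R) x := cR sg * cint (D x) (fun y => (e z x - e z y) * rho z y * phi y).

Lemma cmod_sg (a : CC R) : cmod (cR sg * a) = cmod a.
Proof. by rewrite cmodM cmod_cR; case: (ep_sg ep) => ->; rewrite ?normrN normr1 mul1r. Qed.

Let me_ z : N z -> cmeas (@pos R) (e z).
Proof. by move=> /pe; exact: prim_measF. Qed.

Let mK z x : N z -> cmeas (@pos R) (fun y => (e z x - e z y) * rho z y).
Proof.
move=> Nz; apply: cmeasM; last exact: mrho.
by apply: cmeasB; [exact: cmeas_cst|exact: me_].
Qed.

Lemma vPsi_CI z phi M x : N z -> 0 < x -> vgood phi M -> 0 <= M ->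
  CI (D x) (fun y => rho z y * phi y).
Proof.
move=> Nz x0 g M0; have [] := @vint_le z (rho z) phi M (B x) x Nz x0 g M0 (mrho Nz) => // y Dy.
exact: bR.
Qed.

Lemma vT_CI z phi M x : N z -> 0 < x -> vgood phi M -> 0 <= M ->
  CI (D x) (fun y => (e z x - e z y) * rho z y * phi y).
Proof.
move=> Nz x0 g M0; have [] := @vint_le z _ phi M (c x) x Nz x0 g M0 (mK x Nz) => // y Dy.
exact: bK.
Qed.

(** The kernel bound controls only the difference [e x - e y]; integrability of [e * rho * phi]
    alone follows by adding back [e x * rho], which is bounded through [B]. *)
Lemma veT_CI z phi M x : N z -> 0 < x -> vgood phi M -> 0 <= M ->
  CI (D x) (fun y => e z y * rho z y * phi y).
Proof.
move=> Nz x0 g M0.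
have [] := @vint_le z (fun y => e z y * rho z y) phi M (c x + cmod (e z x) * B x) x Nz x0 g M0 => //.
  by apply: cmeasM; [exact: me_|exact: mrho].
move=> y Dy; rewrite (_ : _ * _ = e z x * rho z y - (e z x - e z y) * rho z y); last by ring.
apply: (le_trans (cmodB _ _)); rewrite [leRHS]mulrDl [leRHS]addrC; apply: lerD; last exact: bK.
by rewrite cmodM -mulrA ler_wpM2l ?cmod_ge0// bR.
Qed.

(** Splitting the kernel writes [vT] as [e] times a primitive minus a primitive; on differentiation
    the two terms [e * rho * phi] cancel. *)
Lemma vT_prim z phi M : N z -> vgood phi M -> 0 <= M ->
  prim (vT z phi) (fun x => de z x * vPsi z phi x) /\ prim (vPsi z phi) (fun x => rho z x * phi x).
Proof.
move=> Nz g M0; have mp := g.1.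
have p1 : prim (vPsi z phi) (fun x => rho z x * phi x).
  apply: (ep_prim_c ep); first by apply: cmeasM => //; exact: mrho.
  by move=> x x0; exact: vPsi_CI g M0.
have pr2 : prim (fun x => cR sg * cint (D x) (fun y => e z y * rho z y * phi y)) (fun y => e z y * rho z y * phi y).
  apply: (ep_prim_c ep); first by apply: cmeasM => //; apply: cmeasM; [exact: me_|exact: mrho].
  by move=> x x0; exact: veT_CI g M0.
split => //; apply: prim_ext (primB (primM (pe Nz) p1) pr2) _ _ => x x0; last by ring.
rewrite /vT /vPsi mulrCA -mulrBr; congr (_ * _).
rewrite -cintZ//; last exact: vPsi_CI g M0.
rewrite -cintB//; [|by apply: CI_Z => //; exact: vPsi_CI g M0|exact: veT_CI g M0].
by apply: cint_ext => y _; ring.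
Qed.

Lemma vT_bound z phi M x : N z -> 0 < x -> vgood phi M -> 0 <= M ->
  cmod (vT z phi x) <= M * om x / 2.
Proof.
move=> Nz x0 g M0; rewrite /vT cmod_sg.
have [i bd] := @vint_le z _ phi M (c x) x Nz x0 g M0 (mK x Nz) (fun y => @bK z x y Nz x0).
apply: (le_trans (cint_le (mD x) i (RI_Z (c x * M) (mD x) (vweight_RI x0)) bd)).
rewrite RintZ//; last exact: vweight_RI.
rewrite (_ : c x * M * _ = M * (c x * Rint (D x) (fun y => w y * om y))); last by ring.
by rewrite -mulrA ler_wpM2l// vweight_int.
Qed.

Lemma vT_sub z phi psi M M' x : N z -> 0 < x -> vgood phi M -> 0 <= M -> vgood psi M' -> 0 <= M' ->
  vT z phi x - vT z psi x = vT z (fun y => phi y - psi y) x.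
Proof.
move=> Nz x0 g M0 g' M0'; rewrite /vT -mulrBr -cintB//; [|exact: vT_CI g M0|exact: vT_CI g' M0'].
by congr (_ * _); apply: cint_ext => y _; ring.
Qed.

Fixpoint viter n z x : CC R := if n is n'.+1 then 1 + vT z (viter n' z) x else 1.

Lemma viter_good n z : N z -> vgood (viter n z) 2.
Proof.
move=> Nz; elim: n => [|n IH].
  split; first exact: cmeas_cst.
  by move=> x x0 /=; rewrite cmod1; have := vweight_ge1 x0; lra.
split.
  apply: cmeasD; first exact: cmeas_cst.
  exact: prim_measF (vT_prim Nz IH p2).1.
move=> x x0 /=; apply: (le_trans (cmodD _ _)); rewrite cmod1.
have := vT_bound Nz x0 IH p2; have := vweight_ge1 x0; lra.
Qed.

Lemma viter_diff n z x : N z -> 0 < x ->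
  cmod (viter n.+1 z x - viter n z x) <= om x * 2^-1 ^+ n.
Proof.
move=> Nz; elim: n x => [|n IH] x x0.
  rewrite /= addrC addKr expr0 mulr1.
  have g1 : vgood (fun=> 1) 1.
    by split; [exact: cmeas_cst|move=> y y0; rewrite cmod1 mul1r vweight_ge1].
  by have := vT_bound Nz x0 g1 ler01; have := om0 x0; lra.
rewrite [viter n.+2 z x]/= [viter n.+1 z x in X in _ - X]/= opprD addrACA subrr add0r.
rewrite (vT_sub Nz x0 (viter_good n.+1 Nz) p2 (viter_good n Nz) p2).
have gd : vgood (fun y => viter n.+1 z y - viter n z y) (2^-1 ^+ n).
  split; last by move=> y y0; rewrite mulrC IH.
  by apply: cmeasB; [exact: (viter_good n.+1 Nz).1|exact: (viter_good n Nz).1].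
apply: (le_trans (vT_bound Nz x0 gd _)); first by rewrite exprn_ge0.
by rewrite exprS le_eqVlt; apply/orP; left; apply/eqP; ring.
Qed.

Lemma vT_fc (phi : CC R -> R -> CC R) M x : 0 < x -> 0 <= M -> (forall z, N z -> vgood (phi z) M) ->
  (forall y, 0 < y -> FF (fun z => phi z y)) ->
  FF (fun z => vT z (phi z) x) /\ FF (fun z => vPsi z (phi z) x).
Proof.
move=> x0 M0 g Fp; split; apply: fc_scale; apply: (@fc_int _ _ FF).
- exact: mD.
- exact: (RI_Z (c x * M) (mD x) (vweight_RI x0)).
- by move=> z Nz; apply: CI_meas; exact: vT_CI (g z Nz) M0.
- move=> z y Nz.
  by have [_] := @vint_le z _ (phi z) M (c x) x Nz x0 (g z Nz) M0 (mK x Nz) (fun y => @bK z x y Nz x0); apply.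
- move=> y Dy; have y0 := ep_self ep x0 Dy; apply: fc_mul; last exact: Fp.
  by apply: fc_mul; [apply: fc_sub; exact: Fe|exact: Frho].
- exact: mD.
- exact: (RI_Z (B x * M) (mD x) (vweight_RI x0)).
- by move=> z Nz; apply: CI_meas; exact: vPsi_CI (g z Nz) M0.
- move=> z y Nz.
  by have [_] := @vint_le z _ (phi z) M (B x) x Nz x0 (g z Nz) M0 (mrho Nz) (fun y => @bR z x y Nz x0); apply.
- move=> y Dy; have y0 := ep_self ep x0 Dy; apply: fc_mul; last exact: Fp.
  exact: Frho.
Qed.

Lemma viter_fc n x : 0 < x -> FF (fun z => viter n z x).
Proof.
elim: n x => [|n IH] x x0; first exact: fc_cst.
apply: fc_add; first exact: fc_cst.
have [] := @vT_fc (viter n) 2 x x0 p2 => // z Nz.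
exact: viter_good.
Qed.

Definition vphi : CC R -> R -> CC R := locked (fun z x => cglim (fun n => viter n z x) (om x)).
Definition vpsi : CC R -> R -> CC R := locked (fun z => vPsi z (vphi z)).

Lemma vpsiE z : vpsi z = vPsi z (vphi z). Proof. by rewrite /vpsi -lock. Qed.

Lemma vphi_lim n z x : N z -> 0 < x -> cmod (viter n z x - vphi z x) <= 4 * om x * 2^-1 ^+ n.
Proof.
rewrite /vphi -lock; move=> Nz x0; apply: cglimP; first exact: om0.
by move=> m; exact: viter_diff.
Qed.

Lemma half_pow_cvg (C : R) : (fun n => C * 2^-1 ^+ n) @ \oo --> (0 : R).
Proof.
rewrite -(mulr0 C); apply: cvgM; first exact: cvg_cst.
by apply: cvg_expr; rewrite ger0_norm// invf_lt1// ltr1n.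
Qed.

Lemma half_pow_le0 (a C : R) : (forall n, a <= C * 2^-1 ^+ n) -> a <= 0.
Proof.
move=> H; have := half_pow_cvg C; rewrite leNgt => lim; apply/negP => a0.
move/cvgrPdist_lt : lim => /(_ a a0) [n _ /(_ n (leqnn n))] /=; rewrite sub0r normrN => h.
by have := le_lt_trans (le_trans (H n) (ler_norm _)) h; rewrite ltxx.
Qed.

(** 5 = 1 + 4: the iterate number 0 is the constant 1, which is at most [om], and the limit is
    within [4 * om] of it. *)
Lemma vphi_good z : N z -> vgood (vphi z) 5.
Proof.
move=> Nz; split.
  apply: (@cmeas_lim _ _ (fun n => viter n z)); first by move=> n; exact: (viter_good n Nz).1.
  move=> x x0; apply/ccvgP; apply: squeeze_cvgr (cvg_cst 0) (half_pow_cvg (4 * om x)).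
  by apply: nearW => n; rewrite cmod_ge0 vphi_lim.
move=> x x0; have := vphi_lim 0 Nz x0; rewrite expr0 mulr1 /= cmodBC => h.
have := cmodD (vphi z x - 1) 1; rewrite subrK cmod1 => /le_trans; apply.
have := vweight_ge1 x0; lra.
Qed.

(** Both sides are within a multiple of 2^(-n) of the iterate number n + 1, for every n. *)
Lemma vphi_eq z x : N z -> 0 < x -> vphi z x = 1 + vT z (vphi z) x.
Proof.
move=> Nz x0; apply/eqP; rewrite -subr_eq0; apply/eqP/cmod_eq0/eqP.
rewrite eq_le cmod_ge0 andbT; apply: (@half_pow_le0 _ (4 * om x)) => n.
rewrite (_ : _ - _ = - (viter n.+1 z x - vphi z x) + (viter n.+1 z x - (1 + vT z (vphi z) x))); last by ring.
apply: (le_trans (cmodD _ _)); rewrite cmodN.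
have h1 := vphi_lim n.+1 Nz x0.
have h2 : cmod (viter n.+1 z x - (1 + vT z (vphi z) x)) <= 2 * om x * 2^-1 ^+ n.
  rewrite /= opprD addrACA subrr add0r.
  rewrite (vT_sub Nz x0 (viter_good n Nz) p2 (vphi_good Nz) p5).
  have gd : vgood (fun y => viter n z y - vphi z y) (4 * 2^-1 ^+ n).
    split; last by move=> y y0; apply: (le_trans (vphi_lim n Nz y0)); rewrite mulrAC.
    by apply: cmeasB; [exact: (viter_good n Nz).1|exact: (vphi_good Nz).1].
  apply: (le_trans (vT_bound Nz x0 gd _)); first by rewrite mulr_ge0// exprn_ge0.
  by rewrite le_eqVlt; apply/orP; left; apply/eqP; field.
apply: (le_trans (lerD h1 h2)); rewrite exprS; move: (om x) (2^-1 ^+ n) => a b; lra.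
Qed.

Lemma vphi_bound z x : N z -> 0 < x -> cmod (vphi z x) <= 5 * om x.
Proof. by move=> Nz; exact: (vphi_good Nz).2. Qed.

Lemma vphi_prim z : N z -> prim (vphi z) (fun x => de z x * vpsi z x).
Proof.
move=> Nz; have [p _] := vT_prim Nz (vphi_good Nz) p5.
apply: prim_ext (primD (prim_cst 1) p) _ _ => x x0; last by rewrite add0r vpsiE.
by rewrite -vphi_eq.
Qed.

Lemma vpsi_prim z : N z -> prim (vpsi z) (fun x => rho z x * vphi z x).
Proof. by move=> Nz; have [_ p] := vT_prim Nz (vphi_good Nz) p5; rewrite vpsiE. Qed.

(** At fixed [x] the iterates converge at a rate independent of [z], so closure under uniform limits
    applies. *)
Lemma vphi_fc x : 0 < x -> FF (fun z => vphi z x).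
Proof.
move=> x0; apply: (@fc_seq_lim _ _ FF (fun n z => viter n z x) _ (fun n => 4 * om x * 2^-1 ^+ n)).
- by move=> n; exact: viter_fc.
- exact: half_pow_cvg.
- by move=> n z Nz; rewrite cmodBC vphi_lim.
Qed.

Lemma vpsi_fc x : 0 < x -> FF (fun z => vpsi z x).
Proof.
move=> x0; have [||_ h] := @vT_fc vphi 5 x x0 p5; first by move=> z; exact: vphi_good.
  by move=> y; exact: vphi_fc.
by apply: fc_ext h => z _; rewrite vpsiE.
Qed.

Lemma vweight_le a x : 0 < a -> D a x -> c x <= c a -> om x <= om a.
Proof.
move=> a0 Dx ca; have x0 := ep_self ep a0 Dx.
apply: ler_pM; rewrite ?expR_ge0 ?(le_trans ler01 (c1 x0))// ler_expR ler_wpM2l//.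
apply: Rint_sub_le => //; [exact: (ep_nest ep)|by move=> y /(ep_self ep a0)/cw0|exact: icw].
Qed.

Hypothesis mw : measurable_fun (@pos R) w.

Lemma w_RI x : 0 < x -> RI (D x) w.
Proof.
move=> x0; apply: RI_le (icw x0) => //; first exact: (ep_meas_sub ep).
move=> y /(ep_self ep x0) y0; rewrite ger0_norm ?w0// ler_peMl ?w0// c1//.
Qed.

Lemma vphi_sub1 z x A : N z -> 0 < x -> (forall y, D x y -> cmod (vphi z y) <= A) ->
  cmod (vphi z x - 1) <= c x * A * Rint (D x) w.
Proof.
move=> Nz x0 bA; rewrite vphi_eq// addrAC subrr add0r /vT cmod_sg -RintZ//; last exact: w_RI.
apply: cint_le => //; first exact: (vT_CI Nz x0 (vphi_good Nz) p5).
  by apply: RI_Z => //; exact: w_RI.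
move=> y Dy; rewrite cmodM mulrAC; apply: ler_pM; rewrite ?cmod_ge0 ?bK ?bA//.
Qed.

Lemma vpsi_le z x (h : R -> R) : N z -> 0 < x -> RI (D x) h ->
  (forall y, D x y -> cmod (rho z y * vphi z y) <= h y) -> cmod (vpsi z x) <= Rint (D x) h.
Proof.
move=> Nz x0 hi hb; rewrite vpsiE /vPsi cmod_sg; apply: cint_le => //.
exact: (vPsi_CI Nz x0 (vphi_good Nz) p5).
Qed.

End Volterra.

(** * Powers with complex exponent *)

Section Powers.
Variable R : realType.
Implicit Types (x y a b : R) (s z w : CC R).

Lemma powRE x a : 0 < x -> x `^ a = expR (a * ln x).
Proof. by move=> x0; rewrite /powR gt_eqF. Qed.

Lemma powR_add x a b : 0 < x -> x `^ (a + b) = x `^ a * x `^ b.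
Proof. by move=> x0; rewrite !powRE// mulrDl expRD. Qed.

Lemma powR_N x a : 0 < x -> x `^ (- a) = (x `^ a)^-1.
Proof. by move=> x0; rewrite !powRE// mulNr expRN. Qed.

Lemma powR_pos x a : 0 < x -> 0 < x `^ a.
Proof. by move=> x0; rewrite powRE// expR_gt0. Qed.

Lemma powR_one x : 0 < x -> x `^ 1 = x.
Proof. by move=> x0; rewrite powRE// mul1r lnK. Qed.

Lemma powR_lemul x y a : 0 < x -> 0 < y -> (x * y) `^ a = x `^ a * y `^ a.
Proof. by move=> x0 y0; rewrite !powRE ?mulr_gt0// lnM// mulrDr expRD. Qed.

Lemma powR_anti x a b : 0 < x -> x <= 1 -> a <= b -> x `^ b <= x `^ a.
Proof.
move=> x0 x1 ab; rewrite !powRE// ler_expR ler_wnM2r//.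
by rewrite -ln1 ler_ln ?posrE.
Qed.

Lemma powR_mono x a b : 1 <= x -> a <= b -> x `^ a <= x `^ b.
Proof.
move=> x1 ab; have x0 := lt_le_trans ltr01 x1; rewrite !powRE// ler_expR ler_wpM2r//.
by rewrite -ln1 ler_ln ?posrE.
Qed.

Lemma powR_base x y a : 0 < x -> x <= y -> 0 <= a -> x `^ a <= y `^ a.
Proof.
move=> x0 xy a0; have y0 := lt_le_trans x0 xy; rewrite !powRE// ler_expR ler_wpM2l//.
by rewrite ler_ln ?posrE.
Qed.

Lemma rprim_ln : rprim (@ln R) (fun x => x^-1).
Proof.
apply: (@rprim_C1 R (@ln R) (fun x => x^-1)) => x x0.
by apply: cvgV; [rewrite gt_eqF|exact: cvg_id].
Qed.

Lemma rprim_id : rprim (@id R) (fun=> 1).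
Proof.
by apply: rprim_C1 => x x0; exact: cvg_cst.
Qed.

Lemma rprim_powR a : rprim (fun x => x `^ a) (fun x => a * x `^ (a - 1)).
Proof.
apply: rprim_ext (rprim_expR (rprimZ a rprim_ln)) _ _ => x x0; first by rewrite powRE.
by rewrite powR_add// powR_N// powR_one// powRE//; ring.
Qed.

Lemma powR_meas a : measurable_fun (@pos R) (fun x => x `^ a).
Proof. exact: rprim_meas (rprim_powR a). Qed.

Lemma RI_powR a x y : 0 < x -> x <= y -> RI `[x, y] (fun t => t `^ a).
Proof.
move=> x0 xy; have [a0|a0] := eqVneq (a + 1) 0.
  have [+ _] := rprim_ln.2 x y x0 xy; apply: RI_ext => t /(itv_pos x0) t0.
  by rewrite (_ : a = -1) ?powR_N ?powR_one//; lra.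
have [+ _] := (rprimZ (a + 1)^-1 (rprim_powR (a + 1))).2 x y x0 xy; apply: RI_ext => t /(itv_pos x0) t0.
by rewrite mulKf// addrK.
Qed.

Lemma Rint_powR a x y : 0 < x -> x <= y -> a + 1 != 0 ->
  Rint `[x, y] (fun t => t `^ a) = (y `^ (a + 1) - x `^ (a + 1)) / (a + 1).
Proof.
move=> x0 xy a0; have [_] := (rprimZ (a + 1)^-1 (rprim_powR (a + 1))).2 x y x0 xy.
rewrite -mulrBr mulrC => ->; apply: Rint_ext => t /(itv_pos x0) t0.
by rewrite mulKf// addrK.
Qed.

Lemma RI_exhaust (D : set R) (S : nat -> set R) (f : R -> R) C :
  (forall n, measurable (S n)) -> \bigcup_n S n = D -> {homo S : n m / (n <= m)%N >-> n `<=` m} ->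
  measurable_fun D f -> (forall x, D x -> 0 <= f x) ->
  (forall n, RI (S n) f) -> (forall n, Rint (S n) f <= C) -> RI D f /\ Rint D f <= C.
Proof.
move=> mS SD Smono mf f0 fi fC.
have SDn n : S n `<=` D by rewrite -SD => x Sx; exists n.
have mD : measurable D by rewrite -SD; exact: bigcupT_measurable.
have Smono' : {homo S : n m / (n <= m)%N >-> (n <= m)%O}.
  by move=> n m nm; rewrite subsetEset; exact: Smono.
have lim : (\int[@lebesgue_measure R]_(x in S n) (f x)%:E)%E @[n --> \oo] -->
    (\int[@lebesgue_measure R]_(x in \bigcup_i S i) (f x)%:E)%E.
  apply: ge0_nondecreasing_set_cvg_integral => //.
    by move=> n; have /integrableP[] := fi n.
  by move=> n x Sx; rewrite lee_fin f0//; exact: SDn Sx.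
have leC : (\int[@lebesgue_measure R]_(x in D) (f x)%:E <= C%:E)%E.
  rewrite -{1}SD -(cvg_lim (@ereal_hausdorff R) lim); apply: lime_le.
    by apply/cvg_ex; eexists; exact: lim.
  by apply: nearW => n; rewrite RI_fin// lee_fin.
have fD : RI D f by apply: RI_ge0 => //; apply: le_lt_trans leC _; exact: ltry.
by split => //; rewrite -lee_fin -RI_fin.
Qed.

Lemma RI_rprim0 (F f : R -> R) x : 0 < x -> rprim F f -> (forall t, 0 < t -> 0 <= f t) ->
  (forall t, 0 < t -> 0 <= F t) -> RI (D0 x) f /\ Rint (D0 x) f <= F x.
Proof.
move=> x0 pF f0 F0; pose S n : set R := `[Num.min x n.+1%:R^-1, x].
have a0 n : 0 < Num.min x n.+1%:R^-1 by rewrite lt_min x0 /= invr_gt0 ltr0n.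
have ax n : Num.min x n.+1%:R^-1 <= x by rewrite ge_min lexx.
apply: (@RI_exhaust _ S).
- by move=> n; exact: measurable_itv.
- apply/seteqP; split => [t [n _]|t]; rewrite /S /D0 /= !in_itv /=.
    by move=> /andP[/(lt_le_trans (a0 n)) -> ->].
  move=> /andP[t0 tx]; have := @cvg_harmonic R => /cvgrPdist_lt /(_ t t0)[n _ /(_ n (leqnn n))] /=.
  rewrite sub0r normrN gtr0_norm ?invr_gt0// => h; exists n => //.
  by rewrite /= in_itv /= tx andbT ge_min (ltW h) orbT.
- move=> n m nm t; rewrite /S /= !in_itv /= => /andP[h ->]; rewrite andbT; apply: le_trans h.
  by rewrite le_min !ge_min lexx /= lef_pV2 ?posrE// ler_nat ltnS nm orbT.
- by apply: measurable_funS pF.1; [exact: pos_meas|move=> t; rewrite /D0 /pos /= in_itv /= => /andP[]].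
- by move=> t; rewrite /D0 /= in_itv /= => /andP[/f0].
- by move=> n; have [] := pF.2 _ x (a0 n) (ax n).
- by move=> n; have [_ <-] := pF.2 _ x (a0 n) (ax n); rewrite lerBlDr lerDl F0.
Qed.

Lemma RI_rprimoo (F f : R -> R) x : 0 < x -> rprim F f -> (forall t, 0 < t -> 0 <= f t) ->
  (forall t, 0 < t -> F t <= 0) -> RI (Doo x) f /\ Rint (Doo x) f <= - F x.
Proof.
move=> x0 pF f0 F0; pose S n : set R := `[x, x + n%:R].
have xn n : x <= x + n%:R by rewrite lerDl.
apply: (@RI_exhaust _ S).
- by move=> n; exact: measurable_itv.
- apply/seteqP; split => [t [n _]|t]; rewrite /S /Doo /= !in_itv /= ?andbT.
    by move=> /andP[->].
  move=> xt; exists (Num.bound (t - x)) => //; rewrite /= in_itv /= xt /= -lerBlDl.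
  by rewrite ltW// archi_boundP// subr_ge0.
- move=> n m nm t; rewrite /S /= !in_itv /= => /andP[-> h] /=; apply: (le_trans h).
  by rewrite lerD2l ler_nat.
- by apply: measurable_funS pF.1; [exact: pos_meas|exact: (ep_pos (@endpointoo R))].
- by move=> t /(ep_pos (@endpointoo R) x0); exact: f0.
- by move=> n; have [] := pF.2 x _ x0 (xn n).
- by move=> n; have [_ <-] := pF.2 x _ x0 (xn n); rewrite gerDr F0// (lt_le_trans x0).
Qed.

Lemma RI_powR0 a x : 0 < x -> -1 < a -> RI (D0 x) (fun t => t `^ a) /\
  Rint (D0 x) (fun t => t `^ a) <= x `^ (a + 1) / (a + 1).
Proof.
move=> x0 a1; have a0 : a + 1 != 0 by rewrite gt_eqF//; lra.
apply: (@RI_rprim0 (fun t => t `^ (a + 1) / (a + 1)) (fun t => t `^ a)) => //.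
- apply: rprim_ext (rprimZ (a + 1)^-1 (rprim_powR (a + 1))) _ _ => t t0; first by rewrite mulrC.
  by rewrite mulKf// addrK.
- by move=> t _; exact: powR_ge0.
- by move=> t _; rewrite divr_ge0 ?powR_ge0//; lra.
Qed.

Lemma expR_neg_int (k x : R) : 0 < k -> 0 < x -> RI (Doo x) (fun t => expR (- k * t)) /\
  Rint (Doo x) (fun t => expR (- k * t)) <= expR (- k * x) / k.
Proof.
move=> k0 x0; rewrite -[leRHS]opprK.
apply: (@RI_rprimoo (fun t => - (expR (- k * t) / k))) => //.
- apply: rprim_ext (rprimZ (- k^-1) (rprim_expR (rprimZ (- k) rprim_id))) _ _ => t t0; first by ring.
  by rewrite mulr1 mulrA mulNr mulrN opprK mulVf ?gt_eqF// mul1r.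
- by move=> t _; rewrite oppr_le0 divr_ge0 ?expR_ge0// ltW.
Qed.

Lemma cpowD x s w : cpow x (s + w) = cpow x s * cpow x w.
Proof.
apply: CCP; rewrite /cpow !cE !mulrDl expRD ?cosD ?sinD; ring.
Qed.

Lemma cpow0 x : cpow x 0 = 1 :> CC R.
Proof. by rewrite /cpow !cE !mul0r expR0 cos0 sin0 mulr1 mulr0. Qed.

Lemma cpow1 s : cpow 1 s = 1 :> CC R.
Proof. by rewrite /cpow ln1 !mulr0 expR0 cos0 sin0 mulr1 mulr0. Qed.

Lemma cmod_cpow x s : 0 < x -> cmod (cpow x s) = x `^ (cre s).
Proof.
move=> x0; rewrite /cmod /cpow !cE !exprMn -mulrDr cos2Dsin2 mulr1 sqrtr_sqr ger0_norm ?expR_ge0//.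
by rewrite powRE.
Qed.

Lemma cpow_neq0 x s : 0 < x -> cpow x s != 0 :> CC R.
Proof.
move=> x0; apply/eqP => /(congr1 (@cmod R)); rewrite cmod0 cmod_cpow//.
by apply/eqP; rewrite gt_eqF// powR_pos.
Qed.

Lemma cpowN x s : cpow x (- s) = (cpow x s)^-1 :> CC R.
Proof.
have h : cpow x s * cpow x (- s) = 1 :> CC R by rewrite -cpowD subrr cpow0.
have s0 : cpow x s != 0 :> CC R by apply: contra_eq_neq h => ->; rewrite mul0r eq_sym oner_neq0.
by apply: (mulfI s0); rewrite h mulfV.
Qed.

Lemma cpow_R x a : 0 < x -> cpow x (cR a) = cR (x `^ a).
Proof.
by move=> x0; apply: CCP; rewrite /cpow !cE mul0r ?cos0 ?sin0 ?mulr1 ?mulr0// powRE.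
Qed.

Lemma cpow_one x : 0 < x -> cpow x 1 = cR x.
Proof. by move=> x0; rewrite -cR1 cpow_R// powR_one. Qed.

Lemma cpowM x y s : 0 < x -> 0 < y -> cpow (x * y) s = cpow x s * cpow y s :> CC R.
Proof.
move=> x0 y0; apply: CCP; rewrite /cpow !cE lnM// !mulrDr expRD ?cosD ?sinD; ring.
Qed.

Lemma cpow_exp x s n : cpow x (n%:R * s) = cpow x s ^+ n :> CC R.
Proof.
elim: n => [|n IH]; first by rewrite mul0r cpow0.
by rewrite -natr1 mulrDl mul1r cpowD IH exprSr.
Qed.

Lemma is_derive_pow_trig a b (g dg : R -> R) x : 0 < x -> (forall y, is_derive y 1 g (dg y)) ->
  is_derive x 1 (fun y => expR (a * ln y) * g (b * ln y))
    (expR (a * ln x) * x^-1 * (a * g (b * ln x) + b * dg (b * ln x))).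
Proof.
move=> x0 hg; have dl : is_derive x 1 (@ln R) x^-1 := is_derive1_ln x0.
have d1 c : is_derive x 1 (fun y => c * ln y) (c * x^-1) := is_deriveZ c dl.
have d2 : is_derive x 1 (expR \o (fun y => a * ln y)) (expR (a * ln x) * (a * x^-1)).
  by apply: is_derive1_comp.
have d3 : is_derive x 1 (g \o (fun y => b * ln y)) (dg (b * ln x) * (b * x^-1)).
  by apply: is_derive1_comp.
have := is_deriveM d2 d3 => h; apply: is_derive_eq h _.
by rewrite /GRing.scale /=; ring.
Qed.

Lemma derive_cont (F : R -> R) x (l : R) : is_derive x 1 F l -> {for x, continuous F}.
Proof. by move=> [d _]; apply/differentiable_continuous/derivable1_diffP. Qed.

Lemma cpow_cont s x : 0 < x -> ccont (fun y => cpow y s) x.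
Proof.
move=> x0; split => /=.
  exact: (derive_cont (is_derive_pow_trig (cre s) (cim s) x0 (@is_derive_cos R))).
exact: (derive_cont (is_derive_pow_trig (cre s) (cim s) x0 (@is_derive_sin R))).
Qed.

Lemma ccontM (f g : R -> CC R) x : ccont f x -> ccont g x -> ccont (fun y => f y * g y) x.
Proof.
move=> [f1 f2] [g1 g2]; split.
  rewrite (_ : (fun y => _) = fun y => cre (f y) * cre (g y) - cim (f y) * cim (g y)).
    by apply: cvgB; apply: cvgM.
  by apply/funext => y; rewrite creM.
rewrite (_ : (fun y => _) = fun y => cre (f y) * cim (g y) + cim (f y) * cre (g y)).
  by apply: cvgD; apply: cvgM.
by apply/funext => y; rewrite cimM.
Qed.

Lemma ccont_cst (c : CC R) x : ccont (fun=> c) x.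
Proof. by split; exact: cvg_cst. Qed.

Lemma prim_cpow s : prim (fun x => cpow x s) (fun x => s * cpow x (s - 1)).
Proof.
have c x (x0 : 0 < x) := ccontM (ccont_cst s x) (cpow_cont (s - 1) x0).
have E x : 0 < x -> cpow x (s - 1) = cpow x s * cR x^-1.
  by move=> x0; rewrite cpowD cpowN cpow_one// cRV.
split; apply: rprim_C1 => [x x0|x x0]; try by have [] := c x x0.
  apply: is_derive_eq (is_derive_pow_trig (cre s) (cim s) x0 (@is_derive_cos R)) _.
  by rewrite E// /cpow !cE; ring.
apply: is_derive_eq (is_derive_pow_trig (cre s) (cim s) x0 (@is_derive_sin R)) _.
by rewrite E// /cpow !cE; ring.
Qed.

(** Taking the exponential as a power of the base e gives it the exponent laws, and the derivative
    of [cpow] in the base yields its estimates. *)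
Definition cexp z : CC R := cpow (expR 1) z.

Lemma cpow_cexp x s : 0 < x -> cpow x s = cexp (s * cR (ln x)).
Proof.
by move=> x0; rewrite /cexp /cpow expRK !mulr1 !cE !mulr0 subr0 add0r.
Qed.

Lemma cmod_cexp z : cmod (cexp z) = expR (cre z).
Proof. by rewrite /cexp cmod_cpow ?expR_gt0// powRE ?expR_gt0// expRK mulr1. Qed.

(** The left side is z times the integral of (y^z - 1)/y over [1, e], and y^z - 1 is in turn the
    integral of z t^(z-1) over [1, y]; each integration contributes a factor e - 1. *)
Lemma cexp_approx z : cmod (cexp z - 1 - z) <= (expR 1 - 1) ^+ 2 * (cmod z ^+ 2 * expR (cmod z)).
Proof.
set E := expR 1; have E1 : 1 <= E by have := @expR_ge1Dx R 1; rewrite /E; lra.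
have pw x : 1 <= x -> x <= E -> x `^ (cre z) <= expR (cmod z).
  move=> x1 xE; have x0 := lt_le_trans ltr01 x1; rewrite powRE// ler_expR.
  have l0 : 0 <= ln x by rewrite ln_ge0.
  have l1 : ln x <= 1 by rewrite -(expRK (1 : R)) ler_ln ?posrE ?expR_gt0.
  apply: (le_trans (ler_norm _)); rewrite normrM (ger0_norm l0) -[leRHS]mulr1.
  by apply: ler_pM => //; exact: cre_le.
have in1 x y : 1 <= x -> `[1, x]%classic y -> 1 <= y /\ y <= x by rewrite /= in_itv /= => _ /andP[].
have h1 x : 1 <= x -> x <= E -> cmod (cpow x z - 1) <= cmod z * expR (cmod z) * (E - 1).
  move=> x1 xE; have [ci' E'] := prim_int (prim_cpow z) ltr01 x1.
  rewrite -(cpow1 z) E'; apply: (@le_trans _ _ (Rint `[1, x] (fun=> cmod z * expR (cmod z)))).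
    apply: cint_le => //; first exact: RI_cst.
    move=> y /(in1 x y x1)[y1 yx]; have y0 := lt_le_trans ltr01 y1.
    rewrite cmodM ler_wpM2l ?cmod_ge0// cmod_cpow// !cE.
    by apply: le_trans (pw y y1 (le_trans yx xE)); apply: powR_mono => //; lra.
  rewrite Rint_cst// ler_wpM2l ?mulr_ge0 ?cmod_ge0 ?expR_ge0//; lra.
pose F x := cpow x z - z * cR (ln x).
have pF : prim F (fun x => z * cpow x (z - 1) - z * cR x^-1).
  by apply: primB; [exact: prim_cpow|apply: primZ; apply: prim_R; exact: rprim_ln].
have [ci cE'] := prim_int pF ltr01 E1.
have -> : cexp z - 1 - z = F E - F 1.
  by rewrite /F /cexp /E expRK ln1 cpow1 cR0 cR1 mulr0 mulr1 subr0; ring.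
rewrite cE'; apply: (@le_trans _ _ (Rint `[1, E] (fun=> cmod z * (cmod z * expR (cmod z) * (E - 1))))).
  apply: cint_le => //; first exact: RI_cst.
  move=> y /(in1 E y E1)[y1 yE]; have y0 := lt_le_trans ltr01 y1.
  rewrite -mulrBr cmodM ler_wpM2l ?cmod_ge0// cpowD cpowN cpow_one// cRV.
  rewrite (_ : _ - _ = (cpow y z - 1) * (cR y)^-1); last by ring.
  rewrite cmodM cmodV cmod_cR gtr0_norm// -[leRHS]mulr1; apply: ler_pM; rewrite ?cmod_ge0 ?invr_ge0 ?(ltW y0)//.
    exact: h1.
  by rewrite invf_le1.
by rewrite Rint_cst// le_eqVlt; apply/orP; left; apply/eqP; ring.
Qed.

Lemma cexpn z n : cexp z = cexp (z / n.+1%:R) ^+ n.+1.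
Proof.
rewrite /cexp -cpow_exp mulrC divfK// -cR_nat cR_neq0// pnatr_eq0//.
Qed.

Lemma pow_diff (a b : CC R) M n : cmod a <= M -> cmod b <= M ->
  cmod (a ^+ n.+1 - b ^+ n.+1) <= n.+1%:R * M ^+ n * cmod (a - b).
Proof.
move=> aM bM; have M0 := le_trans (cmod_ge0 a) aM.
elim: n => [|n IH]; first by rewrite !expr1 expr0 mulr1 mul1r.
rewrite (_ : _ - _ = a * (a ^+ n.+1 - b ^+ n.+1) + (a - b) * b ^+ n.+1); last first.
  by rewrite [a ^+ n.+2]exprS [b ^+ n.+2]exprS; ring.
apply: (le_trans (cmodD _ _)); rewrite !cmodM cmodX -[in leRHS]natr1.
have h1 : cmod a * cmod (a ^+ n.+1 - b ^+ n.+1) <= M * (n.+1%:R * M ^+ n * cmod (a - b)).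
  by apply: ler_pM; rewrite ?cmod_ge0.
have h2 : cmod (a - b) * cmod b ^+ n.+1 <= cmod (a - b) * M ^+ n.+1.
  by rewrite ler_wpM2l ?cmod_ge0// lerXn2r ?nnegrE ?cmod_ge0.
apply: (le_trans (lerD h1 h2)); rewrite exprS le_eqVlt; apply/orP; left; apply/eqP; ring.
Qed.

(** Euler's limit with a rate uniform for |z| <= M: exp(z/N) and 1 + z/N differ by O(N^(-2)), and
    passing to N-th powers costs a factor N. *)
Lemma cexp_lim z M n : cmod z <= M ->
  cmod (cexp z - (1 + z / n.+1%:R) ^+ n.+1) <= ((expR 1 - 1) ^+ 2 * M ^+ 2 * expR M * expR M) * n.+1%:R^-1.
Proof.
move=> zM; have M0 := le_trans (cmod_ge0 z) zM; set q : R := n.+1%:R^-1.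
have q0 : 0 < q by rewrite invr_gt0.
have qn : n.+1%:R * q = 1 by rewrite divff ?pnatr_eq0.
have zq : z / n.+1%:R = z * cR q by rewrite -cR_nat cRV.
have mq : cmod (z * cR q) <= M * q.
  by rewrite cmodM cmod_cR gtr0_norm// ler_wpM2r// ltW.
rewrite (cexpn z n) zq.
have a1 : cmod (cexp (z * cR q)) <= expR (M * q).
  by rewrite cmod_cexp ler_expR (le_trans _ mq)// (le_trans (ler_norm _))// cre_le.
have b1 : cmod (1 + z * cR q) <= expR (M * q).
  apply: (le_trans (cmodD _ _)); rewrite cmod1; apply: le_trans (expR_ge1Dx _).
  by rewrite lerD2l.
apply: (le_trans (pow_diff n a1 b1)).
have e1 : expR (M * q) ^+ n <= expR M.
  have nq : n%:R * q <= 1 by rewrite /q ler_pdivrMr ?ltr0n// mul1r ler_nat leqnSn.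
  by rewrite -expRM_natl ler_expR mulrCA ler_piMr.
have e2 : cmod (cexp (z * cR q) - (1 + z * cR q)) <= (expR 1 - 1) ^+ 2 * ((M * q) ^+ 2 * expR M).
  rewrite opprD addrA; apply: (le_trans (cexp_approx _)); rewrite ler_wpM2l ?sqr_ge0//.
  apply: ler_pM; rewrite ?sqr_ge0 ?expR_ge0//.
    by rewrite lerXn2r ?nnegrE ?cmod_ge0// mulr_ge0// ltW.
  rewrite ler_expR (le_trans mq)// ler_piMr//.
  by rewrite /q invf_le1// ler1n.
apply: (@le_trans _ _ (n.+1%:R * expR M * ((expR 1 - 1) ^+ 2 * ((M * q) ^+ 2 * expR M)))).
  apply: ler_pM; rewrite ?cmod_ge0 ?mulr_ge0 ?exprn_ge0 ?expR_ge0//.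
  by rewrite ler_wpM2l.
rewrite (_ : _ * _ = (n.+1%:R * q) * ((expR 1 - 1) ^+ 2 * M ^+ 2 * expR M * expR M * q)); last by ring.
by rewrite qn mul1r.
Qed.

(** Exponentials belong to every class as uniform limits of polynomials, so no separate closure
    property is asked of [fclass]. *)
Lemma fc_cexp (N : set (CC R)) (FF : fclass N) (f : CC R -> CC R) M :
  (forall z, N z -> cmod (f z) <= M) -> FF f -> FF (fun z => cexp (f z)).
Proof.
move=> fM Ff; set C := (expR 1 - 1) ^+ 2 * M ^+ 2 * expR M * expR M.
apply: (@fc_seq_lim _ _ FF (fun n z => (1 + f z / n.+1%:R) ^+ n.+1) _ (fun n => C * n.+1%:R^-1)).
- move=> n; apply: fc_exp; apply: fc_add; first exact: fc_cst.
  by apply: fc_mul => //; exact: fc_cst.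
- by rewrite -(mulr0 C); apply: cvgM; [exact: cvg_cst|exact: cvg_harmonic].
- by move=> n z Nz; apply: cexp_lim; exact: fM.
Qed.

Lemma fc_cpow (N : set (CC R)) (FF : fclass N) (f : CC R -> CC R) M x : 0 < x ->
  (forall z, N z -> cmod (f z) <= M) -> FF f -> FF (fun z => cpow x (f z)).
Proof.
move=> x0 fM Ff; apply: (@fc_ext _ _ FF (fun z => cexp (f z * cR (ln x)))).
  by move=> z _; rewrite cpow_cexp.
apply: (@fc_cexp _ FF _ (M * `|ln x|)); last by apply: fc_mul => //; exact: fc_cst.
by move=> z Nz; rewrite cmodM cmod_cR ler_wpM2r ?fM.
Qed.

End Powers.

(** * The kernel of the equation at 0 and its three bounds *)

Section LogPrimitive.
Variable R : realType.
Implicit Types (x y : R) (z : CC R).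

(* The primitive of [x ^ (-1 - 2z)] that vanishes at 1. *)
Definition e1 z x : CC R := if z == 0 then cR (ln x) else (1 - cpow x (- (2 * z))) / (2 * z).

Lemma powR_base_neg x y (a : R) : 0 < x -> x <= y -> a <= 0 -> y `^ a <= x `^ a.
Proof.
move=> x0 xy a0; have y0 := lt_le_trans x0 xy; rewrite !powRE// ler_expR ler_wnM2l//.
by rewrite ler_ln ?posrE.
Qed.

Lemma two_neq0 : (2 : CC R) != 0.
Proof. by rewrite -cR_nat cR_neq0// pnatr_eq0. Qed.

Lemma e1_prim z : prim (e1 z) (fun x => cpow x (- 1 - 2 * z)).
Proof.
have [z0|z0] := eqVneq z 0.
  apply: prim_ext (prim_R (@rprim_ln R)) _ _ => x x0; rewrite /e1 z0 ?eqxx// mulr0 subr0.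
  by rewrite cpowN cpow_one// cRV.
have s0 : 2 * z != 0 by rewrite mulf_neq0// two_neq0.
have := primB (prim_cst (2 * z)^-1) (primZ (2 * z)^-1 (prim_cpow (- (2 * z)))).
move=> h; apply: prim_ext h _ _ => x x0; first by rewrite /e1 (negPf z0); ring.
by rewrite sub0r mulNr mulrN opprK mulKf// [-1 - _]addrC.
Qed.

Lemma e1_1 z : e1 z 1 = 0.
Proof. by rewrite /e1 ln1 cpow1 subrr mul0r; case: ifP. Qed.

Lemma cre2 z : cre (- 1 - 2 * z) = - 1 - 2 * cre z.
Proof.
have h0 : cre (2 : CC R) = 2 by rewrite -cR_nat.
have h1 : cim (2 : CC R) = 0 by rewrite -cR_nat.
by rewrite creD !creN creM cre1 h0 h1 mul0r subr0.
Qed.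

Lemma e1_le z x y : 0 < y -> y <= x ->
  cmod (e1 z x - e1 z y) <= Rint `[y, x] (fun s => s `^ (- 1 - 2 * cre z)).
Proof.
move=> y0 yx; have [ci ->] := prim_int (e1_prim z) y0 yx.
apply: cint_le => //; first exact: RI_powR.
by move=> s /(itv_pos y0) s0; rewrite cmod_cpow// cre2.
Qed.

(** The integrand is s^(-ep - 2 Re z) s^(ep - 1); the first factor has a nonpositive exponent and is
    largest at y, the second is integrated. This bound admits negative Re z. *)
Lemma e1_le_pow z x y (ep : R) : 0 < y -> y <= x -> 0 < ep -> - (ep / 2) <= cre z ->
  cmod (e1 z x - e1 z y) * y `^ (2 * cre z) <= x `^ ep / ep * y `^ (- ep).
Proof.
move=> y0 yx e0 ez; have x0 := lt_le_trans y0 yx.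
have h : cmod (e1 z x - e1 z y) <= y `^ (- ep - 2 * cre z) * Rint `[y, x] (fun s => s `^ (ep - 1)).
  apply: (le_trans (e1_le z y0 yx)); rewrite -RintZ//; last exact: RI_powR.
  apply: Rint_le => //; [exact: RI_powR|apply: RI_Z => //; exact: RI_powR|].
  move=> s; rewrite /= in_itv /= => /andP[ys sx]; have s0 := lt_le_trans y0 ys.
  rewrite (_ : - 1 - 2 * cre z = (- ep - 2 * cre z) + (ep - 1)); last by ring.
  rewrite (powR_add (- ep - 2 * cre z))// ler_wpM2r ?powR_ge0//; apply: powR_base_neg => //; lra.
have e1 : ep - 1 + 1 != 0 by rewrite subrK gt_eqF.
rewrite Rint_powR// subrK in h.
apply: (le_trans (ler_wpM2r (powR_ge0 _ _) h)).
rewrite (_ : y `^ (- ep - 2 * cre z) * ((x `^ ep - y `^ ep) / ep) * y `^ (2 * cre z) = (y `^ (- ep - 2 * cre z) * y `^ (2 * cre z)) * ((x `^ ep - y `^ ep) / ep)); last by ring.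
rewrite -powR_add// subrK mulrC ler_wpM2r ?powR_ge0// ler_wpM2r ?invr_ge0 ?(ltW e0)//.
by rewrite gerBl powR_ge0.
Qed.

Lemma pow_ratio z x y : 0 <= cre z -> 0 < y -> y <= x -> x `^ (- (2 * cre z)) * y `^ (2 * cre z) <= 1.
Proof.
move=> z0 y0 yx; have x0 := lt_le_trans y0 yx.
by rewrite powR_N// mulrC ler_pdivrMr ?powR_pos// mul1r powR_base// mulr_ge0.
Qed.

(** Away from z = 0 the denominator 2 z of the closed form is bounded below, and the weight in [y]
    is constant. *)
Lemma e1_le_far z x y (d : R) : 0 < y -> y <= x -> 0 < d -> d <= cmod z -> 0 <= cre z ->
  cmod (e1 z x - e1 z y) * y `^ (2 * cre z) <= d^-1.
Proof.
move=> y0 yx d0 dz mz; have x0 := lt_le_trans y0 yx.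
have z0 : z != 0 by apply: contraTneq dz => ->; rewrite cmod0 -ltNge.
have c2 t : cre (- (2 * t)) = - (2 * cre t) :> R.
  have := cre2 t; rewrite !cE; lra.
have s0 : 2 * z != 0 by rewrite mulf_neq0// two_neq0.
have -> : e1 z x - e1 z y = (cpow y (- (2 * z)) - cpow x (- (2 * z))) * (2 * z)^-1.
  by rewrite /e1 (negPf z0); ring.
have n2 : cmod (2 : CC R) = 2 by rewrite -cR_nat cmod_cR ger0_norm.
rewrite cmodM cmodV cmodM n2 mulrAC.
have h : cmod (cpow y (- (2 * z)) - cpow x (- (2 * z))) * y `^ (2 * cre z) <= 2.
  apply: (le_trans (ler_wpM2r (powR_ge0 _ _) (cmodB _ _))); rewrite !cmod_cpow// c2 mulrDl.
  by have := pow_ratio mz y0 yx; have := pow_ratio mz y0 (lexx y); lra.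
apply: (@le_trans _ _ (2 * (2 * cmod z)^-1)); first by rewrite ler_wpM2r// invr_ge0 mulr_ge0 ?cmod_ge0.
by rewrite invfM mulrA mulfV// mul1r lef_pV2 ?posrE// (lt_le_trans d0).
Qed.

(** For Re z >= 0 the factor (y/s)^(2 Re z) is at most 1 and the integral of 1/s remains; the
    logarithm is the price of including z = 0. *)
Lemma e1_le_ln z x y : 0 < y -> y <= x -> 0 <= cre z ->
  cmod (e1 z x - e1 z y) * y `^ (2 * cre z) <= (1 + Num.max 0 (ln x)) * (1 + `|ln y|).
Proof.
move=> y0 yx mz; have x0 := lt_le_trans y0 yx.
have [ri e] := (@rprim_ln R).2 y x y0 yx.
have h : cmod (e1 z x - e1 z y) * y `^ (2 * cre z) <= ln x - ln y.
  apply: (le_trans (ler_wpM2r (powR_ge0 _ _) (e1_le z y0 yx))).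
  rewrite e mulrC -RintZ//; last exact: RI_powR.
  apply: Rint_le => //; first by apply: RI_Z => //; exact: RI_powR.
  move=> s; rewrite /= in_itv /= => /andP[ys sx]; have s0 := lt_le_trans y0 ys.
  rewrite addrC powR_add// (powR_N 1)// powR_one// mulrA mulrC -[leRHS]mulr1.
  by rewrite ler_wpM2l ?invr_ge0 ?(ltW s0)// mulrC pow_ratio.
apply: (le_trans h); have h1 : ln x <= Num.max 0 (ln x) by rewrite le_max lexx orbT.
have h2 : 0 <= Num.max 0 (ln x) by rewrite le_max lexx.
have h3 := ler_norm (- ln y); rewrite normrN in h3; have h4 := normr_ge0 (ln y).
by move: (Num.max _ _) `|ln y| h1 h2 h3 h4 => a b h1 h2 h3 h4; nra.
Qed.

Lemma powR_abs_le x (a b : R) : 0 < x -> `|a| <= b -> x `^ a <= x `^ b + x `^ (- b).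
Proof.
move=> x0 ab; have := ab; rewrite ler_norml => /andP[ba ab'].
have [x1|x1] := leP 1 x.
  by apply: (le_trans (powR_mono x1 ab')); rewrite lerDl powR_ge0.
by apply: (le_trans (powR_anti x0 (ltW x1) ba)); rewrite lerDr powR_ge0.
Qed.

(** The definition by cases hides the regularity at z = 0; the integral of s^(-1 - 2z) starting at 1
    represents [e1] in both cases. *)
Lemma e1_fc (M : set (CC R)) (FF : fclass M) (b : R) x : (forall z, M z -> cmod z <= b) ->
  0 < x -> FF (fun z => e1 z x).
Proof.
move=> Mb x0.
have nb z : M z -> cmod (- 1 - 2 * z) <= 1 + 2 * b.
  move=> Mz; apply: (le_trans (cmodB _ _)); rewrite cmodN cmod1 cmodM -cR_nat cmod_cR ger0_norm//.
  by rewrite lerD2l ler_wpM2l ?Mb.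
have key a c : 0 < a -> a <= c -> FF (fun z => cint `[a, c] (fun s => cpow s (- 1 - 2 * z))).
  move=> a0 ac.
  apply: (@fc_int _ _ FF _ _ (fun s => s `^ (1 + 2 * b) + s `^ (- (1 + 2 * b)))) => //.
  - by apply: RI_D => //; exact: RI_powR.
  - move=> z _; apply: cmeas_sub (prim_measF (prim_cpow _)); [exact: pos_meas|exact: itv_pos].
  - move=> z s Mz /(itv_pos a0) s0; rewrite cmod_cpow//; apply: powR_abs_le => //.
    exact: le_trans (cre_le _) (nb z Mz).
  - move=> s /(itv_pos a0) s0; apply: (@fc_cpow _ _ FF _ (1 + 2 * b)) => //.
    by apply: fc_sub; [exact: fc_cst|apply: fc_scale; exact: fc_id].
have [x1|/ltW x1] := leP x 1.
  apply: fc_ext (fc_opp (key x 1 x0 x1)) => z _.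
  have [_ <-] := prim_int (e1_prim z) x0 x1.
  by rewrite e1_1 sub0r opprK.
apply: fc_ext (key 1 x ltr01 x1) => z _.
have [_ <-] := prim_int (e1_prim z) ltr01 x1.
by rewrite e1_1 subr0.
Qed.

End LogPrimitive.

(** * The solutions [us] at 0 and [vs] at infinity *)

Section Pack.
Variable R : realType.

(* Uniform bounds on a set [M] of parameters for the kernel
   [e1 z x - e1 z y] of the Volterra equation at 0, by [kc x * kw y]. *)
Record kpack (M : set (CC R)) (Q : R -> CC R) : Type := KPack {
  kw : R -> R; kc : R -> R; kB : R -> R; keps : R; klo : R; khi : R; kbd : R; kC : R;
  kw_meas : measurable_fun (@pos R) kw;
  kc_meas : measurable_fun (@pos R) kc;
  kw_ge0 : forall x, 0 < x -> 0 <= kw x;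
  kw_one : kw 1 = 1;
  kc_ge1 : forall x, 0 < x -> 1 <= kc x;
  kc_mono : forall x y, 0 < x -> x <= y -> kc x <= kc y;
  kB_ge0 : forall x, 0 < x -> 0 <= kB x;
  kw_anti : forall x y, 0 < y -> y <= x -> x <= 1 -> kw x <= kw y;
  kw_anti2 : forall z x y, M z -> 0 < y -> y <= x -> x <= 1 ->
    x `^ (- (2 * cre z)) * kw x <= y `^ (- (2 * cre z)) * kw y;
  kp_e : forall z x y, M z -> 0 < y -> y <= x ->
    cmod (e1 z x - e1 z y) * y `^ (2 * cre z) <= kc x * kw y;
  kp_B : forall z x y, M z -> 0 < y -> y <= x -> y `^ (2 * cre z) <= kB x * kw y;
  kp_int : forall x, 0 < x -> RI (D0 x) (fun y => kc y * (y * kw y * (1 + cmod (Q y))));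
  kp_pow : forall y, 0 < y -> y <= 1 -> kw y <= kC * y `^ (- keps);
  kp_re : forall z, M z -> klo <= cre z /\ cre z <= khi;
  kp_bd : forall z, M z -> cmod z <= kbd;
  kp_lo : - 1 < klo;
  kp_sum : 0 < keps + klo + khi;
  kp_dif : keps + khi - klo < 2 }.

End Pack.

(** * Wronskians and first-order forms of the equation *)

Section Wronskian.
Variable R : realType.
Implicit Types (z : CC R) (f g : R -> CC R).

Definition wr f f1 g g1 (x : R) : CC R := f x * g1 x - f1 x * g x.

Lemma wr_prim f f1 Vf g g1 Vg : prim f f1 -> prim f1 (fun x => Vf x * f x) ->
  prim g g1 -> prim g1 (fun x => Vg x * g x) ->
  prim (wr f f1 g g1) (fun x => (Vg x - Vf x) * (f x * g x)).
Proof.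
move=> pf pf1 pg pg1; apply: prim_ext (primB (primM pf pg1) (primM pf1 pg)) _ _ => x x0 //.
by ring.
Qed.

Lemma wr_const f f1 V g g1 x y : prim f f1 -> prim f1 (fun x => V x * f x) ->
  prim g g1 -> prim g1 (fun x => V x * g x) -> 0 < x -> 0 < y -> wr f f1 g g1 x = wr f f1 g g1 y.
Proof.
move=> pf pf1 pg pg1 x0 y0; apply: prim0_eq x0 y0.
apply: prim_ext (wr_prim pf pf1 pg pg1) _ _ => t t0 //.
by rewrite subrr mul0r.
Qed.

(** Three vectors (f, f') in a plane are linearly dependent. If the Wronskians of [h] with [f] and
    [g] vanish while that of [f] and [g] does not, then [h] is zero. *)
Lemma wr_identity f f1 g g1 h h1 x :
  h x * wr f f1 g g1 x = f x * wr h h1 g g1 x + g x * wr f f1 h h1 x.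
Proof. by rewrite /wr; ring. Qed.

Lemma half_add : 2^-1 + 2^-1 = 1 :> CC R.
Proof. by rewrite -[LHS]/(2^-1 *+ 2) -(mulr_natr 2^-1) mulVf// two_neq0. Qed.

(** With s = 1/2 + z this is the factorization (-d/dx - s/x)(d/dx - s/x) of the operator without
    [Q]. *)
Lemma half_sq z : (2^-1 + z) ^+ 2 - (2^-1 + z) = z ^+ 2 - 4^-1 :> CC R.
Proof.
have e4 : (4 : CC R)^-1 = 2^-1 * 2^-1 by rewrite -invfM -natrM.
rewrite e4; move: (2^-1 : CC R) half_add => h h2.
by transitivity ((h + z) ^+ 2 - (h + z) * (h + h)); [rewrite h2 mulr1|ring].
Qed.

Lemma cpow_half z (x : R) : 0 < x -> let P := cpow x (2^-1 + z) in let X := cR x in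
  [/\ cpow x (- (2^-1 + z)) = P^-1, cpow x ((2^-1 + z) - 1) = P * X^-1,
    cpow x (- (2^-1 + z) - 1) = P^-1 * X^-1,
    cpow x (- 1 - 2 * z) = P^-1 * P^-1 & cpow x (1 + 2 * z) = P * P].
Proof.
move=> x0 P X; have e : 1 + 2 * z = (2^-1 + z) + (2^-1 + z).
  by rewrite addrACA half_add; ring.
split; rewrite ?cpowN//.
- by rewrite cpowD cpowN cpow_one.
- by rewrite cpowD !cpowN cpow_one.
- by rewrite -opprD e opprD cpowD !cpowN.
- by rewrite e cpowD.
Qed.

Definition potV (k : R) (Q : R -> CC R) z (x : R) : CC R :=
  (z ^+ 2 - 4^-1) * cR (x ^- 2) + cR (k ^+ 2) + Q x.

Lemma prim_inv : prim (fun x : R => cR x^-1) (fun x => - cR (x ^- 2)).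
Proof.
have := prim_cpow (- 1 : CC R) => h; apply: prim_ext h _ _ => x x0.
  by rewrite cpowN cpow_one// cRV.
rewrite -opprD cpowN cpowD cpow_one// mulN1r -expr2 -cRX cRV//.
Qed.

Variables (q : R -> CC R).

(** Variation of constants adapted to the factorization: f = x^s phi and psi = x^s (f' - s f/x) with
    s = 1/2 + z. The inverse-square potential disappears into the powers and only [q] drives
    [psi]. *)
Lemma reduce_prim z f f1 : prim f f1 ->
  prim f1 (fun x => ((z ^+ 2 - 4^-1) * cR (x ^- 2) + q x) * f x) ->
  let phi := fun x => cpow x (- (2^-1 + z)) * f x in
  let psi := fun x => cpow x (2^-1 + z) * f1 x - (2^-1 + z) * cR x^-1 * cpow x (2^-1 + z) * f x in
  prim phi (fun x => cpow x (- 1 - 2 * z) * psi x) /\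
  prim psi (fun x => cpow x (1 + 2 * z) * q x * phi x).
Proof.
move=> pf pf1 phi psi; set s : CC R := 2^-1 + z.
split.
  have h := primM (prim_cpow (- s)) pf; apply: prim_ext h _ _ => x x0 //.
  have [e1 e2 e3 e4 e5] := cpow_half z x0; have p0 := cpow_neq0 (2^-1 + z) x0.
  have X0 : cR x != 0 by rewrite cR_neq0// gt_eqF.
  rewrite /psi /s e1 e3 e4 cRV; move: (cpow x (2^-1 + z)) p0 => P P0; move: (cR x) X0 => X X0; move: (2^-1 + z) => t.
  by field; rewrite P0 X0.
have h := primB (primM (prim_cpow s) pf1) (primM (primM (primZ s prim_inv) (prim_cpow s)) pf).
apply: prim_ext h _ _ => x x0; first by rewrite /psi -/s.
have [e1 e2 e3 e4 e5] := cpow_half z x0; have p0 := cpow_neq0 (2^-1 + z) x0.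
have X0 : cR x != 0 by rewrite cR_neq0// gt_eqF.
rewrite /phi /s e1 e2 e5 cRV cRV cRX -half_sq; move: (cpow x (2^-1 + z)) p0 => P P0; move: (cR x) X0 => X X0; move: (2^-1 + z) => t.
by field; rewrite P0 X0.
Qed.

Lemma ladder_prim z phi psi :
  prim phi (fun x => cpow x (- 1 - 2 * z) * psi x) ->
  prim psi (fun x => cpow x (1 + 2 * z) * q x * phi x) ->
  let f := fun x => cpow x (2^-1 + z) * phi x in
  let f1 := fun x => (2^-1 + z) * cR x^-1 * f x + cpow x (- (2^-1 + z)) * psi x in
  prim f f1 /\ prim f1 (fun x => ((z ^+ 2 - 4^-1) * cR (x ^- 2) + q x) * f x).
Proof.
move=> pp ps f f1; set s : CC R := 2^-1 + z.
have pf : prim f f1.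
  have h := primM (prim_cpow s) pp; apply: prim_ext h _ _ => x x0 //.
  have [e1 e2 e3 e4 e5] := cpow_half z x0; have p0 := cpow_neq0 (2^-1 + z) x0.
  have X0 : cR x != 0 by rewrite cR_neq0// gt_eqF.
  rewrite /f1 /f /s e1 e2 e4 cRV; move: (cpow x (2^-1 + z)) p0 => P P0; move: (cR x) X0 => X X0; move: (2^-1 + z) => t.
  by field; rewrite P0 X0.
split; first exact: pf.
have h := primD (primM (primZ s prim_inv) pf) (primM (prim_cpow (- s)) ps).
apply: prim_ext h _ _ => x x0 //.
have [e1 e2 e3 e4 e5] := cpow_half z x0; have p0 := cpow_neq0 (2^-1 + z) x0.
have X0 : cR x != 0 by rewrite cR_neq0// gt_eqF.
rewrite /f1 /f /s e1 e3 e5 cRV cRV cRX -half_sq; move: (cpow x (2^-1 + z)) p0 => P P0; move: (cR x) X0 => X X0; move: (2^-1 + z) => t.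
by field; rewrite P0 X0.
Qed.

Lemma prim_cexpR (k : R) : prim (fun x : R => cR (expR (k * x))) (fun x => cR k * cR (expR (k * x))).
Proof.
apply: prim_ext (prim_R (rprim_expR (rprimZ k (@rprim_id R)))) _ _ => x x0 //.
by rewrite mulr1 cRM.
Qed.

Lemma cexpR_half (k x : R) : let E := cR (expR (k * x)) in
  [/\ E != 0, cR (expR (- k * x)) = E^-1, cR (expR (2 * k * x)) = E ^+ 2 &
    cR (expR (- (2 * k) * x)) = (E ^+ 2)^-1].
Proof.
move=> E; have e : cR (expR (2 * k * x)) = E ^+ 2.
  by rewrite -cRX -expRM_natl mulrA.
split => //; first by rewrite cR_neq0// gt_eqF ?expR_gt0.
  by rewrite mulNr expRN cRV.
by rewrite mulNr expRN cRV e.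
Qed.

(** The analogue for -d^2/dx^2 + k^2: chi = e^(kx) f and eta = e^(-kx) (f' + k f), with [p] as the
    only perturbation. *)
Lemma ladder_exp (k : R) p chi eta :
  prim chi (fun x => cR (expR (2 * k * x)) * eta x) ->
  prim eta (fun x => cR (expR (- (2 * k) * x)) * p x * chi x) ->
  let f := fun x => cR (expR (- k * x)) * chi x in
  let f1 := fun x => cR (expR (k * x)) * eta x - cR k * f x in
  prim f f1 /\ prim f1 (fun x => (cR (k ^+ 2) + p x) * f x).
Proof.
move=> pc pe f f1.
have pf : prim f f1.
  have h := primM (prim_cexpR (- k)) pc; apply: prim_ext h _ _ => x x0 //.
  have [e0 e1 e2 e3] := cexpR_half k x.
  rewrite /f1 /f e1 e2 cRN; move: (cR (expR (k * x))) e0 => E E0; move: (cR k) => t.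
  by field.
split => //.
have h := primB (primM (prim_cexpR k) pe) (primZ (cR k) pf).
apply: prim_ext h _ _ => x x0 //.
have [e0 e1 e2 e3] := cexpR_half k x.
rewrite /f1 /f e1 e3 cRX; move: (cR (expR (k * x))) e0 => E E0; move: (cR k) => t.
by field.
Qed.

End Wronskian.

(** * The solution at 0 *)

Section SolutionAtZero.
Variable R : realType.
Variables (M : set (CC R)) (Q : R -> CC R) (pk : kpack M Q) (k : R).
Hypothesis mQ : cmeas (@pos R) Q.

Definition uq (x : R) : CC R := cR (k ^+ 2) + Q x.
Definition urho (z : CC R) (x : R) : CC R := cpow x (1 + 2 * z) * uq x.
(** (1 + k^2)(1 + |Q|) dominates |k^2 + Q|, and the result is a constant multiple of the weight
    whose integrability [kpack] provides for every [k]. *)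
Definition uw (y : R) : R := (1 + k ^+ 2) * (y * kw pk y * (1 + cmod (Q y))).
Definition uphi := vphi (@D0 R) 1 (@e1 R) urho (kc pk) uw.
Definition upsi := vpsi (@D0 R) 1 (@e1 R) urho (kc pk) uw.
Definition us (z : CC R) (x : R) : CC R := cpow x (2^-1 + z) * uphi z x.
Definition us1 (z : CC R) (x : R) : CC R :=
  (2^-1 + z) * cR x^-1 * us z x + cpow x (- (2^-1 + z)) * upsi z x.

Let ep := @endpoint0 R.

Let k1 : 0 <= 1 + k ^+ 2.
Proof. by rewrite addr_ge0// sqr_ge0. Qed.

Lemma D0P (x y : R) : D0 x y -> 0 < y /\ y <= x.
Proof. by rewrite /D0 /= in_itv /= => /andP[]. Qed.

Lemma uq_le y : cmod (uq y) <= (1 + k ^+ 2) * (1 + cmod (Q y)).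
Proof.
apply: (le_trans (cmodD _ _)); rewrite cmod_cR ger0_norm ?sqr_ge0//.
have := cmod_ge0 (Q y); have := sqr_ge0 k; move: (cmod _) (k ^+ 2) => a b b0 a0; nra.
Qed.

Lemma uw_ge0 y : 0 < y -> 0 <= uw y.
Proof. by move=> y0; rewrite !mulr_ge0 ?(ltW y0) ?kw_ge0 ?addr_ge0 ?cmod_ge0 ?sqr_ge0. Qed.

Lemma uq_meas : cmeas (@pos R) uq.
Proof. by apply: cmeasD => //; exact: cmeas_cst. Qed.

Lemma urho_meas z : cmeas (@pos R) (urho z).
Proof. by apply: cmeasM uq_meas; exact: prim_measF (prim_cpow _). Qed.

Lemma cre12 (z : CC R) : cre (1 + 2 * z) = 1 + 2 * cre z.
Proof. by have := cre2 z; rewrite !cE; lra. Qed.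

Lemma urho_mod z y : 0 < y -> cmod (urho z y) = y * y `^ (2 * cre z) * cmod (uq y).
Proof. by move=> y0; rewrite cmodM cmod_cpow// cre12 powR_add// powR_one. Qed.

Lemma urho_le z y (a : R) : 0 < y -> 0 <= a -> a * y `^ (2 * cre z) <= kw pk y * kc pk 1 ->
  a * cmod (urho z y) <= kc pk 1 * uw y.
Proof.
move=> y0 a0 h; rewrite urho_mod// /uw.
rewrite (_ : a * _ = (a * y `^ (2 * cre z)) * (y * cmod (uq y))); last by ring.
rewrite (_ : kc pk 1 * _ = (kw pk y * kc pk 1) * (y * ((1 + k ^+ 2) * (1 + cmod (Q y))))); last by ring.
apply: ler_pM => //; rewrite ?mulr_ge0 ?powR_ge0 ?cmod_ge0 ?(ltW y0)//.
by rewrite ler_wpM2l ?(ltW y0)// uq_le.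
Qed.

Let bK z x y : M z -> 0 < x -> D0 x y -> cmod ((e1 z x - e1 z y) * urho z y) <= kc pk x * uw y.
Proof.
move=> Mz x0 /D0P[y0 yx]; rewrite cmodM urho_mod// /uw.
rewrite (_ : cmod _ * _ = (cmod (e1 z x - e1 z y) * y `^ (2 * cre z)) * (y * cmod (uq y))); last by ring.
rewrite (_ : kc pk x * _ = (kc pk x * kw pk y) * (y * ((1 + k ^+ 2) * (1 + cmod (Q y))))); last by ring.
apply: ler_pM; rewrite ?mulr_ge0 ?powR_ge0 ?cmod_ge0 ?(ltW y0) ?kp_e//.
by rewrite ler_wpM2l ?(ltW y0)// uq_le.
Qed.

Let bR z x y : M z -> 0 < x -> D0 x y -> cmod (urho z y) <= kB pk x * uw y.
Proof.
move=> Mz x0 /D0P[y0 yx]; rewrite urho_mod// /uw.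
rewrite (_ : y * y `^ (2 * cre z) * cmod (uq y) = y `^ (2 * cre z) * (y * cmod (uq y))); last by ring.
rewrite (_ : kB pk x * _ = (kB pk x * kw pk y) * (y * ((1 + k ^+ 2) * (1 + cmod (Q y))))); last by ring.
apply: ler_pM; rewrite ?mulr_ge0 ?powR_ge0 ?cmod_ge0 ?(ltW y0) ?(kp_B pk Mz)//.
by rewrite ler_wpM2l ?(ltW y0)// uq_le.
Qed.

Let muw : measurable_fun (@pos R) uw.
Proof.
apply: measurable_funM; first exact: measurable_cst.
apply: measurable_funM; first by apply: measurable_funM; [exact: (rprim_meas (@rprim_id R))|exact: kw_meas].
by apply: measurable_funD; [exact: measurable_cst|exact: cmeas_mod].
Qed.

Let mcw : measurable_fun (@pos R) (fun x => kc pk x * uw x).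
Proof. by apply: measurable_funM => //; exact: kc_meas. Qed.

Let icw x : 0 < x -> RI (D0 x) (fun y => kc pk y * uw y).
Proof.
move=> x0; apply: RI_ext (RI_Z (1 + k ^+ 2) (ep_meas ep x) (kp_int pk x0)) => y _.
by rewrite /uw mulrCA.
Qed.

Let pe z : M z -> prim (e1 z) (fun x => cpow x (- 1 - 2 * z)) := fun _ => e1_prim z.
Let mr z : M z -> cmeas (@pos R) (urho z) := fun _ => urho_meas z.

Lemma uw_RI x : 0 < x -> RI (D0 x) uw.
Proof. exact: (w_RI ep (kc_ge1 pk) uw_ge0 icw muw). Qed.

Lemma us_prim z : M z -> prim (us z) (us1 z) /\ prim (us1 z) (fun x => potV k Q z x * us z x).
Proof.
move=> Mz; have p1 := vphi_prim ep pe mr bK bR (kc_ge1 pk) uw_ge0 mcw icw Mz.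
have p2 := vpsi_prim ep pe mr bK bR (kc_ge1 pk) uw_ge0 mcw icw Mz.
have [h1 h2] := ladder_prim p1 p2; split; first exact: h1.
by apply: prim_ext h2 _ _ => x x0 //; rewrite /potV -addrA.
Qed.

Lemma upsi_prim z : M z -> prim (upsi z) (fun x => urho z x * uphi z x).
Proof. by move=> Mz; exact: (vpsi_prim ep pe mr bK bR (kc_ge1 pk) uw_ge0 mcw icw Mz). Qed.

Section Regularity.
Variable FF : fclass M.

Let Fe x : 0 < x -> FF (fun z => e1 z x).
Proof. by move=> x0; apply: e1_fc x0 => z Mz; exact: (kp_bd pk Mz). Qed.

Let Fpow (a b : CC R) x : 0 < x -> FF (fun z => cpow x (a + b * z)).
Proof.
move=> x0; apply: (@fc_cpow _ _ FF _ (cmod a + cmod b * kbd pk)) => //.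
  move=> z Mz; apply: (le_trans (cmodD _ _)); rewrite lerD2l cmodM ler_wpM2l ?cmod_ge0//.
  exact: (kp_bd pk Mz).
by apply: fc_add; [exact: fc_cst|apply: fc_scale; exact: fc_id].
Qed.

Let Fr x : 0 < x -> FF (fun z => urho z x).
Proof. by move=> x0; apply: fc_mul; [exact: Fpow|exact: fc_cst]. Qed.

Lemma us_fc x : 0 < x -> FF (fun z => us z x).
Proof.
move=> x0; apply: fc_mul.
  by apply: fc_ext (Fpow (2^-1) 1 x0) => z _; rewrite mul1r.
exact: (vphi_fc ep pe mr Fe Fr bK bR (kc_ge1 pk) uw_ge0 mcw icw x0).
Qed.

Lemma us1_fc x : 0 < x -> FF (fun z => us1 z x).
Proof.
move=> x0; apply: fc_add.
  apply: fc_mul; last exact: us_fc.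
  apply: fc_mul; last exact: fc_cst.
  by apply: fc_add; [exact: fc_cst|exact: fc_id].
apply: fc_mul; last exact: (vpsi_fc ep pe mr Fe Fr bK bR (kc_ge1 pk) uw_ge0 mcw icw x0).
by apply: fc_ext (Fpow (- 2^-1) (-1) x0) => z _; rewrite mulN1r opprD.
Qed.

End Regularity.

Definition uA : R := locked (5 * vweight (@D0 R) (kc pk) uw 1).

Lemma uA_ge0 : 0 <= uA.
Proof.
have := vweight_ge1 ep (kc_ge1 pk) uw_ge0 (@ltr01 R); rewrite /uA -lock; lra.
Qed.

Lemma uphi_le_gen z x b : M z -> 0 < x -> x <= b ->
  cmod (uphi z x) <= 5 * vweight (@D0 R) (kc pk) uw b.
Proof.
move=> Mz x0 xb; apply: (le_trans (vphi_bound ep pe mr bK bR (kc_ge1 pk) uw_ge0 mcw icw Mz x0)).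
apply: ler_wpM2l; first exact: ler0n.
apply: (vweight_le ep (kc_ge1 pk) uw_ge0 icw (lt_le_trans x0 xb)).
  by rewrite /D0 /= in_itv /= x0.
exact: kc_mono.
Qed.

Lemma uphi_le z x : M z -> 0 < x -> x <= 1 -> cmod (uphi z x) <= uA.
Proof. by rewrite /uA -lock; exact: uphi_le_gen. Qed.

Lemma uphi_sub1 z x : M z -> 0 < x -> x <= 1 -> cmod (uphi z x - 1) <= kc pk 1 * uA * Rint (D0 x) uw.
Proof.
move=> Mz x0 x1; have bA y : D0 x y -> cmod (uphi z y) <= uA.
  by move=> /D0P[y0 yx]; rewrite uphi_le// (le_trans yx).
apply: (le_trans (vphi_sub1 ep pe mr bK bR (kc_ge1 pk) uw_ge0 mcw icw muw Mz x0 bA)).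
apply: ler_wpM2r; first by apply: Rint_ge0 => y /D0P[y0 _]; exact: uw_ge0.
by apply: ler_wpM2r; [exact: uA_ge0|exact: kc_mono].
Qed.

Lemma kw_ge1 y : 0 < y -> y <= 1 -> 1 <= kw pk y.
Proof. by move=> y0 y1; rewrite -[leLHS](kw_one pk) kw_anti. Qed.

Lemma upsi_int z x : M z -> 0 < x -> x <= 1 -> RI (D0 x) (fun y => cmod (urho z y)) /\
  cmod (upsi z x) <= uA * Rint (D0 x) (fun y => cmod (urho z y)).
Proof.
move=> Mz x0 x1.
have i1 : RI (D0 x) (fun y => cmod (urho z y)).
  apply: RI_le (RI_Z (kB pk x) (ep_meas ep x) (uw_RI x0)) => //; first exact: (ep_meas ep x).
    by apply: (ep_meas_sub ep) => //; apply: cmeas_mod; exact: urho_meas.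
  by move=> y Dy; rewrite ger0_norm ?cmod_ge0//; exact: bR.
split => //; rewrite -RintZ//; last exact: (ep_meas ep x).
apply: (vpsi_le ep pe mr bK bR (kc_ge1 pk) uw_ge0 mcw icw Mz x0).
  by apply: RI_Z => //; exact: (ep_meas ep x).
by move=> y /D0P[y0 yx]; rewrite cmodM mulrC ler_wpM2r ?cmod_ge0// uphi_le// (le_trans yx).
Qed.

(* [x ^ (-2 Re z) * kw x] dominates the second solution divided by [x ^ (1/2 + z)]. *)
Definition kg (z : CC R) (x : R) : R := x `^ (- (2 * cre z)) * kw pk x.

Lemma kg_rho z y : 0 < y -> kg z y * cmod (urho z y) <= kc pk 1 * uw y.
Proof.
move=> y0; apply: urho_le => //; first by rewrite mulr_ge0 ?powR_ge0 ?kw_ge0.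
rewrite /kg mulrAC -powR_add// addNr powRr0 mul1r ler_peMr ?kw_ge0 ?kc_ge1//.
Qed.

(** [kg z] is antitone on ]0, 1], so it moves under the integral, where [kg] times |rho| is at most
    a multiple of [uw]. Hence [psi] tends to 0 even after multiplication by the profile of the
    second solution. *)
Lemma upsi_kg z x : M z -> 0 < x -> x <= 1 -> cmod (upsi z x) * kg z x <= uA * kc pk 1 * Rint (D0 x) uw.
Proof.
move=> Mz x0 x1; have [i1 h] := upsi_int Mz x0 x1.
have g0 : 0 <= kg z x by rewrite mulr_ge0 ?powR_ge0 ?kw_ge0.
apply: (le_trans (ler_wpM2r g0 h)); rewrite -(mulrA uA) -(mulrA uA).
apply: ler_wpM2l; first exact: uA_ge0.
have mD := ep_meas ep x; rewrite mulrC -!RintZ//; last exact: uw_RI.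
apply: Rint_le => //; [exact: RI_Z|by apply: RI_Z => //; exact: uw_RI|].
move=> y /D0P[y0 yx]; apply: le_trans (kg_rho z y0); rewrite ler_wpM2r ?cmod_ge0//.
exact: (kw_anti2 pk Mz).
Qed.

End SolutionAtZero.

(** * The solution at infinity *)

Section SolutionAtInfinity.
Variable R : realType.
Variables (M : set (CC R)) (Q : R -> CC R) (k bd : R).
Hypotheses (k0 : 2^-1 <= k) (mQ : cmeas (@pos R) Q)
  (iQ : forall x, 0 < x -> RI (Doo x) (fun y => cmod (Q y)))
  (Mbd : forall z, M z -> cmod z <= bd).

(** The inverse-square term is integrable at infinity and counts as part of the perturbation
    there. *)
Definition vp (z : CC R) (x : R) : CC R := (z ^+ 2 - 4^-1) * cR (x ^- 2) + Q x.
Definition ve (_ : CC R) (x : R) : CC R := cR (expR (2 * k * x) / (2 * k)).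
Definition vrho (z : CC R) (x : R) : CC R := cR (expR (- (2 * k) * x)) * vp z x.
Definition vw (y : R) : R := cmod (Q y) + (bd ^+ 2 + 1) * y ^- 2.
Definition vchi := vphi (@Doo R) (-1) ve vrho (fun=> 1) vw.
Definition veta := vpsi (@Doo R) (-1) ve vrho (fun=> 1) vw.
Definition vs (z : CC R) (x : R) : CC R := cR (expR (- k * x)) * vchi z x.
Definition vs1 (z : CC R) (x : R) : CC R := cR (expR (k * x)) * veta z x - cR k * vs z x.

Let ep := @endpointoo R.
Let kp : 0 < k. Proof. by apply: lt_le_trans k0; rewrite invr_gt0. Qed.

Lemma DooP (x y : R) : Doo x y -> x <= y.
Proof. by rewrite /Doo /= in_itv /= andbT. Qed.

Lemma vw_ge0 y : 0 < y -> 0 <= vw y.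
Proof. by move=> y0; rewrite addr_ge0 ?cmod_ge0// mulr_ge0 ?addr_ge0 ?sqr_ge0// invr_ge0 sqr_ge0. Qed.

Lemma RI_x2 x : 0 < x -> RI (Doo x) (fun y : R => y ^- 2).
Proof.
move=> x0; have p : rprim (fun y : R => - y^-1) (fun y => y ^- 2).
  have h := rprimZ (-1) (rprim_powR (- 1 : R)); apply: rprim_ext h _ _ => y y0.
    by rewrite powR_N// powR_one// mulN1r.
  by rewrite mulrA mulN1r opprK mul1r -opprD powR_N// powR_add// powR_one// -expr2.
have [] := RI_rprimoo x0 p => // t t0; first by rewrite invr_ge0 sqr_ge0.
by rewrite oppr_le0 invr_ge0 ltW.
Qed.

Lemma vw_RI x : 0 < x -> RI (Doo x) vw.
Proof.
move=> x0; apply: RI_D; [exact: (ep_meas ep x)|exact: iQ|].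
by apply: RI_Z; [exact: (ep_meas ep x)|exact: RI_x2].
Qed.

Lemma vp_le z y : M z -> 0 < y -> cmod (vp z y) <= vw y.
Proof.
move=> Mz y0; rewrite /vp addrC; apply: (le_trans (cmodD _ _)); apply: lerD => //; rewrite cmodM cmod_cR.
rewrite ger0_norm ?invr_ge0 ?sqr_ge0// ler_wpM2r ?invr_ge0 ?sqr_ge0//.
apply: (le_trans (cmodB _ _)); rewrite cmodX cmodV -cR_nat cmod_cR ger0_norm//; apply: lerD.
  by rewrite lerXn2r ?nnegrE ?cmod_ge0 ?Mbd// (le_trans (cmod_ge0 z))// Mbd.
by rewrite invf_le1// ler1n.
Qed.

Lemma vp_meas z : cmeas (@pos R) (vp z).
Proof.
apply: cmeasD => //; apply: cmeasZ; have h := prim_meas (@prim_inv R).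
by apply: cmeas_ext (cmeasN h) => y _; rewrite opprK.
Qed.

Lemma vrho_meas z : cmeas (@pos R) (vrho z).
Proof. by apply: cmeasM (vp_meas z); exact: prim_measF (prim_cexpR _). Qed.

(** The constant is 1 because 1/(2k) <= 1; here [2^-1 <= k] enters. *)
Let bK z x y : M z -> 0 < x -> Doo x y -> cmod ((ve z x - ve z y) * vrho z y) <= 1 * vw y.
Proof.
move=> Mz x0 /DooP xy; have y0 := lt_le_trans x0 xy.
rewrite /ve /vrho mulrA cmodM mul1r -[leRHS]mul1r; apply: ler_pM; rewrite ?cmod_ge0 ?vp_le//.
rewrite -cRN -cRD -cRM cmod_cR.
have e0 := expR_gt0 (2 * k * y); have e1 : expR (2 * k * x) <= expR (2 * k * y).
  by rewrite ler_expR ler_wpM2l ?mulr_ge0 ?(ltW kp).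
have e2 := expR_gt0 (2 * k * x).
rewrite mulNr expRN -mulrBl !normrM distrC.
rewrite !ger0_norm ?invr_ge0 ?subr_ge0 ?(ltW e0)// ?mulr_ge0 ?(ltW kp)//.
rewrite ler_pdivrMr// mul1r ler_pdivrMr ?mulr_gt0//.
by have := k0; have := kp; move: (expR _) (expR _) e0 e1 e2 => a b; nra.
Qed.

Let bR z x y : M z -> 0 < x -> Doo x y -> cmod (vrho z y) <= 1 * vw y.
Proof.
move=> Mz x0 /DooP xy; have y0 := lt_le_trans x0 xy.
rewrite cmodM; apply: ler_pM; rewrite ?cmod_ge0 ?vp_le// cmod_cR ger0_norm ?expR_ge0//.
by rewrite mulNr -expR0 ler_expR oppr_le0 !mulr_ge0 ?(ltW kp) ?(ltW y0).
Qed.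

Let mvw : measurable_fun (@pos R) vw.
Proof.
apply: measurable_funD; first exact: cmeas_mod.
apply: measurable_funM; first exact: measurable_cst.
have [h _] := prim_meas (@prim_inv R).
by apply: meas_ext (measurable_funN h) => y _ /=; rewrite opprK.
Qed.

Let mcw : measurable_fun (@pos R) (fun x => 1 * vw x).
Proof. by apply: measurable_funM => //; exact: measurable_cst. Qed.

Let icw x : 0 < x -> RI (Doo x) (fun y => 1 * vw y).
Proof. by move=> x0; apply: RI_ext (vw_RI x0) => y _; rewrite mul1r. Qed.

Let pe z : M z -> prim (ve z) (fun x => cR (expR (2 * k * x))).
Proof.
move=> _; have k2 : 2 * k != 0 by rewrite mulf_neq0// gt_eqF.
have h := primZ (cR (2 * k)^-1) (prim_cexpR (2 * k)); apply: prim_ext h _ _ => x x0.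
  by rewrite /ve cRM mulrC.
by rewrite cRV mulKf// cR_neq0.
Qed.

Let mr z : M z -> cmeas (@pos R) (vrho z) := fun _ => vrho_meas z.
Let c1 (x : R) : 0 < x -> (1 : R) <= 1 := fun _ => lexx 1.

Lemma vs_prim z : M z -> prim (vs z) (vs1 z) /\ prim (vs1 z) (fun x => potV k Q z x * vs z x).
Proof.
move=> Mz; have p1 := vphi_prim ep pe mr bK bR c1 vw_ge0 mcw icw Mz.
have p2 := vpsi_prim ep pe mr bK bR c1 vw_ge0 mcw icw Mz.
have [h1 h2] := ladder_exp p1 p2; split; first exact: h1.
apply: prim_ext h2 _ _ => x x0 //; congr (_ * _); rewrite /potV /vp; ring.
Qed.

Section Regularity.
Variable FF : fclass M.

Let Fe x : 0 < x -> FF (fun z => ve z x).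
Proof. by move=> _; exact: fc_cst. Qed.

Let Fr x : 0 < x -> FF (fun z => vrho z x).
Proof.
move=> x0; apply: fc_scale; apply: fc_add; last exact: fc_cst.
apply: fc_mul; last exact: fc_cst.
by apply: fc_sub; [apply: fc_exp; exact: fc_id|exact: fc_cst].
Qed.

Lemma vs_fc x : 0 < x -> FF (fun z => vs z x).
Proof.
move=> x0; apply: fc_scale.
exact: (vphi_fc ep pe mr Fe Fr bK bR c1 vw_ge0 mcw icw x0).
Qed.

Lemma vs1_fc x : 0 < x -> FF (fun z => vs1 z x).
Proof.
move=> x0; apply: fc_sub; apply: fc_scale; last exact: vs_fc.
exact: (vpsi_fc ep pe mr Fe Fr bK bR c1 vw_ge0 mcw icw x0).
Qed.

End Regularity.

Definition vA (a : R) : R := locked (5 * vweight (@Doo R) (fun=> 1) vw a).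

Lemma vA_ge0 a : 0 < a -> 0 <= vA a.
Proof. move=> a0; have := vweight_ge1 ep c1 vw_ge0 a0; rewrite /vA -lock; lra. Qed.

Lemma vchi_le z a x : M z -> 0 < a -> a <= x -> cmod (vchi z x) <= vA a.
Proof.
move=> Mz a0 ax; have x0 := lt_le_trans a0 ax.
apply: (le_trans (vphi_bound ep pe mr bK bR c1 vw_ge0 mcw icw Mz x0)).
rewrite /vA -lock; apply: ler_wpM2l; first exact: ler0n.
apply: (vweight_le ep c1 vw_ge0 icw a0) => //.
by rewrite /Doo /= in_itv /= ax.
Qed.

Lemma vchi_sub1 z a x : M z -> 0 < a -> a <= x -> cmod (vchi z x - 1) <= vA a * Rint (Doo x) vw.
Proof.
move=> Mz a0 ax; have x0 := lt_le_trans a0 ax.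
have bA y : Doo x y -> cmod (vchi z y) <= vA a.
  by move=> /DooP xy; apply: vchi_le => //; exact: le_trans xy.
have := vphi_sub1 ep pe mr bK bR c1 vw_ge0 mcw icw mvw Mz x0 bA.
by rewrite mul1r.
Qed.

Lemma veta_le z a x : M z -> 0 < a -> a <= x ->
  expR (2 * k * x) * cmod (veta z x) <= vA a * Rint (Doo x) vw.
Proof.
move=> Mz a0 ax; have x0 := lt_le_trans a0 ax.
rewrite -ler_pdivlMl ?expR_gt0// -expRN mulrA -RintZ//; last exact: vw_RI.
  apply: (vpsi_le ep pe mr bK bR c1 vw_ge0 mcw icw Mz x0).
    by apply: RI_Z; [exact: (ep_meas ep x)|exact: vw_RI].
  move=> y /DooP xy; have y0 := lt_le_trans x0 xy.
  rewrite !cmodM cmod_cR ger0_norm ?expR_ge0//.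
  rewrite -(mulrA (expR (- (2 * k) * y))) -(mulrA (expR (- (2 * k * x)))).
  apply: ler_pM; rewrite ?expR_ge0 ?mulr_ge0 ?cmod_ge0//.
    by rewrite ler_expR mulNr lerN2 ler_wpM2l ?mulr_ge0 ?(ltW kp).
  rewrite [leRHS]mulrC; apply: ler_pM; rewrite ?cmod_ge0 ?vp_le//; apply: vchi_le => //.
  exact: le_trans xy.
exact: (ep_meas ep x).
Qed.

End SolutionAtInfinity.

Section BoundedClass.
Variable R : realType.
Variables (M : set (CC R)) (b : R).
Hypothesis Mb : forall z, M z -> cmod z <= b.

Definition ubd (f : CC R -> CC R) := exists C : R, forall z, M z -> cmod (f z) <= C.

(** Boundedness on [M], taken as a class, turns each regularity lemma into a bound uniform in [z];
    it is applied to the data of the solutions at one fixed point. *)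
Definition fc_bounded : fclass M.
Proof.
apply: (@FClass _ M ubd).
- by move=> f g fg [C h]; exists C => z Mz; rewrite -fg// h.
- by move=> c; exists (cmod c).
- by exists b.
- move=> f g [C h] [C' h']; exists (C + C') => z Mz.
  by apply: (le_trans (cmodD _ _)); rewrite lerD ?h ?h'.
- move=> f g [C h] [C' h']; exists (C * C') => z Mz.
  by rewrite cmodM ler_pM ?cmod_ge0 ?h ?h'.
- move=> f /(_ 1 ltr01)[g [C h] fg]; exists (1 + C) => z Mz.
  by rewrite -[f z](subrK (g z)); apply: (le_trans (cmodD _ _)); rewrite lerD ?h ?fg.
- move=> D f h mD hi mf fh _; exists (Rint D h) => z Mz.
  by apply: cint_le => //; [apply: CI_le hi => //; [exact: mf|by move=> y; exact: fh]|by move=> y; exact: fh].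
Defined.

Lemma fc_boundedP f : fc_bounded f -> exists2 C : R, 0 <= C & forall z, M z -> cmod (f z) <= C.
Proof.
move=> [C h]; exists (Num.max 0 C); first by rewrite le_max lexx.
by move=> z Mz; rewrite le_max h ?orbT.
Qed.

End BoundedClass.

(** * Solutions continued from a given point *)

Section ReverseVolterra.
Variable R : realType.
Variables (e de rho phi psi : R -> CC R) (lo hi a A : R) (g w : R -> R).
Hypotheses (pe : prim e de) (pphi : prim phi (fun x => de x * psi x))
  (ppsi : prim psi (fun x => rho x * phi x)) (lo0 : 0 < lo)
  (ah : a = lo \/ a = hi) (A0 : 0 <= A) (g1 : forall x, lo <= x <= hi -> 1 <= g x)
  (hA : forall x, lo <= x <= hi -> cmod (phi a + (e x - e a) * psi a) <= A * g x)
  (hw : forall x y, lo <= x <= hi -> lo <= y <= hi -> (a <= y <= x) || (x <= y <= a) ->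
     cmod ((e x - e y) * rho y) * g y <= g x * w y)
  (w0 : forall y, lo <= y <= hi -> 0 <= w y) (wi : RI `[lo, hi] w) (wh : Rint `[lo, hi] w <= 2^-1).

(** The solution with rho = 0 that has the data of (phi, psi) at [y], evaluated at [x]. It equals
    phi x for y = x, and its derivative in [y] contains only the perturbation. *)
Let zeta x y := phi y + (e x - e y) * psi y.

Let zeta_prim x : prim (zeta x) (fun y => (e x - e y) * rho y * phi y).
Proof.
have h := primD pphi (primM (primB (prim_cst (e x)) pe) ppsi).
by apply: prim_ext h _ _ => y y0 //; ring.
Qed.

Let step S : 0 <= S -> (forall x, lo <= x <= hi -> cmod (phi x) <= S * g x) ->
  forall x, lo <= x <= hi -> cmod (phi x) <= (A + S / 2) * g x.
Proof.
move=> S0 hS x xI.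
have sub c d : lo <= c -> d <= hi -> `[c, d] `<=` `[lo, hi]%classic.
  move=> lc dh y; rewrite /= !in_itv /= => /andP[cy yd].
  by rewrite (le_trans lc cy) (le_trans yd dh).
have key c d : lo <= c -> c <= d -> d <= hi ->
    (forall y, c <= y <= d -> (a <= y <= x) || (x <= y <= a)) ->
    cmod (zeta x d - zeta x c) <= S / 2 * g x.
  move=> lc cd dh hy; have c0 := lt_le_trans lo0 lc.
  have [ci ->] := prim_int (zeta_prim x) c0 cd.
  have wi' : RI `[c, d] w by apply: RI_sub wi => //; exact: sub.
  apply: (@le_trans _ _ (Rint `[c, d] (fun y => (S * g x) * w y))).
    apply: cint_le => //; first exact: RI_Z.
    move=> y; rewrite /= in_itv /= => yI; rewrite cmodM.
    have yI' : lo <= y <= hi by case/andP: yI => h1 h2; rewrite (le_trans lc h1) (le_trans h2 dh).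
    apply: (@le_trans _ _ (cmod ((e x - e y) * rho y) * (S * g y))).
      by rewrite ler_wpM2l ?cmod_ge0// hS.
    by rewrite mulrCA -mulrA ler_wpM2l// hw// hy.
  rewrite RintZ// -!mulrA ler_wpM2l// mulrC ler_wpM2r ?(le_trans ler01 (g1 xI))//.
  apply: le_trans wh; apply: Rint_sub_le => //; first exact: sub.
have hd : cmod (phi x - zeta x a) <= S / 2 * g x.
  have -> : phi x = zeta x x by rewrite /zeta subrr mul0r addr0.
  case/andP: xI => xl xh; case: ah => aE.
    by apply: key; rewrite ?aE// => y ->.
  by rewrite cmodBC; apply: key; rewrite ?aE// => y ->; rewrite orbT.
rewrite -[phi x](subrK (zeta x a)) mulrDl addrC; apply: (le_trans (cmodD _ _)).
by apply: lerD => //; exact: hA.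
Qed.

(** A bound [S] improves to [A + S / 2], whose fixed point is [2 * A]. The iteration starts from the
    bound that continuity gives on the compact interval, and its size disappears in the limit. *)
Lemma reverse_bound x : lo <= x <= hi -> cmod (phi x) <= 2 * A * g x.
Proof.
have [C C0 hC] : exists2 C : R, 0 <= C & forall y, lo <= y <= hi -> cmod (phi y) <= C.
  have [C1 C10 h1] := rprim_bound hi pphi.1 lo0.
  have [C2 C20 h2] := rprim_bound hi pphi.2 lo0.
  exists (C1 + C2); first exact: addr_ge0.
  by move=> y yI; apply: (le_trans (cmod_le _)); rewrite lerD ?h1 ?h2.
have key n : forall y, lo <= y <= hi -> cmod (phi y) <= (2 * A + C * 2^-1 ^+ n) * g y.
  elim: n => [|n IH] y yI.
    apply: (le_trans (hC y yI)); rewrite expr0 mulr1; apply: (@le_trans _ _ (2 * A + C)); first by rewrite lerDr mulr_ge0.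
    by rewrite ler_peMr ?g1// addr_ge0// mulr_ge0.
  apply: (le_trans (step _ IH yI)); first by rewrite addr_ge0 ?mulr_ge0 ?exprn_ge0.
  by rewrite le_eqVlt; apply/orP; left; apply/eqP; rewrite exprS; field.
move=> xI; rewrite -subr_le0; apply: (@half_pow_le0 _ _ (C * g x)) => n.
by rewrite lerBlDr; apply: (le_trans (key n x xI)); rewrite le_eqVlt; apply/orP; left; apply/eqP; ring.
Qed.

End ReverseVolterra.

(** * Majorants uniform in the parameter *)

Section Majorants.
Variable R : realType.
Variables (M : set (CC R)) (Q : R -> CC R) (pk : kpack M Q) (k : R).
Hypotheses (k0 : 2^-1 <= k) (mQ : cmeas (@pos R) Q)
  (iQ : forall x, 0 < x -> RI (Doo x) (fun y => cmod (Q y))).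

Let bd := kbd pk.
Let Mbd : forall z, M z -> cmod z <= bd := kp_bd pk.
Let kp : 0 < k. Proof. by apply: lt_le_trans k0; rewrite invr_gt0. Qed.

Lemma kg_ge1 z x : M z -> 0 < x -> x <= 1 -> 1 <= kg pk z x.
Proof.
move=> Mz x0 x1; have := kw_anti2 pk Mz x0 x1 (lexx 1).
by rewrite kw_one powR1 mulr1.
Qed.

Lemma kg_ge0 z x : 0 < x -> 0 <= kg pk z x.
Proof. by move=> x0; rewrite mulr_ge0 ?powR_ge0 ?kw_ge0. Qed.

Lemma e1_kg z x y : M z -> 0 < x -> x <= y -> y <= 1 -> cmod (e1 z x - e1 z y) <= kc pk 1 * kg pk z x.
Proof.
move=> Mz x0 xy y1; have := kp_e pk Mz x0 xy; rewrite cmodBC -ler_pdivlMr ?powR_pos//.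
move=> /le_trans; apply; rewrite -powR_N// /kg [_ `^ _ * _]mulrC mulrA ler_wpM2r ?powR_ge0//.
by rewrite ler_wpM2r ?kw_ge0// kc_mono// (lt_le_trans x0).
Qed.

Definition redphi (z : CC R) (f : R -> CC R) x := cpow x (- (2^-1 + z)) * f x.
Definition redpsi (z : CC R) (f f1 : R -> CC R) x :=
  cpow x (2^-1 + z) * f1 x - (2^-1 + z) * cR x^-1 * cpow x (2^-1 + z) * f x.

Lemma near0_scale : exists a : R, [/\ 0 < a, a <= 1 &
  (kc pk 1 * kc pk 1) * Rint (D0 a) (uw pk k) <= 2^-1].
Proof.
have c0 : 0 < kc pk 1 * kc pk 1 by rewrite mulr_gt0// (lt_le_trans ltr01)// kc_ge1.
have d0 : 0 < (kc pk 1 * kc pk 1)^-1 / 2 by rewrite divr_gt0// invr_gt0.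
have [x x0 h] := ep_vanish (endpoint0 R) (@uw_RI _ _ _ pk k mQ) d0.
have h1 : Rint (D0 x) (uw pk k) <= (kc pk 1 * kc pk 1)^-1 / 2.
  exact: le_trans (ler_norm _) (ltW h).
exists (Num.min x 1); split; [by rewrite lt_min x0 ltr01|by rewrite ge_min lexx orbT|].
rewrite -ler_pdivlMl//; apply: le_trans h1; apply: Rint_sub_le.
- exact: (ep_meas (endpoint0 R)).
- exact: (ep_meas (endpoint0 R)).
- by move=> y /D0P[y0 yx]; rewrite /D0 /= in_itv /= y0 (le_trans yx)// ge_min lexx.
- by move=> y /D0P[y0 _]; exact: uw_ge0.
- exact: uw_RI.
Qed.

(** Continued from [a] towards 0, any solution is at most of the size x^(1/2 + Re z) kg of the
    second solution; [a] is so small that the perturbation satisfies the smallness condition of the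
    reverse iteration. *)
Lemma hom_near0 a z f f1 x : 0 < a -> a <= 1 -> (kc pk 1 * kc pk 1) * Rint (D0 a) (uw pk k) <= 2^-1 ->
  M z -> prim f f1 -> prim f1 (fun x => potV k Q z x * f x) -> 0 < x -> x <= a ->
  cmod (redphi z f x) <= 2 * (cmod (redphi z f a) + kc pk 1 * cmod (redpsi z f f1 a)) * kg pk z x.
Proof.
move=> a0 a1 ha Mz pf pf1 x0 xa.
have pf1' : prim f1 (fun x => ((z ^+ 2 - 4^-1) * cR (x ^- 2) + uq Q k x) * f x).
  by apply: prim_ext pf1 _ _ => y y0 //; rewrite /potV /uq addrA.
have [p1 p2] := reduce_prim pf pf1'.
have c0 : 0 <= kc pk 1 by rewrite (le_trans ler01)// kc_ge1.
have mD := ep_meas (endpoint0 R).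
have D0s : `[x, a] `<=` D0 a.
  by move=> y; rewrite /D0 /= !in_itv /= => /andP[xy ->]; rewrite (lt_le_trans x0).
have wi : RI (D0 a) (fun y => (kc pk 1 * kc pk 1) * uw pk k y) by apply: RI_Z => //; exact: uw_RI.
have I01 y : x <= y <= a -> 0 < y /\ y <= 1.
  by move=> /andP[xy ya]; rewrite (lt_le_trans x0 xy) (le_trans ya a1).
apply: (@reverse_bound _ (e1 z) _ (urho Q k z) _ (redpsi z f f1) x a a (cmod (redphi z f a) + kc pk 1 * cmod (redpsi z f f1 a)) (kg pk z) (fun y => (kc pk 1 * kc pk 1) * uw pk k y) (e1_prim z) p1 p2 x0) => //.
- by right.
- by rewrite addr_ge0 ?mulr_ge0 ?cmod_ge0.
- by move=> y /I01[y0 y1]; exact: kg_ge1.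
- move=> y yI; have [y0 y1] := I01 y yI; apply: (le_trans (cmodD _ _)); rewrite [leRHS]mulrDl; apply: lerD.
    by rewrite ler_peMr ?cmod_ge0 ?kg_ge1.
  rewrite cmodM mulrC (mulrC (kc pk 1)) -mulrA ler_wpM2l ?cmod_ge0// e1_kg//.
  by case/andP: yI.
- move=> y t yI tI; have [y0 y1] := I01 y yI; have [t0 t1] := I01 t tI.
  have ta : t <= a by case/andP: tI.
  move=> yt; have yt' : y <= t.
    by case/orP: yt => /andP[h1 h2] //; rewrite (le_trans _ h1)//; case/andP: yI.
  rewrite cmodM -mulrA (mulrC (cmod (urho _ _ _ _))).
  apply: (@le_trans _ _ (kc pk 1 * kg pk z y * (kc pk 1 * uw pk k t))).
    apply: ler_pM; [exact: cmod_ge0| |exact: e1_kg|exact: kg_rho].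
    by apply: mulr_ge0; [exact: kg_ge0|exact: cmod_ge0].
  by rewrite le_eqVlt; apply/orP; left; apply/eqP; ring.
- by move=> y /I01[y0 _]; apply: mulr_ge0; [exact: mulr_ge0|exact: uw_ge0].
- exact: RI_sub (measurable_itv _) (mD a) D0s wi.
- apply: le_trans ha; rewrite -RintZ//; last exact: uw_RI.
  by apply: Rint_sub_le => // y /D0P[y0 _]; apply: mulr_ge0; [exact: mulr_ge0|exact: uw_ge0].
- by rewrite xa lexx.
Qed.

Lemma vs_near0 : exists a : R, exists C : R, [/\ 0 < a, a <= 1, 0 <= C &
  forall z x, M z -> 0 < x -> x <= a -> cmod (redphi z (vs Q k bd z) x) <= C * kg pk z x].
Proof.
have [a [a0 a1 ha]] := near0_scale; set FF := fc_bounded Mbd.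
have Fp (s b : CC R) : FF (fun z => cpow a (s + b * z)).
  apply: (@fc_cpow _ _ FF _ (cmod s + cmod b * bd)) => //.
    by move=> z Mz; apply: (le_trans (cmodD _ _)); rewrite lerD2l cmodM ler_wpM2l ?cmod_ge0 ?Mbd.
  by apply: fc_add; [exact: fc_cst|apply: fc_scale; exact: fc_id].
have Fs : FF (fun z => cpow a (2^-1 + z)) by apply: fc_ext (Fp 2^-1 1) => z _; rewrite mul1r.
have Fv : FF (fun z => vs Q k bd z a) by apply: (vs_fc k0 mQ iQ Mbd).
have F1 : FF (fun z => redphi z (vs Q k bd z) a).
  by apply: fc_mul => //; apply: fc_ext (Fp (- 2^-1) (-1)) => z _; rewrite mulN1r opprD.
have F2 : FF (fun z => redpsi z (vs Q k bd z) (vs1 Q k bd z) a).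
  apply: fc_sub; first by apply: fc_mul => //; apply: (vs1_fc k0 mQ iQ Mbd).
  apply: fc_mul => //; apply: fc_mul => //; apply: fc_mul; last exact: fc_cst.
  by apply: fc_add; [exact: fc_cst|exact: fc_id].
have [C1 C10 h1] := fc_boundedP F1; have [C2 C20 h2] := fc_boundedP F2.
have c0 : 0 <= kc pk 1 by rewrite (le_trans ler01)// kc_ge1.
exists a, (2 * (C1 + kc pk 1 * C2)); split => //; first by rewrite mulr_ge0// addr_ge0// mulr_ge0.
move=> z x Mz x0 xa; have [p1 p2] := vs_prim k0 mQ iQ Mbd Mz.
apply: (le_trans (hom_near0 a0 a1 ha Mz p1 p2 x0 xa)).
rewrite ler_wpM2r ?(le_trans ler01 (kg_ge1 Mz x0 (le_trans xa a1)))//.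
by rewrite ler_wpM2l// lerD ?h1// ler_wpM2l ?h2.
Qed.

(** The exponential factorization with k and -k exchanged: a solution is measured against the
    growing exponential. *)
Lemma exp_reduce z f f1 : prim f f1 -> prim f1 (fun x => potV k Q z x * f x) ->
  prim (fun x => cR (expR (- k * x)) * f x)
    (fun x => cR (expR (- (2 * k) * x)) * (cR (expR (k * x)) * (f1 x - cR k * f x))) /\
  prim (fun x => cR (expR (k * x)) * (f1 x - cR k * f x))
    (fun x => cR (expR (2 * k * x)) * vp Q z x * (cR (expR (- k * x)) * f x)).
Proof.
move=> pf pf1; split.
  have h := primM (prim_cexpR (- k)) pf; apply: prim_ext h _ _ => x x0 //.
  have [e0 e1 e2 e3] := cexpR_half k x; rewrite e1 e3 cRN.
  by move: (cR (expR (k * x))) e0 => E E0; field.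
have h := primM (prim_cexpR k) (primB pf1 (primZ (cR k) pf)); apply: prim_ext h _ _ => x x0 //.
have [e0 e1 e2 e3] := cexpR_half k x; rewrite e1 e2 /potV /vp cRX.
move: (cR (expR (k * x))) e0 => E E0; move: (_ * cR (x ^- 2)) => t; by field.
Qed.

Let ke := fun x : R => cR (- (expR (- (2 * k) * x) / (2 * k))).

Let ke_prim : prim ke (fun x => cR (expR (- (2 * k) * x))).
Proof.
have k2 : 2 * k != 0 by rewrite mulf_neq0// gt_eqF.
have h := primZ (cR (- (2 * k)^-1)) (prim_cexpR (- (2 * k))); apply: prim_ext h _ _ => x x0.
  by rewrite /ke -cRM; congr cR; ring.
by rewrite -!cRM; congr cR; field; rewrite gt_eqF.
Qed.

Let ke_le b x y : 0 < b -> b <= y -> y <= x -> cmod (ke x - ke y) <= expR (- (2 * k) * y).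
Proof.
move=> b0 bt yx; rewrite /ke -cRN -cRD cmod_cR opprK addrC -mulrBl.
have h : expR (- (2 * k) * x) <= expR (- (2 * k) * y).
  by rewrite ler_expR !mulNr lerN2 ler_wpM2l// mulr_ge0// ltW.
have k1 : (2 * k)^-1 <= 1 by rewrite invf_le1 ?mulr_gt0//; have := k0; lra.
rewrite ger0_norm; last by rewrite mulr_ge0 ?subr_ge0// invr_ge0 mulr_ge0// ltW.
apply: (@le_trans _ _ (expR (- (2 * k) * y) - expR (- (2 * k) * x))).
  by rewrite ler_piMr ?subr_ge0.
by rewrite gerBl expR_ge0.
Qed.

Lemma hom_infty b z f f1 x : 0 < b -> Rint (Doo b) (vw Q bd) <= 2^-1 -> M z ->
  prim f f1 -> prim f1 (fun x => potV k Q z x * f x) -> b <= x ->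
  cmod (f x) <= 2 * (cmod (f b) + cmod (cR (expR (k * b)) * (f1 b - cR k * f b))) * expR (k * x).
Proof.
move=> b0 hb Mz pf pf1 bx; have [p1 p2] := exp_reduce pf pf1.
have x0 := lt_le_trans b0 bx.
have en y : 0 <= y -> expR (- k * y) <= 1.
  by move=> y0; rewrite -expR0 ler_expR mulNr oppr_le0 mulr_ge0// ltW.
have en2 y : 0 <= y -> expR (- (2 * k) * y) <= 1.
  by move=> y0; rewrite -expR0 ler_expR mulNr oppr_le0 !mulr_ge0// ltW.
have mD := ep_meas (endpointoo R).
have Ds : `[b, x] `<=` Doo b by move=> y; rewrite /Doo /= !in_itv /= => /andP[->].
set psi := fun x => cR (expR (k * x)) * (f1 x - cR k * f x).
have : cmod (cR (expR (- k * x)) * f x) <= 2 * (cmod (f b) + cmod (psi b)) * 1.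
  apply: (@reverse_bound _ ke _ _ _ psi b x b (cmod (f b) + cmod (psi b)) (fun=> 1) (vw Q bd) ke_prim p1 p2 b0) => //.
  - by left.
  - by rewrite addr_ge0 ?cmod_ge0.
  - move=> y /andP[bt yx]; rewrite mulr1; apply: (le_trans (cmodD _ _)); apply: lerD; rewrite cmodM.
      by rewrite ler_piMl ?cmod_ge0// cmod_cR ger0_norm ?expR_ge0// en// ltW.
    rewrite ler_piMl ?cmod_ge0//; apply: (le_trans (ke_le b0 (lexx b) bt)).
    by rewrite en2// ltW.
  - move=> y t /andP[bt yx] /andP[bt' tx] h; rewrite mulr1 mul1r cmodM cmodM.
    have t0 := lt_le_trans b0 bt'; have ty : t <= y.
      by case/orP: h => /andP[h1 h2] //; exact: le_trans h2 bt.
    have := ke_le b0 bt' ty; rewrite mulrA cmod_cR ger0_norm ?expR_ge0// => h1.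
    rewrite -[leRHS]mul1r; apply: ler_pM; rewrite ?mulr_ge0 ?cmod_ge0 ?expR_ge0//.
      apply: (le_trans (ler_wpM2r (expR_ge0 _) h1)).
      by rewrite mulNr expRN mulVf// gt_eqF// expR_gt0.
    exact: (@vp_le _ M).
  - by move=> y /andP[bt _]; apply: vw_ge0; exact: lt_le_trans bt.
  - by apply: RI_sub (measurable_itv _) (mD b) Ds _; exact: vw_RI.
  - apply: le_trans hb; apply: Rint_sub_le => //; first by move=> y /DooP bt; apply: vw_ge0; exact: lt_le_trans bt.
    exact: vw_RI.
  - by rewrite bx lexx.
rewrite mulr1 cmodM cmod_cR ger0_norm ?expR_ge0// mulNr expRN mulrC ler_pdivrMr ?expR_gt0//.
Qed.

Lemma infty_scale : exists2 b : R, 1 <= b & Rint (Doo b) (vw Q bd) <= 2^-1.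
Proof.
have d0 : (0 : R) < 2^-1 by rewrite invr_gt0.
have [x x0 h] := ep_vanish (endpointoo R) (fun x x0 => vw_RI bd iQ x0) d0.
exists (Num.max x 1); first by rewrite le_max lexx orbT.
apply: le_trans (le_trans (ler_norm _) (ltW h)); apply: Rint_sub_le.
- exact: (ep_meas (endpointoo R)).
- exact: (ep_meas (endpointoo R)).
- by move=> y /DooP; rewrite ge_max => /andP[xy _]; rewrite /Doo /= in_itv /= xy.
- by move=> y /DooP xy; apply: vw_ge0; exact: lt_le_trans xy.
- exact: vw_RI.
Qed.

(** The exponents in [ma] and [mb] are the worst ones over [M]: Re z >= klo for the first solution;
    for the second, x^(1/2 - Re z) kw x with Re z <= khi and kw x = O(x^(-keps)). *)
Definition ma x := if x <= 1 then x `^ (2^-1 + klo pk) else expR (k * x).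
Definition mb x := if x <= 1 then x `^ (2^-1 - khi pk - keps pk) else expR (- k * x).

(** The Volterra weight grows too fast to be used at infinity. It is used on ]0, 1] and, by
    monotonicity, on [1, b]; beyond [b], where the tail of the perturbation is small, the growth
    bound for arbitrary solutions takes over. *)
Lemma us_major : exists2 C : R, 0 <= C & forall z x, M z -> 0 < x -> cmod (us pk k z x) <= C * ma x.
Proof.
have [b b1 hb] := infty_scale; set FF := fc_bounded Mbd.
have b0 := lt_le_trans ltr01 b1.
have F1 : FF (fun z => us pk k z b) by apply: us_fc.
have F2 : FF (fun z => cR (expR (k * b)) * (us1 pk k z b - cR k * us pk k z b)).
  by apply: fc_scale; apply: fc_sub; [exact: us1_fc|exact: fc_scale].
have [C1 C10 h1] := fc_boundedP F1; have [C2 C20 h2] := fc_boundedP F2.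
set Cw := b `^ (2^-1 + `|bd|) * (5 * vweight (@D0 R) (kc pk) (uw pk k) b).
have Cw0 : 0 <= Cw.
  rewrite mulr_ge0 ?powR_ge0// mulr_ge0//.
  by rewrite mulr_ge0 ?expR_ge0// (le_trans ler01)// kc_ge1.
have A0 := uA_ge0 pk k.
have cr : cre (2^-1 : CC R) = 2^-1 by rewrite -cR_nat -cRV.
exists (uA pk k + Cw + 2 * (C1 + C2)); first by rewrite !addr_ge0// mulr_ge0// addr_ge0.
move=> z x Mz x0; have [lo hi] := kp_re pk Mz.
have w : 0 <= 2 * (C1 + C2) by rewrite mulr_ge0// addr_ge0.
have [x1|x1] := leP x 1; rewrite /ma ?x1 ?(leNgt x) ?x1 /=.
  rewrite /us cmodM cmod_cpow// mulrC; apply: ler_pM; [exact: cmod_ge0|exact: powR_ge0| |].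
    by apply: (le_trans (uphi_le pk k mQ Mz x0 x1)); lra.
  by apply: powR_anti => //; rewrite creD cr lerD2l.
have [xb|bx] := leP x b; last first.
  have [p1 p2] := us_prim pk k mQ Mz.
  apply: (le_trans (hom_infty b0 hb Mz p1 p2 (ltW bx))); rewrite ler_wpM2r ?expR_ge0//.
  by apply: (@le_trans _ _ (2 * (C1 + C2))); [apply: ler_wpM2l; [exact: ler0n|apply: lerD; [exact: h1|exact: h2]]|lra].
have ex : 1 <= expR (k * x) by rewrite -expR0 ler_expR mulr_ge0// ltW.
apply: (@le_trans _ _ Cw); last first.
  by apply: (@le_trans _ _ (uA pk k + Cw + 2 * (C1 + C2))); [lra|rewrite ler_peMr// !addr_ge0].
rewrite /us cmodM cmod_cpow//; apply: ler_pM; [exact: powR_ge0|exact: cmod_ge0| |].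
  apply: (@le_trans _ _ (x `^ (2^-1 + `|bd|))).
    apply: powR_mono; first exact: ltW.
    rewrite creD cr lerD2l (le_trans (ler_norm _))// (le_trans (cre_le _))//.
    by rewrite (le_trans (Mbd Mz))// ler_norm.
  by apply: powR_base => //; rewrite addr_ge0// invr_ge0.
exact: uphi_le_gen.
Qed.

Lemma vs_major : exists2 C : R, 0 <= C & forall z x, M z -> 0 < x -> cmod (vs Q k bd z x) <= C * mb x.
Proof.
have [a [C [a0 a1 C0 hC]]] := vs_near0.
have kC0 : 0 <= kC pk.
  have := kp_pow pk ltr01 (lexx 1); rewrite kw_one powR1 mulr1; exact: le_trans.
set p := 2^-1 - khi pk - keps pk.
have A0 := vA_ge0 Q bd a0.
have cr : cre (2^-1 : CC R) = 2^-1 by rewrite -cR_nat -cRV.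
exists (C * kC pk + vA Q bd a * a `^ (- `|p|) + vA Q bd a).
  by rewrite !addr_ge0// mulr_ge0// powR_ge0.
have h1 : 0 <= C * kC pk by rewrite mulr_ge0.
have h2 : 0 <= vA Q bd a * a `^ (- `|p|) by rewrite mulr_ge0// powR_ge0.
move=> z x Mz x0; have [lo hi] := kp_re pk Mz.
have vle : a <= x -> cmod (vs Q k bd z x) <= vA Q bd a * expR (- k * x).
  move=> ax; rewrite cmodM cmod_cR ger0_norm ?expR_ge0// mulrC ler_wpM2r ?expR_ge0//.
  exact: (vchi_le k0 mQ iQ Mbd Mz a0 ax).
have [x1|x1] := leP x 1; rewrite /mb ?x1 ?(leNgt x) ?x1 /= -/p; last first.
  by apply: (le_trans (vle (le_trans a1 (ltW x1)))); rewrite ler_wpM2r ?expR_ge0//; lra.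
have [xa|ax] := leP x a.
  have -> : vs Q k bd z x = cpow x (2^-1 + z) * redphi z (vs Q k bd z) x.
    by rewrite /redphi mulrA -cpowD subrr cpow0 mul1r.
  rewrite cmodM cmod_cpow//; apply: (le_trans (ler_wpM2l (powR_ge0 _ _) (hC z x Mz x0 xa))).
  have h : x `^ (2^-1 + cre z) * kg pk z x <= kC pk * x `^ p.
    rewrite /kg mulrA -powR_add//.
    apply: (@le_trans _ _ (x `^ (2^-1 + cre z + - (2 * cre z)) * (kC pk * x `^ (- keps pk)))).
      by rewrite ler_wpM2l ?powR_ge0// kp_pow.
    rewrite mulrCA ler_wpM2l// -powR_add//; apply: powR_anti => //; rewrite /p; lra.
  rewrite creD cr mulrCA; apply: (le_trans (ler_wpM2l C0 h)); rewrite mulrA ler_wpM2r ?powR_ge0//; lra.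
apply: (le_trans (vle (ltW ax))); apply: (@le_trans _ _ (vA Q bd a * 1)).
  by rewrite ler_wpM2l// -expR0 ler_expR mulNr oppr_le0 mulr_ge0// ltW.
have h : 1 <= a `^ (- `|p|) * x `^ p.
  rewrite -[leLHS](powRr0 x) -(addNr p) powR_add// ler_wpM2r ?powR_ge0//.
  apply: (@le_trans _ _ (x `^ (- `|p|))).
    by apply: powR_anti => //; rewrite lerN2 ler_norm.
  by apply: powR_base_neg => //; rewrite ?oppr_le0//; exact: ltW.
apply: (@le_trans _ _ (vA Q bd a * a `^ (- `|p|) * x `^ p)).
  by rewrite -mulrA ler_wpM2l.
rewrite ler_wpM2r ?powR_ge0//; lra.
Qed.

End Majorants.

(** * A Schur test for the Green kernel *)

Section Schur.
Variable R : realType.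
Local Notation mu := (@lebesgue_measure R).
Implicit Types (x y s t : R) (a b h f g F G : R -> R).

Lemma Rint_gt0 s t f : s < t -> RI `[s, t] f -> (forall y, s <= y <= t -> 0 < f y) -> 0 < Rint `[s, t] f.
Proof.
move=> st fi f0.
have fI y : `[s, t]%classic y -> 0 < f y by rewrite /= in_itv /= => /f0.
rewrite lt_def Rint_ge0 ?andbT; last by move=> y /fI/ltW.
apply/eqP => h.
have mf : measurable_fun `[s, t] (EFin \o f) by apply/measurable_EFinP; exact: RI_meas.
have /(ae_eq_integral_abs mu (measurable_itv _) mf) :
    (\int[mu]_(x in `[s, t]) `|(EFin \o f) x| = 0)%E.
  transitivity (\int[mu]_(x in `[s, t]) (f x)%:E)%E; last by rewrite RI_fin// h.
  by apply: eq_integral => y; rewrite inE => /fI y0 /=; rewrite gtr0_norm.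
move=> [N [mN N0 sub]].
have : (mu `[s, t] <= mu N)%E.
  apply: le_measure; rewrite ?inE//=.
  move=> y yI; apply: sub => /= /(_ yI)[] e; have := fI y yI; by rewrite e ltxx.
rewrite N0 lebesgue_measure_itv /= lte_fin st -EFinD lee_fin subr_le0 leNgt st//.
Qed.

(** The discriminant argument for 2 r m <= p + r^2 q. Stated with the pointwise condition m^2 <= p
    q, it involves no square roots of [p] and [q]. *)
Lemma cauchy_schwarz (D : set R) (p m q : R -> R) : measurable D -> measurable_fun D m ->
  (forall x, D x -> 0 <= p x /\ 0 <= q x) -> (forall x, D x -> m x ^+ 2 <= p x * q x) ->
  RI D p -> RI D q -> RI D m /\ Rint D m ^+ 2 <= Rint D p * Rint D q.
Proof.
move=> mD mm pq0 mpq fi gi.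
have quad x r : D x -> 2 * r * m x <= p x + r ^+ 2 * q x.
  move=> Dx; have [p0 q0] := pq0 x Dx; have := mpq x Dx.
  have s0 : 0 <= p x + r ^+ 2 * q x by rewrite addr_ge0// mulr_ge0// sqr_ge0.
  move=> h; apply: (le_trans (ler_norm _)); rewrite -(ger0_norm s0) -ler_sqr ?nnegrE ?normr_ge0//.
  rewrite !real_normK ?num_real//.
  have := sqr_ge0 (p x - r ^+ 2 * q x); have := sqr_ge0 r.
  move: (p x) (q x) (m x) p0 q0 h s0 => u v w u0 v0 h s0 r0 h1.
  have : (2 * r * w) ^+ 2 <= 4 * (r ^+ 2 * (u * v)).
    by rewrite (_ : _ ^+ 2 = 4 * (r ^+ 2 * w ^+ 2)); [rewrite ler_wpM2l// ler_wpM2l|ring].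
  nra.
have pi : RI D m.
  apply: RI_le (RI_D mD fi gi) => //.
  move=> x Dx; have := quad x 1 Dx; have := quad x (-1) Dx; have [p0 q0] := pq0 x Dx.
  rewrite ler_norml sqrrN expr1n; lra.
split => //; set A := Rint D p; set C := Rint D q; set B := Rint D m.
have A0 : 0 <= A by apply: Rint_ge0 => x /pq0[].
have C0 : 0 <= C by apply: Rint_ge0 => x /pq0[].
have key r : 2 * r * B <= A + r ^+ 2 * C.
  rewrite -!RintZ// -RintD//; last exact: RI_Z.
  by apply: Rint_le => //; [exact: RI_Z|by apply: RI_D => //; exact: RI_Z|move=> x /quad].
have [C1|C1] := eqVneq C 0.
  rewrite C1 mulr0; have [->|B1] := eqVneq B 0; first by rewrite expr0n.
  have := key ((A + 1) / B); rewrite C1 mulr0 addr0 -mulrA divfK//; lra.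
have Cp : 0 < C by rewrite lt_def C1.
(* [r = B / C] minimizes A + r^2 C - 2 r B. *)
have := key (B / C); rewrite expr_div_n.
have -> : B ^+ 2 / C ^+ 2 * C = B ^+ 2 / C by field.
have -> : 2 * (B / C) * B = 2 * (B ^+ 2 / C) by field.
move=> h; rewrite -ler_pdivrMr//; lra.
Qed.

Lemma RI_pos_le f C : measurable_fun (@pos R) f -> (forall x, 0 < x -> 0 <= f x) ->
  (forall s t, 0 < s -> s <= t -> RI `[s, t] f /\ Rint `[s, t] f <= C) ->
  RI (@pos R) f /\ Rint (@pos R) f <= C.
Proof.
move=> mf f0 H; pose S n : set R := `[n.+1%:R^-1, n.+1%:R].
have a0 n : 0 < n.+1%:R^-1 :> R by rewrite invr_gt0 ltr0n.
have ab n : n.+1%:R^-1 <= n.+1%:R :> R.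
  by rewrite (@le_trans _ _ 1)// ?invf_le1 ?ltr0n// ler1n.
apply: (@RI_exhaust _ _ S) => //.
- by move=> n; exact: measurable_itv.
- apply/seteqP; split => [x [n _]|x x0]; rewrite /S /pos /= ?in_itv /=.
    by move=> /andP[h _]; exact: lt_le_trans h.
  have h1 := archi_boundP (ltW x0); have xi : 0 < x^-1 by rewrite invr_gt0.
  have h2 := archi_boundP (ltW xi).
  exists (maxn (Num.bound x) (Num.bound x^-1)) => //; rewrite /= in_itv /=.
  rewrite -[x]invrK lef_pV2 ?posrE// !invrK; apply/andP; split; apply: ltW; last first.
    by apply: (lt_le_trans h1); rewrite ler_nat leqW// leq_maxl.
  by apply: (lt_le_trans h2); rewrite ler_nat leqW// leq_maxr.
- move=> n m nm x; rewrite /S /= !in_itv /= => /andP[h1 h2]; apply/andP; split.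
    by apply: le_trans h1; rewrite lef_pV2 ?posrE// ler_nat.
  by apply: (le_trans h2); rewrite ler_nat.
- by move=> n; have [] := H _ _ (a0 n) (ab n).
- by move=> n; have [] := H _ _ (a0 n) (ab n).
Qed.

Variables (a b h : R -> R) (C : R).
Hypotheses (ma_ : measurable_fun (@pos R) a) (mb_ : measurable_fun (@pos R) b)
  (mh_ : measurable_fun (@pos R) h) (a0 : forall x, 0 < x -> 0 < a x)
  (b0 : forall x, 0 < x -> 0 < b x) (h0 : forall x, 0 < x -> 0 < h x)
  (iah : forall x, 0 < x -> RI (D0 x) (fun y => a y * h y))
  (ibh : forall x, 0 < x -> RI (Doo x) (fun y => b y * h y))
  (S1 : forall x, 0 < x -> b x * Rint (D0 x) (fun y => a y * h y) <= C * h x)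
  (S2 : forall x, 0 < x -> a x * Rint (Doo x) (fun y => b y * h y) <= C * h x).

Variables A_ B_ : R -> R.
Hypotheses (AE : forall x, A_ x = Rint (D0 x) (fun y => a y * h y))
  (BE : forall x, B_ x = Rint (Doo x) (fun y => b y * h y)).
Let mD0 := ep_meas (endpoint0 R).
Let mDoo := ep_meas (endpointoo R).

Let mah : measurable_fun (@pos R) (fun y => a y * h y).
Proof. exact: measurable_funM. Qed.
Let mbh : measurable_fun (@pos R) (fun y => b y * h y).
Proof. exact: measurable_funM. Qed.

Let A_gt0 x : 0 < x -> 0 < A_ x.
Proof.
move=> x0; have x2 : 0 < x / 2 by rewrite divr_gt0.
have sub : `[x / 2, x] `<=` D0 x.
  by move=> y; rewrite /D0 /= !in_itv /= => /andP[h1 ->]; rewrite (lt_le_trans x2).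
rewrite AE; apply: (@lt_le_trans _ _ (Rint `[x / 2, x] (fun y => a y * h y))).
  apply: Rint_gt0; first lra; first exact: RI_sub (measurable_itv _) (mD0 x) sub (iah x0).
  by move=> y /andP[h1 _]; rewrite mulr_gt0 ?a0 ?h0// (lt_le_trans x2).
apply: Rint_sub_le => //; last exact: iah.
by move=> y /D0P[y0 _]; rewrite ltW// mulr_gt0 ?a0 ?h0.
Qed.

Let B_gt0 x : 0 < x -> 0 < B_ x.
Proof.
move=> x0.
have sub : `[x, x + 1] `<=` Doo x.
  by move=> y; rewrite /Doo /= !in_itv /= => /andP[-> _].
rewrite BE; apply: (@lt_le_trans _ _ (Rint `[x, x + 1] (fun y => b y * h y))).
  apply: Rint_gt0; first lra; first exact: RI_sub (measurable_itv _) (mDoo x) sub (ibh x0).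
  by move=> y /andP[h1 _]; rewrite mulr_gt0 ?b0 ?h0// (lt_le_trans x0).
apply: Rint_sub_le => //; last exact: ibh.
by move=> y /DooP xy; rewrite ltW// mulr_gt0 ?b0 ?h0// (lt_le_trans x0).
Qed.

Let A_prim : rprim A_ (fun y => a y * h y).
Proof.
by apply: rprim_ext (ep_prim (endpoint0 R) mah iah) _ _ => x x0 //; rewrite mul1r AE.
Qed.
Let B_prim : rprim B_ (fun y => - (b y * h y)).
Proof.
apply: rprim_ext (rprimZ (-1) (ep_prim (endpointoo R) mbh ibh)) _ _ => x x0.
  by rewrite mulrA mulrNN !mul1r BE.
by rewrite mulN1r.
Qed.

Variable F : R -> R.
Hypotheses (mF : measurable_fun (@pos R) F) (F0 : forall x, 0 < x -> 0 <= F x)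
  (iF : RI (@pos R) (fun x => h x * F x)).

Variable K : R.
Hypothesis KE : Rint (@pos R) (fun x => h x * F x) = K.
Let hF0 x : 0 < x -> 0 <= h x * F x.
Proof. by move=> x0; rewrite mulr_ge0 ?F0// ltW// h0. Qed.

(** For y <= x the condition [S2] and the monotonicity of [B_] give a y <= (C / B_ x) h y, so a F is
    dominated by h F. *)
Lemma schur_RI0 x : 0 < x -> RI (D0 x) (fun y => a y * F y).
Proof.
move=> x0; have Bx := B_gt0 x0.
have i1 : RI (D0 x) (fun y => (C / B_ x) * (h y * F y)).
  by apply: RI_Z => //; apply: RI_sub iF => //; [exact: pos_meas|exact: (ep_pos (endpoint0 R))].
apply: RI_le i1 => //.
  by apply: (ep_meas_sub (endpoint0 R)) => //; exact: measurable_funM.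
move=> y /D0P[y0 yx]; rewrite ger0_norm; last by rewrite mulr_ge0 ?F0// ltW// a0.
rewrite [leRHS]mulrA ler_wpM2r ?F0//.
rewrite mulrAC ler_pdivlMr//; apply: le_trans (S2 y0); rewrite ler_wpM2l ?(ltW (a0 y0))// BE.
apply: Rint_sub_le => //; last exact: ibh.
  by move=> t /DooP xt; rewrite /Doo /= in_itv /= (le_trans yx).
by move=> t /DooP yt; rewrite ltW// mulr_gt0 ?b0 ?h0// (lt_le_trans y0).
Qed.

Lemma schur_RIoo x : 0 < x -> RI (Doo x) (fun y => b y * F y).
Proof.
move=> x0; have Bx := A_gt0 x0.
have i1 : RI (Doo x) (fun y => (C / A_ x) * (h y * F y)).
  by apply: RI_Z => //; apply: RI_sub iF => //; [exact: pos_meas|exact: (ep_pos (endpointoo R))].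
apply: RI_le i1 => //.
  by apply: (ep_meas_sub (endpointoo R)) => //; exact: measurable_funM.
move=> y /DooP xy; have y0 := lt_le_trans x0 xy.
rewrite ger0_norm; last by rewrite mulr_ge0 ?F0// ltW// b0.
rewrite [leRHS]mulrA ler_wpM2r ?F0//.
rewrite mulrAC ler_pdivlMr//; apply: le_trans (S1 y0); rewrite ler_wpM2l ?(ltW (b0 y0))// AE.
apply: Rint_sub_le => //; last exact: iah.
  by move=> t /D0P[t0 tx]; rewrite /D0 /= in_itv /= t0 (le_trans tx).
by move=> t /D0P[t0 _]; rewrite ltW// mulr_gt0 ?a0 ?h0.
Qed.

Variables Phi Psi : R -> R.
Hypotheses (PhiE : forall x, Phi x = Rint (D0 x) (fun y => a y * F y))
  (PsiE : forall x, Psi x = Rint (Doo x) (fun y => b y * F y)).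

Let maF : measurable_fun (@pos R) (fun y => a y * F y).
Proof. exact: measurable_funM. Qed.
Let mbF : measurable_fun (@pos R) (fun y => b y * F y).
Proof. exact: measurable_funM. Qed.

Let Phi_prim : rprim Phi (fun y => a y * F y).
Proof.
by apply: rprim_ext (ep_prim (endpoint0 R) maF schur_RI0) _ _ => x x0 //; rewrite mul1r PhiE.
Qed.
Let Psi_prim : rprim Psi (fun y => - (b y * F y)).
Proof.
apply: rprim_ext (rprimZ (-1) (ep_prim (endpointoo R) mbF schur_RIoo)) _ _ => x x0.
  by rewrite mulrA mulrNN !mul1r PsiE.
by rewrite mulN1r.
Qed.

Let C0 : 0 <= C.
Proof.
have := S2 (@ltr01 R); have := mulr_gt0 (a0 (@ltr01 R)) (B_gt0 (@ltr01 R)); rewrite BE => h1 h2.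
have := lt_le_trans h1 h2; rewrite pmulr_lgt0 ?h0//; exact: ltW.
Qed.

(* Integration by parts replaces Tonelli: [(B_ Phi)' = - b h Phi + B_ a F]. *)
Lemma schur_left : RI (@pos R) (fun x => b x * h x * Phi x) /\
  Rint (@pos R) (fun x => b x * h x * Phi x) <= C * K.
Proof.
have Phi0 x : 0 < x -> 0 <= Phi x.
  by move=> x0; rewrite PhiE; apply: Rint_ge0 => y /D0P[y0 _]; rewrite mulr_ge0 ?F0 ?ltW ?a0.
have mPhi : measurable_fun (@pos R) (fun x => b x * h x * Phi x).
  by apply: measurable_funM => //; exact: rprim_meas Phi_prim.
have BaF y : 0 < y -> B_ y * (a y * F y) <= C * (h y * F y).
  by move=> y0; rewrite mulrA mulrA ler_wpM2r ?F0// mulrC BE S2.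
have posBaF y : 0 < y -> 0 <= B_ y * (a y * F y).
  by move=> y0; rewrite !mulr_ge0 ?F0 ?ltW ?a0// B_gt0.
have mBaF : measurable_fun (@pos R) (fun y => B_ y * (a y * F y)).
  by apply: measurable_funM => //; exact: rprim_meas B_prim.
have iC (D : set R) : measurable D -> D `<=` @pos R -> RI D (fun y => C * (h y * F y)).
  by move=> mD Dp; apply: RI_Z => //; apply: RI_sub iF => //; exact: pos_meas.
have iB (D : set R) : measurable D -> D `<=` @pos R -> RI D (fun y => B_ y * (a y * F y)).
  move=> mD Dp; apply: RI_le (iC D mD Dp) => //.
    by apply: measurable_funS mBaF => //; exact: pos_meas.
  by move=> y /Dp y0; rewrite ger0_norm ?posBaF ?BaF.
apply: RI_pos_le => //.
  by move=> x x0; rewrite !mulr_ge0 ?Phi0 ?ltW ?b0 ?h0.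
move=> s t s0 st; have t0 := lt_le_trans s0 st.
have ip : `[s, t] `<=` @pos R := itv_pos s0.
have p := rprimM B_prim Phi_prim; have [i1 e1] := p.2 s t s0 st.
have i2 := iB _ (measurable_itv _) ip.
have i3 : RI `[s, t] (fun x => b x * h x * Phi x).
  by apply: RI_ext (RI_B _ i2 i1) => // x _; ring.
split => //.
have e2 : Rint `[s, t] (fun x => b x * h x * Phi x) =
    Rint `[s, t] (fun y => B_ y * (a y * F y)) - (B_ t * Phi t - B_ s * Phi s).
  by rewrite e1 -RintB//; apply: Rint_ext => x _; ring.
have h1 : B_ s * Phi s <= Rint (D0 s) (fun y => B_ y * (a y * F y)).
  rewrite PhiE -RintZ//; last exact: schur_RI0.
  apply: Rint_le => //; [by apply: RI_Z => //; exact: schur_RI0|exact: iB (mD0 s) (ep_pos (endpoint0 R) s0)|].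
  move=> y /D0P[y0 ys]; rewrite ler_wpM2r ?mulr_ge0 ?F0 ?(ltW (a0 y0))//.
  rewrite !BE; apply: Rint_sub_le => //; last exact: ibh.
    by move=> r /DooP sr; rewrite /Doo /= in_itv /= (le_trans ys).
  by move=> r /DooP yr; rewrite ltW// mulr_gt0 ?b0 ?h0// (lt_le_trans y0).
have h2 : Rint (D0 s) (fun y => B_ y * (a y * F y)) + Rint `[s, t] (fun y => B_ y * (a y * F y)) =
    Rint (D0 t) (fun y => B_ y * (a y * F y)).
  have q := ep_prim (endpoint0 R) mBaF (fun x (x0 : 0 < x) => iB _ (mD0 x) (ep_pos (endpoint0 R) x0)).
  by have [_ <-] := q.2 s t s0 st; rewrite !mul1r addrC subrK.
have h3 : Rint (D0 t) (fun y => B_ y * (a y * F y)) <= C * K.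
  rewrite -KE -RintZ//; last exact: pos_meas.
  apply: (@le_trans _ _ (Rint (D0 t) (fun y => C * (h y * F y)))).
    apply: Rint_le => //; [exact: iB (mD0 t) (ep_pos (endpoint0 R) t0)|exact: iC (mD0 t) (ep_pos (endpoint0 R) t0)|].
    by move=> y /D0P[y0 _]; exact: BaF.
  apply: Rint_sub_le => //; [exact: pos_meas|exact: (ep_pos (endpoint0 R))| |by apply: iC => //; exact: pos_meas].
  by move=> y y0; rewrite mulr_ge0 ?hF0.
have h4 : 0 <= B_ t * Phi t by rewrite mulr_ge0 ?Phi0// ltW// B_gt0.
by rewrite e2; lra.
Qed.

(** The mirror image: (A_ Psi)' = a h Psi - A_ b F, and the boundary term at [t] is absorbed by the
    integral of A_ b F beyond [t]. *)
Lemma schur_right : RI (@pos R) (fun x => a x * h x * Psi x) /\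
  Rint (@pos R) (fun x => a x * h x * Psi x) <= C * K.
Proof.
have C0r : 0 <= C.
  have := S1 (@ltr01 R); have := mulr_gt0 (b0 (@ltr01 R)) (A_gt0 (@ltr01 R)); rewrite AE => h1 h2.
  have := lt_le_trans h1 h2; rewrite pmulr_lgt0 ?h0//; exact: ltW.
have Psi0 x : 0 < x -> 0 <= Psi x.
  move=> x0; rewrite PsiE; apply: Rint_ge0 => y /DooP xy; have y0 := lt_le_trans x0 xy.
  by rewrite mulr_ge0 ?F0 ?ltW ?b0.
have mPsi : measurable_fun (@pos R) (fun x => a x * h x * Psi x).
  by apply: measurable_funM => //; exact: rprim_meas Psi_prim.
have AbF y : 0 < y -> A_ y * (b y * F y) <= C * (h y * F y).
  by move=> y0; rewrite mulrA mulrA ler_wpM2r ?F0// mulrC AE S1.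
have posAbF y : 0 < y -> 0 <= A_ y * (b y * F y).
  by move=> y0; rewrite !mulr_ge0 ?F0 ?ltW ?b0// A_gt0.
have mAbF : measurable_fun (@pos R) (fun y => A_ y * (b y * F y)).
  by apply: measurable_funM => //; exact: rprim_meas A_prim.
have iC (D : set R) : measurable D -> D `<=` @pos R -> RI D (fun y => C * (h y * F y)).
  by move=> mD Dp; apply: RI_Z => //; apply: RI_sub iF => //; exact: pos_meas.
have iB (D : set R) : measurable D -> D `<=` @pos R -> RI D (fun y => A_ y * (b y * F y)).
  move=> mD Dp; apply: RI_le (iC D mD Dp) => //.
    by apply: measurable_funS mAbF => //; exact: pos_meas.
  by move=> y /Dp y0; rewrite ger0_norm ?posAbF ?AbF.
apply: RI_pos_le => //.
  by move=> x x0; rewrite !mulr_ge0 ?Psi0 ?ltW ?a0 ?h0.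
move=> s t s0 st; have t0 := lt_le_trans s0 st.
have ip : `[s, t] `<=` @pos R := itv_pos s0.
have p := rprimM A_prim Psi_prim; have [i1 e1] := p.2 s t s0 st.
have i2 := iB _ (measurable_itv _) ip.
have i3 : RI `[s, t] (fun x => a x * h x * Psi x).
  by apply: RI_ext (RI_D _ i1 i2) => // x _; ring.
split => //.
have e2 : Rint `[s, t] (fun x => a x * h x * Psi x) =
    (A_ t * Psi t - A_ s * Psi s) + Rint `[s, t] (fun y => A_ y * (b y * F y)).
  by rewrite e1 -RintD//; apply: Rint_ext => x _; ring.
have h1 : A_ t * Psi t <= Rint (Doo t) (fun y => A_ y * (b y * F y)).
  rewrite PsiE -RintZ//; last exact: schur_RIoo.
  apply: Rint_le => //; [by apply: RI_Z => //; exact: schur_RIoo|exact: iB (mDoo t) (ep_pos (endpointoo R) t0)|].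
  move=> y /DooP ty; have y0 := lt_le_trans t0 ty.
  rewrite ler_wpM2r ?mulr_ge0 ?F0 ?(ltW (b0 y0))//.
  rewrite !AE; apply: Rint_sub_le => //; last exact: iah.
    by move=> r /D0P[r0 rt]; rewrite /D0 /= in_itv /= r0 (le_trans rt).
  by move=> r /D0P[r0 _]; rewrite ltW// mulr_gt0 ?a0 ?h0.
have h2 : Rint (Doo t) (fun y => A_ y * (b y * F y)) + Rint `[s, t] (fun y => A_ y * (b y * F y)) =
    Rint (Doo s) (fun y => A_ y * (b y * F y)).
  have q := ep_prim (endpointoo R) mAbF (fun x (x0 : 0 < x) => iB _ (mDoo x) (ep_pos (endpointoo R) x0)).
  by have [_ <-] := q.2 s t s0 st; ring.
have h3 : Rint (Doo s) (fun y => A_ y * (b y * F y)) <= C * K.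
  rewrite -KE -RintZ//; last exact: pos_meas.
  apply: (@le_trans _ _ (Rint (Doo s) (fun y => C * (h y * F y)))).
    apply: Rint_le => //; [exact: iB (mDoo s) (ep_pos (endpointoo R) s0)|exact: iC (mDoo s) (ep_pos (endpointoo R) s0)|].
    by move=> y /DooP sy; apply: AbF; exact: lt_le_trans sy.
  apply: Rint_sub_le => //; [exact: pos_meas|exact: (ep_pos (endpointoo R))| |by apply: iC => //; exact: pos_meas].
  by move=> y y0; apply: mulr_ge0; [exact: C0r|exact: hF0].
have h4 : 0 <= A_ s * Psi s by rewrite mulr_ge0 ?Psi0// ltW// A_gt0.
by rewrite e2; lra.
Qed.

End Schur.

Section SchurTest.
Variable R : realType.
Variables (a b h : R -> R) (C : R).
Hypotheses (ma_ : measurable_fun (@pos R) a) (mb_ : measurable_fun (@pos R) b)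
  (mh_ : measurable_fun (@pos R) h) (a0 : forall x, 0 < x -> 0 < a x)
  (b0 : forall x, 0 < x -> 0 < b x) (h0 : forall x, 0 < x -> 0 < h x)
  (iah : forall x, 0 < x -> RI (D0 x) (fun y => a y * h y))
  (ibh : forall x, 0 < x -> RI (Doo x) (fun y => b y * h y))
  (S1 : forall x, 0 < x -> b x * Rint (D0 x) (fun y => a y * h y) <= C * h x)
  (S2 : forall x, 0 < x -> a x * Rint (Doo x) (fun y => b y * h y) <= C * h x).

Definition schurT (G : R -> R) x :=
  b x * Rint (D0 x) (fun y => a y * G y) + a x * Rint (Doo x) (fun y => b y * G y).

(** With F = G^2 / h, Cauchy-Schwarz bounds the square of the integral of a G by the product of the
    integrals of a h and a F, and the Schur conditions bound the first factor. Each half of the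
    kernel contributes C^2, and (p + q)^2 <= 2 p^2 + 2 q^2 turns this into 4 C^2. *)
Lemma schur_test (G : R -> R) : measurable_fun (@pos R) G -> (forall x, 0 < x -> 0 <= G x) ->
  RI (@pos R) (fun x => G x ^+ 2) ->
  [/\ forall x, 0 < x -> RI (D0 x) (fun y => a y * G y),
    forall x, 0 < x -> RI (Doo x) (fun y => b y * G y),
    RI (@pos R) (fun x => schurT G x ^+ 2) &
    Rint (@pos R) (fun x => schurT G x ^+ 2) <= 4 * C ^+ 2 * Rint (@pos R) (fun x => G x ^+ 2)].
Proof.
move=> mG G0 iG; pose F x := G x ^+ 2 / h x.
have C0 : 0 <= C.
  have := S1 (@ltr01 R); have : 0 <= b 1 * Rint (D0 1) (fun y => a y * h y).
    by rewrite mulr_ge0 ?(ltW (b0 _))//; apply: Rint_ge0 => y /D0P[y0 _]; rewrite mulr_ge0// ltW ?a0 ?h0.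
  by move=> h1 h2; have := le_trans h1 h2; rewrite pmulr_lge0// h0.
have F0 x : 0 < x -> 0 <= F x by move=> x0; rewrite mulr_ge0 ?sqr_ge0// invr_ge0 ltW// h0.
have hF x : 0 < x -> h x * F x = G x ^+ 2 by move=> x0; rewrite /F mulrC divfK// gt_eqF// h0.
have mF : measurable_fun (@pos R) F.
  apply: measurable_funM; first exact: measurable_funX.
  apply: (meas_ext (f := fun x => h x `^ (-1))).
    by move=> x x0; rewrite powR_N ?powR_one ?h0.
  exact: measurableT_comp (measurable_powR _) mh_.
have iF : RI (@pos R) (fun x => h x * F x) by apply: RI_ext iG => x x0; rewrite hF.
have KE : Rint (@pos R) (fun x => h x * F x) = Rint (@pos R) (fun x => G x ^+ 2).
  by apply: Rint_ext => x x0; rewrite hF.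
set K := Rint (@pos R) (fun x => G x ^+ 2) in KE *.
have E1 f := fun x => erefl (Rint (@D0 R x) f); have E2 f := fun x => erefl (Rint (@Doo R x) f).
have iaF := schur_RI0 ma_ a0 b0 h0 ibh S2 (E2 _) mF F0 iF.
have ibF := schur_RIoo mb_ a0 b0 h0 iah S1 (E1 _) mF F0 iF.
have [l1 l2] := schur_left ma_ mb_ mh_ a0 b0 h0 ibh S2 (E2 _) mF F0 iF KE (E1 _).
have [r1 r2] := schur_right ma_ mb_ mh_ a0 b0 h0 iah ibh S1 S2 (E1 _) (E2 _) mF F0 iF KE (E2 _).
have mD0 := ep_meas (endpoint0 R); have mDoo := ep_meas (endpointoo R).
have cs (D : set R) (c : R -> R) : measurable D -> D `<=` @pos R -> (forall x, 0 < x -> 0 < c x) ->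
    measurable_fun (@pos R) c ->
    RI D (fun y => c y * h y) -> RI D (fun y => c y * F y) ->
    RI D (fun y => c y * G y) /\
    Rint D (fun y => c y * G y) ^+ 2 <= Rint D (fun y => c y * h y) * Rint D (fun y => c y * F y).
  move=> mD Dp c0 mc i1 i2; apply: cauchy_schwarz => //.
  - by apply: measurable_funS (measurable_funM mc mG) => //; exact: pos_meas.
  - by move=> x /Dp x0; have cx := ltW (c0 x x0); split; apply: mulr_ge0 => //; [exact: ltW (h0 x0)|exact: F0].
  - by move=> x /Dp x0; rewrite mulrACA exprMn -expr2 hF.
have cs1 x : 0 < x -> _ := fun x0 => cs _ _ (mD0 x) (ep_pos (endpoint0 R) x0) a0 ma_ (iah x0) (iaF x x0).
have cs2 x : 0 < x -> _ := fun x0 => cs _ _ (mDoo x) (ep_pos (endpointoo R) x0) b0 mb_ (ibh x0) (ibF x x0).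
have iaG x (x0 : 0 < x) := (cs1 x x0).1; have ibG x (x0 : 0 < x) := (cs2 x x0).1.
set U := fun x => b x * h x * Rint (D0 x) (fun y => a y * F y) in l1 l2.
set V := fun x => a x * h x * Rint (Doo x) (fun y => b y * F y) in r1 r2.
have mT : measurable_fun (@pos R) (fun x => schurT G x ^+ 2).
  apply: measurable_funX; apply: measurable_funD; apply: measurable_funM => //.
    have p := ep_prim (endpoint0 R) (measurable_funM ma_ mG) iaG.
    by apply: meas_ext (rprim_meas p) => x _; rewrite mul1r.
  have p := rprim_meas (rprimZ (-1) (ep_prim (endpointoo R) (measurable_funM mb_ mG) ibG)).
  by apply: meas_ext p => x _; rewrite mulrA mulrNN !mul1r.
have bd x : 0 < x -> schurT G x ^+ 2 <= 2 * C * (U x + V x).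
  move=> x0; have [_ c1] := cs1 x x0; have [_ c2] := cs2 x x0.
  have aF0 : 0 <= Rint (D0 x) (fun y => a y * F y).
    by apply: Rint_ge0 => y /D0P[y0 _]; rewrite mulr_ge0 ?F0// ltW ?a0.
  have bF0 : 0 <= Rint (Doo x) (fun y => b y * F y).
    by apply: Rint_ge0 => y /DooP xy; have y0 := lt_le_trans x0 xy; rewrite mulr_ge0 ?F0// ltW ?b0.
  have half c I1 I2 I3 : 0 < c -> I1 ^+ 2 <= I2 * I3 -> c * I2 <= C * h x -> 0 <= I3 ->
      (c * I1) ^+ 2 <= C * (c * h x * I3).
    move=> c0 q1 q2 q3; rewrite exprMn expr2 -mulrA.
    apply: (@le_trans _ _ (c * (c * (I2 * I3)))); first by rewrite !ler_wpM2l ?(ltW c0).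
    rewrite (_ : C * _ = c * ((C * h x) * I3)); last by ring.
    by rewrite ler_wpM2l ?(ltW c0)// mulrA ler_wpM2r.
  have := half _ _ _ _ (b0 x0) c1 (S1 x0) aF0; have := half _ _ _ _ (a0 x0) c2 (S2 x0) bF0.
  rewrite /schurT /U /V; move: (b x * Rint _ _) (a x * Rint _ _) (b x * h x * _) (a x * h x * _) => p q u v.
  by have := sqr_ge0 (p - q); nra.
have iUV : RI (@pos R) (fun x => 2 * C * (U x + V x)).
  by apply: RI_Z; [exact: pos_meas|apply: RI_D => //; exact: pos_meas].
have iT : RI (@pos R) (fun x => schurT G x ^+ 2).
  by apply: RI_le iUV => //; [exact: pos_meas|move=> x x0; rewrite ger0_norm ?sqr_ge0 ?bd].
split => //.
apply: (@le_trans _ _ (Rint (@pos R) (fun x => 2 * C * (U x + V x)))).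
  by apply: Rint_le => //; exact: pos_meas.
rewrite RintZ; [|exact: pos_meas|by apply: RI_D => //; exact: pos_meas].
rewrite RintD//; last exact: pos_meas.
rewrite (_ : 4 * C ^+ 2 * K = 2 * C * (C * K + C * K)); last by ring.
by apply: ler_wpM2l; [rewrite mulr_ge0|apply: lerD].
Qed.

End SchurTest.

(** * Schur conditions for power and exponential profiles *)

Section Profile.
Variable R : realType.
Implicit Types (x y p c : R).

Definition pw p c x := if x <= 1 then x `^ p else expR (c * x).

Lemma pw_gt0 p c x : 0 < x -> 0 < pw p c x.
Proof. by move=> x0; rewrite /pw; case: ifP => _; rewrite ?powR_pos ?expR_gt0. Qed.

Lemma pw_meas p c : measurable_fun (@pos R) (pw p c).
Proof.
apply: measurable_fun_if; first exact: pos_meas.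
- by apply: measurable_fun_ler => //; exact: measurable_cst.
- exact: measurable_funS (@pos_meas R) (fun x h => proj1 h) (powR_meas p).
- exact: measurable_funS (@pos_meas R) (fun x h => proj1 h) (rprim_meas (rprim_expR (rprimZ c (@rprim_id R)))).
Qed.

Variables (pa pb al k : R).
Hypotheses (k0 : 0 < k) (ca : 0 < pa + al + 1) (cb : pb + al + 1 < 0) (pab : 0 <= pa + pb + 1).

Local Notation a := (pw pa k).
Local Notation b := (pw pb (- k)).
Local Notation h := (pw al 0).

Let h1 x : 1 < x -> h x = 1.
Proof. by move=> x1; rewrite /pw leNgt x1 /= mul0r expR0. Qed.
Let a1 x : 1 < x -> a x = expR (k * x).
Proof. by move=> x1; rewrite /pw leNgt x1. Qed.
Let b1 x : 1 < x -> b x = expR (- k * x).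
Proof. by move=> x1; rewrite /pw leNgt x1. Qed.
Let ah0 x : 0 < x -> x <= 1 -> a x * h x = x `^ (pa + al).
Proof. by move=> x0 x1; rewrite /pw x1 -powR_add. Qed.
Let bh0 x : 0 < x -> x <= 1 -> b x * h x = x `^ (pb + al).
Proof. by move=> x0 x1; rewrite /pw x1 -powR_add. Qed.

Let mah : measurable_fun (@pos R) (fun y => a y * h y).
Proof. by apply: measurable_funM; exact: pw_meas. Qed.
Let mbh : measurable_fun (@pos R) (fun y => b y * h y).
Proof. by apply: measurable_funM; exact: pw_meas. Qed.

Let mD0 := ep_meas (endpoint0 R).
Let mDoo := ep_meas (endpointoo R).
Let ca' : -1 < pa + al. Proof. by have := ca; lra. Qed.

Lemma pw_RI0 x : 0 < x -> RI (D0 x) (fun y => a y * h y).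
Proof.
move=> x0; have [i1 _] := RI_powR0 x0 ca'; have [i0 _] := RI_powR0 x0 (@ltrN10 R).
apply: RI_le (RI_D (mD0 x) i1 (RI_Z (expR (k * x)) (mD0 x) i0)) => //.
  exact: (ep_meas_sub (endpoint0 R)).
move=> y /D0P[y0 yx]; rewrite ger0_norm; last by rewrite mulr_ge0// ltW// pw_gt0.
have [y1|y1] := leP y 1; first by rewrite ah0// lerDl mulr_ge0 ?expR_ge0 ?powR_ge0.
rewrite a1// h1// mulr1 powRr0 mulr1 -[leLHS]add0r lerD ?powR_ge0// ler_expR ler_wpM2l//.
exact: ltW.
Qed.

Lemma pw_RIoo x : 0 < x -> RI (Doo x) (fun y => b y * h y).
Proof.
move=> x0; have [i1 _] := expR_neg_int k0 x0.
apply: RI_le (RI_Z (expR k * x `^ (pb + al) + 1) (mDoo x) i1) => //.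
  exact: (ep_meas_sub (endpointoo R)).
move=> y /DooP xy; have y0 := lt_le_trans x0 xy.
rewrite ger0_norm; last by rewrite mulr_ge0// ltW// pw_gt0.
have [y1|y1] := leP y 1.
  rewrite bh0// mulrDl mul1r -[leLHS]addr0 lerD ?expR_ge0// mulrAC -expRD.
  apply: (@le_trans _ _ (x `^ (pb + al))); first by apply: powR_base_neg => //; have := cb; lra.
  rewrite ler_peMl ?powR_ge0// -expR0 ler_expR mulNr subr_ge0 ler_piMr// ltW//.
by rewrite b1// h1// mulr1 mulrDl mul1r lerDr !mulr_ge0 ?expR_ge0 ?powR_ge0.
Qed.

Definition pwC := (pa + al + 1)^-1 + k^-1 - (pb + al + 1)^-1.

Let ia0 : 0 <= (pa + al + 1)^-1. Proof. by rewrite invr_ge0 ltW. Qed.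
Let ib0 : 0 <= - (pb + al + 1)^-1. Proof. by rewrite oppr_ge0 invr_le0 ltW. Qed.
Let ik0 : 0 <= k^-1. Proof. by rewrite invr_ge0 ltW. Qed.

(** On ]0, 1] the left side is at most a constant times x^(pa + pb + 1) x^al, and [pab] bounds the
    first power by 1; beyond 1 the exponentials of [a] and [b] cancel. *)
Lemma pw_S1 x : 0 < x -> b x * Rint (D0 x) (fun y => a y * h y) <= pwC * h x.
Proof.
move=> x0.
have le1 t : 0 < t -> t <= 1 -> Rint (D0 t) (fun y => a y * h y) <= t `^ (pa + al + 1) / (pa + al + 1).
  move=> t0 t1; have [i1 i2] := RI_powR0 t0 ca'; apply: le_trans i2.
  rewrite le_eqVlt; apply/orP; left; apply/eqP; apply: Rint_ext => y /D0P[y0 yt].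
  by rewrite ah0// (le_trans yt).
have hx := pw_gt0 al 0 x0; have [x1|x1] := leP x 1.
  apply: (@le_trans _ _ (x `^ pb * (x `^ (pa + al + 1) / (pa + al + 1)))).
    by rewrite {1}/pw x1 ler_wpM2l ?powR_ge0// le1.
  rewrite mulrA -powR_add// (_ : pb + (pa + al + 1) = (pa + pb + 1) + al); last by ring.
  rewrite powR_add// {1}/pw x1.
  have := powR_anti x0 x1 pab; rewrite powRr0.
  rewrite /pwC; have := powR_ge0 x al; have := ia0; have := ib0; have := ik0; have := powR_ge0 x (pa + pb + 1).
  move: (x `^ al) (x `^ (pa + pb + 1)) (pa + al + 1)^-1 (k^-1) (- (pb + al + 1)^-1) => A B i j l.
  move=> B0 j0 l0 i0 A0 B1; rewrite mulrAC ler_wpM2r//.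
  by apply: (@le_trans _ _ i); [rewrite ler_piMl|lra].
have p := ep_prim (endpoint0 R) mah pw_RI0.
have [i e] := p.2 1 x ltr01 (ltW x1); rewrite !mul1r in e.
have e1 : Rint (D0 x) (fun y => a y * h y) <= (pa + al + 1)^-1 + expR (k * x) / k.
  rewrite -[leLHS](subrK (Rint (D0 1) (fun y => a y * h y))) e addrC; apply: lerD.
    by have := le1 1 ltr01 (lexx 1); rewrite powR1 mul1r.
  have q := rprimZ k^-1 (rprim_expR (rprimZ k (@rprim_id R))).
  have [qi qe] := q.2 1 x ltr01 (ltW x1).
  apply: (@le_trans _ _ (k^-1 * expR (k * x) - k^-1 * expR (k * 1))); last first.
    by rewrite mulrC gerBl mulr_ge0 ?expR_ge0.
  rewrite qe; apply: Rint_le => // y; rewrite /= in_itv /= => /andP[y1 _].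
  rewrite mulr1 mulrA mulVf ?gt_eqF// mul1r.
  have [y1'|y1'] := leP y 1; last by rewrite a1// h1// mulr1.
  have -> : y = 1 by apply/eqP; rewrite eq_le y1 y1'.
  by rewrite ah0// powR1 mulr1 -expR0 ler_expR ltW.
rewrite b1// h1// mulr1; apply: (le_trans (ler_wpM2l (expR_ge0 _) e1)).
rewrite mulrDr mulrA mulNr expRN mulVf ?gt_eqF ?expR_gt0// mul1r /pwC.
have : (expR (k * x))^-1 <= 1.
  by rewrite invf_le1 ?expR_gt0// -expR0 ler_expR mulr_ge0// ltW.
have := ia0; have := ib0; move: (expR _)^-1 (pa + al + 1)^-1 (k^-1) (- (pb + al + 1)^-1) => E i' j l l0 i0 E1.
have : E * i' <= i' by rewrite ler_piMl.
lra.
Qed.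

(** For x <= 1 the integral has a power part and a constant tail from beyond 1; the tail, multiplied
    by x^pa, is controlled because [cb] and [pab] imply al <= pa. *)
Lemma pw_S2 x : 0 < x -> a x * Rint (Doo x) (fun y => b y * h y) <= pwC * h x.
Proof.
move=> x0.
have le1 : Rint (Doo 1) (fun y => b y * h y) <= k^-1.
  have [i1 i2] := expR_neg_int k0 (@ltr01 R).
  apply: (@le_trans _ _ (expR k * Rint (Doo 1) (fun y => expR (- k * y)))); last first.
    apply: (le_trans (ler_wpM2l (expR_ge0 _) i2)).
    by rewrite mulr1 mulrA -expRD subrr expR0 mul1r.
  rewrite -RintZ//; apply: Rint_le => //; [exact: pw_RIoo|exact: RI_Z|].
  move=> y /DooP y1; rewrite -expRD -[X in expR (X + _)]mulr1 mulNr -mulrBr.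
  have [y1'|y1'] := leP y 1.
    have -> : y = 1 by apply/eqP; rewrite eq_le y1 y1'.
    by rewrite bh0// powR1 subrr mulr0 expR0.
  by rewrite b1// h1// mulr1 ler_expR mulNr -mulrN ler_wpM2l ?ltW//; lra.
have hx := pw_gt0 al 0 x0; have [x1|x1] := leP x 1; last first.
  have [i1 i2] := expR_neg_int k0 x0.
  rewrite a1// h1// mulr1; apply: (@le_trans _ _ (expR (k * x) * (expR (- k * x) / k))).
    rewrite ler_wpM2l ?expR_ge0//; apply: le_trans i2; rewrite le_eqVlt; apply/orP; left; apply/eqP.
    by apply: Rint_ext => y /DooP xy; have y1 := lt_le_trans x1 xy; rewrite b1// h1// mulr1.
  rewrite mulrA -expRD mulNr subrr expR0 mul1r /pwC; have := ia0; have := ib0; lra.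
have p := ep_prim (endpointoo R) mbh pw_RIoo.
have [i e] := p.2 x 1 x0 x1; rewrite !mulN1r in e.
have cb0 : pb + al + 1 != 0 by rewrite lt_eqF.
have e2 : Rint `[x, 1] (fun y => b y * h y) <= x `^ (pb + al + 1) * - (pb + al + 1)^-1.
  rewrite (_ : Rint _ _ = Rint `[x, 1] (fun y => y `^ (pb + al))).
    rewrite Rint_powR// powR1 mulrBl mul1r mulrN; have := ib0; lra.
  by apply: Rint_ext => y; rewrite /= in_itv /= => /andP[xy y1]; rewrite bh0// (lt_le_trans x0).
have e1 : Rint (Doo x) (fun y => b y * h y) <= x `^ (pb + al + 1) * - (pb + al + 1)^-1 + k^-1.
  by move: e e2 le1; lra.
have paal : al <= pa by have := cb; have := pab; lra.
rewrite /pw x1; apply: (le_trans (ler_wpM2l (powR_ge0 _ _) e1)).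
rewrite mulrDr mulrA -powR_add// (_ : pa + (pb + al + 1) = (pa + pb + 1) + al); last by ring.
rewrite powR_add//.
have := powR_anti x0 x1 pab; rewrite powRr0; have := powR_anti x0 x1 paal.
rewrite /pwC; have := powR_ge0 x al; have := ia0; have := ib0; have := ik0; have := powR_ge0 x (pa + pb + 1).
move: (x `^ al) (x `^ pa) (x `^ (pa + pb + 1)) (pa + al + 1)^-1 (k^-1) (- (pb + al + 1)^-1) => A D B i' j l.
move=> B0 j0 l0 i0 A0 DA B1.
have q1 : B * A * l <= A * l by rewrite ler_wpM2r// ler_piMl.
have q2 : D * j <= A * j by rewrite ler_wpM2r.
by have := mulr_ge0 i0 A0; nra.
Qed.

End Profile.

(** * Wronskian, uniqueness and the resolvent *)

Section Uniqueness.
Variable R : realType.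
Local Notation mu := (@lebesgue_measure R).

Lemma L2P (f : R -> CC R) : L2 f <-> cmeas (@pos R) f /\ RI (@pos R) (fun x => cmod (f x) ^+ 2).
Proof.
split=> -[mf h]; split => //.
  apply: RI_ge0 => //; first by apply: measurable_funX; exact: cmeas_mod.
  by move=> x _; exact: sqr_ge0.
by rewrite RI_fin ?ltry//; exact: pos_meas.
Qed.

Lemma cvg0P (h : R -> CC R) : h x @[x --> 0^'+] --> (0 : CC R) <->
  forall e : R, 0 < e -> exists2 d : R, 0 < d & forall x, 0 < x -> x < d -> cmod (h x) < e.
Proof.
split=> [/cvgr0Pnorm_lt H e e0|H].
  have e0' : (0 : R[i]) < (cR e : R[i]) by rewrite ltcR.
  have [d /= d0 hd] := H _ e0'; exists d => // x x0 xd.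
  have := hd x; rewrite /= sub0r normrN gtr0_norm// => /(_ xd x0).
  by rewrite cmod_norm ltcR.
apply/cvgr0Pnorm_lt => -[a b]; rewrite ltcE /= => /andP[/eqP b0 a0].
have [d d0 hd] := H a a0; exists d => //= x; rewrite /= sub0r normrN => xd x0.
by rewrite cmod_norm ltcE /= b0 eqxx hd// (le_lt_trans (ler_norm _) xd).
Qed.

Lemma rprim_ae (F f g : R -> R) : rprim F f -> measurable_fun (@pos R) g ->
  {ae mu, forall x, pos x -> f x = g x} -> rprim F g.
Proof.
move=> [mf H] mg fg; split => // a b a0 ab; have [i e] := H a b a0 ab.
have ip := itv_pos a0 (b := b).
have mg' : measurable_fun `[a, b] g by apply: measurable_funS mg => //; exact: pos_meas.
have ae : {ae mu, forall x, `[a, b]%classic x -> f x = g x} by apply: aeS fg => x h /ip/h.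
by have [i' <-] := RI_ae (measurable_itv _) mg' ae i.
Qed.

Lemma RI_sqr_itv (f : R -> R) x : measurable_fun (@pos R) f -> RI (@pos R) (fun y => f y ^+ 2) -> 0 < x ->
  RI `[x, x + 1] (fun y => `|f y|) /\ Rint `[x, x + 1] (fun y => `|f y|) <= 1 + Rint (@pos R) (fun y => f y ^+ 2).
Proof.
move=> mf fi x0; have ip := itv_pos x0 (b := x + 1).
have i2 : RI `[x, x + 1] (fun y => f y ^+ 2) by apply: RI_sub fi => //; exact: pos_meas.
have i3 := RI_D (measurable_itv _) (RI_cst x (x + 1) 1) i2.
have le y : `|f y| <= 1 + f y ^+ 2.
  by rewrite -(real_normK (num_real (f y))); have := normr_ge0 (f y); have := sqr_ge0 (`|f y| - 1); nra.
have i1 : RI `[x, x + 1] (fun y => `|f y|).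
  apply: RI_le i3 => //; last by move=> y _; rewrite normr_id le.
  by apply: measurableT_comp => //; apply: measurable_funS mf => //; exact: pos_meas.
split => //; apply: (le_trans (Rint_le (measurable_itv _) i1 i3 (fun y _ => le y))).
rewrite RintD//; last exact: RI_cst.
rewrite Rint_cst; last lra.
rewrite (_ : 1 * (x + 1 - x) = 1); last by ring.
rewrite lerD2l; apply: Rint_sub_le => //; [exact: pos_meas|by move=> y _; exact: sqr_ge0].
Qed.

End Uniqueness.

(** * The Wronskian with a decaying solution *)

Section Decay.
Variables (R : realType) (k : R).
Hypothesis kp : 0 < k.

Lemma exp_small (C e : R) : 0 < e -> exists2 x : R, 1 <= x & C * expR (- k * x) < e.
Proof.
move=> e0; pose x := 1 + `|C| / (k * e).
have x1 : 1 <= x by rewrite lerDl divr_ge0// mulr_ge0 ?(ltW kp) ?(ltW e0).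
exists x => //; rewrite mulNr expRN ltr_pdivrMr ?expR_gt0//.
have kx : k * x = k + `|C| / e by rewrite /x mulrDr mulr1; congr (_ + _); field; rewrite !gt_eqF.
have h1 : 1 + k * x <= expR (k * x) := expR_ge1Dx _.
apply: (@lt_le_trans _ _ (e * (1 + k * x))); last by rewrite ler_wpM2l// ltW.
rewrite kx (_ : e * _ = e + e * k + `|C|); last by field; rewrite gt_eqF.
have := ler_norm C; have := mulr_gt0 e0 kp; lra.
Qed.

(* Integrating [W(f, v)] against a bump [t] that vanishes at the ends removes
   [f'], of which nothing is known at infinity. *)
Lemma wr_decay_eq0 (V v v1 f f1 : R -> CC R) (C x : R) : prim v v1 -> prim v1 (fun x => V x * v x) ->
  0 <= C -> (forall x, 1 <= x -> cmod (v x) <= C * expR (- k * x) /\ cmod (v1 x) <= C * expR (- k * x)) ->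
  prim f f1 -> prim f1 (fun x => V x * f x) ->
  RI (@pos R) (fun x => cmod (f x) ^+ 2) -> 0 < x -> wr f f1 v v1 x = 0.
Proof.
move=> pv pv1 C0 hC pf pf1 fi x0.
set c0 := wr f f1 v v1 1.
have W x' : 0 < x' -> wr f f1 v v1 x' = c0 by move=> x0'; apply: wr_const pf pf1 pv pv1 x0' ltr01.
rewrite W//; apply: cmod_eq0; apply/eqP; rewrite eq_le cmod_ge0 andbT.
set K := 1 + Rint (@pos R) (fun x => cmod (f x) ^+ 2).
apply/ler_addgt0Pl => e e0; rewrite addr0.
(* 18 = 6 * 3: the bump has integral 1/6, and |2 t| + |t'| <= 3 on its support. *)
have [s s1 hs] := exp_small (18 * C * K) e0.
have s0 := lt_le_trans ltr01 s1; have ss : s <= s + 1 by lra.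
pose t := fun y : R => (y - s) * (s + 1 - y).
pose t1 := fun y : R => 2 * s + 1 - 2 * y.
have pt : rprim t t1.
  have h := rprimM (rprimD (@rprim_id R) (rprim_cst (- s))) (rprimD (rprim_cst (s + 1)) (rprimZ (-1) (@rprim_id R))).
  apply: rprim_ext h _ _ => y y0; rewrite /t /t1; first by ring.
  by ring.
have pT := prim_R pt.
have p3 := primM pT (primM pf pv).
have [i3 e3] := prim_int p3 s0 ss.
have ts0 : t s = 0 by rewrite /t subrr mul0r.
have ts1 : t (s + 1) = 0 by rewrite /t subrr mulr0.
have e0' : cR (0 : R) = 0 by [].
rewrite ts0 ts1 e0' mul0r mul0r subrr in e3.
have itvP y : `[s, s + 1]%classic y -> s <= y /\ y <= s + 1 by rewrite /= in_itv /= => /andP[].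
have [mfi mfle] := RI_sqr_itv (cmeas_mod (prim_measF pf)) fi s0.
have bt y : `[s, s + 1]%classic y -> `|t y| <= 1 /\ `|t1 y| <= 1.
  move=> /itvP[h1 h2]; rewrite /t /t1 !ler_norml; split; apply/andP; split; nra.
have ip := itv_pos s0 (b := s + 1).
have mI g : cmeas (@pos R) g -> cmeas `[s, s + 1] g.
  by apply: cmeas_sub => //; exact: pos_meas.
have ek : forall y, s <= y -> expR (- k * y) <= expR (- k * s).
  by move=> y sy; rewrite ler_expR !mulNr lerN2 ler_wpM2l// ltW.
have bv y : `[s, s + 1]%classic y -> cmod (v y) <= C * expR (- k * s) /\ cmod (v1 y) <= C * expR (- k * s).
  move=> /itvP[h1 _]; have [b1 b2] := hC y (le_trans s1 h1); have := ek y h1.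
  by split; [apply: (le_trans b1)|apply: (le_trans b2)]; rewrite ler_wpM2l.
pose g y := cR (2 * t y) * (f y * v1 y) + cR (t1 y) * (f y * v y).
have mg : cmeas (@pos R) g.
  apply: cmeasD; apply: cmeasM.
  - by apply: cmeas_R; apply: measurable_funM; [exact: measurable_cst|exact: rprim_meas pt].
  - by apply: cmeasM; [exact: prim_measF pf|exact: prim_meas pv].
  - by apply: cmeas_R; exact: pt.1.
  - by apply: cmeasM; [exact: prim_measF pf|exact: prim_measF pv].
have gle y : `[s, s + 1]%classic y -> cmod (g y) <= (3 * C * expR (- k * s)) * `|cmod (f y)|.
  move=> yI; have [b1 b2] := bt y yI; have [b3 b4] := bv y yI.
  apply: (le_trans (cmodD _ _)); rewrite !cmodM !cmod_cR normrM (ger0_norm (ler0n _ 2)) (ger0_norm (cmod_ge0 _)).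
  have f0 := cmod_ge0 (f y); set E := expR _ in b3 b4 *.
  have E0 : 0 <= C * E by rewrite mulr_ge0 ?expR_ge0.
  have q1 : `|t y| * (cmod (f y) * cmod (v1 y)) <= cmod (f y) * (C * E).
    rewrite -[leRHS]mul1r; apply: ler_pM; rewrite ?mulr_ge0 ?cmod_ge0//.
    by rewrite ler_wpM2l.
  have q2 : `|t1 y| * (cmod (f y) * cmod (v y)) <= cmod (f y) * (C * E).
    rewrite -[leRHS]mul1r; apply: ler_pM; rewrite ?mulr_ge0 ?cmod_ge0//.
    by rewrite ler_wpM2l.
  rewrite -(mulrA 2) (_ : 3 * C * E * cmod (f y) = 3 * (cmod (f y) * (C * E))); last by ring.
  by move: q1 q2; move: (`|t y| * _) (`|t1 y| * _) (cmod _ * (C * E)) => a b c; lra.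
have gi : CI `[s, s + 1] g.
  by apply: (CI_le (measurable_itv _) (mI _ mg) gle); exact: RI_Z.
have e4 : cint `[s, s + 1] g = cint `[s, s + 1] (fun y => c0 * cR (t y)).
  have it : CI `[s, s + 1] (fun y => c0 * cR (t y)).
    apply: CI_le (RI_cst s (s + 1) (cmod c0)) => //.
      by apply: mI; apply: cmeasZ; exact: prim_measF pT.
    by move=> y /bt[b1 _]; rewrite cmodM cmod_cR ler_piMr ?cmod_ge0.
  apply/eqP; rewrite -subr_eq0 -cintB//; apply/eqP; rewrite [RHS]e3; apply: cint_ext => y yI.
  rewrite -(W y (ip y yI)) /wr /g cRM cR_nat; ring.
have pt3 : rprim (fun y => - (y ^+ 3) / 3 + (2 * s + 1) / 2 * y ^+ 2 - s * (s + 1) * y) t.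
  have px2 := rprimM (@rprim_id R) (@rprim_id R); have px3 := rprimM px2 (@rprim_id R).
  have h := rprimD (rprimD (rprimZ (- 3^-1) px3) (rprimZ ((2 * s + 1) / 2) px2)) (rprimZ (- (s * (s + 1))) (@rprim_id R)).
  apply: rprim_ext h _ _ => y y0 /=; first by field.
  by rewrite /t; field.
have [_ e5] := pt3.2 s (s + 1) s0 ss.
have e6 : cint `[s, s + 1] (fun y => c0 * cR (t y)) = c0 * cR 6^-1.
  have it : CI `[s, s + 1] (fun y => cR (t y)).
    apply: CI_le (RI_cst s (s + 1) 1) => //; first by apply: mI; exact: prim_measF pT.
    by move=> y /bt[b1 _]; rewrite cmod_cR.
  rewrite cintZ//; congr (_ * _); apply: CCP; rewrite /cint !cE.
    by rewrite -e5; field.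
  by rewrite (_ : Rint _ _ = Rint `[s, s + 1] (fun=> 0))// Rint_cst// mul0r.
have e7 : cmod c0 = 6 * cmod (cint `[s, s + 1] g).
  by rewrite e4 e6 cmodM cmod_cR gtr0_norm ?invr_gt0//; field.
rewrite e7; apply: ltW; apply: le_lt_trans hs.
have := cint_le (measurable_itv _) gi (RI_Z _ (measurable_itv _) mfi) gle.
rewrite RintZ//; set E := expR _ => h.
have E0 : 0 <= C * E by rewrite mulr_ge0 ?expR_ge0.
have := mfle; rewrite -/K; move: (Rint `[s, s + 1] _) h => I h IK.
have : 3 * C * E * I <= 3 * C * E * K by rewrite ler_wpM2l// -mulrA mulr_ge0.
move: (cmod _) h => a h h'; lra.
Qed.

End Decay.

Lemma D0_small (R : realType) (f : R -> R) (C e : R) : (forall x, 0 < x -> RI (D0 x) f) ->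
  (forall x, 0 < x -> 0 <= f x) -> 0 <= C -> 0 < e ->
  exists d : R, [/\ 0 < d, d <= 1 & forall x, 0 < x -> x <= d -> C * Rint (D0 x) f < e].
Proof.
move=> fi f0 C0 e0; have e1 : 0 < e / (C + 1) by rewrite divr_gt0// ltr_wpDl.
have [x x0 h] := ep_vanish (endpoint0 R) fi e1.
exists (Num.min x 1); split; [by rewrite lt_min x0 ltr01|by rewrite ge_min lexx orbT|].
move=> y y0; rewrite le_min => /andP[yx _].
have h1 : Rint (D0 y) f < e / (C + 1).
  apply: le_lt_trans (le_lt_trans (ler_norm _) h); apply: Rint_sub_le.
  - exact: (ep_meas (endpoint0 R)).
  - exact: (ep_meas (endpoint0 R)).
  - by move=> t /D0P[t0 ty]; rewrite /D0 /= in_itv /= t0 (le_trans ty).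
  - by move=> t /D0P[t0 _]; exact: f0.
  - exact: fi.
have I0 : 0 <= Rint (D0 y) f by apply: Rint_ge0 => t /D0P[t0 _]; exact: f0.
apply: (@le_lt_trans _ _ ((C + 1) * Rint (D0 y) f)); first by rewrite ler_wpM2r// lerDl.
by rewrite mulrC -ltr_pdivlMr// ltr_wpDl.
Qed.

(** * Homogeneous solutions and the boundary condition *)

Section HomogeneousSolutions.
Variable R : realType.
Variables (M : set (CC R)) (Q : R -> CC R) (pk : kpack M Q) (k : R).
Hypotheses (k0 : 2^-1 <= k) (mQ : cmeas (@pos R) Q)
  (iQ : forall x, 0 < x -> RI (Doo x) (fun y => cmod (Q y))).

Let bd := kbd pk.
Let Mbd : forall z, M z -> cmod z <= bd := kp_bd pk.
Let kp : 0 < k. Proof. by apply: lt_le_trans k0; rewrite invr_gt0. Qed.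

Variable z : CC R.
Hypothesis Mz : M z.

Local Notation u := (us pk k z).
Local Notation u1 := (us1 pk k z).
Local Notation v := (vs Q k bd z).
Local Notation v1 := (vs1 Q k bd z).

Definition Wr : CC R := wr u u1 v v1 1.

Let pu := us_prim pk k mQ Mz.
Let pv := vs_prim k0 mQ iQ Mbd Mz.

Lemma WrE x : 0 < x -> wr u u1 v v1 x = Wr.
Proof. by move=> x0; apply: wr_const pu.1 pu.2 pv.1 pv.2 x0 ltr01. Qed.

Lemma vs_decay : exists2 C : R, 0 <= C & forall x, 1 <= x ->
  cmod (v x) <= C * expR (- k * x) /\ cmod (v1 x) <= C * expR (- k * x).
Proof.
set A := vA Q bd 1; have A0 : 0 <= A := vA_ge0 Q bd ltr01.
set J := Rint (Doo 1) (vw Q bd).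
have J0 : 0 <= J.
  by apply: Rint_ge0 => y /DooP y1; apply: vw_ge0; exact: lt_le_trans y1.
have kA0 : 0 <= k * A by rewrite mulr_ge0// ltW.
exists (A + A * J + k * A); first by rewrite !addr_ge0// mulr_ge0.
move=> x x1; have x0 := lt_le_trans ltr01 x1.
have e0 := expR_ge0 (- k * x).
have hv : cmod (v x) <= A * expR (- k * x).
  rewrite cmodM cmod_cR ger0_norm// mulrC ler_wpM2r//.
  exact: (vchi_le k0 mQ iQ Mbd Mz ltr01 x1).
split.
  by apply: (le_trans hv); rewrite ler_wpM2r// -addrA lerDl addr_ge0// mulr_ge0.
apply: (le_trans (cmodB _ _)); rewrite [X in _ + X]cmodM cmod_cR (gtr0_norm kp).
rewrite !mulrDl -addrA; apply: (@le_trans _ _ (0 + (A * J * expR (- k * x) + k * A * expR (- k * x)))); last first.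
  by rewrite lerD2r mulr_ge0.
rewrite add0r; apply: lerD; last by rewrite -mulrA ler_wpM2l// ltW.
rewrite cmodM cmod_cR ger0_norm ?expR_ge0// mulNr expRN ler_pdivlMr ?expR_gt0//.
rewrite mulrAC -expRD (_ : k * x + k * x = 2 * k * x); last by ring.
apply: (le_trans (veta_le k0 mQ iQ Mbd Mz ltr01 x1)); rewrite ler_wpM2l//.
apply: Rint_sub_le.
- exact: (ep_meas (endpointoo R)).
- exact: (ep_meas (endpointoo R)).
- by move=> y /DooP xy; rewrite /Doo /= in_itv /= (le_trans x1 xy).
- by move=> y /DooP y1; apply: vw_ge0; exact: lt_le_trans y1.
- exact: vw_RI.
Qed.

Lemma wr_v_eq0 f f1 x : prim f f1 -> prim f1 (fun x => potV k Q z x * f x) ->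
  RI (@pos R) (fun x => cmod (f x) ^+ 2) -> 0 < x -> wr f f1 v v1 x = 0.
Proof.
by move=> pf pf1 fi; have [C C0 hC] := vs_decay; exact: (wr_decay_eq0 kp pv.1 pv.2 C0 hC).
Qed.

Lemma uw_small (C e : R) : 0 <= C -> 0 < e ->
  exists d : R, [/\ 0 < d, d <= 1 & forall x, 0 < x -> x <= d -> C * Rint (D0 x) (uw pk k) < e].
Proof.
by move=> C0 e0; apply: D0_small => // x x0; [exact: uw_RI|exact: uw_ge0].
Qed.

Lemma wr_u_red f f1 x : 0 < x ->
  wr u u1 f f1 x = uphi pk k z x * redpsi z f f1 x - upsi pk k z x * redphi z f x.
Proof. by move=> x0; rewrite /wr /us1 /us /redpsi /redphi; ring. Qed.

Lemma hom_kg f f1 : prim f f1 -> prim f1 (fun x => potV k Q z x * f x) ->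
  exists a C : R, [/\ 0 < a, a <= 1, 0 <= C & forall x, 0 < x -> x <= a -> cmod (redphi z f x) <= C * kg pk z x].
Proof.
move=> pf pf1; have [a [a0 a1 ha]] := near0_scale pk k mQ.
exists a, (2 * (cmod (redphi z f a) + kc pk 1 * cmod (redpsi z f f1 a))); split => //.
  by rewrite mulr_ge0// addr_ge0 ?cmod_ge0// mulr_ge0 ?cmod_ge0// (le_trans ler01)// kc_ge1.
by move=> x x0 xa; exact: (hom_near0 mQ a0 a1 ha Mz pf pf1 x0 xa).
Qed.

(** In reduced form W(u, f) = phi_u psi_f - psi_u phi_f. At 0 the first product vanishes as phi_u is
    bounded; in the second, phi_f may grow like [kg], but psi_u kg tends to 0. The Wronskian being
    constant, it is zero. *)
Lemma wr_u_eq0 f f1 x : prim f f1 -> prim f1 (fun x => potV k Q z x * f x) ->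
  (forall e : R, 0 < e -> exists2 d : R, 0 < d & forall x, 0 < x -> x < d -> cmod (redpsi z f f1 x) < e) ->
  0 < x -> wr u u1 f f1 x = 0.
Proof.
move=> pf pf1 bc x0.
rewrite (wr_const pu.1 pu.2 pf pf1 x0 ltr01); set c := wr _ _ _ _ _.
have [a [C [a0 a1 C0 hC]]] := hom_kg pf pf1.
have A0 := uA_ge0 pk k; have c0 : 0 <= kc pk 1 by rewrite (le_trans ler01)// kc_ge1.
apply: cmod_eq0; apply/eqP; rewrite eq_le cmod_ge0 andbT.
apply/ler_addgt0Pl => e e0; rewrite addr0.
have e2 : 0 < e / 2 by rewrite divr_gt0.
have [d1 d10 h1] := bc (e / 2 / (uA pk k + 1)) (divr_gt0 e2 (ltr_wpDl A0 ltr01)).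
have [d2 [d20 d21 h2]] := uw_small (mulr_ge0 (mulr_ge0 A0 c0) C0) e2.
pose y := Num.min (d1 / 2) (Num.min d2 a).
have y0 : 0 < y by rewrite !lt_min divr_gt0// d20 a0.
have yd1 : y < d1 by rewrite /y gt_min; apply/orP; left; lra.
have yd2 : y <= d2 by rewrite /y !ge_min lexx orbT.
have ya : y <= a by rewrite /y !ge_min lexx !orbT.
have y1 := le_trans ya a1.
rewrite /c -(wr_const pu.1 pu.2 pf pf1 y0 ltr01) wr_u_red//.
apply: (le_trans (cmodB _ _)); rewrite (cmodM (uphi _ _ _ _)) (cmodM (upsi _ _ _ _)) [leRHS](splitr e); apply: lerD.
  apply: (@le_trans _ _ ((uA pk k + 1) * (e / 2 / (uA pk k + 1)))).
    apply: ler_pM; rewrite ?cmod_ge0 ?(ltW (h1 _ _ _))//.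
    by apply: (le_trans (uphi_le pk k mQ Mz y0 y1)); rewrite lerDl.
  by rewrite mulrC divfK// gt_eqF// ltr_wpDl.
apply: (@le_trans _ _ (cmod (upsi pk k z y) * (C * kg pk z y))).
  by rewrite ler_wpM2l ?cmod_ge0// hC.
rewrite mulrCA; apply: ltW; apply: le_lt_trans (h2 y y0 yd2).
rewrite [uA pk k * kc pk 1 * C]mulrC -(mulrA C) ler_wpM2l//.
exact: (@upsi_kg _ _ _ pk k mQ z y Mz y0 y1).
Qed.

Lemma hom_eq0 f f1 x : Wr != 0 -> prim f f1 -> prim f1 (fun x => potV k Q z x * f x) ->
  (forall e : R, 0 < e -> exists2 d : R, 0 < d & forall x, 0 < x -> x < d -> cmod (redpsi z f f1 x) < e) ->
  RI (@pos R) (fun x => cmod (f x) ^+ 2) -> 0 < x -> f x = 0.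
Proof.
move=> W0 pf pf1 bc fi x0; have := wr_identity u u1 v v1 f f1 x.
rewrite (WrE x0) (wr_v_eq0 pf pf1 fi x0) (wr_u_eq0 pf pf1 bc x0).
move: Wr W0 (us _ _ _ _) (vs _ _ _ _ _) => W W0 a b; rewrite mulr0 mulr0 addr0 => /eqP.
by rewrite mulf_eq0 (negPf W0) orbF => /eqP.
Qed.

Lemma cderiv_cpow (s : CC R) x : 0 < x -> cderiv (fun y => cpow y s) x = s * cpow x (s - 1).
Proof.
move=> x0; have [h1 h2] := prim_cpow s.
have [c1 c2] := ccontM (ccont_cst s x) (cpow_cont (s - 1) x0).
apply: CCP; rewrite /cderiv.
  by rewrite creC (rprim_derive1 h1 x0 c1).2.
by rewrite cimC (rprim_derive1 h2 x0 c2).2.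
Qed.

(** The derivative of [redpsi] is rho phi, phi is bounded by a multiple of [kg], and rho kg is
    integrable at 0. *)
Lemma redpsi_bounded f f1 : prim f f1 -> prim f1 (fun x => potV k Q z x * f x) ->
  exists a C : R, [/\ 0 < a, a <= 1, 0 <= C & forall x, 0 < x -> x <= a -> cmod (redpsi z f f1 x) <= C].
Proof.
move=> pf pf1; have [a [C [a0 a1 C0 hC]]] := hom_kg pf pf1.
have pf1' : prim f1 (fun x => ((z ^+ 2 - 4^-1) * cR (x ^- 2) + uq Q k x) * f x).
  by apply: prim_ext pf1 _ _ => y y0 //; rewrite /potV /uq addrA.
have [_ p2] := reduce_prim pf pf1'.
have c0 : 0 <= kc pk 1 by rewrite (le_trans ler01)// kc_ge1.
set J := Rint (D0 a) (uw pk k).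
have J0 : 0 <= J by apply: Rint_ge0 => y /D0P[y0 _]; exact: uw_ge0.
have mD := ep_meas (endpoint0 R).
exists a, (cmod (redpsi z f f1 a) + (C * kc pk 1) * J); split => //.
  by rewrite addr_ge0 ?cmod_ge0// !mulr_ge0.
move=> x x0 xa.
have D0s : `[x, a] `<=` D0 a.
  by move=> y; rewrite /D0 /= !in_itv /= => /andP[xy ->]; rewrite (lt_le_trans x0).
have wi : RI (D0 a) (fun y => (C * kc pk 1) * uw pk k y) by apply: RI_Z => //; exact: uw_RI.
have wi' := RI_sub (measurable_itv _) (mD a) D0s wi.
have [ci e] := prim_int p2 x0 xa.
have : cmod (redpsi z f f1 a - redpsi z f f1 x) <= (C * kc pk 1) * J.
  rewrite /redpsi e -RintZ//; last exact: uw_RI.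
  apply: (@le_trans _ _ (Rint `[x, a] (fun y => (C * kc pk 1) * uw pk k y))).
    apply: cint_le => // y /D0s/D0P[y0 ya]; rewrite cmodM.
    apply: (@le_trans _ _ (cmod (urho Q k z y) * (C * kg pk z y))).
      by rewrite ler_wpM2l ?cmod_ge0//; exact: hC.
    by rewrite mulrCA -mulrA ler_wpM2l// mulrC kg_rho.
  apply: Rint_sub_le => // y /D0P[y0 _]; apply: mulr_ge0; [exact: mulr_ge0|exact: uw_ge0].
move=> h; rewrite -[redpsi z f f1 x](subKr (redpsi z f f1 a)).
by apply: (le_trans (cmodB _ _)); rewrite lerD2l.
Qed.

(** The domain is defined with the pure power rather than with the solution [us]; the Wronskian with
    the power is exactly [redpsi], the quantity that the Volterra estimates control. *)
Lemma wronsk0_red f : wronsk0_eq0 (fun x => cpow x (2^-1 + z)) f <->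
  (forall e : R, 0 < e -> exists2 d : R, 0 < d & forall x, 0 < x -> x < d -> cmod (redpsi z f (cderiv f) x) < e).
Proof.
have E x : 0 < x -> cpow x (2^-1 + z) * cderiv f x - cderiv (fun x => cpow x (2^-1 + z)) x * f x =
    redpsi z f (cderiv f) x.
  move=> x0; rewrite cderiv_cpow// /redpsi; have [_ -> _ _ _] := cpow_half z x0.
  rewrite cRV; ring.
split=> [/cvg0P H e e0|H]; last apply/cvg0P => e e0.
  by have [d d0 h] := H e e0; exists d => // x x0 xd; rewrite -E// h.
by have [d d0 h] := H e e0; exists d => // x x0 xd; rewrite E// h.
Qed.

End HomogeneousSolutions.

(** * The Green kernel *)

Section Green.
Variable R : realType.
Variables (M : set (CC R)) (u u1 v v1 V : CC R -> R -> CC R) (W : CC R -> CC R).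
Hypotheses (pu : forall z, M z -> prim (u z) (u1 z)) (pu1 : forall z, M z -> prim (u1 z) (fun x => V z x * u z x))
  (pv : forall z, M z -> prim (v z) (v1 z)) (pv1 : forall z, M z -> prim (v1 z) (fun x => V z x * v z x))
  (WE : forall z x, M z -> 0 < x -> wr (u z) (u1 z) (v z) (v1 z) x = W z).
Variables (a b h : R -> R) (C : R).
Hypotheses (ma_ : measurable_fun (@pos R) a) (mb_ : measurable_fun (@pos R) b)
  (mh_ : measurable_fun (@pos R) h) (a0 : forall x, 0 < x -> 0 < a x)
  (b0 : forall x, 0 < x -> 0 < b x) (h0 : forall x, 0 < x -> 0 < h x)
  (iah : forall x, 0 < x -> RI (D0 x) (fun y => a y * h y))
  (ibh : forall x, 0 < x -> RI (Doo x) (fun y => b y * h y))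
  (S1 : forall x, 0 < x -> b x * Rint (D0 x) (fun y => a y * h y) <= C * h x)
  (S2 : forall x, 0 < x -> a x * Rint (Doo x) (fun y => b y * h y) <= C * h x)
  (ua : forall z x, M z -> 0 < x -> cmod (u z x) <= a x)
  (vb : forall z x, M z -> 0 < x -> cmod (v z x) <= b x).
Variable g : R -> CC R.
Hypotheses (mg : cmeas (@pos R) g) (ig : RI (@pos R) (fun x => cmod (g x) ^+ 2)).

Let mD0 := ep_meas (endpoint0 R).
Let mDoo := ep_meas (endpointoo R).
Let G x := cmod (g x).

Definition gI0 z x := cint (D0 x) (fun y => u z y * g y).
Definition gIoo z x := cint (Doo x) (fun y => v z y * g y).
(** The Green function without the factor -1/W: its bounds and its regularity in [z] hold on all of
    [M], zeros of [W] included, and inverses are not among the operations of [fclass]. *)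
Definition gpre z x := u z x * gIoo z x + v z x * gI0 z x.
Definition green z x := - (W z)^-1 * gpre z x.
Definition green1 z x := - (W z)^-1 * (u1 z x * gIoo z x + v1 z x * gI0 z x).

Let schur := schur_test ma_ mb_ mh_ a0 b0 h0 iah ibh S1 S2 (cmeas_mod mg) (fun x _ => cmod_ge0 (g x)) ig.

Lemma green_RI0 x : 0 < x -> RI (D0 x) (fun y => a y * cmod (g y)).
Proof. by case: schur => i _ _ _; exact: i. Qed.

Lemma green_RIoo x : 0 < x -> RI (Doo x) (fun y => b y * cmod (g y)).
Proof. by case: schur => _ i _ _; exact: i. Qed.

Let cm z : M z -> cmeas (@pos R) (fun y => u z y * g y).
Proof. by move=> Mz; apply: cmeasM => //; exact: prim_measF (pu Mz). Qed.
Let cm' z : M z -> cmeas (@pos R) (fun y => v z y * g y).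
Proof. by move=> Mz; apply: cmeasM => //; exact: prim_measF (pv Mz). Qed.

Let leu z y : M z -> 0 < y -> cmod (u z y * g y) <= a y * cmod (g y).
Proof. by move=> Mz y0; rewrite cmodM ler_wpM2r ?cmod_ge0 ?ua. Qed.
Let lev z y : M z -> 0 < y -> cmod (v z y * g y) <= b y * cmod (g y).
Proof. by move=> Mz y0; rewrite cmodM ler_wpM2r ?cmod_ge0 ?vb. Qed.

Lemma gI0_CI z x : M z -> 0 < x -> CI (D0 x) (fun y => u z y * g y).
Proof.
move=> Mz x0; apply: (CI_le (mD0 x) (ep_cmeas (endpoint0 R) x0 (cm Mz))) (green_RI0 x0).
by move=> y /D0P[y0 _]; exact: leu.
Qed.

Lemma gIoo_CI z x : M z -> 0 < x -> CI (Doo x) (fun y => v z y * g y).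
Proof.
move=> Mz x0; apply: (CI_le (mDoo x) (ep_cmeas (endpointoo R) x0 (cm' Mz))) (green_RIoo x0).
by move=> y /DooP xy; apply: lev => //; exact: lt_le_trans xy.
Qed.

Lemma gI0_prim z : M z -> prim (gI0 z) (fun y => u z y * g y).
Proof.
move=> Mz; have p := ep_prim_c (endpoint0 R) (cm Mz) (fun x x0 => gI0_CI Mz x0).
by apply: prim_ext p _ _ => x x0 //; rewrite cR1 mul1r.
Qed.

Lemma gIoo_prim z : M z -> prim (gIoo z) (fun y => - (v z y * g y)).
Proof.
move=> Mz; have p := primZ (-1) (ep_prim_c (endpointoo R) (cm' Mz) (fun x x0 => gIoo_CI Mz x0)).
apply: prim_ext p _ _ => x x0; last by rewrite mulN1r.
by rewrite cRN cR1 mulrA mulrNN !mul1r.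
Qed.

Lemma gI0_le z x : M z -> 0 < x -> cmod (gI0 z x) <= Rint (D0 x) (fun y => a y * cmod (g y)).
Proof.
move=> Mz x0; apply: (cint_le (mD0 x) (gI0_CI Mz x0) (green_RI0 x0)).
by move=> y /D0P[y0 _]; exact: leu.
Qed.

Lemma gIoo_le z x : M z -> 0 < x -> cmod (gIoo z x) <= Rint (Doo x) (fun y => b y * cmod (g y)).
Proof.
move=> Mz x0; apply: (cint_le (mDoo x) (gIoo_CI Mz x0) (green_RIoo x0)).
by move=> y /DooP xy; apply: lev => //; exact: lt_le_trans xy.
Qed.

(** Variation of parameters: the terms with [g] cancel in the first derivative, and in the second
    they combine to W g / W. *)
Lemma green_prim z : M z -> W z != 0 ->
  prim (green z) (green1 z) /\ prim (green1 z) (fun x => V z x * green z x - g x).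
Proof.
move=> Mz W0; have p0 := gI0_prim Mz; have poo := gIoo_prim Mz.
split.
  have h1 := primZ (- (W z)^-1) (primD (primM (pu Mz) poo) (primM (pv Mz) p0)).
  by apply: prim_ext h1 _ _ => x x0 //; rewrite /green1; congr (_ * _); ring.
have h1 := primZ (- (W z)^-1) (primD (primM (pu1 Mz) poo) (primM (pv1 Mz) p0)).
apply: prim_ext h1 _ _ => x x0 //; rewrite /green /gpre.
have e : u z x * v1 z x - u1 z x * v z x = W z := WE Mz x0.
have hw : (W z)^-1 * (u z x * v1 z x - u1 z x * v z x) = 1 by rewrite e mulVf.
transitivity (V z x * (- (W z)^-1 * (u z x * gIoo z x + v z x * gI0 z x)) -
  ((W z)^-1 * (u z x * v1 z x - u1 z x * v z x)) * g x); first by ring.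
by rewrite hw mul1r.
Qed.

Lemma gpre_le z x : M z -> 0 < x -> cmod (gpre z x) <= schurT a b G x.
Proof.
move=> Mz x0; apply: (le_trans (cmodD _ _)); rewrite addrC !cmodM /schurT; apply: lerD.
  by apply: ler_pM; rewrite ?cmod_ge0 ?vb ?gI0_le.
by apply: ler_pM; rewrite ?cmod_ge0 ?ua ?gIoo_le.
Qed.

Lemma gpre_meas z : M z -> cmeas (@pos R) (gpre z).
Proof.
move=> Mz; apply: cmeasD; apply: cmeasM.
- exact: prim_measF (pu Mz).
- exact: prim_measF (gIoo_prim Mz).
- exact: prim_measF (pv Mz).
- exact: prim_measF (gI0_prim Mz).
Qed.

Lemma green_meas z : M z -> cmeas (@pos R) (green z).
Proof. by move=> Mz; apply: cmeasZ; exact: gpre_meas. Qed.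

Lemma green_L2 z : M z -> RI (@pos R) (fun x => cmod (green z x) ^+ 2) /\
  Rint (@pos R) (fun x => cmod (green z x) ^+ 2) <=
    (cmod (W z)^-1) ^+ 2 * (4 * C ^+ 2) * Rint (@pos R) (fun x => cmod (g x) ^+ 2).
Proof.
move=> Mz; have [_ _ iT leT] := schur; have pm : measurable (@pos R) := @pos_meas R.
have le x : pos x -> cmod (green z x) ^+ 2 <= (cmod (W z)^-1) ^+ 2 * schurT a b G x ^+ 2.
  move=> x0; rewrite /green cmodM cmodN exprMn ler_wpM2l ?sqr_ge0//.
  have := gpre_le Mz x0 => hh; have := le_trans (cmod_ge0 _) hh => h2.
  by rewrite lerXn2r ?nnegrE ?cmod_ge0.
have iS : RI (@pos R) (fun x => (cmod (W z)^-1) ^+ 2 * schurT a b G x ^+ 2) by exact: RI_Z.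
have i1 : RI (@pos R) (fun x => cmod (green z x) ^+ 2).
  apply: RI_le iS => //; first by apply: measurable_funX; apply: cmeas_mod; exact: green_meas.
  by move=> x x0; rewrite ger0_norm ?sqr_ge0 ?le.
split => //; apply: (le_trans (Rint_le pm i1 iS le)); rewrite RintZ// -mulrA.
by rewrite ler_wpM2l ?sqr_ge0.
Qed.

Variable FF : fclass M.
Hypotheses (Fu : forall x, 0 < x -> FF (fun z => u z x)) (Fv : forall x, 0 < x -> FF (fun z => v z x)).

Lemma gpre_fc x : 0 < x -> FF (fun z => gpre z x).
Proof.
move=> x0; apply: fc_add; apply: fc_mul; [exact: Fu| |exact: Fv|].
  apply: (@fc_int _ _ FF _ _ (fun y => b y * cmod (g y))) => //.
  - exact: green_RIoo.
  - by move=> z Mz; apply: (ep_cmeas (endpointoo R) x0); exact: cm'.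
  - by move=> z y Mz /DooP xy; apply: lev => //; exact: lt_le_trans xy.
  - move=> y /DooP xy; apply: fc_mul; last exact: fc_cst.
    by apply: Fv; exact: lt_le_trans xy.
apply: (@fc_int _ _ FF _ _ (fun y => a y * cmod (g y))) => //.
- exact: green_RI0.
- by move=> z Mz; apply: (ep_cmeas (endpoint0 R) x0); exact: cm.
- by move=> z y Mz /D0P[y0 _]; apply: leu.
- by move=> y /D0P[y0 _]; apply: fc_mul; [exact: Fu|exact: fc_cst].
Qed.

Definition conjf (f : R -> CC R) (x : R) : CC R := Complex (cre (f x)) (- cim (f x)).

Lemma innerE (f r : R -> CC R) : inner f r = cint (@pos R) (fun x => conjf f x * r x).
Proof. by apply: CCP; rewrite /inner /cint !cE; apply: Rint_ext => x _; rewrite /conjf !cE; ring. Qed.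

(** The integral over the half-line is uniform in [z] thanks to the majorant |f|^2 + (schurT |g|)^2,
    whose integrability is the Schur test. *)
Lemma inner_green (f : R -> CC R) : cmeas (@pos R) f -> RI (@pos R) (fun x => cmod (f x) ^+ 2) ->
  exists2 N : CC R -> CC R, FF N & forall z, M z -> inner f (green z) = - (W z)^-1 * N z.
Proof.
move=> mf fi; have pm : measurable (@pos R) := @pos_meas R; have [_ _ iT _] := schur.
have mc : cmeas (@pos R) (conjf f) by exact: cmeas_conj.
have cc x : cmod (conjf f x) = cmod (f x) by rewrite /cmod /conjf !cE sqrrN.
have iH : RI (@pos R) (fun x => cmod (f x) ^+ 2 + schurT a b G x ^+ 2) by exact: RI_D.
have le z x : M z -> 0 < x -> cmod (conjf f x * gpre z x) <= cmod (f x) ^+ 2 + schurT a b G x ^+ 2.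
  move=> Mz x0; rewrite cmodM cc; have := gpre_le Mz x0; have := cmod_ge0 (f x); have := cmod_ge0 (gpre z x).
  move: (cmod _) (cmod _) (schurT _ _ _ _) => p q t p0 q0 pt.
  apply: (@le_trans _ _ (p * t)); first by rewrite ler_wpM2l.
  have := sqr_ge0 (p - t); have := sqr_ge0 t; have := sqr_ge0 p; nra.
exists (fun z => cint (@pos R) (fun x => conjf f x * gpre z x)).
  apply: (@fc_int _ _ FF _ _ (fun x => cmod (f x) ^+ 2 + schurT a b G x ^+ 2)) => //.
  - by move=> z Mz; apply: cmeasM => //; exact: gpre_meas.
  - by move=> x x0; apply: fc_scale; exact: gpre_fc.
move=> z Mz; rewrite innerE -cintZ//.
  by apply: cint_ext => x _; rewrite /green mulrCA.
apply: CI_le iH => //; first by apply: cmeasM => //; exact: gpre_meas.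
by move=> x x0; exact: le.
Qed.

End Green.

Section Resolvent.
Variable R : realType.
Variables (M : set (CC R)) (Q : R -> CC R) (pk : kpack M Q) (k : R).
Hypotheses (k0 : 2^-1 <= k) (mQ : cmeas (@pos R) Q)
  (iQ : forall x, 0 < x -> RI (Doo x) (fun y => cmod (Q y))).

Let bd := kbd pk.
Let Mbd : forall z, M z -> cmod z <= bd := kp_bd pk.
Let kp : 0 < k. Proof. by apply: lt_le_trans k0; rewrite invr_gt0. Qed.

Local Notation u := (us pk k).
Local Notation u1 := (us1 pk k).
Local Notation v := (vs Q k bd).
Local Notation v1 := (vs1 Q k bd).
Local Notation W := (Wr pk k).

(* Profiles [sa], [sb] of [u], [v] and a weight [sh] for the Schur test. *)
Record schur_pack : Type := SchurPack {
  sa : R -> R; sb : R -> R; sh : R -> R; sC : R;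
  sa_meas : measurable_fun (@pos R) sa;
  sb_meas : measurable_fun (@pos R) sb;
  sh_meas : measurable_fun (@pos R) sh;
  sa_gt0 : forall x, 0 < x -> 0 < sa x;
  sb_gt0 : forall x, 0 < x -> 0 < sb x;
  sh_gt0 : forall x, 0 < x -> 0 < sh x;
  s_RI0 : forall x, 0 < x -> RI (D0 x) (fun y => sa y * sh y);
  s_RIoo : forall x, 0 < x -> RI (Doo x) (fun y => sb y * sh y);
  s_S1 : forall x, 0 < x -> sb x * Rint (D0 x) (fun y => sa y * sh y) <= sC * sh x;
  s_S2 : forall x, 0 < x -> sa x * Rint (Doo x) (fun y => sb y * sh y) <= sC * sh x;
  s_u : forall z x, M z -> 0 < x -> cmod (u z x) <= sa x;
  s_v : forall z x, M z -> 0 < x -> cmod (v z x) <= sb x;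
  s_a : forall x, 0 < x -> x <= 1 -> x `^ (2^-1 + klo pk) <= sa x }.

Lemma schur_pack_ex : exists s : schur_pack, True.
Proof.
have [A A0 hA] := us_major pk k0 mQ iQ; have [B B0 hB] := vs_major pk k0 mQ iQ.
have A1 : 0 < A + 1 by rewrite ltr_wpDl. 
have B1 : 0 < B + 1 by rewrite ltr_wpDl.
(* [al] is the midpoint of the interval ]- pa - 1, - pb - 1[ of admissible exponents, nonempty by
   [kp_sum]; the remaining condition on pa + pb + 1 is [kp_dif]. *)
pose al : R := - (3 / 2) + (keps pk + khi pk - klo pk) / 2.
pose pa : R := 2^-1 + klo pk; pose pb : R := 2^-1 - khi pk - keps pk.
have h1 := kp_sum pk; have h2 := kp_dif pk; have h3 := kp_lo pk.
have ca : 0 < pa + al + 1 by rewrite /pa /al; lra.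
have cb : pb + al + 1 < 0 by rewrite /pb /al; lra.
have cab : 0 <= pa + pb + 1 by rewrite /pa /pb; lra.
have mD0 := ep_meas (endpoint0 R); have mDoo := ep_meas (endpointoo R).
pose a x := (A + 1) * pw pa k x; pose b x := (B + 1) * pw pb (- k) x; pose h := pw al (0 : R).
have i0 x : 0 < x -> RI (D0 x) (fun y => a y * h y).
  move=> x0; apply: RI_ext (RI_Z (A + 1) (mD0 x) (pw_RI0 kp ca x0)) => y _.
  by rewrite /a mulrA.
have ioo x : 0 < x -> RI (Doo x) (fun y => b y * h y).
  move=> x0; apply: RI_ext (RI_Z (B + 1) (mDoo x) (pw_RIoo kp cb x0)) => y _.
  by rewrite /b mulrA.
have e0 x : 0 < x -> Rint (D0 x) (fun y => a y * h y) = (A + 1) * Rint (D0 x) (fun y => pw pa k y * h y).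
  move=> x0; rewrite -RintZ//; last exact: pw_RI0.
  by apply: Rint_ext => y _; rewrite /a mulrA.
have eoo x : 0 < x -> Rint (Doo x) (fun y => b y * h y) = (B + 1) * Rint (Doo x) (fun y => pw pb (- k) y * h y).
  move=> x0; rewrite -RintZ//; last exact: pw_RIoo.
  by apply: Rint_ext => y _; rewrite /b mulrA.
have up (c x y : R) : 0 <= c -> x <= c * y -> 0 <= y -> x <= (c + 1) * y.
  by move=> c0 xy y0; apply: (le_trans xy); rewrite ler_wpM2r// lerDl.
unshelve eexists (@SchurPack a b h ((A + 1) * (B + 1) * pwC pa pb al k) _ _ _ _ _ _ i0 ioo _ _ _ _ _) => //.
- by apply: measurable_funM; [exact: measurable_cst|exact: pw_meas].
- by apply: measurable_funM; [exact: measurable_cst|exact: pw_meas].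
- exact: pw_meas.
- by move=> x x0; rewrite mulr_gt0// pw_gt0.
- by move=> x x0; rewrite mulr_gt0// pw_gt0.
- by move=> x x0; exact: pw_gt0.
- move=> x x0; rewrite e0// /b.
  rewrite (_ : _ * _ = (A + 1) * (B + 1) * (pw pb (- k) x * Rint (D0 x) (fun y => pw pa k y * h y))); last by ring.
  rewrite -[leRHS]mulrA; apply: ler_wpM2l; last exact: pw_S1.
  by rewrite mulr_ge0// ltW.
- move=> x x0; rewrite eoo// /a.
  rewrite (_ : _ * _ = (A + 1) * (B + 1) * (pw pa k x * Rint (Doo x) (fun y => pw pb (- k) y * h y))); last by ring.
  rewrite -[leRHS]mulrA; apply: ler_wpM2l; last exact: pw_S2.
  by rewrite mulr_ge0// ltW.
- by move=> z x Mz x0; apply: up => //; [exact: hA|exact: ltW (pw_gt0 _ _ x0)].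
- by move=> z x Mz x0; apply: up => //; [exact: hB|exact: ltW (pw_gt0 _ _ x0)].
- by move=> x x0 x1; rewrite /a /pw x1 ler_peMl ?powR_ge0// lerDr.
Qed.

Variable s : schur_pack.

Definition res (g : R -> CC R) := green u v W g.
Definition res1 (g : R -> CC R) := green1 u u1 v v1 W g.

Let pu z (Mz : M z) := (us_prim pk k mQ Mz).1.
Let pu1 z (Mz : M z) := (us_prim pk k mQ Mz).2.
Let pv z (Mz : M z) := (vs_prim k0 mQ iQ Mbd Mz).1.
Let pv1 z (Mz : M z) := (vs_prim k0 mQ iQ Mbd Mz).2.
Let WE z x (Mz : M z) (x0 : 0 < x) := WrE pk k0 mQ iQ Mz x0.

Section Source.
Variable g : R -> CC R.
Hypothesis g2 : L2 g.

Let mg : cmeas (@pos R) g. Proof. by have [] := (L2P g).1 g2. Qed.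
Let ig : RI (@pos R) (fun x => cmod (g x) ^+ 2). Proof. by have [] := (L2P g).1 g2. Qed.

Lemma res_prim z : M z -> W z != 0 ->
  prim (res g z) (res1 g z) /\ prim (res1 g z) (fun x => potV k Q z x * res g z x - g x).
Proof.
exact: (green_prim pu pu1 pv pv1 WE (sa_meas s) (sb_meas s) (sh_meas s) (sa_gt0 s) (sb_gt0 s)
  (sh_gt0 s) (s_RI0 s) (s_RIoo s) (s_S1 s) (s_S2 s) (s_u s) (s_v s) mg ig).
Qed.

Lemma res_bound z : M z -> RI (@pos R) (fun x => cmod (res g z x) ^+ 2) /\
  Rint (@pos R) (fun x => cmod (res g z x) ^+ 2) <=
    (cmod (W z)^-1) ^+ 2 * (4 * sC s ^+ 2) * Rint (@pos R) (fun x => cmod (g x) ^+ 2).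
Proof.
exact: (green_L2 W pu pv (sa_meas s) (sb_meas s) (sh_meas s) (sa_gt0 s) (sb_gt0 s)
  (sh_gt0 s) (s_RI0 s) (s_RIoo s) (s_S1 s) (s_S2 s) (s_u s) (s_v s) mg ig).
Qed.

Let RI0 x (x0 : 0 < x) := green_RI0 (sa_meas s) (sb_meas s) (sh_meas s) (sa_gt0 s) (sb_gt0 s)
  (sh_gt0 s) (s_RI0 s) (s_RIoo s) (s_S1 s) (s_S2 s) mg ig x0.

(** Up to the factor -1/W, the reduced derivative is psi_u times the integral of v g over [x, oo[
    plus that of v times the integral of u g over ]0, x]. The first integral may grow like [kg],
    which psi_u compensates; in the second product a bounded factor meets an integral that tends to
    0. *)
Lemma res_bc z : M z -> (forall e : R, 0 < e -> exists2 d : R, 0 < d &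
  forall x, 0 < x -> x < d -> cmod (redpsi z (res g z) (res1 g z) x) < e).
Proof.
move=> Mz.
have poo : prim (gIoo v g z) (fun y => - (v z y * g y)).
  exact: (gIoo_prim pv (sa_meas s) (sb_meas s) (sh_meas s) (sa_gt0 s) (sb_gt0 s)
    (sh_gt0 s) (s_RI0 s) (s_RIoo s) (s_S1 s) (s_S2 s) (s_v s) mg ig).
have I0le x : 0 < x -> cmod (gI0 u g z x) <= Rint (D0 x) (fun y => sa s y * cmod (g y)).
  exact: (gI0_le pu (sa_meas s) (sb_meas s) (sh_meas s) (sa_gt0 s) (sb_gt0 s)
    (sh_gt0 s) (s_RI0 s) (s_RIoo s) (s_S1 s) (s_S2 s) (s_u s) mg ig).
have E x : 0 < x -> redpsi z (res g z) (res1 g z) x =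
    - (W z)^-1 * (upsi pk k z x * gIoo v g z x + redpsi z (v z) (v1 z) x * gI0 u g z x).
  move=> x0; have -> : upsi pk k z x = redpsi z (u z) (u1 z) x.
    rewrite /redpsi /us1 cpowN; have P0 := cpow_neq0 (2^-1 + z) x0.
    by move: (cpow x (2^-1 + z)) P0 => P P0; field.
  by rewrite /redpsi /res /res1 /green /green1 /gpre; ring.
have [a1 [C1 [a10 a11 C10 h1]]] := redpsi_bounded pk mQ Mz (pv Mz) (pv1 Mz).
have [a2 [C2 [a20 a21 C20 h2]]] := hom_kg pk mQ Mz (pv Mz) (pv1 Mz).
have c0 : 0 <= kc pk 1 by rewrite (le_trans ler01)// kc_ge1.
set J := Rint (D0 a2) (fun y => sa s y * cmod (g y)).
have J0 : 0 <= J by apply: Rint_ge0 => y /D0P[y0 _]; rewrite mulr_ge0 ?cmod_ge0 ?ltW ?sa_gt0.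
have oole x : 0 < x -> x <= a2 -> cmod (gIoo v g z x) <= (cmod (gIoo v g z a2) + C2 * J) * kg pk z x.
  move=> x0 xa; have x1 := le_trans xa a21; have [ci e] := prim_int poo x0 xa.
  have g1 := kg_ge1 pk Mz x0 x1; have g0 := le_trans ler01 g1.
  have D0s : `[x, a2] `<=` D0 a2.
    by move=> y; rewrite /D0 /= !in_itv /= => /andP[xy ->]; rewrite (lt_le_trans x0).
  have mD := ep_meas (endpoint0 R).
  have i1 := RI_sub (measurable_itv _) (mD a2) D0s (RI0 a20).
  have h : cmod (gIoo v g z a2 - gIoo v g z x) <= C2 * J * kg pk z x.
    rewrite e; apply: (@le_trans _ _ (Rint `[x, a2] (fun y => (C2 * kg pk z x) * (sa s y * cmod (g y))))).
      apply: cint_le => //; first exact: RI_Z.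
      move=> y yI; have [y0 ya] := D0P (D0s y yI).
      have xy : x <= y by move: yI; rewrite /= in_itv /= => /andP[].
      have y1 := le_trans ya a21; have [lo _] := kp_re pk Mz.
      rewrite cmodN cmodM mulrA ler_wpM2r ?cmod_ge0//.
      have -> : v z y = cpow y (2^-1 + z) * redphi z (v z) y.
        by rewrite /redphi mulrA -cpowD subrr cpow0 mul1r.
      rewrite cmodM cmod_cpow// mulrC; apply: ler_pM; rewrite ?cmod_ge0 ?powR_ge0//.
        apply: (le_trans (h2 y y0 ya)); rewrite ler_wpM2l//; exact: (kw_anti2 pk Mz).
      apply: le_trans (s_a s y0 y1); apply: powR_anti => //.
      have cr : cre (2^-1 : CC R) = 2^-1 by rewrite -cR_nat -cRV.
      by rewrite creD cr lerD2l.
    rewrite RintZ// [leRHS]mulrAC; apply: ler_wpM2l; first exact: mulr_ge0.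
    apply: Rint_sub_le => //; last exact: RI0.
    by move=> y /D0P[y0 _]; rewrite mulr_ge0 ?cmod_ge0 ?ltW ?sa_gt0.
  rewrite -[gIoo v g z x](subKr (gIoo v g z a2)).
  apply: (le_trans (cmodB _ _)); rewrite mulrDl; apply: lerD => //.
  by rewrite ler_peMr ?cmod_ge0.
set K := cmod (gIoo v g z a2) + C2 * J in oole *.
have K0 : 0 <= K by rewrite addr_ge0 ?cmod_ge0 ?mulr_ge0.
have A0 := uA_ge0 pk k; set w := cmod (W z)^-1.
have w0 : 0 <= w := cmod_ge0 _.
move=> e e0; have e2 : 0 < e / 2 by rewrite divr_gt0.
have [d1 [d10 d11 k1]] := uw_small pk k mQ (mulr_ge0 w0 (mulr_ge0 K0 (mulr_ge0 A0 c0))) e2.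
have fge x : 0 < x -> 0 <= sa s x * cmod (g x).
  by move=> x0; rewrite mulr_ge0 ?cmod_ge0 ?ltW ?sa_gt0.
have [d2 [d20 d21 k2]] := D0_small RI0 fge (mulr_ge0 w0 C10) e2.
exists (Num.min (Num.min d1 d2) (Num.min a1 a2)); first by rewrite !lt_min d10 d20 a10 a20.
move=> x x0; rewrite !lt_min => /andP[/andP[xd1 xd2] /andP[xa1 xa2]].
have x1 := le_trans (ltW xa1) a11.
rewrite E// cmodM cmodN -/w; apply: (@le_lt_trans _ _ (w * (K * (uA pk k * kc pk 1)) * Rint (D0 x) (uw pk k) +
  w * C1 * Rint (D0 x) (fun y => sa s y * cmod (g y)))); last first.
  by rewrite [ltRHS]splitr ltrD// ?k1 ?k2// ltW.
have q1 := @upsi_kg _ _ _ pk k mQ z x Mz x0 x1; have q2 := oole x x0 (ltW xa2).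
have q3 := h1 x x0 (ltW xa1); have q4 := I0le x x0.
rewrite -(mulrA w) -(mulrA w) -mulrDr ler_wpM2l//.
move: q1 q2 q3 q4; move: (upsi pk k z x) (gIoo v g z x) (redpsi z (v z) (v1 z) x) (gI0 u g z x).
move: (kg pk z x) (Rint (D0 x) _) (Rint (D0 x) _) => t I I' p q p' q' q1 q2 q3 q4.
apply: (le_trans (cmodD _ _)); rewrite !cmodM; apply: lerD; last by apply: ler_pM; rewrite ?cmod_ge0.
apply: (@le_trans _ _ (cmod p * (K * t))); first by rewrite ler_wpM2l ?cmod_ge0.
by rewrite mulrCA -(mulrA K) ler_wpM2l.
Qed.

End Source.

Lemma lambda_shift z (f : R -> CC R) x :
  Lexpr Q z f x - cR (- k ^+ 2) * f x = - cderiv (cderiv f) x + potV k Q z x * f x.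
Proof. by rewrite /Lexpr /potV cRN; ring. Qed.

Lemma potV_meas z : cmeas (@pos R) (potV k Q z).
Proof.
apply: cmeas_ext (cmeasD (cmeas_cst _ (cR (k ^+ 2))) (vp_meas mQ z)) => x _.
by rewrite /potV /vp; ring.
Qed.

(** Membership of [Lexpr] in [L2] concerns the pointwise second derivative itself, so its
    measurability cannot be borrowed from a function that equals it almost everywhere. *)
Lemma cmeas_cderiv2 (f : R -> CC R) : AC1 f -> cmeas (@pos R) (cderiv (cderiv f)).
Proof.
move=> af; have [_ p] := AC1_prim af.
by split; apply: derive1_meas => x x0; have [] := prim_cont p x0.
Qed.

Lemma L2D (f g : R -> CC R) : L2 f -> L2 g -> L2 (fun x => f x + g x).
Proof.
have pm : measurable (@pos R) := @pos_meas R.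
move=> /L2P[mf fi] /L2P[mg gi]; apply/L2P; split; first exact: cmeasD.
apply: RI_le (RI_Z 2 pm (RI_D pm fi gi)) => //.
  by apply: measurable_funX; apply: cmeas_mod; exact: cmeasD.
move=> x _; rewrite ger0_norm ?sqr_ge0//.
have := cmodD (f x) (g x); have := cmod_ge0 (f x + g x).
move: (cmod (f x + g x)) (cmod (f x)) (cmod (g x)) => a b c a0 abc.
apply: (@le_trans _ _ ((b + c) ^+ 2)); first by rewrite lerXn2r ?nnegrE// (le_trans a0).
by have := sqr_ge0 (b - c); nra.
Qed.

Lemma L2Z (c : CC R) (f : R -> CC R) : L2 f -> L2 (fun x => c * f x).
Proof.
have pm : measurable (@pos R) := @pos_meas R.
move=> /L2P[mf fi]; apply/L2P; split; first exact: cmeasZ.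
by apply: RI_ext (RI_Z (cmod c ^+ 2) pm fi) => x _; rewrite cmodM exprMn.
Qed.

Lemma L2_ae (f g : R -> CC R) : cmeas (@pos R) f -> L2 g -> ae_eq f g -> L2 f.
Proof.
move=> mf /L2P[mg gi] fg; apply/L2P; split => //.
have ae : {ae @lebesgue_measure R, forall x, pos x -> cmod (g x) ^+ 2 = cmod (f x) ^+ 2}.
  by apply: aeS fg => x h /h ->.
have mm : measurable_fun (@pos R) (fun x => cmod (f x) ^+ 2).
  by apply: measurable_funX; exact: cmeas_mod.
by have [] := RI_ae (@pos_meas R) mm ae gi.
Qed.

Lemma res_solves g z : L2 g -> M z -> W z != 0 ->
  DH Q z (res g z) /\ ae_eq (fun x => Lexpr Q z (res g z) x - cR (- k ^+ 2) * res g z x) g.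
Proof.
move=> g2 Mz W0; have [p1 p2] := res_prim g2 Mz W0.
have [ac dE ae] := prim_AC1 p1 p2.
have eqn : ae_eq (fun x => Lexpr Q z (res g z) x - cR (- k ^+ 2) * res g z x) g.
  by apply: aeS ae => x h x0; rewrite lambda_shift h//; ring.
have [mg ig] := (L2P g).1 g2; have [ir _] := res_bound g2 Mz.
have r2 : L2 (res g z) by apply/L2P; split; [exact: prim_measF p1|].
split; last exact: eqn.
split; last first.
  apply/wronsk0_red => e e0; have [d d0 h] := res_bc g2 Mz e0; exists d => // x x0 xd.
  by rewrite /redpsi dE//; exact: h.
split; first exact: r2.
split; first exact: ac.
apply: (L2_ae (g := fun x => g x + cR (- k ^+ 2) * res g z x)).
- apply: cmeas_ext (cmeasD (cmeasN (cmeas_cderiv2 ac)) (cmeasD (cmeasM (potV_meas z) (prim_measF p1))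
    (cmeasZ (cR (- k ^+ 2)) (prim_measF p1)))) => x _.
  by rewrite /Lexpr /potV cRN; ring.
- by apply: L2D; [exact: g2|exact: L2Z r2].
- by apply: aeS eqn => x h x0; rewrite -h// subrK.
Qed.

(** The difference satisfies the homogeneous equation almost everywhere, which suffices for [prim],
    and it inherits the boundary condition and square integrability. *)
Lemma DH_unique z (f1 f2 : R -> CC R) : M z -> W z != 0 -> DH Q z f1 -> DH Q z f2 ->
  ae_eq (fun x => Lexpr Q z f1 x - cR (- k ^+ 2) * f1 x) (fun x => Lexpr Q z f2 x - cR (- k ^+ 2) * f2 x) ->
  forall x, 0 < x -> f1 x = f2 x.
Proof.
move=> Mz W0 [[/L2P[m1 i1] [a1 _]] b1] [[/L2P[m2 i2] [a2 _]] b2] ae x x0.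
have [p1 q1] := AC1_prim a1; have [p2 q2] := AC1_prim a2.
have pf := primB p1 p2; have qf := primB q1 q2.
pose f := fun x => f1 x - f2 x; pose f' := fun x => cderiv f1 x - cderiv f2 x.
have mV : cmeas (@pos R) (fun x => potV k Q z x * f x).
  by apply: cmeasM; [exact: potV_meas|exact: prim_measF pf].
have pf' : prim f' (fun x => potV k Q z x * f x).
  have E : {ae @lebesgue_measure R, forall x, pos x ->
      cderiv (cderiv f1) x - cderiv (cderiv f2) x = potV k Q z x * f x}.
    apply: aeS ae => y h y0; have := h y0; rewrite !lambda_shift /f => e.
    move: (potV k Q z y) (f1 y) (f2 y) (cderiv (cderiv f1) y) (cderiv (cderiv f2) y) e => V c d p q e.
    transitivity ((V * c - V * d) - ((- p + V * c) - (- q + V * d))); first by ring.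
    by rewrite e subrr subr0; ring.
  split; [apply: rprim_ae qf.1 mV.1 _|apply: rprim_ae qf.2 mV.2 _].
    by apply: aeS E => y h y0; rewrite h.
  by apply: aeS E => y h y0; rewrite h.
apply/eqP; rewrite -subr_eq0; apply/eqP.
apply: (hom_eq0 k0 mQ iQ Mz W0 pf pf') x0.
- move=> e e0; have e2 : 0 < e / 2 by rewrite divr_gt0.
  have [d1 d10 h1] := (wronsk0_red z f1).1 b1 _ e2; have [d2 d20 h2] := (wronsk0_red z f2).1 b2 _ e2.
  exists (Num.min d1 d2); first by rewrite lt_min d10.
  move=> y y0; rewrite lt_min => /andP[yd1 yd2].
  rewrite (_ : redpsi _ _ _ y = redpsi z f1 (cderiv f1) y - redpsi z f2 (cderiv f2) y); last first.
    by rewrite /redpsi /f /f'; ring.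
  have l1 := h1 y y0 yd1; have l2 := h2 y y0 yd2.
  move: (redpsi z f1 _ y) (redpsi z f2 _ y) l1 l2 => p q l1 l2.
  by apply: (le_lt_trans (cmodB p q)); rewrite [ltRHS]splitr ltrD.
- have l1 : L2 f1 by apply/L2P. have l2 : L2 f2 by apply/L2P.
  have /L2P[_ i] := L2D l1 (L2Z (-1) l2).
  by apply: RI_ext i => y _; rewrite mulN1r.
Qed.

Lemma norm2E (f : R -> CC R) : norm2 f = Num.sqrt (Rint (@pos R) (fun x => cmod (f x) ^+ 2)).
Proof. by []. Qed.

(** By uniqueness every [f] in the domain is the resolvent of its own image, so the required
    inequality is the L^2 bound of the Green kernel. *)
Lemma res_resolvent z : M z -> W z != 0 -> in_resolvent (Hop Q z) (cR (- k ^+ 2)).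
Proof.
move=> Mz W0; split; [|split].
- by move=> g g2; exists (res g z); have [] := res_solves g2 Mz W0.
- by move=> f1 f2 d1 d2 ae; have u := DH_unique Mz W0 d1 d2 ae; apply: aeS ae => x _ x0; exact: u.
set c := Num.sqrt ((cmod (W z)^-1) ^+ 2 * (4 * sC s ^+ 2)).
exists c => f df; set g := fun x => Lexpr Q z f x - cR (- k ^+ 2) * f x.
have g2 : L2 g.
  have [[l2f [_ l2L]] _] := df.
  have h := L2D l2L (L2Z (- cR (- k ^+ 2)) l2f).
  by rewrite (_ : g = fun x => Lexpr Q z f x + - cR (- k ^+ 2) * f x)//; apply/funext => x; rewrite /g mulNr.
have [dr ae] := res_solves g2 Mz W0.
have fr := DH_unique Mz W0 df dr.
have ae' : ae_eq g (fun x => Lexpr Q z (res g z) x - cR (- k ^+ 2) * res g z x).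
  by apply: aeS ae => x h x0; rewrite h.
have [_ le] := res_bound g2 Mz.
rewrite !norm2E /c -sqrtrM; last by rewrite mulr_ge0 ?sqr_ge0// mulr_ge0// sqr_ge0.
rewrite ler_sqrt; last first.
  by rewrite mulr_ge0; [|rewrite mulr_ge0 ?sqr_ge0// mulr_ge0// sqr_ge0|apply: Rint_ge0 => x _; exact: sqr_ge0].
apply: le_trans le; rewrite le_eqVlt; apply/orP; left; apply/eqP; apply: Rint_ext => x x0.
by rewrite (fr ae' x x0).
Qed.

Lemma res_inner (FF : fclass M) (f g : R -> CC R) : L2 f -> L2 g ->
  exists2 N : CC R -> CC R, FF N & forall z, M z -> inner f (res g z) = - (W z)^-1 * N z.
Proof.
move=> /L2P[mf fi] /L2P[mg gi].
have Fu x (x0 : 0 < x) : FF (fun z => u z x) := us_fc pk k mQ FF x0.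
have Fv x (x0 : 0 < x) : FF (fun z => v z x) := vs_fc k0 mQ iQ Mbd FF x0.
exact: (inner_green W pu pv (sa_meas s) (sb_meas s) (sh_meas s) (sa_gt0 s) (sb_gt0 s)
  (sh_gt0 s) (s_RI0 s) (s_RIoo s) (s_S1 s) (s_S2 s) (s_u s) (s_v s) mg gi Fu Fv mf fi).
Qed.

Lemma Wr_fc (FF : fclass M) : FF W.
Proof.
have l := @ltr01 R; apply: fc_sub; apply: fc_mul.
- exact: us_fc.
- exact: vs1_fc.
- exact: us1_fc.
- exact: vs_fc.
Qed.

End Resolvent.

(** * Nonvanishing of the Wronskian for large k *)

Section OdeUniqueness.
Variable R : realType.

Lemma rprim_mono (F f : R -> R) x y : rprim F f -> (forall t, 0 < t -> 0 <= f t) ->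
  0 < x -> x <= y -> F x <= F y.
Proof.
move=> pF f0 x0 xy; have [_ e] := pF.2 x y x0 xy.
by rewrite -subr_ge0 e; apply: Rint_ge0 => t /(itv_pos x0)/f0.
Qed.

Variables (Q : R -> CC R) (k : R) (z : CC R).
Hypotheses (mQ : cmeas (@pos R) Q) (iQ : forall x, 0 < x -> RI (Doo x) (fun y => cmod (Q y))).

(* Gronwall in the form [(E exp (- T))' <= 0] with [E = |g|^2 + |g1|^2]. *)
Lemma cauchy_uniq g g1 a x : prim g g1 -> prim g1 (fun x => potV k Q z x * g x) ->
  0 < a -> g a = 0 -> g1 a = 0 -> a <= x -> g x = 0 /\ g1 x = 0.
Proof.
move=> pg pg1 a0 ga g1a ax; set c2 := cmod (z ^+ 2 - 4^-1).
have x0 := lt_le_trans a0 ax.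
pose T x := (1 + k ^+ 2) * x - c2 * x^-1 - Rint (Doo x) (fun y => cmod (Q y)).
pose t x := 1 + k ^+ 2 + c2 * x ^- 2 + cmod (Q x).
have pinv : rprim (fun x : R => x^-1) (fun x => - x ^- 2) := (@prim_inv R).1.
have pQ := ep_prim (endpointoo R) (cmeas_mod mQ) iQ.
have pT : rprim T t.
  have h := rprimD (rprimD (rprimZ (1 + k ^+ 2) (@rprim_id R)) (rprimZ (- c2) pinv)) pQ.
  by apply: rprim_ext h _ _ => y y0; rewrite /T /t; ring.
pose E y := cmod (g y) ^+ 2 + cmod (g1 y) ^+ 2.
pose V := potV k Q z.
pose E' y := 2 * (cre (g y) * cre (g1 y) + cim (g y) * cim (g1 y)) +
  2 * (cre (g1 y) * cre (V y * g y) + cim (g1 y) * cim (V y * g y)).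
have pE : rprim E E'.
  have h := rprimD (rprimD (rprimM pg.1 pg.1) (rprimM pg.2 pg.2)) (rprimD (rprimM pg1.1 pg1.1) (rprimM pg1.2 pg1.2)).
  apply: rprim_ext h _ _ => y y0; first by rewrite /E !cmod_sqr; ring.
  by rewrite /E'; ring.
have EE y : 0 < y -> E' y <= t y * E y.
  move=> y0.
  have dot (p q : CC R) : cre p * cre q + cim p * cim q <= cmod p * cmod q.
    apply: (le_trans (ler_norm _)); rewrite -ler_sqr ?nnegrE ?normr_ge0 ?mulr_ge0 ?cmod_ge0//.
    rewrite real_normK ?num_real// exprMn !cmod_sqr.
    have := sqr_ge0 (cre p * cim q - cim p * cre q); nra.
  have Vt : 1 + cmod (V y) <= t y.
    rewrite /t -!addrA lerD2l; apply: (le_trans (cmodD _ _)); rewrite addrA lerD//.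
    apply: (le_trans (cmodD _ _)); rewrite cmodM !cmod_cR addrC lerD//.
      by rewrite ger0_norm// invr_ge0 sqr_ge0.
    by rewrite ger0_norm ?sqr_ge0.
  have d1 := dot (g y) (g1 y); have d2 := dot (g1 y) (V y * g y); rewrite cmodM in d2.
  rewrite /E' /E; have p0 := cmod_ge0 (g y); have q0 := cmod_ge0 (g1 y); have v0 := cmod_ge0 (V y).
  move: d1 d2; move: (_ + _) (_ + _) => D1 D2.
  move: (cmod (g y)) (cmod (g1 y)) (cmod (V y)) (t y) p0 q0 v0 Vt => p q v s p0 q0 v0 vs d1 d2.
  apply: (@le_trans _ _ ((1 + v) * (p ^+ 2 + q ^+ 2))); last first.
    by rewrite ler_wpM2r// addr_ge0 ?sqr_ge0.
  apply: (@le_trans _ _ ((1 + v) * (2 * (p * q)))); first by nra.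
  by rewrite ler_wpM2l ?addr_ge0//; have := sqr_ge0 (p - q); nra.
have pF := rprimM (rprimZ (-1) pE) (rprim_expR (rprimZ (-1) pT)).
have le := rprim_mono pF _ a0 ax.
have {le} : -1 * E a * expR (-1 * T a) <= -1 * E x * expR (-1 * T x).
  apply: le => y y0.
  rewrite (_ : _ + _ = (t y * E y - E' y) * expR (-1 * T y)); last by ring.
  by rewrite mulr_ge0 ?expR_ge0// subr_ge0 EE.
rewrite /E ga g1a cmod0 expr0n addr0 !mulr0 mul0r mulN1r mulNr oppr_ge0.
rewrite pmulr_lle0 ?expR_gt0// => h.
have h1 := sqr_ge0 (cmod (g x)); have h2 := sqr_ge0 (cmod (g1 x)).
have e1 : cmod (g x) ^+ 2 = 0 by apply/eqP; rewrite eq_le h1 andbT; lra.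
have e2 : cmod (g1 x) ^+ 2 = 0 by apply/eqP; rewrite eq_le h2 andbT; lra.
by split; apply: cmod_eq0; apply/eqP; rewrite -sqrf_eq0 ?e1 ?e2.
Qed.

(** A vanishing Wronskian at [a] makes the Cauchy data proportional, and uniqueness carries this to
    [a, oo[. *)
Lemma wr0_proportional u u1 v v1 a x : prim u u1 -> prim u1 (fun x => potV k Q z x * u x) ->
  prim v v1 -> prim v1 (fun x => potV k Q z x * v x) -> 0 < a -> v a != 0 -> wr u u1 v v1 a = 0 ->
  a <= x -> u x = u a / v a * v x /\ u1 x = u a / v a * v1 x.
Proof.
move=> pu pu1 pv pv1 a0 va W ax; set c := u a / v a.
have pg := primB pu (primZ c pv).
have pg1 : prim (fun x => u1 x - c * v1 x) (fun x => potV k Q z x * (u x - c * v x)).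
  by apply: prim_ext (primB pu1 (primZ c pv1)) _ _ => y y0 //; ring.
have e1 : u a - c * v a = 0 by rewrite /c divfK// subrr.
have e2 : u1 a - c * v1 a = 0.
  apply: (mulIf va); rewrite mul0r mulrBl mulrAC /c divfK//.
  by move: W; rewrite /wr => /eqP; rewrite subr_eq0 => /eqP ->; rewrite subrr.
have [h1 h2] := cauchy_uniq pg pg1 a0 e1 e2 ax.
by split; apply/eqP; rewrite -subr_eq0; apply/eqP.
Qed.

End OdeUniqueness.

(** * Rigidity by monotone quadratic expressions *)

Section MonotoneVanishing.
Variable R : realType.

Lemma mono_vanish (F f : R -> R) : rprim F f -> (forall t, 0 < t -> 0 <= f t) ->
  (forall e : R, 0 < e -> exists2 d : R, 0 < d & forall x, 0 < x -> x < d -> `|F x| <= e) ->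
  (forall e : R, 0 < e -> exists X : R, forall x, X <= x -> `|F x| <= e) ->
  forall x, 0 < x -> F x = 0.
Proof.
move=> pF f0 z0 zoo x x0; apply/eqP; rewrite eq_le; apply/andP; split.
  apply/ler_addgt0Pl => e e0; rewrite addr0; have [X hX] := zoo e e0.
  have y : x <= Num.max x X by rewrite le_max lexx.
  apply: (le_trans (rprim_mono pF f0 x0 y)); apply: (le_trans (ler_norm _)).
  by apply: hX; rewrite le_max lexx orbT.
rewrite -oppr_le0; apply/ler_addgt0Pl => e e0; rewrite addr0; have [d d0 hd] := z0 e e0.
pose y := Num.min x (d / 2); have y0 : 0 < y by rewrite lt_min x0 divr_gt0.
have yx : y <= x by rewrite ge_min lexx.
have yd : y < d by rewrite gt_min; apply/orP; right; lra.
apply: (@le_trans _ _ (- F y)); first by rewrite lerN2 (rprim_mono pF).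
by apply: (le_trans (ler_norm _)); rewrite normrN hd.
Qed.

Lemma rprim_zero (F f : R -> R) x : rprim F f -> (forall y, 0 < y -> F y = 0) -> 0 < x ->
  {for x, continuous f} -> f x = 0.
Proof.
move=> pF F0 x0 cf; have [_ <-] := rprim_derive1 pF x0 cf.
rewrite -(derive1_cst 0 x); apply: derive1_near; near=> y.
by rewrite F0//; near: y; exact: lt_nbhsr.
Unshelve. all: by end_near. Qed.

End MonotoneVanishing.

Section LadderVanishing.
Variables (R : realType) (s : CC R) (u w : R -> CC R).
Hypotheses (hs : 0 < 2 * cre s + 1)
  (pu : prim u (fun x => w x + s * cR x^-1 * u x)) (pw : prim w (fun x => u x - s * cR x^-1 * w x)).

(** Each of the quadratic expressions used below is bounded by a multiple of [N], so its smallness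
    at both ends makes them vanish. *)
Let N (x : R) := Num.max (cmod (u x) * cmod (w x)) (cmod (w x) ^+ 2 / x).
Hypotheses (z0 : forall e : R, 0 < e -> exists2 d : R, 0 < d & forall x, 0 < x -> x < d -> N x <= e)
  (zoo : forall e : R, 0 < e -> exists X : R, forall x, X <= x -> N x <= e).

(* With [X = conj w * u] one has [X' = |u|^2 + |w|^2 + 2 i Im s X / x]; hence
   [Re X] is monotone for real [s], and [Im X - Im s |w|^2 / x] is monotone
   otherwise. *)
Lemma ladder_zero x : 0 < x -> u x = 0.
Proof.
set nu := cim s.
pose sq x := cre (w x) ^+ 2 + cim (w x) ^+ 2.
pose X x := cre (w x) * cre (u x) + cim (w x) * cim (u x).
pose Y x := cre (w x) * cim (u x) - cim (w x) * cre (u x).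
have dot (a b c d : R) (p q : CC R) : (a * b + c * d) ^+ 2 <= (a ^+ 2 + c ^+ 2) * (b ^+ 2 + d ^+ 2) ->
    cmod q ^+ 2 = a ^+ 2 + c ^+ 2 -> cmod p ^+ 2 = b ^+ 2 + d ^+ 2 -> `|a * b + c * d| <= cmod p * cmod q.
  move=> h hq hp; rewrite -ler_sqr ?nnegrE ?normr_ge0 ?mulr_ge0 ?cmod_ge0//.
  by rewrite real_normK ?num_real// exprMn hp hq [leRHS]mulrC.
have Xle y : `|X y| <= cmod (u y) * cmod (w y).
  apply: dot; rewrite ?cmod_sqr//.
  by have := sqr_ge0 (cre (w y) * cim (u y) - cim (w y) * cre (u y)); nra.
have Yle y : `|Y y| <= cmod (u y) * cmod (w y).
  rewrite /Y -mulNr; apply: dot; rewrite ?cmod_sqr ?sqrrN//.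
    by have := sqr_ge0 (cre (w y) * cre (u y) + cim (w y) * cim (u y)); nra.
  by rewrite addrC.
have zer (F f : R -> R) (C : R) : rprim F f -> (forall t, 0 < t -> 0 <= f t) -> 0 < C ->
    (forall y, 0 < y -> `|F y| <= C * N y) -> forall y, 0 < y -> F y = 0.
  move=> pF f0 C0 hF; apply: (mono_vanish pF f0) => e e0.
    have [d d0 h] := z0 (divr_gt0 e0 C0); exists d => // y y0 yd.
    by apply: (le_trans (hF y y0)); rewrite mulrC -ler_pdivlMr// h.
  have [X1 h] := zoo (divr_gt0 e0 C0); exists (Num.max 1 X1) => y; rewrite ge_max => /andP[y1 yX].
  by apply: (le_trans (hF y (lt_le_trans ltr01 y1))); rewrite mulrC -ler_pdivlMr// h.
have sq0 p : 0 <= sq p by rewrite addr_ge0// sqr_ge0.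
have w0 : forall x, 0 < x -> w x = 0.
  have [nu0|nu0] := eqVneq nu 0.
    have pX : rprim X (fun x => cre (u x) ^+ 2 + cim (u x) ^+ 2 + sq x).
      have h := rprimD (rprimM pw.1 pu.1) (rprimM pw.2 pu.2).
      apply: rprim_ext h _ _ => y y0; first by rewrite /X.
      rewrite !cE -/nu nu0 /sq; ring.
    have X0 : forall y, 0 < y -> X y = 0.
      apply: (zer _ _ 1 pX) => //.
      - by move=> t _; rewrite !addr_ge0// sqr_ge0.
      - by move=> y y0; rewrite mul1r (le_trans (Xle y))// le_max lexx.
    move=> y y0; have := rprim_zero pX X0 y0 _.
    have c1 := rprim_cont (rprimD (rprimD (rprimM pu.1 pu.1) (rprimM pu.2 pu.2))
      (rprimD (rprimM pw.1 pw.1) (rprimM pw.2 pw.2))) y0.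
    rewrite -cmod_sqr /sq -cmod_sqr => /(_ c1) h; apply: cmod_eq0; apply/eqP; rewrite -sqrf_eq0.
    by have := sqr_ge0 (cmod (u y)); have := sqr_ge0 (cmod (w y)); rewrite eq_le => *; apply/andP; split => //; lra.
  have pinv : rprim (fun x : R => x^-1) (fun x => - x ^- 2) := (@prim_inv R).1.
  pose Z x := Y x / nu - sq x / x.
  have pZ : rprim Z (fun x => (2 * cre s + 1) * (cre (w x) * cre (w x) + cim (w x) * cim (w x)) * (x^-1 * x^-1)).
    have h := rprimD (rprimZ nu^-1 (rprimD (rprimM pw.1 pu.2) (rprimZ (-1) (rprimM pw.2 pu.1))))
      (rprimZ (-1) (rprimM (rprimD (rprimM pw.1 pw.1) (rprimM pw.2 pw.2)) pinv)).
    apply: rprim_ext h _ _ => y y0; first by rewrite /Z /Y /sq; ring.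
    rewrite !cE -/nu /sq; field; rewrite nu0 gt_eqF//.
  have Z0 : forall y, 0 < y -> Z y = 0.
    apply: (zer _ _ (`|nu^-1| + 1) pZ) => //.
    - move=> t t0; apply: mulr_ge0; last by rewrite mulr_ge0// invr_ge0 ltW.
      by apply: mulr_ge0; [exact: ltW|rewrite -!expr2 addr_ge0 ?sqr_ge0].
    - move=> y y0; apply: (le_trans (ler_normB _ _)); rewrite normrM [X in X + _]mulrC [leRHS]mulrDl mul1r lerD//.
        by rewrite ler_wpM2l// (le_trans (Yle y))// le_max lexx.
      by rewrite /sq -cmod_sqr ger0_norm ?divr_ge0 ?sqr_ge0 ?(ltW y0)// le_max lexx orbT.
  move=> y y0; have := rprim_zero pZ Z0 y0 _.
  have c1 := rprim_cont (rprimM (rprimZ (2 * cre s + 1) (rprimD (rprimM pw.1 pw.1) (rprimM pw.2 pw.2)))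
    (rprimM pinv pinv)) y0.
  move=> /(_ c1); rewrite -!expr2 -cmod_sqr => /eqP.
  by rewrite mulf_eq0 mulf_eq0 (gt_eqF hs) /= !expf_eq0 /= invr_eq0 (gt_eqF y0) orbF => /eqP/cmod_eq0.
(* With w = 0 the density of w is u itself, so u vanishes by continuity. *)
have pw0 : prim w u by apply: prim_ext pw _ _ => y y0 //; rewrite w0// mulr0 subr0.
move=> x0; have [c1 c2] := prim_cont pu x0.
apply: CCP.
  by rewrite (rprim_zero pw0.1 _ x0 c1)// => y /w0 ->.
by rewrite (rprim_zero pw0.2 _ x0 c2)// => y /w0 ->.
Qed.

End LadderVanishing.

Section NonzeroAtInfinity.
Variable R : realType.
Variables (M : set (CC R)) (Q : R -> CC R) (k bd : R) (z : CC R).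
Hypotheses (k0 : 2^-1 <= k) (mQ : cmeas (@pos R) Q)
  (iQ : forall x, 0 < x -> RI (Doo x) (fun y => cmod (Q y)))
  (Mbd : forall z, M z -> cmod z <= bd) (Mz : M z).

(** [vchi] tends to 1 at infinity, and [a] is taken where it differs from 1 by less than 1. *)
Lemma vs_neq0 : exists2 a : R, 1 <= a & vs Q k bd z a != 0.
Proof.
have A0 := vA_ge0 Q bd (@ltr01 R).
have e0 : 0 < (vA Q bd 1 + 1)^-1 by rewrite invr_gt0 ltr_wpDl.
have [a a0 h] := ep_vanish (endpointoo R) (vw_RI bd iQ) e0.
pose b := Num.max 1 a; have b1 : 1 <= b by rewrite le_max lexx.
have b0 := lt_le_trans ltr01 b1.
exists b => //; apply/negP; rewrite mulf_eq0 => /orP[/eqP/(congr1 (@cre R))|/eqP v0].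
  by rewrite cre_cR cre0 => /eqP; rewrite gt_eqF// expR_gt0.
have := vchi_sub1 k0 mQ iQ Mbd Mz ltr01 b1; rewrite v0 sub0r cmodN cmod1.
have I0 : 0 <= Rint (Doo b) (vw Q bd).
  by apply: Rint_ge0 => y /DooP by'; apply: vw_ge0; exact: lt_le_trans by'.
have : Rint (Doo b) (vw Q bd) < (vA Q bd 1 + 1)^-1.
  apply: le_lt_trans (le_lt_trans (ler_norm _) h); apply: Rint_sub_le.
  - exact: (ep_meas (endpointoo R)).
  - exact: (ep_meas (endpointoo R)).
  - by move=> y /DooP yb; rewrite /Doo /= in_itv /= andbT (le_trans _ yb)// le_max lexx orbT.
  - by move=> y /DooP ay; apply: vw_ge0; exact: lt_le_trans ay.
  - exact: vw_RI.
move: (Rint _ _) (vA _ _ _) I0 A0 => I A I0 A0.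
rewrite -[_^-1]mul1r ltr_pdivlMr ?ltr_wpDl// => h1 h2; nra.
Qed.

End NonzeroAtInfinity.

Lemma us_neq0 (R : realType) (M : set (CC R)) (Q : R -> CC R) (pk : kpack M Q) k z :
  cmeas (@pos R) Q -> M z -> exists2 x : R, 0 < x & us pk k z x != 0.
Proof.
move=> mQ Mz; have A0 := uA_ge0 pk k; have c0 : 0 <= kc pk 1 by rewrite (le_trans ler01)// kc_ge1.
have [d [d0 d1 h]] := uw_small pk k mQ (mulr_ge0 c0 A0) (@ltr01 R).
exists d => //; rewrite mulf_neq0 ?cpow_neq0//; apply/eqP => u0.
have := uphi_sub1 pk k mQ Mz d0 d1; have := h d d0 (lexx d).
rewrite /uphi in u0 *; rewrite u0 sub0r cmodN cmod1 => l1 l2.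
by have := lt_le_trans l1 l2; rewrite ltxx.
Qed.

Lemma upsi_small (R : realType) (M : set (CC R)) (Q : R -> CC R) (pk : kpack M Q) k z :
  cmeas (@pos R) Q -> M z -> forall e : R, 0 < e ->
  exists d : R, [/\ 0 < d, d <= 1 & forall x, 0 < x -> x <= d -> cmod (upsi pk k z x) < e].
Proof.
move=> mQ Mz e e0; have A0 := uA_ge0 pk k; have c0 : 0 <= kc pk 1 by rewrite (le_trans ler01)// kc_ge1.
have [d [d0 d1 h]] := uw_small pk k mQ (mulr_ge0 A0 c0) e0.
exists d; split => // x x0 xd; apply: le_lt_trans (h x x0 xd).
apply: le_trans (upsi_kg pk k mQ Mz x0 (le_trans xd d1)).
by rewrite ler_peMr ?cmod_ge0// kg_ge1// (le_trans xd).
Qed.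

Section FreeWronskian.
Variable R : realType.
Variables (M : set (CC R)) (pk : kpack M (fun=> 0)) (z : CC R).
Hypothesis Mz : M z.

Let mQ : cmeas (@pos R) (fun=> 0) := cmeas_cst _ _.
Let iQ (x : R) : 0 < x -> RI (Doo x) (fun y => cmod (0 : CC R)).
Proof. by move=> x0; rewrite cmod0; apply: RI0; exact: (ep_meas (endpointoo R)). Qed.
Let k0 : 2^-1 <= (1 : R). Proof. by rewrite invf_le1// ler1n. Qed.
Let bd := kbd pk.
Let Mbd : forall z, M z -> cmod z <= bd := kp_bd pk.

Local Notation u := (us pk 1 z).
Local Notation u1 := (us1 pk 1 z).
Local Notation v := (vs (fun=> 0) 1 bd z).
Local Notation v1 := (vs1 (fun=> 0) 1 bd z).

Let s : CC R := 2^-1 + z.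
Let pu := us_prim pk 1 mQ Mz.
Let pv := vs_prim k0 mQ iQ Mbd Mz.

Let w x := cpow x (- s) * upsi pk 1 z x.

Let pu' : prim u (fun x => w x + s * cR x^-1 * u x).
Proof. by apply: prim_ext pu.1 _ _ => x x0 //; rewrite addrC. Qed.

Let pw' : prim w (fun x => u x - s * cR x^-1 * w x).
Proof.
have h := primM (prim_cpow (- s)) (upsi_prim pk 1 mQ Mz); apply: prim_ext h _ _ => x x0 //.
have [e1 e2 e3 e4 e5] := cpow_half z x0; have p0 := cpow_neq0 (2^-1 + z) x0.
have X0 : cR x != 0 by rewrite cR_neq0// gt_eqF.
rewrite /w /us /urho /uq /s e1 e3 e5 cRV expr1n cR1; move: (cpow x (2^-1 + z)) p0 (upsi _ _ _ _) (uphi _ _ _ _) => P P0 a b.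
move: (cR x) X0 => X X0; move: (2^-1 + z) => t.
by field; rewrite P0 X0.
Qed.

(** For k = 1 and Q = 0 the function w = u' - s u/x satisfies w' = u - s w/x without error terms.
    Its decay at infinity comes from the proportionality of u and v, its smallness at 0 from the
    Volterra estimates for [upsi]. *)
Lemma free_wronskian : Wr pk 1 z != 0.
Proof.
apply/eqP => W0.
have [a a1 va] := vs_neq0 k0 mQ iQ Mbd Mz; have a0 := lt_le_trans ltr01 a1.
have Wa : wr u u1 v v1 a = 0 by rewrite (wr_const pu.1 pu.2 pv.1 pv.2 a0 ltr01).
have prop := wr0_proportional mQ iQ pu.1 pu.2 pv.1 pv.2 a0 va Wa.
have [C C0 hC] := vs_decay pk k0 mQ iQ Mz.
have A0 := uA_ge0 pk 1; have c0 : 0 <= kc pk 1 by rewrite (le_trans ler01)// kc_ge1.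
have mu0 : 0 < 2 * cre z + 2 by have := kp_lo pk; have := (kp_re pk Mz).1; lra.
have cs : cre s = 2^-1 + cre z by rewrite creD -cR_nat -cRV.
have psmall := upsi_small pk 1 mQ Mz.
(* The explicit rate is required by the term |w|^2 / x = |psi|^2 / x^(2 Re z + 2); the exponent is
   positive by [kp_lo]. *)
have pint x : 0 < x -> x <= 1 -> cmod (upsi pk 1 z x) <= uA pk 1 / (2 * cre z + 2) * x `^ (2 * cre z + 2).
  move=> x0 x1; have [_ h] := upsi_int pk 1 mQ Mz x0 x1; apply: (le_trans h).
  rewrite -mulrA ler_wpM2l//.
  have l1 : -1 < 1 + 2 * cre z by lra.
  have [_ e] := RI_powR0 x0 l1.
  rewrite (Rint_ext (g := fun t => t `^ (1 + 2 * cre z))); last first.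
    move=> y /D0P[y0 _]; rewrite urho_mod// /uq expr1n addr0 cR1 cmod1 mulr1 powR_add// powR_one//.
  apply: (le_trans e); rewrite (_ : 1 + 2 * cre z + 1 = 2 * cre z + 2); last by ring.
  by rewrite mulrC.
have uz x : 0 < x -> u x = 0.
  move: x; apply: (ladder_zero (s := s) _ pu' pw').
  - by rewrite cs; lra.
  - move=> e e0; pose K := uA pk 1 + uA pk 1 / (2 * cre z + 2) + 1.
    have B0 : 0 <= uA pk 1 / (2 * cre z + 2) by rewrite divr_ge0// ltW.
    have K0 : 0 < K by rewrite ltr_wpDl// addr_ge0.
    have [d [d0 d1 h]] := psmall _ (divr_gt0 e0 K0).
    exists d => // x x0 xd; have x1 := ltW (lt_le_trans xd d1).
    have hx := ltW (h x x0 (ltW xd)); have p0 := cmod_ge0 (upsi pk 1 z x).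
    have Kp : cmod (upsi pk 1 z x) * K <= e by rewrite -ler_pdivlMr.
    have wE : cmod (w x) = (x `^ cre s)^-1 * cmod (upsi pk 1 z x) by rewrite cmodM cmod_cpow// creN powR_N.
    have Pp := powR_pos (cre s) x0.
    rewrite ge_max; apply/andP; split; apply: le_trans Kp.
      rewrite (cmodM (cpow x s)) cmod_cpow// wE.
      rewrite (_ : _ * _ = cmod (upsi pk 1 z x) * cmod (uphi pk 1 z x)); last by field; rewrite gt_eqF.
      by rewrite ler_wpM2l// (le_trans (uphi_le pk 1 mQ Mz x0 x1))// /K -addrA lerDl addr_ge0.
    rewrite wE; apply: (@le_trans _ _ (cmod (upsi pk 1 z x) * (uA pk 1 / (2 * cre z + 2)))); last first.
      by rewrite ler_wpM2l// /K -addrA addrC -addrA lerDl addr_ge0.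
    have -> : ((x `^ cre s)^-1 * cmod (upsi pk 1 z x)) ^+ 2 / x = cmod (upsi pk 1 z x) * (cmod (upsi pk 1 z x) / x `^ (2 * cre z + 2)).
      have -> : 2 * cre z + 2 = cre s + cre s + 1 by rewrite cs; field.
      rewrite !powR_add// powR_one//; field; rewrite !gt_eqF//.
    by rewrite ler_wpM2l// ler_pdivrMr ?powR_pos// pint.
  - move=> e e0; set c := u a / v a in prop.
    pose D := (1 + cmod s) * (cmod c * C).
    have cC : 0 <= cmod c * C by rewrite mulr_ge0 ?cmod_ge0.
    have D0 : 0 <= D by rewrite mulr_ge0// addr_ge0 ?cmod_ge0.
    have [X X1 hX] := exp_small (@ltr01 R) (D * D) e0.
    exists (Num.max a X) => x; rewrite ge_max => /andP[ax Xx].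
    have x1 := le_trans a1 ax; have x0 := lt_le_trans ltr01 x1.
    have [p1 p2] := prop x ax; have [h1 h2] := hC x x1.
    have wE : w x = u1 x - s * cR x^-1 * u x by rewrite /us1 -/s -/(w x) addrAC subrr add0r.
    set E := expR (-1 * x) in h1 h2; have E0 : 0 <= E by exact: expR_ge0.
    have E1 : E <= 1 by rewrite -expR0 ler_expR mulN1r oppr_le0 ltW.
    have EX : E <= expR (-1 * X) by rewrite ler_expR !mulN1r lerN2.
    have bu : cmod (u x) <= cmod c * C * E by rewrite p1 (cmodM c) -mulrA ler_wpM2l ?cmod_ge0.
    have bw : cmod (w x) <= D * E.
      rewrite wE p2; apply: (le_trans (cmodB _ _)); rewrite (_ : D * E = cmod c * C * E + cmod s * (cmod c * C) * E); last by rewrite /D; ring.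
      apply: lerD.
        by rewrite (cmodM c) -mulrA ler_wpM2l ?cmod_ge0.
      rewrite (cmodM (s * _)) (cmodM s) cmod_cR -!(mulrA (cmod s)) ler_wpM2l ?cmod_ge0//.
      rewrite -[leRHS]mul1r; apply: ler_pM; rewrite ?cmod_ge0//.
      by rewrite ger0_norm ?invr_ge0 ?(ltW x0)// invf_le1.
    have bu' : cmod (u x) <= D * E.
      by apply: (le_trans bu); rewrite ler_wpM2r// /D mulrDl mul1r lerDl mulr_ge0 ?cmod_ge0.
    have fin t : t <= D * E * (D * E) -> t <= e.
      move=> h; apply: (le_trans h); apply: ltW; apply: le_lt_trans hX.
      rewrite mulrACA; apply: ler_wpM2l; first exact: mulr_ge0.
      by apply: le_trans EX; rewrite ler_piMl.
    rewrite ge_max; apply/andP; split; apply: fin.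
      by apply: ler_pM; rewrite ?cmod_ge0.
    apply: (@le_trans _ _ (cmod (w x) ^+ 2)); last by rewrite expr2; apply: ler_pM; rewrite ?cmod_ge0.
    by rewrite ler_piMr ?sqr_ge0// invf_le1.
have [d d0] := us_neq0 pk 1 mQ Mz; by rewrite uz ?eqxx.
Qed.

End FreeWronskian.

(* [W f = v * W(u, f) + u * W(f, v)] and [W(u, f)' = Q u f] bound [|f| / U] by half of itself. *)
Section Contraction.
Variable R : realType.
Variables (V Q u u1 v v1 f f1 : R -> CC R) (W : CC R) (U m : R -> R) (S0 : R).
Hypotheses (pu : prim u u1) (pu1 : prim u1 (fun x => V x * u x))
  (pv : prim v v1) (pv1 : prim v1 (fun x => V x * v x))
  (pf : prim f f1) (pf1 : prim f1 (fun x => (V x + Q x) * f x))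
  (WE : forall x, 0 < x -> wr u u1 v v1 x = W) (W0 : W != 0)
  (U0 : forall x, 0 < x -> 0 <= U x) (m0 : forall x, 0 < x -> 0 <= m x)
  (m1 : forall x, 0 < x -> RI (D0 x) m) (m2 : forall x, 0 < x -> RI (Doo x) m)
  (l1 : forall x, 0 < x -> Rint (D0 x) m <= cmod W / 4) (l2 : forall x, 0 < x -> Rint (Doo x) m <= cmod W / 4)
  (b1 : forall x y, 0 < y -> y <= x -> cmod (u y) * cmod (Q y) * U y * cmod (v x) <= U x * m y)
  (b2 : forall x y, 0 < x -> x <= y -> cmod (v y) * cmod (Q y) * U y * cmod (u x) <= U x * m y)
  (z0 : forall e : R, 0 < e -> exists2 d : R, 0 < d & forall x, 0 < x -> x < d -> cmod (wr u u1 f f1 x) <= e)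
  (zoo : forall e : R, 0 < e -> exists X : R, forall x, X <= x -> cmod (wr f f1 v v1 x) <= e)
  (S00 : 0 <= S0) (fU : forall x, 0 < x -> cmod (f x) <= S0 * U x).

Let small (a c : R) : 0 <= c -> (forall e : R, 0 < e -> a <= c * e) -> a <= 0.
Proof.
move=> c0 h; apply/ler_addgt0Pl => e e0; rewrite addr0.
have c1 : 0 < c + 1 by rewrite ltr_wpDl.
apply: (le_trans (h _ (divr_gt0 e0 c1))); rewrite mulrCA ler_piMr ?(ltW e0)//.
by rewrite ler_pdivrMr// mul1r lerDl.
Qed.

Let step S : 0 <= S -> (forall x, 0 < x -> cmod (f x) <= S * U x) ->
  forall x, 0 < x -> cmod (f x) <= S / 2 * U x.
Proof.
move=> SS hS x x0.
have q1 : cmod (v x * wr u u1 f f1 x) <= S * U x * (cmod W / 4).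
  rewrite -subr_le0; apply: (small (cmod_ge0 (v x))) => e e0.
  have [d d0 hd] := z0 e0; pose y := Num.min x (d / 2).
  have y0 : 0 < y by rewrite lt_min x0 divr_gt0.
  have yx : y <= x by rewrite ge_min lexx.
  have yd : y < d by rewrite gt_min; apply/orP; right; lra.
  have p := primZ (v x) (wr_prim pu pu1 pf pf1).
  have [ci e1] := prim_int p y0 yx.
  have D0s : `[y, x] `<=` D0 x.
    by move=> t; rewrite /D0 /= !in_itv /= => /andP[yt ->]; rewrite (lt_le_trans y0).
  have mD := ep_meas (endpoint0 R) x.
  have wi := RI_Z (S * U x) mD (m1 x0); have wi' := RI_sub (measurable_itv _) mD D0s wi.
  have h : cmod (v x * wr u u1 f f1 x - v x * wr u u1 f f1 y) <= S * U x * (cmod W / 4).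
    rewrite e1; apply: (@le_trans _ _ (Rint `[y, x] (fun t => S * U x * m t))).
      apply: cint_le => // t /D0s/D0P[t0 tx].
      rewrite addrAC subrr add0r !cmodM; apply: (@le_trans _ _ (S * (cmod (u t) * cmod (Q t) * U t * cmod (v x)))).
        rewrite (_ : S * _ = cmod (v x) * (cmod (Q t) * (cmod (u t) * (S * U t)))); last by ring.
        by rewrite !ler_wpM2l ?cmod_ge0// hS.
      by rewrite -[leRHS]mulrA; apply: ler_wpM2l => //; exact: b1.
    apply: (@le_trans _ _ (Rint (D0 x) (fun t => S * U x * m t))).
      by apply: Rint_sub_le => // t /D0P[t0 _]; rewrite !mulr_ge0 ?U0 ?m0.
    by rewrite RintZ ?(m1 x0)//; apply: ler_wpM2l; [rewrite mulr_ge0 ?U0|exact: l1].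
  have h2 : cmod (v x * wr u u1 f f1 y) <= cmod (v x) * e by rewrite cmodM ler_wpM2l ?cmod_ge0// hd.
  have := cmodD (v x * wr u u1 f f1 x - v x * wr u u1 f f1 y) (v x * wr u u1 f f1 y).
  rewrite subrK; move: (cmod _) (cmod _) (cmod _) h h2 => a b c; lra.
have q2 : cmod (u x * wr f f1 v v1 x) <= S * U x * (cmod W / 4).
  rewrite -subr_le0; apply: (small (cmod_ge0 (u x))) => e e0.
  have [X hX] := zoo e0; pose y := Num.max x X.
  have xy : x <= y by rewrite le_max lexx.
  have Xy : X <= y by rewrite le_max lexx orbT.
  have p := primZ (u x) (wr_prim pf pf1 pv pv1).
  have [ci e1] := prim_int p x0 xy.
  have Ds : `[x, y] `<=` Doo x by move=> t; rewrite /Doo /= !in_itv /= => /andP[-> _].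
  have mD := ep_meas (endpointoo R) x.
  have wi := RI_Z (S * U x) mD (m2 x0); have wi' := RI_sub (measurable_itv _) mD Ds wi.
  have h : cmod (u x * wr f f1 v v1 y - u x * wr f f1 v v1 x) <= S * U x * (cmod W / 4).
    rewrite e1; apply: (@le_trans _ _ (Rint `[x, y] (fun t => S * U x * m t))).
      apply: cint_le => // t /Ds/DooP xt; have t0 := lt_le_trans x0 xt.
      rewrite opprD addrA subrr add0r !cmodM cmodN; apply: (@le_trans _ _ (S * (cmod (v t) * cmod (Q t) * U t * cmod (u x)))).
        rewrite (_ : S * _ = cmod (u x) * (cmod (Q t) * ((S * U t) * cmod (v t)))); last by ring.
        by rewrite !ler_wpM2l ?cmod_ge0// ler_wpM2r ?cmod_ge0// hS.
      by rewrite -[leRHS]mulrA; apply: ler_wpM2l => //; exact: b2.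
    apply: (@le_trans _ _ (Rint (Doo x) (fun t => S * U x * m t))).
      apply: Rint_sub_le => // t /DooP xt; have t0 := lt_le_trans x0 xt.
      by rewrite !mulr_ge0 ?U0 ?m0.
    by rewrite RintZ ?(m2 x0)//; apply: ler_wpM2l; [rewrite mulr_ge0 ?U0|exact: l2].
  have h2 : cmod (u x * wr f f1 v v1 y) <= cmod (u x) * e by rewrite cmodM ler_wpM2l ?cmod_ge0// hX.
  have := cmodB (u x * wr f f1 v v1 y) (u x * wr f f1 v v1 y - u x * wr f f1 v v1 x).
  rewrite subKr; move: (cmod _) (cmod _) (cmod _) h h2 => a b c; lra.
have := wr_identity u u1 v v1 f f1 x; rewrite (WE x0) => /(congr1 (@cmod R)) e3.
have Wp : 0 < cmod W by rewrite cmod_gt0.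
have : cmod (f x) * cmod W <= S * U x * (cmod W / 4) + S * U x * (cmod W / 4).
  by rewrite -cmodM e3; apply: (le_trans (cmodD _ _)); rewrite addrC lerD.
rewrite (_ : S * U x * (cmod W / 4) + S * U x * (cmod W / 4) = S / 2 * U x * cmod W); last by field.
by rewrite ler_pM2r.
Qed.

Lemma contraction_zero x : 0 < x -> f x = 0.
Proof.
move=> x0; apply: cmod_eq0; apply/eqP; rewrite eq_le cmod_ge0 andbT.
have h n : forall x, 0 < x -> cmod (f x) <= (S0 / 2 ^+ n) * U x.
  elim: n => [|n IH]; first by rewrite expr0 divr1.
  have -> : S0 / 2 ^+ n.+1 = S0 / 2 ^+ n / 2 by rewrite exprSr invfM mulrA.
  by apply: step => //; rewrite divr_ge0// exprn_ge0.
apply: (@half_pow_le0 _ _ (S0 * U x)) => n.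
by apply: (le_trans (h n x x0)); rewrite mulrAC exprVn.
Qed.

End Contraction.

(** * Scaling of the free problem *)

Section Scaling.
Variable R : realType.

Lemma rprim_scale (F f : R -> R) k : 0 < k -> rprim F f -> (forall x, 0 < x -> {for x, continuous f}) ->
  rprim (fun x => F (k * x)) (fun x => k * f (k * x)).
Proof.
move=> k0 pF cf; have dk (x : R) : is_derive x (1 : R) (fun x : R => k * x) k.
  have := is_deriveM (is_derive_cst k x 1) (is_derive_id x 1) => h; apply: is_derive_eq h _.
  by rewrite /GRing.scale /= mulr1 mulr0 addr0.
have ck x : {for x, continuous (fun x : R => k * x)} by exact: derive_cont (dk x).
apply: rprim_C1 => x x0; have kx : 0 < k * x by rewrite mulr_gt0.
  have [d e] := rprim_derive1 pF kx (cf _ kx); rewrite derive1E in e.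
  have dF : is_derive (k * x) 1 F (f (k * x)) := DeriveDef d e.
  by have := is_derive1_comp dF (dk x); rewrite mulrC.
apply: continuousM; first exact: cst_continuous.
by apply: (continuous_comp (ck x)); exact: cf.
Qed.

Lemma prim_scale (F f : R -> CC R) k : 0 < k -> prim F f -> (forall x, 0 < x -> ccont f x) ->
  prim (fun x => F (k * x)) (fun x => cR k * f (k * x)).
Proof.
move=> k0 [p1 p2] cf; split.
  have := rprim_scale k0 p1 (fun x x0 => (cf x x0).1) => h; apply: rprim_ext h _ _ => x x0 //.
  by rewrite !cE mul0r subr0.
have := rprim_scale k0 p2 (fun x x0 => (cf x x0).2) => h; apply: rprim_ext h _ _ => x x0 //.
by rewrite !cE mul0r addr0.
Qed.

Lemma potV_scale k z x : 0 < x -> 0 < k ->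
  cR k * (cR k * potV 1 (fun=> 0) z (k * x)) = potV k (fun=> 0) z x :> CC R.
Proof.
move=> x0 k0; rewrite /potV !addr0 !mulrDr expr1n cR1 mulr1 -cRM -expr2; congr (_ + _).
rewrite (mulrCA (cR k) (_ - _)) (mulrCA (cR k) (_ - _)) -!cRM; congr (_ * cR _).
by field; rewrite !gt_eqF.
Qed.

Lemma potV_ccont k z x : 0 < x -> ccont (potV k (fun=> (0 : CC R)) z) x.
Proof.
move=> x0; have cx : ccont (fun x : R => cR (x ^- 2)) x.
  have := ccontM (prim_cont (@prim_inv R) x0) (prim_cont (@prim_inv R) x0).
  by rewrite (_ : (fun x => cR x^-1 * cR x^-1) = fun x : R => cR (x ^- 2))//; apply/funext => y; rewrite -cRM expr2 invfM.
have [h1 h2] := ccontM (ccont_cst (z ^+ 2 - 4^-1) x) cx.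
split.
  rewrite (_ : (fun y => _) = fun y => cre ((z ^+ 2 - 4^-1) * cR (y ^- 2)) + k ^+ 2).
    by apply: cvgD => //; exact: cvg_cst.
  by apply/funext => y; rewrite /potV addr0 creD.
rewrite (_ : (fun y => _) = fun y => cim ((z ^+ 2 - 4^-1) * cR (y ^- 2))) //.
by apply/funext => y; rewrite /potV addr0 cimD cim_cR addr0.
Qed.

End Scaling.

Section PackZero.
Variables (R : realType) (M : set (CC R)) (Q : R -> CC R) (pk : kpack M Q).
Hypothesis mQ : cmeas (@pos R) Q.

Let m0 x : 0 < x -> RI (D0 x) (fun y => kc pk y * (y * kw pk y * (1 + cmod (0 : CC R)))).
Proof.
move=> x0; apply: RI_le (kp_int pk x0).
- exact: (ep_meas (endpoint0 R)).
- apply: measurable_funS (@pos_meas R) (ep_pos (endpoint0 R) x0) _.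
  apply: measurable_funM; first exact: kc_meas.
  apply: measurable_funM; last exact: measurable_cst.
  by apply: measurable_funM; [exact: (rprim_meas (@rprim_id R))|exact: kw_meas].
move=> y /D0P[y0 _]; have c0 : 0 <= kc pk y by rewrite (le_trans ler01)// kc_ge1.
rewrite cmod0 addr0 mulr1 ger0_norm ?mulr_ge0 ?kw_ge0 ?(ltW y0)//.
by rewrite ler_wpM2l// ler_peMr ?mulr_ge0 ?kw_ge0 ?(ltW y0)// lerDl cmod_ge0.
Qed.

(** The weights for [Q] also serve the free problem, as 1 <= 1 + |Q|; the comparison relies on both
    problems having the same [kw]. *)
Definition kpack0 : kpack M (fun=> 0) :=
  KPack (kw_meas pk) (kc_meas pk) (kw_ge0 pk) (kw_one pk) (kc_ge1 pk) (kc_mono pk) (kB_ge0 pk)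
    (kw_anti pk) (kw_anti2 pk) (kp_e pk) (kp_B pk) m0 (kp_pow pk) (kp_re pk) (kp_bd pk)
    (kp_lo pk) (kp_sum pk) (kp_dif pk).

End PackZero.

Section Mass.
Variables (R : realType) (w q : R -> R).
Hypotheses (w0 : forall x, 0 < x -> 0 <= w x) (q0 : forall x, 0 < x -> 0 <= q x)
  (iw : forall x, 0 < x -> RI (D0 x) w) (iq : forall x, 0 < x -> RI (Doo x) q).

(** A majorant for the rescaled kernel times |Q|: near 0 the weight picks up a factor [k], beyond
    [a] only |Q| remains. Its integral is made small relative to [k], not in absolute terms. *)
Definition mass (a k : R) (y : R) : R := k * (w \_ (D0 a)) y + (q \_ (Doo a)) y.

Lemma mass_small (e : R) : 0 < e -> exists a : R, exists k : R, [/\ 0 < a, a <= 1, 1 <= k * a,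
  RI setT (mass a k) & Rint setT (mass a k) <= e * k].
Proof.
move=> e0; have e2 : 0 < e / 2 by rewrite divr_gt0.
have [a1 a10 ha] := ep_vanish (endpoint0 R) iw e2.
pose a := Num.min a1 1; have a0 : 0 < a by rewrite lt_min a10 ltr01.
have mD0 := ep_meas (endpoint0 R); have mDoo := ep_meas (endpointoo R).
have Ia : Rint (D0 a) w <= e / 2.
  apply: (le_trans _ (ltW (le_lt_trans (ler_norm _) ha))); apply: Rint_sub_le => //.
  - by move=> y /D0P[y0 ya]; rewrite /D0 /= in_itv /= y0 (le_trans ya)// ge_min lexx.
  - by move=> y /D0P[y0 _]; exact: w0.
  - exact: iw.
pose I := Rint (Doo a) q.
have I0 : 0 <= I by apply: Rint_ge0 => y /DooP ay; rewrite q0// (lt_le_trans a0).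
(* [a^-1] ensures [1 <= k * a]; [2 * I / e] makes the mass beyond [a] at most half of [e * k], the
   other half being for ]0, a]. *)
pose k := a^-1 + 2 * I / e.
have J0 : 0 <= 2 * I / e by rewrite !mulr_ge0// invr_ge0 ltW.
have k0 : 0 < k by rewrite ltr_pwDl// invr_gt0.
have iw' := RI_restrict (mD0 a) (iw a0); have iq' := RI_restrict (mDoo a) (iq a0).
exists a, k; split => //; first by rewrite ge_min lexx orbT.
- by rewrite mulrDl mulVf ?gt_eqF// lerDl mulr_ge0// ltW.
- by apply: RI_D => //; exact: RI_Z.
rewrite RintD ?RintZ//; last exact: RI_Z.
rewrite !Rint_restrict// -/I.
have kI : I <= e / 2 * k.
  by rewrite /k mulrDr (_ : e / 2 * (2 * I / e) = I) ?lerDr ?mulr_ge0 ?invr_ge0 ?(ltW a0) ?(ltW e0)//; field; rewrite gt_eqF.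
apply: (@le_trans _ _ (k * (e / 2) + e / 2 * k)); last by rewrite (_ : k * (e / 2) + e / 2 * k = e * k)//; field.
by rewrite lerD// ler_wpM2l// ltW.
Qed.

Lemma mass_ge0 a k y : 0 < a -> 0 <= k -> 0 <= mass a k y.
Proof.
move=> a0 k0; rewrite /mass !patchE; apply: addr_ge0.
  apply: mulr_ge0 => //; case: ifP => //; rewrite inE => /D0P[y0 _]; exact: w0.
by case: ifP => //; rewrite inE => /DooP ay; apply: q0; exact: lt_le_trans ay.
Qed.

Lemma mass_le a k y : 0 < a -> 0 <= k -> 0 < y -> y <= a -> k * w y <= mass a k y.
Proof.
move=> a0 k0 y0 ya; rewrite /mass [(w \_ _) _]patchE ifT; last by rewrite inE /D0 /= in_itv /= y0.
rewrite lerDl patchE; case: ifP => //; rewrite inE => /DooP _; exact: q0.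
Qed.

Lemma mass_leoo a k y : 0 < a -> 0 <= k -> a <= y -> q y <= mass a k y.
Proof.
move=> a0 k0 ay; rewrite /mass [(q \_ _) _]patchE ifT; last by rewrite inE /Doo /= in_itv /= ay.
rewrite lerDr; apply: mulr_ge0 => //; rewrite patchE; case: ifP => //; rewrite inE => /D0P[y0 _]; exact: w0.
Qed.

End Mass.

Lemma uphi_bounded (R : realType) (M : set (CC R)) (Q : R -> CC R) (pk : kpack M Q) k z :
  cmeas (@pos R) Q -> M z ->
  exists2 B : R, 0 <= B & forall x, 0 < x -> x <= 1 -> cmod (uphi pk k z x) <= B.
Proof. by move=> mQ Mz; exists (uA pk k); [exact: uA_ge0|move=> x; exact: uphi_le]. Qed.

(** * Comparison with the free problem for large k *)

Section LargeSpectralParameter.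
Variable R : realType.
Variables (M : set (CC R)) (Q : R -> CC R) (pk : kpack M Q).
Hypotheses (mQ : cmeas (@pos R) Q) (iQ : forall x, 0 < x -> RI (Doo x) (fun y => cmod (Q y))).
Variable z : CC R.
Hypothesis Mz : M z.

Let pk0 := kpack0 pk.
Let m0 : cmeas (@pos R) (fun=> 0) := cmeas_cst _ _.
Let i0 (x : R) : 0 < x -> RI (Doo x) (fun y => cmod (0 : CC R)).
Proof. by move=> x0; rewrite cmod0; apply: RI0; exact: (ep_meas (endpointoo R)). Qed.
Let k1 : 2^-1 <= (1 : R). Proof. by rewrite invf_le1// ler1n. Qed.
Let bd := kbd pk.
Let Mbd : forall z, M z -> cmod z <= bd := kp_bd pk.

Local Notation u := (us pk0 1 z).
Local Notation v := (vs (fun=> 0) 1 bd z).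
Local Notation v1 := (vs1 (fun=> 0) 1 bd z).

Let s : CC R := 2^-1 + z.

Lemma free_bounds : exists A : R, [/\ 0 <= A,
  forall x, 0 < x -> x <= 1 -> cmod (u x) <= A * x `^ cre s /\ cmod (v x) <= A * (x `^ cre s * kg pk z x) &
  forall x, 1 <= x -> [/\ cmod (u x) <= A * expR x, cmod (v x) <= A * expR (- x) & cmod (v1 x) <= A * expR (- x)]].
Proof.
have [C1 C10 h1] := us_major pk0 k1 m0 i0.
have [C2 C20 h2] := vs_decay pk0 k1 m0 i0 Mz.
have pv := vs_prim k1 m0 i0 Mbd Mz.
have [a [C3 [a0 a1 C30 h3]]] := hom_kg pk0 m0 Mz pv.1 pv.2.
have pred := primM (prim_cpow (- s)) pv.1.
have [C4 C40 h4] := rprim_bound 1 pred.1 a0; have [C5 C50 h5] := rprim_bound 1 pred.2 a0.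
have A0 := uA_ge0 pk0 1.
pose A := uA pk0 1 + C1 + C2 + C3 + C4 + C5.
exists A; split; first by rewrite !addr_ge0.
  move=> x x0 x1; have p0 := powR_ge0 x (cre s); split.
    rewrite cmodM cmod_cpow// mulrC ler_wpM2r// (le_trans (uphi_le pk0 1 m0 Mz x0 x1))//.
    by rewrite /A -!addrA lerDl !addr_ge0.
  have g0 := kg_ge0 pk z x0.
  have : cmod (redphi z v x) <= A * kg pk z x.
    have [xa|ax] := leP x a.
      by apply: (le_trans (h3 x x0 xa)); rewrite ler_wpM2r// /A; lra.
    apply: (@le_trans _ _ (C4 + C5)); last first.
      have g1 := kg_ge1 pk Mz x0 x1; apply: (@le_trans _ _ A); first by rewrite /A; lra.
      by rewrite ler_peMr// /A !addr_ge0.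
    by apply: (le_trans (cmod_le _)); apply: lerD; [apply: h4|apply: h5]; rewrite (ltW ax).
  rewrite /redphi cmodM cmod_cpow// creN powR_N// mulrC ler_pdivrMr ?powR_pos//.
  by rewrite mulrAC mulrA.
move=> x x1; have x0 := lt_le_trans ltr01 x1; have [h6 h7] := h2 x x1; rewrite mulN1r in h6 h7.
split.
- apply: (le_trans (h1 z x Mz x0)); rewrite /ma; case: ifP => xx.
    have -> : x = 1 by apply/eqP; rewrite eq_le xx.
    rewrite powR1 mulr1; apply: (@le_trans _ _ (A * 1)); first by rewrite mulr1 /A; lra.
    by rewrite ler_wpM2l /A ?addr_ge0// -expR0 ler_expR.
  by rewrite mul1r ler_wpM2r ?expR_ge0// /A; lra.
- by apply: (le_trans h6); rewrite ler_wpM2r ?expR_ge0// /A; lra.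
- by apply: (le_trans h7); rewrite ler_wpM2r ?expR_ge0// /A; lra.
Qed.

Let cs := cre s.

Lemma cre_half : cs = 2^-1 + cre z.
Proof. by rewrite /cs creD -cR_nat -cRV. Qed.

Lemma powR_kg t : 0 < t -> t `^ cs * t `^ cs * kg pk z t = t * kw pk t.
Proof.
move=> t0; rewrite /kg mulrA -!powR_add// cre_half (_ : _ + _ - _ = 1) ?powR_one//.
by field.
Qed.

(** The profile against which the contraction measures solutions: that of [u] up to 1, constant
    afterwards, so that beyond 1 the product of the growing and the decaying exponential is simply
    bounded by 1. *)
Let U0 (t : R) : R := if t <= 1 then t `^ cs else 1.
Let n0 (t : R) : R := if t <= 1 then t * kw pk t else 1.

Let U0_ge0 t : 0 <= U0 t. Proof. by rewrite /U0; case: ifP => // _; exact: powR_ge0. Qed.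

Lemma free_kernel : exists2 A : R, 0 <= A & [/\ forall t x, 0 < t -> t <= x ->
    cmod (u t) * U0 t * cmod (v x) <= U0 x * (A * n0 t),
  forall t x, 0 < x -> x <= t -> cmod (v t) * U0 t * cmod (u x) <= U0 x * (A * n0 t) &
  forall x, 1 <= x -> cmod (v x) <= A * expR (- x) /\ cmod (v1 x) <= A * expR (- x)].
Proof.
have [A [A0 hA hB]] := free_bounds; exists (A * A + A); first by rewrite addr_ge0// mulr_ge0.
have n00 t : 0 < t -> 0 <= n0 t.
  by move=> t0; rewrite /n0; case: ifP => // _; rewrite mulr_ge0 ?kw_ge0// ltW.
have fin t x B : 0 < t -> B <= U0 x * (A * A * n0 t) -> B <= U0 x * ((A * A + A) * n0 t).
  move=> t0 /le_trans; apply; rewrite ler_wpM2l// ler_wpM2r ?n00//; lra.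
split.
- move=> t x t0 tx; have x0 := lt_le_trans t0 tx; apply: fin => //; rewrite /U0 /n0.
  have [x1|x1] := leP x 1.
    rewrite (le_trans tx x1); have [b1 _] := hA t t0 (le_trans tx x1); have [_ b2] := hA x x0 x1.
    have gg : kg pk z x <= kg pk z t := kw_anti2 pk Mz t0 tx x1.
    rewrite -powR_kg//; apply: (@le_trans _ _ (A * t `^ cs * t `^ cs * (A * (x `^ cs * kg pk z x)))).
      by apply: ler_pM; rewrite ?mulr_ge0 ?cmod_ge0 ?powR_ge0// ler_wpM2r ?powR_ge0.
    rewrite (_ : A * t `^ cs * t `^ cs * _ = x `^ cs * (A * A * (t `^ cs * t `^ cs * kg pk z x))); last by ring.
    by rewrite !ler_wpM2l ?mulr_ge0 ?powR_ge0.
  have [_ b2 _] := hB x (ltW x1).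
  have e1 : expR (- x) <= 1 by rewrite -expR0 ler_expR oppr_le0 ltW.
  have [t1|t1] := leP t 1; last first.
    have [b1 _ _] := hB t (ltW t1); rewrite mulr1 mul1r mulr1.
    apply: (@le_trans _ _ (A * expR t * (A * expR (- x)))); first by apply: ler_pM; rewrite ?cmod_ge0.
    by rewrite mulrACA -expRD ler_piMr ?mulr_ge0// -expR0 ler_expR subr_le0.
  have [b1 _] := hA t t0 t1; rewrite mul1r -powR_kg//.
  apply: (@le_trans _ _ (A * t `^ cs * t `^ cs * (A * 1))).
    apply: ler_pM; rewrite ?mulr_ge0 ?cmod_ge0 ?powR_ge0 ?ler_wpM2r ?powR_ge0//.
    by apply: (le_trans b2); rewrite ler_wpM2l.
  rewrite (_ : A * t `^ cs * t `^ cs * _ = A * A * (t `^ cs * t `^ cs * 1)); last by ring.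
  by rewrite !ler_wpM2l ?mulr_ge0 ?powR_ge0// kg_ge1.
- move=> t x x0 xt; have t0 := lt_le_trans x0 xt; apply: fin => //; rewrite /U0 /n0.
  have [t1|t1] := leP t 1.
    have x1 := le_trans xt t1; rewrite x1; have [_ b1] := hA t t0 t1; have [b2 _] := hA x x0 x1.
    rewrite -powR_kg//; apply: (@le_trans _ _ (A * (t `^ cs * kg pk z t) * t `^ cs * (A * x `^ cs))).
      by apply: ler_pM; rewrite ?mulr_ge0 ?cmod_ge0 ?powR_ge0// ler_wpM2r ?powR_ge0.
    by rewrite le_eqVlt; apply/orP; left; apply/eqP; ring.
  have [_ b1 _] := hB t (ltW t1); rewrite !mulr1.
  have e1 : expR (- t) <= 1 by rewrite -expR0 ler_expR oppr_le0 ltW.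
  have [x1|x1] := leP x 1.
    have [b2 _] := hA x x0 x1.
    rewrite (_ : _ * (A * A) = A * 1 * (A * x `^ cs)); last by ring.
    by apply: ler_pM; rewrite ?cmod_ge0// (le_trans b1)// ler_wpM2l.
  have [b2 _ _] := hB x (ltW x1); rewrite mul1r.
  apply: (@le_trans _ _ (A * expR (- t) * (A * expR x))); first by apply: ler_pM; rewrite ?cmod_ge0.
  by rewrite mulrACA -expRD ler_piMr ?mulr_ge0// -expR0 ler_expR addrC subr_le0.
move=> x x1; have [_ b1 b2] := hB x x1.
by split; [apply: (le_trans b1)|apply: (le_trans b2)]; rewrite ler_wpM2r ?expR_ge0// lerDr mulr_ge0.
Qed.

Let w y := y * kw pk y * cmod (Q y).
Let q y := cmod (Q y).

Let w0 x : 0 < x -> 0 <= w x.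
Proof. by move=> x0; rewrite !mulr_ge0 ?kw_ge0 ?cmod_ge0// ltW. Qed.

Let q0 x : 0 < x -> 0 <= q x. Proof. by move=> _; exact: cmod_ge0. Qed.

Let iw x : 0 < x -> RI (D0 x) w.
Proof.
move=> x0; apply: RI_le (kp_int pk x0).
- exact: (ep_meas (endpoint0 R)).
- apply: measurable_funS (@pos_meas R) (ep_pos (endpoint0 R) x0) _.
  apply: measurable_funM; last exact: cmeas_mod.
  by apply: measurable_funM; [exact: (rprim_meas (@rprim_id R))|exact: kw_meas].
move=> y /D0P[y0 _]; have c0 := kc_ge1 pk y0; have p0 : 0 <= y * kw pk y by rewrite mulr_ge0 ?kw_ge0// ltW.
have r0 := cmod_ge0 (Q y); rewrite ger0_norm ?w0// /w.
have p1 : 0 <= y * kw pk y * (1 + cmod (Q y)) by rewrite mulr_ge0// addr_ge0.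
apply: (@le_trans _ _ (y * kw pk y * (1 + cmod (Q y)))); first by rewrite ler_wpM2l// lerDr.
by rewrite ler_peMl.
Qed.

(** As [kw] is antitone, kw (k y) <= kw y when k y <= 1; when k y > 1 and y <= a, the value 1 is at
    most k y kw y because kw >= 1 on ]0, 1]. *)
Let n0_mass a k y : 0 < a -> a <= 1 -> 1 <= k * a -> 0 < k -> 0 < y -> n0 (k * y) * cmod (Q y) <= mass w q a k y.
Proof.
move=> a0 a1 ka k0 y0; have kge : 1 <= k by rewrite (le_trans ka)// ler_piMr// ltW.
have ge y' : y' <= a -> 0 < y' -> n0 (k * y') * cmod (Q y') <= k * w y'.
  move=> ya y'0; have ky0 : 0 < k * y' by rewrite mulr_gt0.
  rewrite /w !mulrA ler_wpM2r ?cmod_ge0// /n0; case: ifP => ky; last first.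
    move/negbT : ky; rewrite -ltNge => /ltW h; rewrite -[leLHS]mulr1; apply: ler_pM => //.
    by apply: kw_ge1 => //; exact: le_trans a1.
  by rewrite ler_wpM2l ?(ltW ky0)//; apply: kw_anti => //; rewrite ler_peMl// ltW.
have [ya|ay] := leP y a; first by apply: (le_trans (ge y ya y0)); apply: mass_le => //; exact: ltW.
have -> : n0 (k * y) = 1.
  by rewrite /n0 ifF//; apply/negbTE; rewrite -ltNge (le_lt_trans ka)// ltr_pM2l.
by rewrite mul1r; exact: (@mass_leoo _ w q w0 a k y a0 (ltW k0) (ltW ay)).
Qed.

Let pu := us_prim pk0 1 m0 Mz.
Let pv := vs_prim k1 m0 i0 Mbd Mz.

Let g (k x : R) := u (k * x).
Let g1 (k x : R) : CC R := cR k * us1 pk0 1 z (k * x).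
Let h (k x : R) := v (k * x).
Let h1 (k x : R) : CC R := cR k * v1 (k * x).

Lemma scale_prim f f1 k : 0 < k -> prim f f1 -> prim f1 (fun x => potV 1 (fun=> 0) z x * f x) ->
  prim (fun x => f (k * x)) (fun x => cR k * f1 (k * x)) /\
  prim (fun x => cR k * f1 (k * x)) (fun x => potV k (fun=> 0) z x * f (k * x)).
Proof.
move=> k0 pf pf1; split; first by apply: prim_scale => // x x0; exact: prim_cont pf1 x0.
have c x (x0 : 0 < x) := ccontM (potV_ccont 1 z x0) (prim_cont pf x0).
have := primZ (cR k) (prim_scale k0 pf1 c) => p; apply: prim_ext p _ _ => x x0 //.
by rewrite -(potV_scale z x0 k0) -!mulrA.
Qed.

Section ScaledComparison.
Variable k : R.
Hypothesis kge : 1 <= k.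
Let kp : 0 < k := lt_le_trans ltr01 kge.
Let kh : 2^-1 <= k := le_trans k1 kge.

Local Notation f := (us pk k z).
Local Notation f1 := (us1 pk k z).
Local Notation vk := (vs Q k bd z).

(** Both functions are multiples of x^s times bounded functions, with the same logarithmic
    derivative s/x to leading order; these terms cancel, and each remaining one contains one of the
    two [upsi], which tend to 0. *)
Lemma scaled_wr0 (e : R) : 0 < e ->
  exists2 d : R, 0 < d & forall x, 0 < x -> x < d -> cmod (wr (g k) (g1 k) f f1 x) <= e.
Proof.
move=> e0; have [B1 B10 hB1] := uphi_bounded pk0 1 m0 Mz; have [B2 B20 hB2] := uphi_bounded pk k mQ Mz.
pose K1 := cmod (cpow k s) * B1; pose K2 := k * cmod (cpow k (- s)) * B2.
have K10 : 0 <= K1 by rewrite mulr_ge0 ?cmod_ge0.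
have K20 : 0 <= K2 by rewrite !mulr_ge0 ?cmod_ge0// ltW.
have Kp : 0 < K1 + K2 + 1 by rewrite ltr_wpDl// addr_ge0.
have e1 := divr_gt0 e0 Kp.
have [d1 [d10 d11 h1']] := upsi_small pk0 1 m0 Mz e1; have [d2 [d20 d21 h2']] := upsi_small pk k mQ Mz e1.
exists (Num.min (d1 / k) d2); first by rewrite lt_min divr_gt0.
move=> x x0; rewrite lt_min => /andP[/ltW xd1 /ltW xd2].
have kx0 : 0 < k * x by rewrite mulr_gt0.
have kx1 : k * x <= d1 by rewrite mulrC -ler_pdivlMr.
have -> : wr (g k) (g1 k) f f1 x = cpow k s * (uphi pk0 1 z (k * x) * upsi pk k z x) -
    cR k * cpow k (- s) * (upsi pk0 1 z (k * x) * uphi pk k z x).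
  rewrite /wr /g /g1 /us1 /us -/s !cpowN cpowM// (cRV (k * x)) (cRM k x).
  have p1 := cpow_neq0 s kp; have p2 := cpow_neq0 s x0.
  have p3 : cR k != 0 by rewrite cR_neq0// gt_eqF.
  have p4 : cR x != 0 by rewrite cR_neq0// gt_eqF.
  rewrite cRV; move: p1 p2 p3 p4; move: (cpow k s) (cpow x s) (cR k) (cR x) => a b c d p1 p2 p3 p4.
  move: (uphi _ _ _ _) (upsi _ _ _ _) (uphi _ _ _ _) (upsi _ _ _ _) => A B C D; move: s => t.
  by field; rewrite p1 p2 p3 p4.
apply: (@le_trans _ _ (K1 * (e / (K1 + K2 + 1)) + K2 * (e / (K1 + K2 + 1)))); last first.
  by rewrite -mulrDl mulrCA ler_piMr ?(ltW e0)// ler_pdivrMr// mul1r lerDl.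
apply: (le_trans (cmodB _ _)); apply: lerD.
  rewrite (cmodM (cpow _ _)) (cmodM (uphi _ _ _ _)) /K1 -mulrA ler_wpM2l ?cmod_ge0//.
  apply: ler_pM; [exact: cmod_ge0|exact: cmod_ge0| |exact: (ltW (h2' x x0 xd2))].
  exact: (hB1 _ kx0 (le_trans kx1 d11)).
rewrite (cmodM (cR k * _)) (cmodM (cR k)) cmod_cR (gtr0_norm kp) (cmodM (upsi _ _ _ _)) /K2 -[leRHS](mulrA _ B2).
rewrite [X in _ * X <= _]mulrC; apply: ler_wpM2l; first by rewrite mulr_ge0 ?cmod_ge0// ltW.
apply: ler_pM; [exact: cmod_ge0|exact: cmod_ge0| |exact: (ltW (h1' _ kx0 kx1))].
exact: (hB2 _ x0 (le_trans xd2 d21)).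
Qed.

Hypothesis W0 : Wr pk k z = 0.

Lemma proportional_decay : exists a : R, exists C : R, [/\ 1 <= a, 0 <= C & forall x, a <= x ->
  cmod (f x) <= C * expR (- x) /\ cmod (f1 x) <= C * expR (- x)].
Proof.
have pf := us_prim pk k mQ Mz; have pvk := vs_prim kh mQ iQ Mbd Mz.
have [a a1 va] := vs_neq0 kh mQ iQ Mbd Mz; have a0 := lt_le_trans ltr01 a1.
have Wa : wr f f1 vk (vs1 Q k bd z) a = 0 by rewrite (wr_const pf.1 pf.2 pvk.1 pvk.2 a0 ltr01).
have prop := wr0_proportional mQ iQ pf.1 pf.2 pvk.1 pvk.2 a0 va Wa.
have [C C0 hC] := vs_decay pk kh mQ iQ Mz.
exists a, (cmod (f a / vk a) * C); split => //; first by rewrite mulr_ge0 ?cmod_ge0.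
move: prop; move: (f a / vk a) => c prop x ax; have [-> ->] := prop x ax.
have x1 := le_trans a1 ax; have [b1 b2] := hC x x1.
have E : expR (- k * x) <= expR (- x) by rewrite ler_expR mulNr lerN2 ler_peMl// (le_trans ler01).
by split; rewrite (cmodM c) -mulrA ler_wpM2l ?cmod_ge0//; [apply: (le_trans b1)|apply: (le_trans b2)]; rewrite ler_wpM2l.
Qed.

Lemma scaled_wroo (e : R) : 0 < e ->
  exists X : R, forall x, X <= x -> cmod (wr f f1 (h k) (h1 k) x) <= e.
Proof.
move=> e0; have [a [C [a1 C0 hC]]] := proportional_decay.
have [A A0 [_ _ hA]] := free_kernel.
have [X X1 hX] := exp_small (@ltr01 R) (2 * (C * (k * A))) e0.
exists (Num.max a X) => x; rewrite ge_max => /andP[ax Xx].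
have x1 := le_trans a1 ax; have x0 := lt_le_trans ltr01 x1.
have kx : 1 <= k * x by rewrite -[leLHS]mulr1; apply: ler_pM.
have [b1 b2] := hC x ax; have [b3 b4] := hA _ kx.
have E1 : expR (- (k * x)) <= 1 by rewrite -expR0 ler_expR oppr_le0 mulr_ge0// ltW.
have AA : A * expR (- (k * x)) <= A by rewrite ler_piMr.
have b3' : cmod (h k x) <= k * A.
  by apply: (le_trans b3); apply: (le_trans AA); rewrite ler_peMl.
have b4' : cmod (h1 k x) <= k * A.
  by rewrite /h1 (cmodM (cR k)) cmod_cR (gtr0_norm kp) ler_wpM2l ?(ltW kp)// (le_trans b4).
apply: ltW; apply: le_lt_trans hX; apply: (@le_trans _ _ (2 * (C * (k * A)) * expR (- x))); last first.
  by rewrite ler_wpM2l ?mulr_ge0 ?(ltW kp)// ler_expR mulN1r lerN2.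
rewrite (_ : 2 * _ * _ = C * expR (- x) * (k * A) + C * expR (- x) * (k * A)); last by ring.
apply: (le_trans (cmodB _ _)); rewrite (cmodM (f x)) (cmodM (f1 x)).
by apply: lerD; apply: ler_pM; rewrite ?cmod_ge0.
Qed.

(** Only finiteness of [S] matters: it starts the contraction. It is available because [f] decays
    when its Wronskian with the solution at infinity vanishes. *)
Lemma scaled_bound : exists2 S : R, 0 <= S & forall x, 0 < x -> cmod (f x) <= S * U0 (k * x).
Proof.
have pf := us_prim pk k mQ Mz; have A0 := uA_ge0 pk k.
have [a [C [a1 C0 hC]]] := proportional_decay.
have ki : 0 < k^-1 by rewrite invr_gt0.
have [C1 C10 h1'] := rprim_bound a pf.1.1 ki; have [C2 C20 h2'] := rprim_bound a pf.1.2 ki.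
have B0 : 0 <= uA pk k / k `^ cs by rewrite divr_ge0 ?powR_ge0.
exists (uA pk k / k `^ cs + C + C1 + C2); first by rewrite !addr_ge0.
move=> x x0; rewrite /U0; have [kx|kx] := leP (k * x) 1.
  have x1 : x <= 1 by rewrite (le_trans _ kx)// ler_peMl// ltW.
  rewrite powR_lemul// cmodM cmod_cpow// -/s -/cs mulrC.
  apply: (@le_trans _ _ (uA pk k / k `^ cs * (k `^ cs * x `^ cs))); last first.
    by rewrite ler_wpM2r ?mulr_ge0 ?powR_ge0// -!addrA lerDl !addr_ge0.
  by rewrite mulrA divfK ?gt_eqF ?powR_pos// ler_wpM2r ?powR_ge0// (uphi_le pk k mQ Mz).
rewrite mulr1; have [xa|ax] := leP x a.
  have xx : k^-1 <= x <= a by rewrite xa andbT ltW// -div1r ltr_pdivrMr// mulrC.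
  have := cmod_le (f x); have := h1' x xx; have := h2' x xx; lra.
have [b _] := hC x (ltW ax); apply: (le_trans b); apply: (@le_trans _ _ C); last by lra.
by rewrite ler_piMr// -expR0 ler_expR oppr_le0 ltW.
Qed.

End ScaledComparison.

(** The rescaled free solutions have Wronskian k W_1, with W_1 the free one, so the contraction
    tolerates a perturbation whose mass is a small multiple of k. If the Wronskian vanished at this
    k, [us] would be zero. *)
Lemma wronskian_large : exists2 k : R, 1 <= k & Wr pk k z != 0.
Proof.
have W00 := free_wronskian pk0 Mz.
have [A A0 [hA hB _]] := free_kernel.
have Wp : 0 < cmod (Wr pk0 1 z) by rewrite cmod_gt0.
have A1 : 0 < 4 * (A + 1) by rewrite mulr_gt0// ltr_wpDl.
(* The smallness is |W_1| / (4 (A + 1)): the kernel constant [A] times the mass has to stay below |k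
   W_1| / 4. *)
have [a [k [a0 a1 ka im lm]]] := mass_small w0 q0 iw iQ (divr_gt0 Wp A1).
have k0 : 0 < k by rewrite -(pmulr_lgt0 _ a0); exact: lt_le_trans ka.
have kge : 1 <= k by rewrite (le_trans ka)// ler_piMr// ltW.
exists k; [exact: kge|apply/eqP => Wk].
have [S S0 hS] := scaled_bound kge Wk.
have [x x0] := us_neq0 pk k mQ Mz; rewrite (_ : us pk k z x = 0) ?eqxx//.
have [pg pg1] := scale_prim k0 pu.1 pu.2; have [ph ph1] := scale_prim k0 pv.1 pv.2.
have pf := us_prim pk k mQ Mz.
have pf1 : prim (us1 pk k z) (fun x => (potV k (fun=> 0) z x + Q x) * us pk k z x).
  by apply: prim_ext pf.2 _ _ => y y0 //; rewrite /potV addr0.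
pose m y := A * mass w q a k y.
have mge y : 0 <= mass w q a k y by apply: mass_ge0 => //; exact: ltW.
have Im D : measurable D -> RI D m /\ Rint D m <= cmod (cR k * Wr pk0 1 z) / 4.
  move=> mD; have i1 := RI_sub mD measurableT (@subsetT _ _) im; split; first exact: RI_Z.
  rewrite RintZ// cmodM cmod_cR (gtr0_norm k0).
  have l : Rint D (mass w q a k) <= cmod (Wr pk0 1 z) / (4 * (A + 1)) * k.
    by apply: le_trans lm; apply: Rint_sub_le.
  apply: (le_trans (ler_wpM2l A0 l)).
  rewrite (_ : A * _ = A / (A + 1) * (k * cmod (Wr pk0 1 z) / 4)); last by field; rewrite gt_eqF// ltr_wpDl.
  by rewrite ler_piMl// ?mulr_ge0 ?cmod_ge0 ?(ltW k0)// ler_pdivrMr ?ltr_wpDl// mul1r lerDl.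
have ker (X Y : R -> CC R) t y : 0 < t -> cmod (X (k * t)) * U0 (k * t) * cmod (Y (k * y)) <= U0 (k * y) * (A * n0 (k * t)) ->
    cmod (X (k * t)) * cmod (Q t) * U0 (k * t) * cmod (Y (k * y)) <= U0 (k * y) * m t.
  move=> t0 b; apply: (@le_trans _ _ (U0 (k * y) * (A * n0 (k * t)) * cmod (Q t))).
    rewrite (_ : cmod (X _) * _ * _ * _ = cmod (X (k * t)) * U0 (k * t) * cmod (Y (k * y)) * cmod (Q t)); last by ring.
    by rewrite ler_wpM2r ?cmod_ge0.
  by rewrite -mulrA ler_wpM2l// /m -mulrA ler_wpM2l// n0_mass.
have WE y : 0 < y -> wr (fun x => u (k * x)) (fun x => cR k * us1 pk0 1 z (k * x))
    (fun x => v (k * x)) (fun x => cR k * v1 (k * x)) y = cR k * Wr pk0 1 z.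
  move=> y0; have ky : 0 < k * y by rewrite mulr_gt0.
  rewrite -(WrE pk0 k1 m0 i0 Mz ky) /wr.
  by move: (u (k * y)) (v (k * y)) (v1 (k * y)) (us1 pk0 1 z (k * y)) (cR k) => b c d e t; ring.
have Wn : cR k * Wr pk0 1 z != 0 by rewrite mulf_neq0// cR_neq0// gt_eqF.
apply: (contraction_zero pg pg1 ph ph1 pf.1 pf1 WE Wn (U := fun x => U0 (k * x)) (m := m) _ _ _ _ _ _ _ _ _ _ S0 hS x0).
- by move=> y _; exact: U0_ge0.
- by move=> y _; exact: mulr_ge0.
- by move=> y y0; have [] := Im _ (ep_meas (endpoint0 R) y).
- by move=> y y0; have [] := Im _ (ep_meas (endpointoo R) y).
- by move=> y y0; have [] := Im _ (ep_meas (endpoint0 R) y).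
- by move=> y y0; have [] := Im _ (ep_meas (endpointoo R) y).
- by move=> y t t0 ty; apply: (ker u v) => //; apply: hA; rewrite ?mulr_gt0// ler_pM2l.
- by move=> y t y0 yt; have t0 := lt_le_trans y0 yt; apply: (ker v u) => //; apply: hB; rewrite ?mulr_gt0// ler_pM2l.
- exact: scaled_wr0.
- exact: scaled_wroo.
Qed.

End LargeSpectralParameter.

(** * Continuous and holomorphic dependence on the parameter *)

Section ContinuousClass.
Variables (R : realType) (M : set (CC R)).

Definition ucont (f : CC R -> CC R) := forall z0, M z0 -> forall e : R, 0 < e ->
  exists2 d : R, 0 < d & forall z, M z -> cmod (z - z0) < d -> cmod (f z - f z0) <= e.

Lemma ucont_mul f g : ucont f -> ucont g -> ucont (fun z => f z * g z).
Proof.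
move=> cf cg z0 Mz0 e e0; set a := cmod (f z0) + 1; set b := cmod (g z0) + 1.
have a0 : 0 < a by rewrite ltr_wpDl ?cmod_ge0.
have b0 : 0 < b by rewrite ltr_wpDl ?cmod_ge0.
pose e1 := Num.min 1 (e / 2 / b); pose e2 := e / 2 / a.
have e10 : 0 < e1 by rewrite lt_min ltr01 !divr_gt0.
have e20 : 0 < e2 by rewrite !divr_gt0.
have [d1 d10 h1] := cf z0 Mz0 e1 e10; have [d2 d20 h2] := cg z0 Mz0 e2 e20.
exists (Num.min d1 d2); first by rewrite lt_min d10.
move=> z Mz; rewrite lt_min => /andP[zd1 zd2].
have l1 := h1 z Mz zd1; have l2 := h2 z Mz zd2.
have la : cmod (f z) <= a.
  have := cmodD (f z - f z0) (f z0); rewrite subrK => /le_trans; apply.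
  by rewrite addrC lerD2l (le_trans l1)// ge_min lexx.
have lb : cmod (g z0) <= b by rewrite lerDl.
have -> : f z * g z - f z0 * g z0 = f z * (g z - g z0) + (f z - f z0) * g z0 by ring.
apply: (le_trans (cmodD _ _)); rewrite !cmodM [leRHS](splitr e) lerD//.
  apply: (@le_trans _ _ (a * e2)); first by apply: ler_pM; rewrite ?cmod_ge0.
  by rewrite /e2 mulrC divfK// gt_eqF.
apply: (@le_trans _ _ (e / 2 / b * b)); last by rewrite divfK// gt_eqF.
by apply: ler_pM; rewrite ?cmod_ge0// (le_trans l1)// ge_min lexx orbT.
Qed.

(** Dominated convergence is sequential, so a failure of continuity at [z0] is turned into a
    sequence of parameters converging to [z0]. *)
Lemma ucont_int (D : set R) (f : CC R -> R -> CC R) (h : R -> R) :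
  measurable D -> RI D h -> (forall z, M z -> cmeas D (f z)) ->
  (forall z y, M z -> D y -> cmod (f z y) <= h y) ->
  (forall y, D y -> ucont (fun z => f z y)) -> ucont (fun z => cint D (f z)).
Proof.
move=> mD hi fm fh fc z0 Mz0 e e0; apply: contrapT => H.
have /choice[u hu] n : exists z, [/\ M z, cmod (z - z0) < n.+1%:R^-1 & e < cmod (cint D (f z) - cint D (f z0))].
  apply: contrapT => Hn; apply: H; exists (n.+1%:R^-1); first by rewrite invr_gt0 ltr0n.
  by move=> z Mz zd; rewrite leNgt; apply/negP => l; apply: Hn; exists z.
have Mu n : M (u n) by have [] := hu n.
have [||_ /ccvgP lim] := @cint_dct R D (fun n => f (u n)) (f z0) h mD (fun n => fm _ (Mu n)) _ _ hi.
- move=> y Dy; apply/ccvgP/cvgrPdist_le => d d0.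
  have [d' d'0 hd] := fc y Dy z0 Mz0 d d0.
  near=> n; rewrite sub0r normrN ger0_norm ?cmod_ge0//; apply: hd => //.
  have [_ + _] := hu n; move=> /lt_trans; apply.
  by near: n; exact: near_infty_natSinv_lt (PosNum d'0).
- by move=> n y Dy; exact: fh.
move/cvgrPdist_lt : lim => /(_ e e0) [n _ /(_ n (leqnn n))] /=.
rewrite sub0r normrN ger0_norm ?cmod_ge0//; have [_ _] := hu n.
by move=> l1 l2; have := lt_trans l1 l2; rewrite ltxx.
Unshelve. all: by end_near. Qed.

Definition fc_cont : fclass M.
Proof.
apply: (@FClass _ M ucont).
- move=> f g fg cf z0 Mz0 e e0; have [d d0 h] := cf z0 Mz0 e e0.
  by exists d => // z Mz zd; rewrite -!fg// h.
- by move=> c z0 _ e e0; exists 1 => // z _ _; rewrite subrr cmod0 ltW.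
- by move=> z0 _ e e0; exists e => // z _ /ltW.
- move=> f g cf cg z0 Mz0 e e0; have e2 : 0 < e / 2 by rewrite divr_gt0.
  have [d1 d10 h1] := cf z0 Mz0 _ e2; have [d2 d20 h2] := cg z0 Mz0 _ e2.
  exists (Num.min d1 d2); first by rewrite lt_min d10.
  move=> z Mz; rewrite lt_min => /andP[zd1 zd2]; rewrite opprD addrACA.
  by apply: (le_trans (cmodD _ _)); rewrite (splitr e) lerD ?h1 ?h2.
- exact: ucont_mul.
- move=> f hf z0 Mz0 e e0; have e3 : 0 < e / 3 by rewrite divr_gt0.
  have [g cg fg] := hf _ e3; have [d d0 h] := cg z0 Mz0 _ e3; exists d => // z Mz zd.
  have -> : f z - f z0 = (f z - g z) + (g z - g z0) - (f z0 - g z0) by ring.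
  apply: (le_trans (cmodB _ _)); have := cmodD (f z - g z) (g z - g z0).
  have := fg z Mz; have := fg z0 Mz0; have := h z Mz zd; lra.
- exact: ucont_int.
Defined.

End ContinuousClass.

(** * Roots of unity and their orthogonality *)

Section RootsOfUnity.
Variable R : realType.

(** Over an algebraically closed field X^n - 1 splits, and in characteristic 0 it is separable; the
    n distinct roots of unity include a generator. *)
Lemma prim_root_ex n : (0 < n)%N -> exists w : R[i], n.-primitive_root w.
Proof.
move=> n0; pose p : {poly R[i]} := ('X^n - 1)%R.
have [r Dp] := closed_field_poly_normal p.
rewrite (monicP _) ?monicXnsubC// scale1r in Dp.
have rn1 : all n.-unity_root r by apply/allP => z; rewrite -root_prod_XsubC -Dp.
have sz_r : (n < (size r).+1)%N by rewrite -(size_prod_XsubC r id) -Dp size_XnsubC.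
have [|z] := hasP (cyclic.has_prim_root n0 rn1 _ sz_r); last by exists z.
by rewrite -separable.separable_prod_XsubC -Dp cyclotomic.separable_Xn_sub_1// pnatr_eq0 -lt0n.
Qed.

Variables (n : nat) (w : CC R).
Hypotheses (n0 : (0 < n)%N) (pw : n.-primitive_root (w : R[i])).

Lemma prim_root_mod : cmod w = 1.
Proof.
apply: (pexpIrn n0); rewrite ?nnegrE ?cmod_ge0//.
by rewrite -cmodX expr1n [w ^+ n](prim_expr_order pw) cmod1.
Qed.

Lemma prim_root_neq0 : w != 0.
Proof. by apply/eqP => e; have := prim_root_mod; rewrite e cmod0 => /esym/eqP; rewrite oner_eq0. Qed.

Lemma nat_neq0 : (n%:R : CC R) != 0.
Proof. by rewrite -cR_nat cR_neq0// pnatr_eq0 -lt0n. Qed.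

Lemma root_sum (j m : 'I_n) :
  \sum_(l < n) (w ^+ l) ^+ m * (w ^+ l) ^- j = if m == j then n%:R else 0 :> CC R.
Proof.
have wn0 l : w ^+ l != 0 by rewrite expf_neq0// prim_root_neq0.
case: ifP => [/eqP ->|mj].
  rewrite (eq_bigr (fun=> 1)); first by rewrite sumr_const card_ord.
  by move=> l _; rewrite mulfV// expf_neq0.
pose x : CC R := w ^+ m / w ^+ j.
rewrite (eq_bigr (fun l : 'I_n => x ^+ l)); last first.
  by move=> l _; rewrite /x expr_div_n -!exprM mulnC [(j * l)%N]mulnC.
apply/eqP; have x1 : x - 1 != 0.
  rewrite subr_eq0; apply/eqP => /(congr1 ( *%R^~ (w ^+ j))); rewrite divfK// mul1r => e.
  have := eq_prim_root_expr pw m j; rewrite [w ^+ m]e eqxx !modn_small// => /esym/eqP/val_inj mj'.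
  by rewrite mj' eqxx in mj.
have := subrX1 x n; rewrite /x expr_div_n -!exprM !(mulnC _ n) !exprM [w ^+ n](prim_expr_order pw) !expr1n divr1 subrr.
by move=> /esym/eqP; rewrite mulf_eq0 (negPf x1).
Qed.

End RootsOfUnity.

(** * Interpolation at roots of unity *)

Section DiskInterpolation.
Variable R : realType.
Implicit Types (p : {poly CC R}) (x : CC R).

Lemma cmod_sum (I : finType) (F : I -> CC R) : cmod (\sum_i F i) <= \sum_i cmod (F i).
Proof.
elim/big_ind2 : _ => [||//]; first by rewrite cmod0.
by move=> a b c d ab cd; apply: (le_trans (cmodD _ _)); exact: lerD.
Qed.

Section Nodes.
Variables (n : nat) (w : CC R) (r : R).
Hypotheses (n0 : (0 < n)%N) (pw : n.-primitive_root (w : R[i])) (r0 : 0 < r).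

Definition node (l : 'I_n) : CC R := cR r * w ^+ l.
(** The Lagrange basis at the nodes as a discrete Fourier sum; in this form the bound 1 on the disc
    is immediate. *)
Definition lagr (l : 'I_n) : {poly CC R} := \sum_(j < n) ((n%:R : CC R)^-1 * node l ^- j) *: 'X^j.

Lemma node_mod l : cmod (node l) = r.
Proof. by rewrite cmodM cmodX (prim_root_mod n0 pw) expr1n mulr1 cmod_cR gtr0_norm. Qed.

Lemma node_sum (j m : 'I_n) : \sum_(l < n) node l ^+ m * node l ^- j = if m == j then n%:R else 0 :> CC R.
Proof.
have c0 : cR r != 0 by rewrite cR_neq0// gt_eqF.
transitivity (cR r ^+ m / cR r ^+ j * \sum_(l < n) (w ^+ l) ^+ m * (w ^+ l) ^- j).
  rewrite mulr_sumr; apply: eq_bigr => l _; rewrite /node !exprMn invfM.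
  by rewrite mulrACA.
rewrite (root_sum n0 pw); case: ifP => [/eqP ->|]; last by rewrite mulr0.
by rewrite mulfV ?mul1r// expf_neq0.
Qed.

Lemma lagr_le l x : cmod x <= r -> cmod (lagr l).[x] <= 1.
Proof.
move=> xr; have np : 0 < n%:R :> R by rewrite ltr0n.
rewrite horner_sum; apply: (le_trans (cmod_sum _)).
apply: (@le_trans _ _ (\sum_(j < n) (n%:R^-1 : R))); last first.
  by rewrite sumr_const card_ord -[_ *+ _]mulr_natr mulVf// gt_eqF.
apply: ler_sum => j _; rewrite hornerZ hornerXn !cmodM !cmodV !cmodX node_mod -cR_nat cmod_cR.
rewrite ger0_norm// -mulrA ler_piMr ?invr_ge0// mulrC ler_pdivrMr ?exprn_gt0// mul1r.
by rewrite lerXn2r ?nnegrE ?cmod_ge0// ltW.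
Qed.

Definition interp (f : CC R -> CC R) : {poly CC R} := \sum_(l < n) f (node l) *: lagr l.

Lemma interp_horner f x : (interp f).[x] = \sum_(l < n) f (node l) * (lagr l).[x].
Proof. by rewrite horner_sum; apply: eq_bigr => l _; rewrite hornerZ. Qed.

Lemma interp_le f B x : cmod x <= r -> (forall z, cmod z <= r -> cmod (f z) <= B) ->
  cmod (interp f).[x] <= n%:R * B.
Proof.
move=> xr hf; rewrite interp_horner; apply: (le_trans (cmod_sum _)).
rewrite (_ : n%:R * B = \sum_(l < n) B); last by rewrite sumr_const card_ord mulr_natl.
apply: ler_sum => l _.
rewrite cmodM -[leRHS]mulr1; apply: ler_pM; rewrite ?cmod_ge0 ?lagr_le//.
by rewrite hf// node_mod.
Qed.

Lemma interp_X (m : 'I_n) x : (interp (fun z => z ^+ m)).[x] = x ^+ m.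
Proof.
rewrite interp_horner.
transitivity (\sum_(j < n) (n%:R : CC R)^-1 * x ^+ j * \sum_(l < n) node l ^+ m * node l ^- j).
  under [RHS]eq_bigr => j _ do rewrite mulr_sumr.
  rewrite exchange_big; apply: eq_bigr => l _; rewrite horner_sum mulr_sumr; apply: eq_bigr => j _.
  by rewrite hornerZ hornerXn; ring.
rewrite (eq_bigr (fun j : 'I_n => if j == m then x ^+ j else 0)); last first.
  move=> j _; rewrite (node_sum j m) eq_sym; case: ifP => _; last by rewrite mulr0.
  by rewrite mulrAC mulVf ?mul1r// (nat_neq0 R n0).
by rewrite -big_mkcond /= big_pred1_eq.
Qed.

Lemma interp_poly p x (K : nat) : (size p <= K)%N ->
  p.[x] - (interp (fun z => p.[z])).[x] =
  \sum_(m < K) p`_m * (x ^+ m - (interp (fun z => z ^+ m)).[x]).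
Proof.
move=> pK; rewrite (horner_coef_wide x pK) interp_horner.
under [RHS]eq_bigr => m _ do rewrite mulrBr.
rewrite sumrB; congr (_ - _).
under eq_bigr => l _ do rewrite (horner_coef_wide _ pK) mulr_suml.
rewrite exchange_big; apply: eq_bigr => m _; rewrite interp_horner mulr_sumr.
by apply: eq_bigr => l _; rewrite mulrA.
Qed.

End Nodes.

(** The Cauchy estimate with a discrete mean: as there are at least as many nodes as coefficients,
    no other coefficient aliases into the j-th one. *)
Lemma cauchy_coef p (t B : R) (j : nat) : 0 < t -> (forall x, cmod x <= t -> cmod p.[x] <= B) ->
  cmod p`_j <= B / t ^+ j.
Proof.
move=> t0 hp; set n := maxn (size p) j.+1.
have n0 : (0 < n)%N by rewrite leq_max orbT.
have jn : (j < n)%N by rewrite leq_max leqnn orbT.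
have [w pw] := prim_root_ex R n0; pose J := Ordinal jn.
have e : \sum_(l < n) p.[node w t l] * node w t l ^- j = n%:R * p`_j.
  transitivity (\sum_(m < n) p`_m * \sum_(l < n) node w t l ^+ m * node w t l ^- j).
    under eq_bigr => l _ do rewrite (horner_coef_wide _ (leq_maxl _ j.+1)) mulr_suml.
    rewrite exchange_big; apply: eq_bigr => m _; rewrite mulr_sumr; apply: eq_bigr => l _.
    by rewrite mulrA.
  rewrite (eq_bigr (fun m : 'I_n => if m == J then p`_m * n%:R else 0)); last first.
    by move=> m _; rewrite (node_sum n0 pw t0 J m); case: ifP => _; rewrite ?mulr0.
  by rewrite -big_mkcond /= big_pred1_eq mulrC.
have np : 0 < n%:R :> R by rewrite ltr0n.
have : n%:R * cmod p`_j <= n%:R * (B / t ^+ j).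
  have -> : n%:R * cmod p`_j = cmod (n%:R * p`_j) by rewrite cmodM -cR_nat cmod_cR ger0_norm.
  rewrite -e; apply: (le_trans (cmod_sum _)).
  rewrite (_ : n%:R * _ = \sum_(l < n) B / t ^+ j); last by rewrite sumr_const card_ord mulr_natl.
  apply: ler_sum => l _.
  rewrite cmodM cmodV cmodX (node_mod n0 pw t0) ler_wpM2r ?invr_ge0 ?exprn_ge0 ?(ltW t0)// hp//.
  by rewrite (node_mod n0 pw t0).
by rewrite ler_pM2l.
Qed.

Lemma geom_tail (q : R) n K : 0 <= q -> q < 1 ->
  \sum_(m < K) (if (n <= m)%N then q ^+ m else 0) <= q ^+ n / (1 - q).
Proof.
move=> q0 q1; have q2 : 0 < 1 - q by rewrite subr_gt0.
rewrite ler_pdivlMr//; apply: (@le_trans _ _ (q ^+ n - q ^+ (maxn n K))); last by rewrite gerBl exprn_ge0.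
elim: K => [|K IH]; first by rewrite big_ord0 mul0r maxn0 subrr.
rewrite big_ord_recr /= mulrDl; apply: (le_trans (lerD IH (lexx _))).
case: ifP => nK.
  by rewrite (maxn_idPr nK) (maxn_idPr (leqW nK)) exprS; lra.
have Kn : (K < n)%N by rewrite ltnNge nK.
by rewrite mul0r addr0 (maxn_idPl (ltnW Kn)) (maxn_idPl Kn).
Qed.

(** Interpolation is exact below degree n. From degree n on, |p_m| <= B / s^m leaves a geometric
    tail in r / s; the factor n + 1 bounds the monomial together with its interpolant, relative to
    r^m. *)
Lemma interp_err n w p (r s B : R) x : (0 < n)%N -> n.-primitive_root (w : R[i]) -> 0 < r -> r < s ->
  (forall x, cmod x <= s -> cmod p.[x] <= B) -> cmod x <= r ->
  cmod (p.[x] - (@interp n w r (fun z => p.[z])).[x]) <= B * (n%:R + 1) * ((r / s) ^+ n / (1 - r / s)).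
Proof.
move=> n0 pw r0 rs hp xr; have s0 := lt_trans r0 rs.
have B0 : 0 <= B by apply: le_trans (cmod_ge0 _) (hp 0 _); rewrite cmod0 ltW.
have q0 : 0 <= r / s by rewrite divr_ge0 ?ltW.
have q1 : r / s < 1 by rewrite ltr_pdivrMr// mul1r.
rewrite (@interp_poly n w r p x _ (leqnn _)); apply: (le_trans (cmod_sum _)).
apply: le_trans (ler_wpM2l _ (geom_tail n (size p) q0 q1)); last by rewrite mulr_ge0// addr_ge0.
rewrite mulr_sumr; apply: ler_sum => m _; case: ifP => nm; last first.
  have mn : (m < n)%N by rewrite ltnNge nm.
  by rewrite (interp_X n0 pw r0 (Ordinal mn)) subrr mulr0 cmod0 mulr0.
rewrite cmodM (_ : B * _ * _ = B / s ^+ m * ((n%:R + 1) * r ^+ m)); last first.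
  by rewrite expr_div_n; field; rewrite expf_neq0// gt_eqF.
apply: ler_pM; rewrite ?cmod_ge0 ?(cauchy_coef _ s0 hp)//.
apply: (le_trans (cmodB _ _)); rewrite mulrDl mul1r addrC lerD//.
  apply: (interp_le n0 pw r0 xr) => z zr; rewrite cmodX lerXn2r ?nnegrE ?cmod_ge0//; exact: ltW.
by rewrite cmodX lerXn2r ?nnegrE ?cmod_ge0//; exact: ltW.
Qed.

(** Half of the decay absorbs the factor n + 1: with t = sqrt q, (n + 1) t^n <= 1 + t + ... + t^n <=
    1 / (1 - t). *)
Lemma interp_rate (q : R) (e : R) : 0 <= q -> q < 1 -> 0 < e ->
  exists2 n, (0 < n)%N & (n%:R + 1) * (q ^+ n / (1 - q)) <= e.
Proof.
move=> q0 q1 e0; pose t := Num.sqrt q.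
have t0 : 0 <= t by exact: sqrtr_ge0.
have t1 : t < 1 by rewrite -(sqrtr1 R) ltr_sqrt.
have qt : q = t ^+ 2 by rewrite sqr_sqrtr.
have t2 : 0 < 1 - t by rewrite subr_gt0.
have q2 : 0 < 1 - q by rewrite subr_gt0.
have h n : (n%:R + 1) * t ^+ n <= (1 - t)^-1.
  have -> : (n%:R + 1) * t ^+ n = \sum_(m < n.+1) t ^+ n.
    by rewrite sumr_const card_ord -[RHS]mulr_natl -natr1.
  apply: (@le_trans _ _ (\sum_(m < n.+1) (if (0 <= m)%N then t ^+ m else 0))).
    by apply: ler_sum => m _; rewrite /=; apply: ler_wiXn2l => //; [exact: ltW|rewrite -ltnS].
  by apply: (le_trans (geom_tail 0 n.+1 t0 t1)); rewrite expr0 mul1r.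
have c : (fun n => t ^+ n) @ \oo --> (0 : R) by apply: cvg_expr; rewrite ger0_norm.
have C0 : 0 < (1 - t) * (1 - q) * e by rewrite !mulr_gt0.
move/cvgrPdist_le : c => /(_ _ C0) [n _ /(_ n.+1 (leqnSn n))] /=.
rewrite sub0r normrN ger0_norm ?exprn_ge0// => hn; exists n.+1 => //.
have -> : (n.+1%:R + 1) * (q ^+ n.+1 / (1 - q)) = ((n.+1%:R + 1) * t ^+ n.+1) * (t ^+ n.+1 / (1 - q)).
  by rewrite qt -exprM mul2n -addnn exprD; ring.
apply: (@le_trans _ _ ((1 - t)^-1 * ((1 - t) * e))).
  apply: ler_pM; rewrite ?mulr_ge0 ?exprn_ge0 ?addr_ge0 ?invr_ge0 ?(ltW q2)//.
  by rewrite ler_pdivrMr// mulrAC.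
by rewrite mulrA mulVf ?mul1r// gt_eqF.
Qed.

End DiskInterpolation.

Section HolomorphicClass.
Variable R : realType.
Implicit Types (p : {poly CC R}).

Lemma poly_bound p (r : R) : exists2 C : R, 0 <= C & forall x, cmod x <= r -> cmod p.[x] <= C.
Proof.
exists (\sum_(m < size p) cmod p`_m * `|r| ^+ m).
  by apply: sumr_ge0 => m _; rewrite mulr_ge0 ?cmod_ge0 ?exprn_ge0.
move=> x xr; rewrite horner_coef; apply: (le_trans (cmod_sum _)); apply: ler_sum => m _.
rewrite cmodM cmodX ler_wpM2l ?cmod_ge0// lerXn2r ?nnegrE ?cmod_ge0//.
exact: le_trans xr (ler_norm r).
Qed.

Lemma poly_taylor p (t B : R) x : 0 < t -> (forall x, cmod x <= t -> cmod p.[x] <= B) -> cmod x <= t / 2 ->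
  cmod (p.[x] - p`_0 - p`_1 * x) <= 2 * B * (cmod x / t) ^+ 2.
Proof.
move=> t0 hp xt; pose K := (size p).+2; pose q := cmod x / t.
have B0 : 0 <= B by apply: le_trans (cmod_ge0 _) (hp 0 _); rewrite cmod0 ltW.
have q0 : 0 <= q by rewrite divr_ge0 ?cmod_ge0 ?ltW.
have q2 : q <= 2^-1 by rewrite /q ler_pdivrMr// mulrC.
have q1 : q < 1 by lra.
have pK : (size p <= K)%N by rewrite /K; do 2 apply: leqW.
have -> : p.[x] - p`_0 - p`_1 * x = \sum_(m < K) (if (2 <= m)%N then p`_m * x ^+ m else 0).
  rewrite (horner_coef_wide x pK) /K !big_ord_recl /= expr0 mulr1 expr1 !add0r.
  rewrite /bump /= addn0; move: (\sum_(i < _) _) => S; ring.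
apply: (@le_trans _ _ (B * (q ^+ 2 / (1 - q)))).
  apply: le_trans (ler_wpM2l B0 (geom_tail 2 K q0 q1)); rewrite mulr_sumr.
  apply: (le_trans (cmod_sum _)); apply: ler_sum => m _; case: ifP => _; last by rewrite cmod0 mulr0.
  rewrite cmodM cmodX /q expr_div_n mulrA mulrAC ler_wpM2r ?exprn_ge0 ?cmod_ge0//.
  exact: cauchy_coef.
rewrite -/q (_ : 2 * B * q ^+ 2 = B * (q ^+ 2 * 2)); last by ring.
apply: ler_wpM2l => //; apply: ler_wpM2l; first exact: sqr_ge0.
by rewrite -[leRHS]invrK lef_pV2 ?posrE ?invr_gt0 ?subr_gt0//; lra.
Qed.

Lemma interp_sub n w (r : R) (f g : CC R -> CC R) x : n.-primitive_root (w : R[i]) ->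
  (@interp R n w r f).[x] - (@interp R n w r g).[x] = (@interp R n w r (fun z => f z - g z)).[x].
Proof.
by move=> pw; rewrite !interp_horner -sumrB; apply: eq_bigr => l _; rewrite mulrBl.
Qed.

Lemma cint_sum (I : Type) (s : seq I) (D : set R) (f : I -> R -> CC R) (a : I -> CC R) : measurable D ->
  (forall i, CI D (f i)) -> CI D (fun y => \sum_(i <- s) f i y * a i) /\
  cint D (fun y => \sum_(i <- s) f i y * a i) = \sum_(i <- s) cint D (f i) * a i.
Proof.
move=> mD fi; elim: s => [|i s [IH1 IH2]].
  rewrite big_nil; split.
    by apply: CI_ext (CI_Z 0 mD (conj (RI0 mD) (RI0 mD) : CI D (fun=> 0))) => y _; rewrite big_nil mul0r.
  rewrite (cint_ext (g := fun=> 0)); last by move=> y _; rewrite big_nil.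
  have i0 : CI D (fun=> 0 : CC R) := conj (RI0 mD) (RI0 mD).
  rewrite (cint_ext (g := fun y => 0 * (0 : CC R))); last by move=> y _; rewrite mul0r.
  by rewrite cintZ// mul0r.
have i1 : CI D (fun y => f i y * a i).
  by apply: CI_ext (CI_Z (a i) mD (fi i)) => y _; rewrite mulrC.
split; first by apply: CI_ext (CI_D mD i1 IH1) => y _; rewrite big_cons.
rewrite (cint_ext (g := fun y => f i y * a i + \sum_(j <- s) f j y * a j)); last by move=> y _; rewrite big_cons.
rewrite cintD// IH2 big_cons; congr (_ + _).
rewrite (cint_ext (g := fun y => a i * f i y)); last by move=> y _; rewrite mulrC.
by rewrite cintZ// mulrC.
Qed.

Variables (c : CC R) (rho : R).
Definition disc : set (CC R) := [set z | cmod (z - c) < rho].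

(* Holomorphy on the disc, in a form that is preserved by integration over a parameter:
   interpolation at roots of unity only uses finitely many values. *)
Definition uhol (f : CC R -> CC R) := forall r : R, 0 < r -> r < rho -> forall e : R, 0 < e ->
  exists p, forall z, cmod (z - c) <= r -> cmod (f z - p.[z - c]) <= e.

Lemma uhol_mul f g : uhol f -> uhol g -> uhol (fun z => f z * g z).
Proof.
move=> hf hg r r0 rr e e0; have [p0 hp0] := hf r r0 rr 1 ltr01.
have [C C0 hC] := poly_bound p0 r.
have e1 : 0 < e / 2 / (C + 1) by rewrite !divr_gt0// ltr_wpDl.
have [q hq] := hg r r0 rr _ e1; have [C' C'0 hC'] := poly_bound q r.
have e2 : 0 < e / 2 / (C' + 1) by rewrite !divr_gt0// ltr_wpDl.
have [p hp] := hf r r0 rr _ e2; exists (p * q) => z zr; rewrite hornerM.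
have -> : f z * g z - p.[z - c] * q.[z - c] = f z * (g z - q.[z - c]) + (f z - p.[z - c]) * q.[z - c] by ring.
have fb : cmod (f z) <= C + 1.
  have := cmodD (f z - p0.[z - c]) p0.[z - c]; rewrite subrK => /le_trans; apply.
  by rewrite addrC lerD ?hC ?hp0.
apply: (le_trans (cmodD _ _)); rewrite !cmodM (splitr e); apply: lerD.
  apply: (@le_trans _ _ ((C + 1) * (e / 2 / (C + 1)))).
    by apply: ler_pM; rewrite ?cmod_ge0 ?hq.
  by rewrite mulrC divfK// gt_eqF// ltr_wpDl.
apply: (@le_trans _ _ (e / 2 / (C' + 1) * (C' + 1))).
  by apply: ler_pM; rewrite ?cmod_ge0 ?hp// (le_trans (hC' _ zr))// lerDl.
by rewrite divfK// gt_eqF// ltr_wpDl.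
Qed.

(** The interpolant uses finitely many values of [z], so integrating it over [y] yields a polynomial
    again. With a number of nodes independent of [y] the interpolation error is at most a small
    multiple of [h y], which is integrable. *)
Lemma uhol_int (D : set R) (f : CC R -> R -> CC R) (h : R -> R) :
  measurable D -> RI D h -> (forall z, disc z -> cmeas D (f z)) ->
  (forall z y, disc z -> D y -> cmod (f z y) <= h y) ->
  (forall y, D y -> uhol (fun z => f z y)) -> uhol (fun z => cint D (f z)).
Proof.
move=> mD hi fm fh hf r r0 rr e e0; pose s := (r + rho) / 2.
have rs : r < s by rewrite /s; lra.
have sr : s < rho by rewrite /s; lra.
have s0 := lt_trans r0 rs; pose q := r / s.
have q0 : 0 <= q by rewrite divr_ge0 ?ltW.
have q1 : q < 1 by rewrite /q ltr_pdivrMr// mul1r.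
have h0 y : D y -> 0 <= h y.
  move=> Dy; apply: le_trans (cmod_ge0 _) (fh c y _ Dy).
  by rewrite /disc /= subrr cmod0 (lt_trans r0).
set H := Rint D h; have H0 : 0 <= H by apply: Rint_ge0.
have e1 : 0 < e / (H + 1) by rewrite divr_gt0// ltr_wpDl.
have [n n0 hn] := interp_rate q0 q1 e1.
have [w pw] := prim_root_ex R n0; set e' := e / (H + 1) in e1 hn.
(* The polynomial [p] that approximates [f] at this [y] enters only the estimate, and its error [d']
   is removed by letting [d] tend to 0; so no measurable choice of [p] in [y] arises. *)
have key y x : D y -> cmod x <= r ->
    cmod (f (x + c) y - (@interp R n w r (fun x => f (x + c) y)).[x]) <= e' * h y.
  move=> Dy xr; apply/ler_addgt0Pl => d d0.
  have K0 : 0 < 1 + n%:R + e' by rewrite ltr_pwDr// addr_ge0.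
  have d1 : 0 < d / (1 + n%:R + e') by rewrite divr_gt0.
  have [p hp] := hf y Dy s s0 sr _ d1; set d' := d / _ in d1 hp.
  have fp z : cmod z <= s -> cmod (f (z + c) y - p.[z]) <= d'.
    by move=> zs; have := hp (z + c); rewrite addrK; apply.
  have pb z : cmod z <= s -> cmod p.[z] <= h y + d'.
    move=> zs; rewrite -[p.[z]](subKr (f (z + c) y)); apply: (le_trans (cmodB _ _)).
    by apply: lerD (fp z zs); apply: fh => //; rewrite /disc /= addrK (le_lt_trans zs).
  have E := interp_err n0 pw r0 rs pb xr.
  have E2 : cmod ((@interp R n w r (fun z => p.[z])).[x] - (@interp R n w r (fun x => f (x + c) y)).[x]) <= n%:R * d'.
    rewrite interp_sub//; apply: (interp_le n0 pw r0 xr) => z zr; rewrite cmodBC fp//.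
    exact: le_trans zr (ltW rs).
  have E3 := fp x (le_trans xr (ltW rs)).
  have E4 : (h y + d') * (n%:R + 1) * ((r / s) ^+ n / (1 - r / s)) <= (h y + d') * e'.
    by rewrite -mulrA ler_wpM2l// addr_ge0 ?h0// ltW.
  have -> : d = d' * (1 + n%:R + e') by rewrite /d' divfK// gt_eqF.
  have := cmod_tri (f (x + c) y) p.[x] (@interp R n w r (fun x => f (x + c) y)).[x].
  have := cmod_tri p.[x] (@interp R n w r (fun z => p.[z])).[x] (@interp R n w r (fun x => f (x + c) y)).[x].
  by move: E E2 E3 E4; move: (cmod _) (cmod _) (cmod _) (cmod _) (cmod _) => a1 a2 a3 a4 a5; lra.
have ci z : disc z -> CI D (f z) by move=> dz; exact: (CI_le mD (fm z dz) (fun y Dy => fh z y dz Dy) hi).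
have dn l : disc (@node R n w r l + c) by rewrite /disc /= addrK (node_mod n0 pw r0).
exists (@interp R n w r (fun x => cint D (f (x + c)))) => z zr.
have dz : disc z by exact: le_lt_trans zr rr.
rewrite interp_horner.
have [i1 <-] := @cint_sum _ (index_enum 'I_n) D (fun l => f (@node R n w r l + c))
  (fun l => (@lagr R n w r l).[z - c]) mD (fun l => ci _ (dn l)).
rewrite -cintB//; last exact: ci.
apply: (@le_trans _ _ (Rint D (fun y => e' * h y))).
  apply: cint_le => //; [by apply: CI_B => //; exact: ci|exact: RI_Z|move=> y Dy].
  have := key y (z - c) Dy zr; rewrite subrK interp_horner; apply: le_trans.
  by rewrite le_eqVlt eqxx.
rewrite RintZ// -/H /e' mulrAC ler_pdivrMr ?ltr_wpDl// ler_wpM2l ?(ltW e0)//.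
by rewrite lerDl.
Qed.

Definition fc_hol : fclass disc.
Proof.
apply: (@FClass _ disc uhol).
- move=> f g fg hf r r0 rr e e0; have [p hp] := hf r r0 rr e e0; exists p => z zr.
  by rewrite -fg ?hp//; exact: le_lt_trans zr rr.
- by move=> a r r0 rr e e0; exists (a%:P) => z zr; rewrite hornerC subrr cmod0 ltW.
- by move=> r r0 rr e e0; exists ('X + c%:P) => z zr; rewrite hornerD hornerX hornerC subrK subrr cmod0 ltW.
- move=> f g hf hg r r0 rr e e0; have e2 : 0 < e / 2 by rewrite divr_gt0.
  have [p hp] := hf r r0 rr _ e2; have [q hq] := hg r r0 rr _ e2.
  exists (p + q) => z zr; rewrite hornerD opprD addrACA.
  by apply: (le_trans (cmodD _ _)); rewrite (splitr e) lerD ?hp ?hq.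
- exact: uhol_mul.
- move=> f hf r r0 rr e e0; have e2 : 0 < e / 2 by rewrite divr_gt0.
  have [g hg fg] := hf _ e2; have [p hp] := hg r r0 rr _ e2; exists p => z zr.
  apply: (le_trans (cmod_tri _ (g z) _)); rewrite (splitr e) lerD ?hp// fg//.
  exact: le_lt_trans zr rr.
- exact: uhol_int.
Defined.

(** The linear coefficients of the approximating polynomials, recentred at [z], form a Cauchy
    sequence by the coefficient estimate. Their limit is the derivative, since the quadratic
    remainder is bounded uniformly along the sequence. *)
Lemma uhol_diff f z : uhol f -> disc z -> exists L : CC R, exists t : R, exists C : R,
  [/\ 0 < t, 0 <= C & forall x, cmod x <= t -> cmod (f (z + x) - f z - L * x) <= C * cmod x ^+ 2].
Proof.
move=> hf dz; pose t := (rho - cmod (z - c)) / 2.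
have t0 : 0 < t by rewrite divr_gt0// subr_gt0.
pose r := cmod (z - c) + t; have r0 : 0 < r by rewrite ltr_wpDl ?cmod_ge0.
have rr : r < rho by rewrite /r /t; have := dz; rewrite /disc /=; lra.
have /choice[P hP] n : exists p, forall z, cmod (z - c) <= r -> cmod (f z - p.[z - c]) <= 2^-1 ^+ n.
  by apply: hf => //; rewrite exprn_gt0// invr_gt0.
pose q n := P n \Po ('X + (z - c)%:P).
have hq n x : cmod x <= t -> cmod (f (z + x) - (q n).[x]) <= 2^-1 ^+ n.
  move=> xt; rewrite /q horner_comp hornerD hornerX hornerC.
  have -> : x + (z - c) = z + x - c by ring.
  by apply: hP; rewrite addrAC (le_trans (cmodD _ _))// lerD2l.
have [B B0 hB] := poly_bound (q 0%N) t.
have p1 n : (2^-1 : R) ^+ n <= 1 by rewrite exprn_ile1// invf_le1// ler1n.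
have hqB n x : cmod x <= t -> cmod (q n).[x] <= B + 2.
  move=> xt; have T1 := cmod_tri (q n).[x] (f (z + x)) 0; have T2 := cmod_tri (f (z + x)) (q 0%N).[x] 0.
  rewrite !subr0 in T1 T2; rewrite (cmodBC (q n).[x]) in T1.
  apply: (le_trans T1); rewrite addrC; apply: (@le_trans _ _ ((1 + B) + 1)); last by lra.
  apply: lerD; last exact: le_trans (hq n x xt) (p1 n).
  by apply: (le_trans T2); apply: lerD; [exact: (hq 0%N x xt)|exact: hB].
pose a n := (q n)`_1; pose A := 2 / t.
have A0 : 0 <= A by rewrite divr_ge0 ?ltW.
have ha n : cmod (a n.+1 - a n) <= A * 2^-1 ^+ n.
  rewrite /a -coefB (_ : A * _ = 2 * 2^-1 ^+ n / t ^+ 1); last by rewrite /A expr1 mulrAC.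
  apply: cauchy_coef => // x xt; rewrite hornerD hornerN.
  apply: (le_trans (cmod_tri _ (f (z + x)) _)); rewrite (cmodBC (q n.+1).[x]) mulr_natl mulr2n.
  apply: lerD; last exact: hq.
  by apply: (le_trans (hq n.+1 x xt)); rewrite exprS ler_piMl ?exprn_ge0// invf_le1// ler1n.
pose L := cglim a A; have hL n : cmod (a n - L) <= 4 * A * 2^-1 ^+ n := cglimP n A0 ha.
exists L, (t / 2), (2 * (B + 2) / t ^+ 2); split; first by rewrite divr_gt0.
  by rewrite mulr_ge0 ?invr_ge0 ?sqr_ge0// mulr_ge0// addr_ge0.
move=> x xt2; have xt : cmod x <= t by rewrite (le_trans xt2)// ler_pdivrMr// ler_peMr ?ler1n// ltW.
rewrite -subr_le0; apply: (@half_pow_le0 _ _ (2 + 4 * A * cmod x)) => n.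
have E1 := hq n x xt; have E2 := hq n 0; rewrite cmod0 addr0 horner_coef0 in E2; have {}E2 := E2 (ltW t0).
have E3 := poly_taylor t0 (hqB n) xt2.
have E4 : cmod ((a n - L) * x) <= 4 * A * 2^-1 ^+ n * cmod x by rewrite cmodM ler_wpM2r ?cmod_ge0.
have E5 : 2 * (B + 2) * (cmod x / t) ^+ 2 = 2 * (B + 2) / t ^+ 2 * cmod x ^+ 2 by rewrite expr_div_n; ring.
rewrite E5 in E3.
have -> : f (z + x) - f z - L * x = (f (z + x) - (q n).[x]) - (f z - (q n)`_0) +
    ((q n).[x] - (q n)`_0 - a n * x) + (a n - L) * x by ring.
have T1 := cmodD ((f (z + x) - (q n).[x]) - (f z - (q n)`_0) + ((q n).[x] - (q n)`_0 - a n * x)) ((a n - L) * x).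
have T2 := cmodD ((f (z + x) - (q n).[x]) - (f z - (q n)`_0)) ((q n).[x] - (q n)`_0 - a n * x).
have T3 := cmodB (f (z + x) - (q n).[x]) (f z - (q n)`_0).
rewrite lerBlDr; apply: (le_trans T1); apply: (le_trans (lerD T2 E4)).
have := lerD E1 E2; rewrite -/(a n) in E3; move: T3 E3.
move: (cmod x ^+ 2) => X2 T3 E3 E6.
have -> : (2 + 4 * A * cmod x) * 2^-1 ^+ n = 2^-1 ^+ n + 2^-1 ^+ n + 4 * A * 2^-1 ^+ n * cmod x by ring.
lra.
Qed.

Lemma diff_derivable (f : CC R -> CC R) (z L : CC R) (t C : R) : 0 < t -> 0 <= C ->
  (forall x, cmod x <= t -> cmod (f (z + x) - f z - L * x) <= C * cmod x ^+ 2) -> derivable f z 1.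
Proof.
move=> t0 C0 h; apply/cvg_ex; exists L; apply/cvgrPdist_lt => -[e e'].
rewrite ltcE /= => /andP[/eqP -> e0].
pose d := Num.min t (e / (C + 1)); have C1 : 0 < C + 1 by rewrite ltr_wpDl.
have d0 : 0 < d by rewrite lt_min t0 divr_gt0.
have d0' : (0 : R[i]) < (cR d : R[i]) by rewrite ltcR.
near=> x.
have x0 : x != 0 by near: x; exact: (@nbhs_dnbhs_neq _ (0 : CC R)).
have xd : cmod x < d.
  have : `|x| < (cR d : R[i]) by near: x; exact: (@dnbhs0_lt _ (CC R) _ d0').
  by rewrite cmod_norm ltcR.
have xp : 0 < cmod x by exact: cmod_gt0.
rewrite distrC /= (_ : _ - L = x^-1 * (f (z + x) - f z - L * x)); last first.
  by rewrite /GRing.scale /= mulr1 (addrC x z) [RHS]mulrBr mulrCA mulVf ?mulr1.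
rewrite cmod_norm ltcR cmodM cmodV.
apply: (@le_lt_trans _ _ ((cmod x)^-1 * (C * cmod x ^+ 2))).
  by rewrite ler_wpM2l ?invr_ge0 ?(ltW xp)// h// (le_trans (ltW xd))// ge_min lexx.
have -> : (cmod x)^-1 * (C * cmod x ^+ 2) = C * cmod x.
  by move: (cmod x) (gt_eqF xp) => X X0; field; rewrite X0.
apply: (@le_lt_trans _ _ (C * d)); first by rewrite ler_wpM2l// ltW.
apply: (@lt_le_trans _ _ ((C + 1) * d)); first by rewrite ltr_pM2r// ltrDl.
by rewrite mulrC -ler_pdivlMr// ge_min lexx orbT.
Unshelve. all: by end_near. Qed.

End HolomorphicClass.

(** * Regularity of the family *)

Section LocalIntegrability.
Variable R : realType.
Implicit Types (f : R -> R).

Lemma RI_cover (D A B : set R) f : measurable D -> measurable A -> measurable B -> D `<=` A `|` B ->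
  measurable_fun D f -> RI A f -> RI B f -> RI D f.
Proof.
move=> mD mA mB DAB mf iA iB.
have i1 := RI_restrict mA (RI_norm mA iA); have i2 := RI_restrict mB (RI_norm mB iB).
apply: RI_le (RI_sub mD measurableT (@subsetT _ _) (RI_D measurableT i1 i2)) => // x Dx.
rewrite !patchE; have [Ax|Bx] := DAB x Dx.
  by rewrite ifT ?inE// lerDl; case: ifP.
by rewrite [X in _ <= _ + X]ifT ?inE// lerDr; case: ifP.
Qed.

Variable Q : R -> CC R.
Hypotheses (lQ : loc_integrable Q).

Let mQ : cmeas (@pos R) Q := lQ.1.

Lemma loc_RI (a b : R) : 0 < a -> a <= b -> RI `[a, b] (fun x => cmod (Q x)).
Proof.
move=> a0 ab; apply: RI_ge0; [|by move=> x _; exact: cmod_ge0|].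
  by apply: measurable_funS (@pos_meas R) (itv_pos a0) _; exact: cmeas_mod.
have := lQ.2 a b a0 ab; rewrite (_ : [set y | a <= y <= b] = `[a, b]%classic)//.
Qed.

Lemma infty_RI : Linf0 Q -> forall x, 0 < x -> RI (Doo x) (fun x => cmod (Q x)).
Proof.
move=> iQ x x0; have mDoo := ep_meas (endpointoo R).
have i1 : RI (Doo 1) (fun x => cmod (Q x)).
  apply: RI_ge0; [|by move=> y _; exact: cmod_ge0|].
    by apply: (ep_meas_sub (endpointoo R)) => //; exact: cmeas_mod.
  move: iQ; rewrite /Linf0 (_ : [set y : R | 1 <= y] = Doo 1)//.
  by apply/seteqP; split => y; rewrite /Doo /= in_itv /= andbT.
apply: (@RI_cover (Doo x) `[x, Num.max x 1]%classic (Doo 1)) => //.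
- move=> y /DooP xy; have [y1|/ltW y1] := leP 1 y; [right|left].
    by rewrite /Doo /= in_itv /= y1.
  by rewrite /= in_itv /= xy le_max y1 orbT.
- by apply: (ep_meas_sub (endpointoo R)) => //; exact: cmeas_mod.
- by apply: loc_RI => //; rewrite le_max lexx.
Qed.

Variables (kw kc : R -> R) (e C : R).
Hypotheses (mkw : measurable_fun (@pos R) kw) (mkc : measurable_fun (@pos R) kc)
  (kw0 : forall x, 0 < x -> 0 <= kw x) (kc1 : forall x, 0 < x -> 1 <= kc x)
  (kcm : forall x y, 0 < x -> x <= y -> kc x <= kc y) (e2 : e < 2)
  (kwp : forall y, 0 < y -> y <= 1 -> kw y <= C * y `^ (- e)) (kwl : forall y, 1 <= y -> kw y <= 1 + y)
  (iw : RI (D0 1) (fun y => y * kw y * cmod (Q y))).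

Lemma weight_RI x : 0 < x -> RI (D0 x) (fun y => kc y * (y * kw y * (1 + cmod (Q y)))).
Proof.
move=> x0; have mD := ep_meas (endpoint0 R); pose X := Num.max x 1.
have X1 : 1 <= X by rewrite le_max lexx orbT.
have X0 := lt_le_trans ltr01 X1.
have mid : measurable_fun (@pos R) (fun y : R => y) := rprim_meas (@rprim_id R).
have myw : measurable_fun (@pos R) (fun y => y * kw y) by exact: measurable_funM.
have mF : measurable_fun (@pos R) (fun y => y * kw y * (1 + cmod (Q y))).
  apply: measurable_funM => //; apply: measurable_funD; [exact: measurable_cst|exact: cmeas_mod].
have iF : RI (D0 x) (fun y => y * kw y * (1 + cmod (Q y))).
  apply: (@RI_cover (D0 x) (D0 1) `[1, X]%classic) => //.
  - move=> y /D0P[y0 yx]; have [y1|/ltW y1] := leP y 1; [left|right].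
      by rewrite /D0 /= in_itv /= y0.
    by rewrite /= in_itv /= y1 le_max yx.
  - by apply: (ep_meas_sub (endpoint0 R)).
  - apply: (RI_ext (f := fun y => y * kw y + y * kw y * cmod (Q y))); first by move=> y _; rewrite mulrDr mulr1.
    apply: RI_D => //.
    have e1 : -1 < 1 - e by have := e2; lra.
    have [i1 _] := RI_powR0 (@ltr01 R) e1.
    apply: RI_le (RI_Z C (mD 1) i1) => //; first exact: (ep_meas_sub (endpoint0 R)).
    move=> y /D0P[y0 y1]; rewrite ger0_norm ?mulr_ge0 ?kw0 ?(ltW y0)//.
    by rewrite powR_add// powR_one// mulrCA ler_wpM2l ?(ltW y0)// kwp.
  - have i1 := loc_RI (@ltr01 R) X1; have i2 := RI_D (measurable_itv _) (RI_cst 1 X 1) i1.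
    apply: RI_le (RI_Z (X * (1 + X)) (measurable_itv _) i2) => //.
      exact: measurable_funS (@pos_meas R) (itv_pos (@ltr01 R)) mF.
    move=> y; rewrite /= in_itv /= => /andP[y1 yX]; have y0 := lt_le_trans ltr01 y1.
    rewrite ger0_norm ?mulr_ge0 ?kw0 ?addr_ge0 ?cmod_ge0 ?(ltW y0)//.
    rewrite ler_wpM2r ?addr_ge0 ?cmod_ge0//; apply: ler_pM; rewrite ?kw0 ?(ltW y0)//.
    by apply: (le_trans (kwl y1)); rewrite lerD2l.
apply: RI_le (RI_Z (kc x) (mD x) iF) => //.
  by apply: (ep_meas_sub (endpoint0 R)) => //; exact: measurable_funM.
move=> y /D0P[y0 yx]; have c0 : 0 <= kc y by rewrite (le_trans ler01)// kc1.
have f0 : 0 <= y * kw y * (1 + cmod (Q y)) by rewrite !mulr_ge0 ?addr_ge0 ?cmod_ge0 ?kw0// ltW.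
by rewrite (ger0_norm (mulr_ge0 c0 f0)) ler_wpM2r// kcm.
Qed.

End LocalIntegrability.

(** * The weights for the three integrability conditions *)

Section Packs.
Variables (R : realType) (Q : R -> CC R).
Hypotheses (lQ : loc_integrable Q).
Variables (z0 : CC R) (rho : R).
Hypothesis (rho0 : 0 < rho).
Let mQ : cmeas (@pos R) Q := lQ.1.
Let D := disc z0 rho.

Let Dre z : D z -> cre z0 - rho <= cre z /\ cre z <= cre z0 + rho.
Proof.
move=> Dz; have := le_lt_trans (cre_le (z - z0)) Dz; rewrite creD creN.
by rewrite ltr_norml => /andP[h1 h2]; split; lra.
Qed.

Let Dbd z : D z -> cmod z <= cmod z0 + rho.
Proof.
move=> Dz; have := cmodD (z - z0) z0; rewrite subrK => /le_trans; apply.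
by rewrite addrC lerD2l ltW.
Qed.

Let set01 : [set y : R | 0 < y <= 1] = D0 1.
Proof. by apply/seteqP; split => y; rewrite /D0 /= in_itv. Qed.

Let wRI (w : R -> R) : measurable_fun (@pos R) w -> (forall y, 0 < y -> 0 <= w y) ->
  (\int[@lebesgue_measure R]_(x in [set y : R | (0 < y <= 1)%R]) (w x * cmod (Q x))%R%:E < +oo)%E ->
  RI (D0 1) (fun y => w y * cmod (Q y)).
Proof.
move=> mw w0; rewrite set01 => h; apply: RI_ge0 => //.
  by apply: (ep_meas_sub (endpoint0 R)) => //; apply: measurable_funM => //; exact: cmeas_mod.
by move=> y /D0P[y0 _]; rewrite mulr_ge0 ?w0 ?cmod_ge0.
Qed.

Let pow_kB (x y p P : R) : 0 < y -> y <= x -> 0 <= p -> p <= P -> y `^ p <= (1 + x) `^ P.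
Proof.
move=> y0 yx p0 pP; have x0 := lt_le_trans y0 yx.
apply: (@le_trans _ _ ((1 + x) `^ p)); first by apply: powR_base => //; lra.
by apply: powR_mono => //; lra.
Qed.

Let mid : measurable_fun (@pos R) (fun y : R => y) := rprim_meas (@rprim_id R).

(** The weight is y^(-eps). The bound -eps/2 on Re z enters the kernel estimate and the monotonicity
    of y^(-2 Re z) kw y; [eps + 2 * rho < 2] keeps the spread of Re z within [kp_dif]. *)
Lemma pack_eps (eps : R) : 0 < eps -> eps + 2 * rho < 2 -> - (eps / 2) <= cre z0 -> L0eps eps Q ->
  inhabited (kpack ([set m | - (eps / 2) <= cre m] `&` D) Q).
Proof.
move=> e0 e2 mz0 iQ; set M := _ `&` _.
pose kw (y : R) := y `^ (- eps); pose kc (y : R) := 1 + y `^ eps / eps.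
have mkw : measurable_fun (@pos R) kw by exact: powR_meas.
have mkc : measurable_fun (@pos R) kc.
  by apply: measurable_funD; [exact: measurable_cst|apply: measurable_funM; [exact: powR_meas|exact: measurable_cst]].
have kw0 x : 0 < x -> 0 <= kw x by move=> _; exact: powR_ge0.
have kc1 x : 0 < x -> 1 <= kc x by move=> _; rewrite lerDl divr_ge0 ?powR_ge0// ltW.
have kcm x y : 0 < x -> x <= y -> kc x <= kc y.
  by move=> x0 xy; rewrite lerD2l ler_wpM2r ?invr_ge0 ?(ltW e0)// powR_base// ltW.
have kwp y : 0 < y -> y <= 1 -> kw y <= 1 * y `^ (- eps) by rewrite mul1r.
have kwl y : 1 <= y -> kw y <= 1 + y.
  move=> y1; apply: (@le_trans _ _ (y `^ 0)); first by apply: powR_mono => //; lra.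
  by rewrite powRr0; lra.
have iw : RI (D0 1) (fun y => y * kw y * cmod (Q y)).
  apply: RI_ext (wRI (powR_meas (1 - eps)) _ iQ) => [y /D0P[y0 _]|y _]; last exact: powR_ge0.
  by rewrite powR_add// powR_one.
have ee : eps < 2 by move: rho0; lra.
have kint := weight_RI lQ mkw mkc kw0 kc1 kcm ee kwp kwl iw.
(* Near the edge the lower bound is that of the half-plane rather than that of the disc, which
   ensures [0 < eps + klo + khi] and [-1 < klo]. *)
pose klo := Num.max (- (eps / 2)) (cre z0 - rho); pose khi := cre z0 + rho.
have Mlo z : M z -> klo <= cre z /\ cre z <= khi.
  by move=> [/= mz /Dre[h1 h2]]; rewrite ge_max mz h1.
have hlo : - 1 < klo by rewrite lt_max; apply/orP; left; move: ee; lra.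
have hs : 0 < eps + klo + khi.
  have : - (eps / 2) <= klo by rewrite le_max lexx.
  by rewrite /khi; move: mz0 rho0; lra.
have hd : eps + khi - klo < 2.
  have : cre z0 - rho <= klo by rewrite le_max lexx orbT.
  rewrite /khi; move: e2; lra.
constructor; apply: (@KPack _ M Q kw kc (fun x => (1 + x) `^ (2 * khi + eps)) eps klo khi (cmod z0 + rho) 1) => //.
- by rewrite /kw powR1.
- by move=> x _; exact: powR_ge0.
- by move=> x y y0 yx _; apply: powR_base_neg => //; rewrite oppr_le0 ltW.
- move=> z x y [/= mz _] y0 yx _; have x0 := lt_le_trans y0 yx.
  by rewrite /kw -!powR_add//; apply: powR_base_neg => //; move: mz; lra.
- move=> z x y [/= mz _] y0 yx; apply: (le_trans (e1_le_pow y0 yx e0 mz)).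
  by rewrite ler_wpM2r ?powR_ge0// /kc lerDr.
- move=> z x y Mz y0 yx; have [h1 h2] := Mlo z Mz; case: Mz => /= mz _.
  rewrite /kw powR_N// ler_pdivlMr ?powR_pos// -powR_add//; apply: pow_kB => //; move: mz h2; lra.
- by move=> z [_ /Dbd].
Qed.

Variable O : set (CC R).
Hypotheses (O0 : forall z, O z -> 0 <= cre z) (Oz0 : O z0).

Let klo := Num.max 0 (cre z0 - rho).
Let khi := cre z0 + rho.

Let bounds z : (O `&` D) z -> klo <= cre z /\ cre z <= khi.
Proof. by move=> [/O0 mz /Dre[h1 h2]]; rewrite ge_max mz h1. Qed.

Let hlo : - 1 < klo.
Proof. by rewrite lt_max; apply/orP; left; rewrite ltrN10. Qed.

Let hs : 0 < klo + khi.
Proof.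
have h : 0 <= klo by rewrite le_max lexx.
by have := O0 Oz0; rewrite /khi; move: rho0; lra.
Qed.

Let hd : khi - klo <= 2 * rho.
Proof.
have : cre z0 - rho <= klo by rewrite le_max lexx orbT.
by rewrite /khi; lra.
Qed.

Let anti2 z x y : (O `&` D) z -> 0 < y -> y <= x -> x `^ (- (2 * cre z)) <= y `^ (- (2 * cre z)).
Proof. by move=> [/O0 mz _] y0 yx; apply: powR_base_neg => //; rewrite oppr_le0 mulr_ge0. Qed.

Let kB_le z x y : (O `&` D) z -> 0 < y -> y <= x -> y `^ (2 * cre z) <= (1 + x) `^ (2 * khi).
Proof.
move=> Mz y0 yx; have [_ h] := bounds Mz; case: Mz => /O0 mz _.
by apply: pow_kB => //; rewrite ?mulr_ge0// ler_wpM2l.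
Qed.

(** The weight is constant and [keps = 0], because the parameters keep the distance [d] from 0; the
    distance only affects the constant [1 + d^-1]. *)
Lemma pack_far (d : R) : rho < 1 -> 0 < d -> (forall z, D z -> d <= cmod z) -> L0eps 0 Q ->
  inhabited (kpack (O `&` D) Q).
Proof.
move=> r1 d0 hz iQ.
have iw : RI (D0 1) (fun y => y * 1 * cmod (Q y)).
  apply: RI_ext (wRI (powR_meas (1 - 0)) _ iQ) => [y /D0P[y0 _]|y _]; last exact: powR_ge0.
  by rewrite subr0 powR_one// mulr1.
have kc1 (x : R) : 0 < x -> 1 <= 1 + d^-1 by move=> _; rewrite lerDl invr_ge0 ltW.
have kwp (y : R) : 0 < y -> y <= 1 -> 1 <= 1 * y `^ (- 0) by rewrite oppr0 powRr0 mul1r.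
have kwl (y : R) : 1 <= y -> 1 <= 1 + y by move=> y1; lra.
have kint := weight_RI lQ (measurable_cst (1 : R)) (measurable_cst (1 + d^-1)) (fun _ _ => ler01)
  kc1 (fun _ _ _ _ => lexx _) (@ltr0Sn R 1) kwp kwl iw.
constructor; apply: (@KPack _ (O `&` D) Q (fun=> 1) (fun=> 1 + d^-1) (fun x => (1 + x) `^ (2 * khi)) 0 klo khi
  (cmod z0 + rho) 1) => //.
- by move=> x _; exact: powR_ge0.
- by move=> z x y Mz y0 yx _; rewrite !mulr1; exact: anti2.
- move=> z x y [/O0 mz Dz] y0 yx; rewrite mulr1.
  by apply: (le_trans (e1_le_far y0 yx d0 (hz z Dz) mz)); rewrite lerDr.
- by move=> z x y Mz y0 yx; rewrite mulr1; exact: kB_le.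
- by move=> z [_ /Dbd].
- by rewrite add0r.
- by rewrite add0r; apply: (le_lt_trans hd); move: r1; lra.
Qed.

(** The weight is 1 + |ln y|, and [keps = 1/4] is a power that dominates it near 0; with rho <= 1/2
    the sum in [kp_dif] is at most 5/4. *)
Lemma pack_ln : rho <= 2^-1 -> L0ln2 Q -> inhabited (kpack (O `&` D) Q).
Proof.
move=> r1 iQ; pose kw (y : R) := 1 + `|ln y|; pose kc (y : R) := 1 + Num.max 0 (ln y).
have mln : measurable_fun (@pos R) (@ln R) := rprim_meas (@rprim_ln R).
have mkw : measurable_fun (@pos R) kw.
  by apply: measurable_funD; [exact: measurable_cst|exact: measurableT_comp].
have mkc : measurable_fun (@pos R) kc.
  by apply: measurable_funD; [exact: measurable_cst|apply: measurable_maxr => //; exact: measurable_cst].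
have kw0 x : 0 < x -> 0 <= kw x by move=> _; rewrite addr_ge0.
have kc1 x : 0 < x -> 1 <= kc x by move=> _; rewrite lerDl le_max lexx.
have kcm x y : 0 < x -> x <= y -> kc x <= kc y.
  move=> x0 xy; rewrite lerD2l ge_max !le_max lexx /=; apply/orP; right.
  by rewrite ler_ln// posrE// (lt_le_trans x0).
have ln_le (t : R) : 0 < t -> ln t <= t - 1 by move=> t0; rewrite -{2}(lnK t0) lerBrDl expR_ge1Dx.
(* From ln t <= t - 1 at t = y^(-1/4). *)
have kwp y : 0 < y -> y <= 1 -> kw y <= 4 * y `^ (- 4^-1).
  move=> y0 y1; have l0 : ln y <= 0 by rewrite ln_le0.
  have t0 := powR_pos (- 4^-1) y0; have := ln_le _ t0.
  by rewrite ln_powR /kw ler0_norm//; lra.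
have kwl y : 1 <= y -> kw y <= 1 + y.
  move=> y1; have y0 := lt_le_trans ltr01 y1; rewrite lerD2l ger0_norm ?ln_ge0//.
  by have := ln_le y y0; lra.
have iw : RI (D0 1) (fun y => y * kw y * cmod (Q y)).
  have mw : measurable_fun (@pos R) (fun y : R => y * (1 + ln y ^+ 2)).
    apply: measurable_funM => //; apply: measurable_funD; [exact: measurable_cst|exact: measurable_funX].
  have i1 : RI (D0 1) (fun y => y * (1 + ln y ^+ 2) * cmod (Q y)).
    by apply: (wRI mw _ iQ) => y y0; rewrite mulr_ge0 ?addr_ge0 ?sqr_ge0// ltW.
  apply: RI_le (RI_Z 2 (ep_meas (endpoint0 R) 1) i1) => //; first exact: (ep_meas (endpoint0 R)).
    apply: (ep_meas_sub (endpoint0 R)) => //; apply: measurable_funM; last exact: cmeas_mod.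
    exact: measurable_funM.
  move=> y /D0P[y0 y1]; rewrite ger0_norm ?mulr_ge0 ?cmod_ge0 ?kw0 ?(ltW y0)//.
  rewrite mulrA ler_wpM2r ?cmod_ge0// mulrCA ler_wpM2l ?(ltW y0)//.
  rewrite /kw -(real_normK (num_real (ln y))); have := normr_ge0 (ln y); have := sqr_ge0 (`|ln y| - 1); nra.
have e2 : 4^-1 < 2 :> R by lra.
have kint := weight_RI lQ mkw mkc kw0 kc1 kcm e2 kwp kwl iw.
have kwa x y : 0 < y -> y <= x -> x <= 1 -> kw x <= kw y.
  move=> y0 yx x1; have x0 := lt_le_trans y0 yx; rewrite lerD2l !ler0_norm ?ln_le0 ?(le_trans yx)//.
  by rewrite lerN2 ler_ln.
constructor; apply: (@KPack _ (O `&` D) Q kw kc (fun x => (1 + x) `^ (2 * khi)) 4^-1 klo khi (cmod z0 + rho) 4) => //.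
- by rewrite /kw ln1 normr0 addr0.
- by move=> x _; exact: powR_ge0.
- move=> z x y Mz y0 yx x1; have x0 := lt_le_trans y0 yx.
  by apply: ler_pM; rewrite ?powR_ge0 ?kw0// ?anti2 ?kwa.
- by move=> z x y [/O0 mz _] y0 yx; exact: e1_le_ln.
- move=> z x y Mz y0 yx; apply: (le_trans (kB_le Mz y0 yx)).
  by rewrite ler_peMr ?powR_ge0// lerDl.
- by move=> z [_ /Dbd].
- by have := hs; lra.
- by have := hd; lra.
Qed.

End Packs.

Section Topology.
Variable R : realType.

Lemma disc_nbhs (c : CC R) (rho : R) z : disc c rho z -> nbhs z (disc c rho).
Proof.
move=> dz; apply/nbhs_ballP; exists (cR (rho - cmod (z - c)) : R[i]).
  by rewrite /= (_ : (0 : R[i]) = cR 0)// ltcR subr_gt0.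
move=> w; rewrite -ball_normE /= cmod_norm ltcR (cmodBC z w) => zw; rewrite /disc /=.
have -> : w - c = (w - z) + (z - c) by ring.
by apply: (le_lt_trans (cmodD _ _)); rewrite -ltrBrDr.
Qed.

Lemma disc_open (c : CC R) (rho : R) : open (disc c rho).
Proof. by rewrite openE => z /disc_nbhs. Qed.

Lemma nbhs_disc (z : CC R) (A : set (CC R)) : nbhs z A -> exists2 rho : R, 0 < rho & disc z rho `<=` A.
Proof.
move=> /nbhs_ballP[[e e'] /=]; rewrite ltcE /= => /andP[/eqP -> e0] h; exists e => // w wz.
by apply: h; rewrite -ball_normE /= cmod_norm cmodBC (ltcR _ e).
Qed.

Lemma ucont_within (A : set (CC R)) (f : CC R -> CC R) : ucont A f -> {within A, continuous f}.
Proof.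
move=> cf; apply/subspace_continuousP => x Ax; apply/cvgrPdist_lt => -[e e'].
rewrite ltcE /= => /andP[/eqP -> e0]; have e2 : 0 < e / 2 by rewrite divr_gt0.
have [d d0 h] := cf x Ax _ e2; rewrite near_withinE.
have xd : disc x d x by rewrite /disc /= subrr cmod0.
apply: filterS (disc_nbhs xd) => y xy Ay.
by rewrite cmod_norm (ltcR _ e) cmodBC (le_lt_trans (h y Ay xy))// ltr_pdivrMr// ltr_pMr// ltr1n.
Qed.

Lemma ucont_sub (A B : set (CC R)) (f : CC R -> CC R) : B `<=` A -> ucont A f -> ucont B f.
Proof.
move=> BA cf z Bz e e0; have [d d0 h] := cf z (BA z Bz) e e0.
by exists d => // w /BA Aw; exact: h.
Qed.

Lemma ucont_inv (A : set (CC R)) (f : CC R -> CC R) (m : R) : 0 < m -> ucont A f ->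
  (forall z, A z -> m <= cmod (f z)) -> ucont A (fun z => (f z)^-1).
Proof.
move=> m0 cf fm z Az e e0; have e1 : 0 < e * (m * m) by rewrite !mulr_gt0.
have [d d0 h] := cf z Az _ e1; exists d => // w Aw wz.
have n0 t : A t -> f t != 0 by move=> At; apply/eqP => f0; have := fm t At; rewrite f0 cmod0 leNgt m0.
have -> : (f w)^-1 - (f z)^-1 = (f z - f w) / (f w * f z) by field; rewrite !n0.
have p := lt_le_trans m0 (fm z Az); have q := lt_le_trans m0 (fm w Aw).
rewrite cmodM cmodV cmodM ler_pdivrMr ?mulr_gt0// cmodBC (le_trans (h w Aw wz))//.
by rewrite ler_wpM2l ?(ltW e0)//; apply: ler_pM; rewrite ?fm// ltW.
Qed.

Lemma ucont_lower (A : set (CC R)) (f : CC R -> CC R) z0 : ucont A f -> A z0 -> f z0 != 0 ->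
  exists d : R, exists m : R, [/\ 0 < d, 0 < m & forall z, A z -> disc z0 d z -> m <= cmod (f z)].
Proof.
move=> cf Az f0; have m0 : 0 < cmod (f z0) / 2 by rewrite divr_gt0// cmod_gt0.
have [d d0 h] := cf z0 Az _ m0; exists d, (cmod (f z0) / 2); split => // z Az' zd.
have := cmodD (f z - f z0) (f z0); have := cmodB (f z) (f z - f z0); rewrite subKr.
by have := h z Az' zd; lra.
Qed.

End Topology.

(** * From local weights to regular families *)

Section Assembly.
Variables (R : realType) (Q : R -> CC R).
Hypotheses (lQ : loc_integrable Q) (iQ : Linf0 Q).
Let mQ : cmeas (@pos R) Q := lQ.1.
Let iQ' := infty_RI lQ iQ.

(** At interior points the intersection of the region with a disc is shrunk to a full disc, on which
    the holomorphic class is defined. *)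
Definition kpack_sub (M N : set (CC R)) (MN : N `<=` M) (pk : kpack M Q) : kpack N Q :=
  KPack (kw_meas pk) (kc_meas pk) (kw_ge0 pk) (kw_one pk) (kc_ge1 pk) (kc_mono pk) (kB_ge0 pk)
    (kw_anti pk) (fun z x y Nz => kw_anti2 pk (MN z Nz)) (fun z x y Nz => kp_e pk (MN z Nz))
    (fun z x y Nz => kp_B pk (MN z Nz)) (kp_int pk) (kp_pow pk) (fun z Nz => kp_re pk (MN z Nz))
    (fun z Nz => kp_bd pk (MN z Nz)) (kp_lo pk) (kp_sum pk) (kp_dif pk).

Lemma local_resolvent (M : set (CC R)) (pk : kpack M Q) z0 : M z0 ->
  exists k : R, exists d : R, exists m : R, [/\ 2^-1 <= k, 0 < d, 0 < m &
    forall z, M z -> disc z0 d z -> m <= cmod (Wr pk k z)].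
Proof.
move=> Mz0; have [k k1 W0] := wronskian_large pk mQ iQ' Mz0.
have kh : 2^-1 <= k by apply: le_trans k1; rewrite invf_le1// ler1n.
have [d [m [d0 m0 h]]] := ucont_lower (Wr_fc pk kh mQ iQ' (fc_cont M)) Mz0 W0.
by exists k, d, m; split.
Qed.

Lemma wcontinuous_of_packs (O : set (CC R)) :
  (forall z0, O z0 -> exists2 rho : R, 0 < rho & inhabited (kpack (O `&` disc z0 rho) Q)) ->
  wcontinuous_on O (Hop Q).
Proof.
move=> packs z0 Oz0; have [rho rho0 [pk]] := packs z0 Oz0; set M := O `&` disc z0 rho in pk.
have Mz0 : M z0 by split; rewrite // /disc /= subrr cmod0.
have [k [d [m [kh d0 m0 hW]]]] := local_resolvent pk Mz0.
pose e := Num.min d rho; have e0 : 0 < e by rewrite lt_min d0.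
have sub z : (O `&` disc z0 e) z -> M z /\ disc z0 d z.
  by move=> [Oz]; rewrite /disc /= lt_min => /andP[h1 h2].
have W0 z : (O `&` disc z0 e) z -> Wr pk k z != 0.
  by move=> /sub[Mz dz]; apply/eqP => w0; have := hW z Mz dz; rewrite w0 cmod0 leNgt m0.
have [s _] := schur_pack_ex pk kh mQ iQ'.
exists (cR (- k ^+ 2)), (disc z0 e); split.
- exact: disc_open.
- by rewrite /disc /= subrr cmod0.
- by move=> z Oz; have [Mz _] := sub z Oz; exact: (res_resolvent kh mQ iQ' s Mz (W0 z Oz)).
move=> f g f2 g2; exists (res pk k g); split.
  by move=> z Oz; have [Mz _] := sub z Oz; exact: (res_solves kh mQ iQ' s g2 Mz (W0 z Oz)).
have [N cN hN] := res_inner kh mQ iQ' s (fc_cont M) f2 g2.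
have SM : O `&` disc z0 e `<=` M by move=> z /sub[].
apply: ucont_within.
have cW : ucont (O `&` disc z0 e) (fun z => (Wr pk k z)^-1).
  apply: (ucont_inv m0); first exact: (ucont_sub SM (Wr_fc pk kh mQ iQ' (fc_cont M))).
  by move=> z /sub[Mz dz]; exact: hW.
have := @fc_opp _ _ (fc_cont _) _ (ucont_mul cW (ucont_sub SM cN)).
apply: (@fc_ext _ _ (fc_cont _)) => z /SM Mz.
by rewrite hN// mulNr.
Qed.

Lemma wholomorphic_of_packs (O : set (CC R)) :
  (forall z0, O z0 -> exists2 rho : R, 0 < rho & inhabited (kpack (O `&` disc z0 rho) Q)) ->
  wholomorphic_on O° (Hop Q).
Proof.
move=> packs z0 Oi; have Oz0 := interior_subset Oi.
have [rho1 rho10 [pk1]] := packs z0 Oz0; have [rho2 rho20 sub2] := nbhs_disc Oi.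
pose rho := Num.min rho1 rho2; have rho0 : 0 < rho by rewrite lt_min rho10.
have sub1 : disc z0 rho `<=` O `&` disc z0 rho1.
  move=> z; rewrite /disc /= lt_min => /andP[h1 h2]; split => //.
  exact: sub2.
have pk := kpack_sub sub1 pk1; set M := disc z0 rho in pk.
have Mz0 : M z0 by rewrite /M /disc /= subrr cmod0.
have [k [d [m [kh d0 m0 hW]]]] := local_resolvent pk Mz0.
pose e := Num.min d rho; have e0 : 0 < e by rewrite lt_min d0.
have sub z : disc z0 e z -> M z /\ disc z0 d z.
  by rewrite /M /disc /= lt_min => /andP[h1 h2].
have W0 z : disc z0 e z -> Wr pk k z != 0.
  by move=> /sub[Mz dz]; apply/eqP => w0; have := hW z Mz dz; rewrite w0 cmod0 leNgt m0.
have [s _] := schur_pack_ex pk kh mQ iQ'.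
exists (cR (- k ^+ 2)), (disc z0 e); split.
- exact: disc_open.
- by rewrite /disc /= subrr cmod0.
- rewrite -open_subsetE; last exact: disc_open.
  by move=> z /sub[/sub1[]].
- by move=> z Oz; have [Mz _] := sub z Oz; exact: (res_resolvent kh mQ iQ' s Mz (W0 z Oz)).
move=> f g f2 g2; exists (res pk k g); split.
  by move=> z Oz; have [Mz _] := sub z Oz; exact: (res_solves kh mQ iQ' s g2 Mz (W0 z Oz)).
have [N hN eN] := res_inner kh mQ iQ' s (fc_hol z0 rho) f2 g2.
have dW := Wr_fc pk kh mQ iQ' (fc_hol z0 rho).
move=> z dz; have [Mz _] := sub z dz.
have der (h : CC R -> CC R) : uhol z0 rho h -> derivable h z 1.
  move=> uh; have [L [t [C [t0 C0 hd]]]] := uhol_diff uh Mz.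
  exact: diff_derivable t0 C0 hd.
apply: (@near_eq_derivable _ _ _ (fun z => - ((Wr pk k z)^-1 * N z))).
  apply: filterS (disc_nbhs Mz) => w Mw.
  by rewrite eN// mulNr.
apply: derivableN; apply: derivableM; last exact: der.
by apply: derivableV; [exact: W0|exact: der].
Qed.

Lemma regular_of_packs (O : set (CC R)) :
  (forall z0, O z0 -> exists2 rho : R, 0 < rho & inhabited (kpack (O `&` disc z0 rho) Q)) ->
  regular_on O (Hop Q).
Proof. by move=> packs; split; [exact: wcontinuous_of_packs|exact: wholomorphic_of_packs]. Qed.

End Assembly.

Theorem theorem6p11 (R : realType) (Q : R -> CC R) :
  loc_integrable Q -> Linf0 Q ->
  (forall eps : R, 0 < eps < 2 -> L0eps eps Q ->
     regular_on [set m | - (eps / 2) <= cre m] (Hop Q)) /\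
  (L0eps 0 Q ->
     regular_on [set m | 0 <= cre m /\ m != 0] (Hop Q) /\
     (L0ln2 Q -> regular_on [set m | 0 <= cre m] (Hop Q))).
Proof.
move=> lQ iQ; split=> [eps /andP[e0 e2] hQ|hQ].
  apply: regular_of_packs => // z0 Oz0.
  (* With this radius eps + 2 rho = 1 + eps/2, which is below 2. *)
  have r0 : 0 < (2 - eps) / 4 by rewrite divr_gt0// subr_gt0.
  by exists ((2 - eps) / 4) => //; apply: pack_eps => //; lra.
split=> [|hl]; apply: regular_of_packs => // z0 Oz0; last first.
  have r0 : (0 : R) < 2^-1 by rewrite invr_gt0.
  by exists 2^-1 => //; apply: pack_ln.
have n0 : 0 < cmod z0 by case: Oz0 => _; exact: cmod_gt0.
(* As the radius is at most |z0| / 2, the disc stays at distance at least [rho] from 0. *)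
pose rho := Num.min 2^-1 (cmod z0 / 2).
have r0 : 0 < rho by rewrite lt_min invr_gt0 (divr_gt0 n0)// ltr0n.
have r1 : rho < 1 by rewrite gt_min; apply/orP; left; lra.
exists rho => //; apply: (pack_far lQ r0 _ Oz0 r1 r0) => //; first by move=> z [].
move=> z dz; have := cmodD (z - z0) (- z); rewrite addrAC subrr sub0r !cmodN => l.
have : rho <= cmod z0 / 2 by rewrite ge_min lexx orbT.
by have : cmod (z - z0) < rho := dz; lra.
Qed.
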